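(* Let $\rho,r\in\mathcal X_0$, $\gamma\neq0$, $n_0\in\mathbb N$, $l_0>0$, $N\in\mathbb N$ satisfy the hypotheses (H) listed in the context, let $\varepsilon\in(0,\varepsilon_0)$, and let $v\in C^2([-\varepsilon^{-(2N+1)},\varepsilon^{-(2N+1)}],\mathcal X)$ be a modulating pulse profile as described in the context. Take an arbitrary function $\phi\in C^2(\mathbb R\setminus[-\varepsilon^{-(2N+1)},\varepsilon^{-(2N+1)}],\mathcal X)$ such that $$v_{\rm ext}(\xi,z,x):=\begin{cases}v(\xi,z,x),&\xi\in[-\varepsilon^{-(2N+1)},\varepsilon^{-(2N+1)}],\ z,x\in\mathbb R,\\ \phi(\xi,z,x),&\xi\in\mathbb R\setminus[-\varepsilon^{-(2N+1)},\varepsilon^{-(2N+1)}],\ z,x\in\mathbb R,\end{cases}$$ satisfies $v_{\rm ext}\in C^2(\mathbb R,\mathcal X)$. Let $$u_0(x):=v_{\rm ext}(x,l_0x,x),\qquad u_1(x):=-c_g\,\partial_\xi v_{\rm ext}(x,l_0x,x)-\omega\,\partial_zv_{\rm ext}(x,l_0x,x).$$ Then the corresponding solution $u$ of $$\partial_t^2u(x,t)-\partial_x^2u(x,t)+\rho(x)u(x,t)=\gamma r(x)u(x,t)^3$$ with $u(\cdot,0)=u_0$ and $\partial_tu(\cdot,0)=u_1$ satisfies $$u(x,t)=v(x-c_gt,\,l_0x-\omega t,\,x)$$ for all $(x,t)\in[-\varepsilon^{-(2N+1)},\varepsilon^{-(2N+1)}]\times(0,\infty)$ such that $|x|+t<\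varepsilon^{-(2N+1)}$.
   Context: **Coefficients and Bloch modes.** $\mathcal X_0=\{\rho\in L^\infty(\mathbb R):\ \rho(x)=\rho(x+2\pi),\ \rho(-x)=\rho(x),\ \rho(x)\ge\rho_0>0\ \forall x\in\mathbb R\}$ (with some constant $\rho_0>0$ depending on the function). For $l\in\mathbb R$, the numbers $0<\omega_1(l)\le\omega_2(l)\le\cdots$ (with $\omega_n(l)\to\infty$) and $2\pi$-periodic functions $f_n(l,\cdot)$ solve $$-(\partial_x+il)^2f_n(l,x)+\rho(x)f_n(l,x)=\omega_n^2(l)f_n(l,x),\qquad f_n(l,x)=f_n(l,x+2\pi),\qquad f_n(l,x)=f_n(l+1,x)e^{ix},$$ with $\int_0^{2\pi}|f_n(l,x)|^2dx=1$; the $\omega_n$ are $1$-periodic in $l$. Put $\gamma_{n_0}(l_0)=\frac{3\gamma}{\omega_{n_0}(l_0)}\int_0^{2\pi}r|f_{n_0}(l_0,\cdot)|^4dx$, $\omega_0=\omega_{n_0}(l_0)$, $c_g=\omega'_{n_0}(l_0)$, and $\omega=\omega_0+\widetilde\omega\varepsilon^2$ with $\widetilde\omega=-\mathrm{sgn}(\omega_{n_0}''(l_0))$. $\mathbb T=\mathbb R/2\pi\mathbb Z$ and $$\mathcal X=H^2_{\rm per}(\mathbb T,L^2(\mathbb T))\cap H^1_{\rm per}(\mathbb T,H^1_{\rm per}(\mathbb T))\cap L^2(\mathbb T,H^2_{\rm per}(\mathbb T)),$$ a space of functions of $(z,x)$, $2\pi$-periodic in each variable (outer variable $z$, inner variable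 $x$). **Hypotheses (H).** $\omega_n(l_0)\ne\omega_{n_0}(l_0)$ for all $n\neq n_0$; $\omega_{n_0}'(l_0)\neq\pm1$; $\omega_{n_0}''(l_0)\ne0$; $\omega_n^2(ml_0)\ne m^2\omega_{n_0}^2(l_0)$ for all $m\in\{3,5,\dots,2N+1\}$, $n\in\mathbb N$; $\mathrm{sgn}(\omega_{n_0}''(l_0))=\mathrm{sgn}(\gamma_{n_0}(l_0))$; and Assumption (SG) below. **Assumption (SG).** For $m$ odd and positive let $A_m(\omega,c)$, with domain $H^2_{\rm per}(\mathbb T)\times H^1_{\rm per}(\mathbb T)$ and range space $H^1_{\rm per}(\mathbb T)\times L^2(\mathbb T)$, be $$A_m(\omega,c)=\begin{pmatrix}0&1\\(1-c^2)^{-1}[-(\partial_x+iml_0)^2+\rho(x)-m^2\omega^2]&2(1-c^2)^{-1}[imc\omega-(\partial_x+iml_0)]\end{pmatrix}.$$ Let $\Pi$ be the projection whose kernel is the (two-dimensional) generalized kernel of $A_1(\omega_0,c_g)$ and whose range is the $L^2$-orthogonal complement of the generalized kernel of $A_1(\omega_0,c_g)^*$. Let $\ell^{2,k}(H^s)$ be the sequences $(v_m)_m$ with $\sum_m\|v_m\|_{H^s}^2(1+m^2)^k<\infty$, and let $\mathcal D$ be the space of sequences $(v_m,w_m)_m$ indexed by odd $m\ge1$ (components with index $-m$ being complex conjugates, even ones zero) with $(v_m)\in\ell^{2,2}(L^2)\cap\ell^{2,1}(H^1_{\rm per})\cap\ell^{2,0}(H^2_{\rm per})$ and $(w_m)\in\ell^{2,1}(L^2)\cap\ell^{2,0}(H^1_{\rm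 per})$, with its natural norm. Let $\Lambda_r(S_1,(Y_m)_{m\ge3\text{ odd}})=(\Pi A_1(\omega_0,c_g)S_1,(A_m(\omega_0,c_g)Y_m)_m)$ on the sequences in $\mathcal D$ with $\Pi S_1=S_1$. This space is split into $\mathcal D_s\oplus\mathcal D_u\oplus\mathcal D_c$, the parts corresponding to eigenvalues of $\Lambda_r$ with negative, positive, zero real part respectively, with bounded projections; $\Lambda_s,\Lambda_u,\Lambda_c$ are the restrictions. (SG) requires that there are $K,\varepsilon_0>0$ such that for all $\varepsilon\in(0,\varepsilon_0)$: $\|e^{\Lambda_s\xi}\|_{\mathcal D\to\mathcal D}\le K$ for $\xi\ge0$, $\|e^{\Lambda_u\xi}\|_{\mathcal D\to\mathcal D}\le K$ for $\xi\le0$, $\|e^{\Lambda_c\xi}\|_{\mathcal D\to\mathcal D}\le K$ for $\xi\in\mathbb R$. **The profile $v$.** Under (H) it is known that there are $\varepsilon_0,C>0$ such that for each $\varepsilon\in(0,\varepsilon_0)$ there is a real-valued $v\in C^2([-\varepsilon^{-(2N+1)},\varepsilon^{-(2N+1)}],\mathcal X)$ such that $(x,t)\mapsto v(x-c_gt,l_0x-\omega t,x)$ solves the semi-linear wave equation in the claim (for $|x-c_gt|\le\varepsilon^{-(2N+1)}$), and a real-valued $h\in C^2(\mathbb R,\mathcal X)$ with $\lim_{|\xi|\to\infty}h(\xi,z,x)=0$, $$\sup_{\xi\in[-\varepsilon^{-(2N+1)},\varepsilon^{-(2N+1)}]}|v(\xi,z,x)-h(\xi,z,x)|\le C\varepsilon^{2N},\qquad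 \sup_{\xi,z,x}|h-h_{\rm app}|\le C\varepsilon^2,$$ where $h_{\rm app}(\xi,z,x)=\varepsilon\gamma_1\mathrm{sech}(\varepsilon\gamma_2\xi)f_{n_0}(l_0,x)e^{iz}+\text{c.c.}$ (c.c. = complex conjugate of the preceding term), $\gamma_1=\sqrt{2|\widetilde\omega|/|\gamma_{n_0}(l_0)|}$, $\gamma_2=\sqrt{2|\widetilde\omega|/|\omega_{n_0}''(l_0)|}$. The $v$ in the claim is such a function. **Solutions.** Solutions of the wave equation are understood as functions satisfying it almost everywhere and having bounded energy $\frac12\int_{|x-x_0|\le t_0-t}[(\partial_tu)^2+(\partial_xu)^2+\rho u^2]dx$, $0\le t\le t_0$, in every backward light cone with vertex $(x_0,t_0)$, $t_0>0$. *)

(* Defs.v *)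
From HB Require Import structures.
From mathcomp Require Import all_boot all_order all_algebra.
From mathcomp Require Import all_classical all_reals all_analysis.
From mathcomp Require Import complex.

Set Implicit Arguments.
Unset Strict Implicit.
Unset Printing Implicit Defensive.

Import Order.TTheory GRing.Theory Num.Theory.
Import numFieldNormedType.Exports.

Local Open Scope classical_set_scope.
Local Open Scope ring_scope.
Local Open Scope complex_scope.

(* Periodic functions are functions on the whole line; elements of L^2 and of
   the Sobolev spaces are represented by functions, compared almost everywhere
   by [aeq]. *)

Section PeriodicSobolev.
Context {R : realType}.
Local Notation C := R[i].
Local Notation mu := (@lebesgue_measure R).

Definition imc : C := 0 +i* 1.

Definition cis (t : R) : C := cos t +i* sin t.

Definition sqmod (z : C) : R := complex.Re z ^+ 2 + complex.Im z ^+ 2.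

Definition cint (a b : R) (f : R -> C) : C :=
  (\int[mu]_(x in `[a, b]) complex.Re (f x))
    +i* (\int[mu]_(x in `[a, b]) complex.Im (f x)).

Definition aeq (f g : R -> C) : Prop := {ae mu, forall x, f x = g x}.

Definition periodic2pi (T : Type) (f : R -> T) : Prop :=
  forall x, f (x + 2 * pi) = f x.

Definition L2per (f : R -> C) : Prop :=
  [/\ periodic2pi f,
      measurable_fun setT (fun x => complex.Re (f x)),
      measurable_fun setT (fun x => complex.Im (f x)) &
      mu.-integrable `[0, 2 * pi] (EFin \o (fun x => sqmod (f x)))].

Definition L2norm2 (f : R -> C) : R :=
  \int[mu]_(x in `[0, 2 * pi]) sqmod (f x).

Definition ip (f g : R -> C) : C := cint 0 (2 * pi) (fun x => f x * conjc (g x)).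

(* One-dimensional weak derivative: [f] agrees almost everywhere with a
   primitive of [g]. *)
Definition wderiv (f g : R -> C) : Prop :=
  exists F : R -> C,
    aeq f F /\ forall a b, a <= b -> F b - F a = cint a b g.

Fixpoint Hper (s : nat) (f : R -> C) : Prop :=
  L2per f /\
  if s is s'.+1 then exists2 g, wderiv f g & Hper s' g else True.

(* Unique up to [aeq] on [Hper 1], unspecified outside. *)
Definition Dx (f : R -> C) : R -> C :=
  xget (fun=> 0) [set g | L2per g /\ wderiv f g].

(* The operator d/dx + i l. *)
Definition Dxl (l : R) (f : R -> C) : R -> C :=
  fun x => Dx f x + imc * l%:C * f x.

Definition Hnorm2 (s : nat) (f : R -> C) : R :=
  \sum_(j < s.+1) L2norm2 (iter j Dx f).

(* l^{2,k}(H^s) for a family (v i) in which v i is the Fourier mode of index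
   m i. *)
Definition lnorm2 (I : choiceType) (m : I -> int) (k s : nat)
    (v : I -> R -> C) : \bar R :=
  \esum_(i in [set: I]) ((1 + (m i)%:~R ^+ 2) ^+ k * Hnorm2 s (v i))%:E.

Definition lseq (I : choiceType) (m : I -> int) (k s : nat)
    (v : I -> R -> C) : Prop :=
  (forall i, Hper s (v i)) /\ (lnorm2 m k s v < +oo)%E.

End PeriodicSobolev.

(* The space H^2(T, L^2) n H^1(T, H^1) n L^2(T, H^2) of real functions g z x.
   It embeds into the continuous functions, so its elements are represented
   by their continuous representatives; Sobolev regularity in z is measured
   on the Fourier coefficients in z. *)
Section SpaceX.
Context {R : realType}.
Local Notation C := R[i].

Definition zcoef (g : R -> R -> R) (m : int) : R -> C :=
  fun x => ((2 * pi)^-1)%:C *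
    cint 0 (2 * pi) (fun z => (g z x)%:C * cis (- (m%:~R * z))).

Definition inX (g : R -> R -> R) : Prop :=
  [/\ continuous (fun p : R * R => g p.1 p.2),
      (forall x, periodic2pi (fun z => g z x)),
      (forall z, periodic2pi (g z)) &
      [/\ lseq id 2 0 (zcoef g), lseq id 1 1 (zcoef g)
        & lseq id 0 2 (zcoef g)]].

Definition Xnorm (g : R -> R -> R) : \bar R :=
  sqrte (lnorm2 id 2 0 (zcoef g) + lnorm2 id 1 1 (zcoef g)
         + lnorm2 id 0 2 (zcoef g))%E.

(* One-sided at the endpoints belonging to J. *)
Definition X_derivative_on (J : set R) (v v' : R -> R -> R -> R) : Prop :=
  forall xi, J xi ->
    (fun eta => Xnorm (fun z x =>
       (eta - xi)^-1 * (v eta z x - v xi z x) - v' xi z x))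
      @ within J xi^' --> 0%E.

Definition X_continuous_on (J : set R) (v : R -> R -> R -> R) : Prop :=
  forall xi, J xi ->
    (fun eta => Xnorm (fun z x => v eta z x - v xi z x))
      @ within J (nbhs xi) --> 0%E.

Definition C2X (J : set R) (v : R -> R -> R -> R) : Prop :=
  exists v1 v2 : R -> R -> R -> R,
    [/\ forall xi, J xi -> [/\ inX (v xi), inX (v1 xi) & inX (v2 xi)],
        X_derivative_on J v v1, X_derivative_on J v1 v2
      & X_continuous_on J v2].

End SpaceX.

Section Bloch.
Context {R : realType}.
Local Notation C := R[i].
Local Notation mu := (@lebesgue_measure R).

Definition inX0 (rho : R -> R) : Prop :=
  [/\ measurable_fun setT rho,
      exists M : R, {ae mu, forall x, `|rho x| <= M},
      periodic2pi rho,
      forall x, rho (- x) = rho x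
    & exists2 rho0 : R, 0 < rho0 & forall x, rho0 <= rho x].

(* Indices start at 0: [omega n], [f n] is the (n+1)-st Bloch band.  All
   eigenvalues are listed, with multiplicity: the eigenfunctions form a
   complete orthonormal system for every l. *)
Definition bloch_bands (rho : R -> R) (omega : nat -> R -> R)
    (f : nat -> R -> R -> C) : Prop :=
  [/\ forall n l, 0 < omega n l /\ omega n l <= omega n.+1 l,
      forall l, omega ^~ l @ \oo --> +oo%R,
      forall n l, omega n (l + 1) = omega n l,
      forall n l x, f n l x = f n (l + 1) x * cis x &
      forall l,
      [/\ forall n, [/\ Hper 2 (f n l),
            continuous (fun x => complex.Re (f n l x))
          & continuous (fun x => complex.Im (f n l x))],
          forall n, {ae mu, forall x,
            - Dxl l (Dxl l (f n l)) x + (rho x)%:C * f n l x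
              = (omega n l ^+ 2)%:C * f n l x},
          forall n m, ip (f n l) (f m l) = (n == m)%:R
        & forall g, L2per g -> (forall n, ip g (f n l) = 0) ->
            aeq g (fun=> 0)]].

End Bloch.

Section SpectralGap.
Context {R : realType}.
Local Notation C := R[i].
Local Notation mode := ((R -> C) * (R -> C))%type.
Local Notation state := (nat -> mode).

Definition aeq2 (U V : mode) : Prop := aeq U.1 V.1 /\ aeq U.2 V.2.

Definition ip2 (U V : mode) : C := ip U.1 V.1 + ip U.2 V.2.

Definition Aop (rho : R -> R) (l0 : R) (m : nat) (om c : R) (U : mode) : mode :=
  (U.2,
   fun x =>
     ((1 - c ^+ 2)^-1)%:C *
       (- Dxl (m%:R * l0) (Dxl (m%:R * l0) U.1) x + (rho x)%:C * U.1 x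
        - (m%:R ^+ 2 * om ^+ 2)%:C * U.1 x)
     + (2 * (1 - c ^+ 2)^-1)%:C *
       (imc * (m%:R * c * om)%:C * U.2 x - Dxl (m%:R * l0) U.2 x)).

Definition domA (U : mode) : Prop := Hper 2 U.1 /\ Hper 1 U.2.

Definition A_graph rho l0 m om c (U V : mode) : Prop :=
  domA U /\ aeq2 V (Aop rho l0 m om c U).

(* Graph of the adjoint with respect to L^2 x L^2. *)
Definition Aadj_graph rho l0 m om c (U V : mode) : Prop :=
  [/\ L2per U.1 /\ L2per U.2, L2per V.1 /\ L2per V.2 &
      forall W, domA W -> ip2 (Aop rho l0 m om c W) U = ip2 W V].

(* Generalized kernel of the operator with graph [G]: the union over n of the
   kernels of its n-th powers. *)
Fixpoint kerpow (T : Type) (null : T -> Prop) (G : T -> T -> Prop)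
    (n : nat) (U : T) : Prop :=
  if n is n'.+1 then exists2 V, G U V & kerpow null G n' V else null U.

Definition gker (T : Type) (null : T -> Prop) (G : T -> T -> Prop) (U : T) :=
  exists n, kerpow null G n U.

Definition gkerA rho l0 om c : mode -> Prop :=
  gker (aeq2^~ 0) (A_graph rho l0 1 om c).

Definition gkerAadj rho l0 om c : mode -> Prop :=
  gker (aeq2^~ 0) (Aadj_graph rho l0 1 om c).

Definition Pi_proj rho l0 om c (U : mode) : mode :=
  xget 0 [set P : mode |
    [/\ L2per P.1 /\ L2per P.2, gkerA rho l0 om c (U - P)
      & forall W, gkerAadj rho l0 om c W -> ip2 P W = 0]].

(* Sequences over the odd m >= 1, with m = 2 j + 1. *)
Definition oddidx (j : nat) : nat := j.*2.+1.

Local Notation oddz := (fun j => (oddidx j)%:Z).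

Definition inD (U : state) : Prop :=
  let v := fun j => (U j).1 in let w := fun j => (U j).2 in
  [/\ lseq oddz 2 0 v, lseq oddz 1 1 v, lseq oddz 0 2 v,
      lseq oddz 1 0 w & lseq oddz 0 1 w].

Definition Dnorm (U : state) : \bar R :=
  let v := fun j => (U j).1 in let w := fun j => (U j).2 in
  sqrte (lnorm2 oddz 2 0 v + lnorm2 oddz 1 1 v + lnorm2 oddz 0 2 v
         + lnorm2 oddz 1 0 w + lnorm2 oddz 0 1 w)%E.

Definition seqv (U V : state) : Prop := forall j, aeq2 (U j) (V j).

Definition sscale (a : C) (U : state) : state :=
  fun j => (fun x => a * (U j).1 x, fun x => a * (U j).2 x).

Definition Lam (rho : R -> R) (l0 om c : R) (U : state) : state :=
  fun j => let AU := Aop rho l0 (oddidx j) om c (U j) in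
           if j is 0 then Pi_proj rho l0 om c AU else AU.

Definition inDr (rho : R -> R) (l0 om c : R) (U : state) : Prop :=
  inD U /\ aeq2 (Pi_proj rho l0 om c (U 0%N)) (U 0%N).

Definition root_vector rho l0 om c (lambda : C) : state -> Prop :=
  gker (seqv^~ 0) (fun U V =>
    inDr rho l0 om c U /\ seqv V (Lam rho l0 om c U - sscale lambda U)).

(* The part of [inDr] belonging to the eigenvalues selected by [sel]: the
   closed linear span of their generalized eigenvectors. *)
Definition spectral_part rho l0 om c (sel : C -> Prop) (U : state) : Prop :=
  inDr rho l0 om c U /\
  forall e : R, 0 < e ->
    exists n (lambda : 'I_n -> C) (V : 'I_n -> state),
      (forall i, [/\ sel (lambda i), inDr rho l0 om c (V i)
                   & root_vector rho l0 om c (lambda i) (V i)]) /\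
      (Dnorm (U - \sum_(i < n) V i)%R < e%:E)%E.

(* [E] is the family of operators exp(Lam xi), xi in J, on the subspace [S]:
   J is [0, +oo[ or ]-oo, 0] for a semigroup and the whole line for a group.
   It is strongly continuous and its generator is the part of Lam in S. *)
Definition is_exp_on rho l0 om c (J : set R) (S : state -> Prop)
    (E : R -> state -> state) : Prop :=
  [/\ (forall xi U, J xi -> S U -> S (E xi U)),
      (forall xi a U V, J xi -> S U -> S V ->
         seqv (E xi (sscale a U + V)) (sscale a (E xi U) + E xi V)),
      (forall U, S U -> seqv (E 0 U) U) /\
      (forall xi eta U, J xi -> J eta -> S U ->
         seqv (E (xi + eta) U) (E xi (E eta U))),
      (forall U, S U ->
         (fun h => Dnorm (E h U - U)) @ within J 0^' --> 0%E) &
      (forall U V, S U -> S V ->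
         (fun h => Dnorm (sscale (h^-1)%:C (E h U - U) - V))
           @ within J 0^' --> 0%E <-> seqv V (Lam rho l0 om c U))].

Definition exp_bounded rho l0 om c (J : set R) (S : state -> Prop) (K : R) :=
  exists E, is_exp_on rho l0 om c J S E /\
    forall xi U, J xi -> S U -> (Dnorm (E xi U) <= K%:E * Dnorm U)%E.

(* First clause: direct sum with bounded projections. *)
Definition SG (rho : R -> R) (l0 om c : R) : Prop :=
  let Ds := spectral_part rho l0 om c (fun z => complex.Re z < 0) in
  let Du := spectral_part rho l0 om c (fun z => 0 < complex.Re z) in
  let Dc := spectral_part rho l0 om c (fun z => complex.Re z = 0) in
  ((forall U, inDr rho l0 om c U ->
      exists Us Uu Uc : state, [/\ Ds Us, Du Uu, Dc Uc & seqv U (Us + Uu + Uc)]) /\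
   exists M : R, forall Us Uu Uc, Ds Us -> Du Uu -> Dc Uc ->
     [/\ Dnorm Us <= M%:E * Dnorm (Us + Uu + Uc)%R,
         Dnorm Uu <= M%:E * Dnorm (Us + Uu + Uc)%R
       & Dnorm Uc <= M%:E * Dnorm (Us + Uu + Uc)%R]%E) /\
  exists K eps0 : R, [/\ 0 < K, 0 < eps0 &
    forall eps : R, 0 < eps < eps0 ->
      [/\ exp_bounded rho l0 om c `[0, +oo[ Ds K,
          exp_bounded rho l0 om c `]-oo, 0] Du K
        & exp_bounded rho l0 om c setT Dc K]].

End SpectralGap.

(* Space-time points are pairs (x, t). *)
Section WaveEquation.
Context {R : realType}.
Local Notation mu := (@lebesgue_measure R).
Local Notation mu2 := (mu \x mu)%E.

Definition locint (Omega : set (R * R)) (g : R * R -> R) : Prop :=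
  forall K : set (R * R), compact K -> K `<=` Omega ->
    mu2.-integrable K (EFin \o g).

Definition dx (g : R * R -> R) : R * R -> R :=
  fun p => derive1 (fun y => g (y, p.2)) p.1.
Definition dt (g : R * R -> R) : R * R -> R :=
  fun p => derive1 (fun s => g (p.1, s)) p.2.

Definition test_fun (Omega : set (R * R)) (phi : R * R -> R) : Prop :=
  [/\ forall x t, derivable (fun y => phi (y, t)) x 1,
      forall x t, derivable (fun s => phi (x, s)) t 1,
      continuous (dx phi), continuous (dt phi)
    & exists K, [/\ compact K, K `<=` Omega
                  & forall p, ~ K p -> phi p = 0]].

Definition weak_dx (Omega : set (R * R)) (u ux : R * R -> R) : Prop :=
  [/\ locint Omega u, locint Omega ux & forall phi, test_fun Omega phi ->
      \int[mu2]_(p in Omega) (u p * dx phi p)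
        = - \int[mu2]_(p in Omega) (ux p * phi p)].

Definition weak_dt (Omega : set (R * R)) (u ut : R * R -> R) : Prop :=
  [/\ locint Omega u, locint Omega ut & forall phi, test_fun Omega phi ->
      \int[mu2]_(p in Omega) (u p * dt phi p)
        = - \int[mu2]_(p in Omega) (ut p * phi p)].

Definition back_cone (x0 t0 : R) : set (R * R) :=
  [set p | 0 <= p.2 /\ `|p.1 - x0| <= t0 - p.2].

(* Solutions on the open set Omega: the derivatives in the equation are weak
   derivatives, the equation holds almost everywhere, and the energy is
   bounded in the backward light cones whose part in {t > 0} lies in
   Omega. *)
Definition wave_solution (rho r : R -> R) (gamma : R) (Omega : set (R * R))
    (u : R -> R -> R) : Prop :=
  exists ux ut uxx utt : R * R -> R,
  [/\ weak_dx Omega (fun p => u p.1 p.2) ux /\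
      weak_dt Omega (fun p => u p.1 p.2) ut,
      weak_dx Omega ux uxx /\ weak_dt Omega ut utt,
      {ae mu2, forall p, Omega p ->
        utt p - uxx p + rho p.1 * u p.1 p.2
          = gamma * r p.1 * u p.1 p.2 ^+ 3} &
      forall x0 t0, 0 < t0 ->
        back_cone x0 t0 `&` [set p | 0 < p.2] `<=` Omega ->
        exists M : R, {ae mu, forall t, 0 < t < t0 ->
          (\int[mu]_(x in [set x | (`|x - x0| <= t0 - t)%R])
             (2^-1 * (ut (x, t) ^+ 2 + ux (x, t) ^+ 2
                      + rho x * u x t ^+ 2))%:E <= M%:E)%E}].

(* A solution of the Cauchy problem may blow up, so it is considered on a
   relatively open subset D of {t >= 0} containing the backward light cones of
   its points, for instance D = {t >= 0} for a global solution. *)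
Definition existence_domain (D : set (R * R)) : Prop :=
  (exists2 O : set (R * R), open O & D = O `&` [set p | 0 <= p.2]) /\
  forall x0 t0, D (x0, t0) -> back_cone x0 t0 `<=` D.

Definition cauchy_solution (rho r : R -> R) (gamma : R) (u0 u1 : R -> R)
    (D : set (R * R)) (u : R -> R -> R) : Prop :=
  [/\ wave_solution rho r gamma (D `&` [set p | 0 < p.2]) u,
      {within D, continuous (fun p => u p.1 p.2)},
      forall x, D (x, 0) -> u x 0 = u0 x
    & {ae mu, forall x, D (x, 0) ->
        (fun t => t^-1 * (u x t - u x 0)) @ 0^'+ --> u1 x}].

End WaveEquation.

Section ModulatingPulse.
Context {R : realType}.
Local Notation C := R[i].
Local Notation mu := (@lebesgue_measure R).
Variables (rho r : R -> R) (gamma l0 : R) (n0 N : nat).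
Variables (omega : nat -> R -> R) (f : nat -> R -> R -> C).

Definition gamma_n0 : R :=
  3 * gamma / omega n0 l0 *
    \int[mu]_(x in `[0, 2 * pi]) (r x * sqmod (f n0 l0 x) ^+ 2).

Definition omega0 : R := omega n0 l0.

Definition cg : R := derive1 (omega n0) l0.

Definition omega'' : R := derive1n 2 (omega n0) l0.

Definition omegatilde : R := - Num.sg omega''.

Definition omega_eps (eps : R) : R := omega0 + omegatilde * eps ^+ 2.

Definition xi_max (eps : R) : R := eps ^- N.*2.+1.

Definition hypH : Prop :=
  [/\ (forall n, n != n0 -> omega n l0 != omega n0 l0),
      (cg != 1 /\ cg != -1) /\ omega'' != 0,
      (forall m n : nat, odd m -> (3 <= m <= N.*2.+1)%N ->
         omega n (m%:R * l0) ^+ 2 != m%:R ^+ 2 * omega n0 l0 ^+ 2),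
      Num.sg omega'' = Num.sg gamma_n0
    & SG rho l0 omega0 cg].

Definition sech (y : R) : R := 2 / (expR y + expR (- y)).

Definition gamma1 : R := Num.sqrt (2 * `|omegatilde| / `|gamma_n0|).
Definition gamma2 : R := Num.sqrt (2 * `|omegatilde| / `|omega''|).

(* a + c.c. = 2 Re a. *)
Definition h_app (eps xi z x : R) : R :=
  2 * complex.Re
    ((eps * gamma1 * sech (eps * gamma2 * xi))%:C * f n0 l0 x * cis z).

(* The function (x, t) |-> v (x - c_g t, l0 x - omega t, x). *)
Definition travelling (eps : R) (v : R -> R -> R -> R) (x t : R) : R :=
  v (x - cg * t) (l0 * x - omega_eps eps * t) x.

Definition pulse_profile (cst eps : R) (v : R -> R -> R -> R) : Prop :=
  [/\ C2X `[- xi_max eps, xi_max eps] v,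
      wave_solution rho r gamma
        [set p | `|p.1 - cg * p.2| < xi_max eps] (travelling eps v) &
      exists h : R -> R -> R -> R,
      [/\ C2X setT h,
          forall z x, (fun xi => h xi z x) @ +oo --> (0 : R),
          forall z x, (fun xi => h xi z x) @ -oo --> (0 : R),
          forall xi z x, `|xi| <= xi_max eps ->
            `|v xi z x - h xi z x| <= cst * eps ^+ N.*2
        & forall xi z x, `|h xi z x - h_app eps xi z x| <= cst * eps ^+ 2]].

Definition v_ext (eps : R) (v phi : R -> R -> R -> R) : R -> R -> R -> R :=
  fun xi z x => if `|xi| <= xi_max eps then v xi z x else phi xi z x.

Definition u0_of (w : R -> R -> R -> R) (x : R) : R := w x (l0 * x) x.

(* The partial derivative in z of a C^2 map into the space X is classical at
   (x, l0 x, x) for almost every x; this determines the initial velocity. *)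
Definition u1_of (eps : R) (w : R -> R -> R -> R) (x : R) : R :=
  - cg * derive1 (fun xi => w xi (l0 * x) x) x
  - omega_eps eps * derive1 (fun z => w x z x) (l0 * x).

End ModulatingPulse.

(* Main.v *)
Require Import Defs.
From HB Require Import structures.
From mathcomp Require Import all_boot all_order all_algebra.
From mathcomp Require Import all_classical all_reals all_analysis.
From mathcomp Require Import complex.
From mathcomp Require Import measurable_realfun ring lra.

Import Order.TTheory GRing.Theory Num.Theory.
Import numFieldNormedType.Exports.

Local Open Scope classical_set_scope.
Local Open Scope ring_scope.

Set Implicit Arguments.
Unset Strict Implicit.
Unset Printing Implicit Defensive.

(** The solution [u] and the travelling pulse solve the same semilinear wave
    equation and have the same Cauchy data on the base of the backward triangle
    of [(x, t)], so finite speed of propagation forces them to agree at the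
    vertex.  Solutions are weak, and three things have to be supplied.

    Uniqueness in a triangle ([triangle_unique]).  In the characteristic
    coordinates [x + t] and [x - t] the equation reads [- 4 U_12 = F].  Testing
    it with products of windows shows that for a continuous weak solution the
    alternating sum of [U] over the corners of a rectangle is [- 1/4] times the
    integral of [F] ([rectangle_identity], carried over to space-time by
    [char_box]), and that [U] is absolutely continuous along edges
    ([edge_primitive]).  Let [W] be the difference of two solutions; its value
    and its velocity vanish on the initial line, which is the diagonal.  Hence
    [|W|] is at most one quarter of the integral of [|F|] over the triangle
    below the point ([tri_bound]).  Bounded solutions satisfy [|F| <= C |W|],
    because the nonlinearity is locally Lipschitz, and a weighted Gronwall
    argument ([triangle_gronwall]) gives [W = 0].

    The initial velocity of the pulse ([strip_velocity]).  The velocity [u1] is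
    prescribed through derivatives of the profile in [xi] and [z].  The
    derivative in [xi] exists uniformly in the other variables, since X embeds
    into the bounded functions: a function of [z] is bounded by the sum of its
    Fourier coefficients ([fejer_sup]), and each coefficient is bounded by its
    Sobolev norm in [x] ([X_sup]).  The derivative in [z] is obtained from the
    equation.  The pulse is itself a weak solution with locally bounded
    right-hand side; near the initial line it is the sum of an absolutely
    continuous function of each characteristic coordinate and a term quadratic
    in [t] ([square_decomp]), so it is differentiable in time at [t = 0] for
    almost every [x] ([wave_time_derivative]), and the chain rule identifies
    the derivative with [u1] ([carried_velocity]).

    The speed of the pulse ([group_velocity_le1]).  The pulse is a solution
    only in the strip [|x - c_g t| < L], and the backward triangle of a point
    with [|x| + t < L] stays inside the strip because [|c_g| <= 1].  This holds
    for every band: the energy form of the Bloch operator satisfies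
    [B_(l+d) <= (1 + s) B_l + (1 + 1/s) d ^+ 2 N], with [N] the mass form
    ([energy_shift]); the min-max principle ([minmax_compare]) passes this to
    the eigenvalues [omega_n ^+ 2], and [s = |d| / omega_n l] makes the right
    hand side the square of [omega_n l + |d|].  The min-max principle rests on
    the completeness of the eigenfunctions ([energy_complete]). *)

(** * Linear changes of variables for the plane Lebesgue measure *)

Local Notation pushforward_measure :=
  measure_function_pushforward__canonical__measure_function_Measure.

Section AffineImages.
Context {R : realType}.
Local Notation mu := (@lebesgue_measure R).
Local Notation mu2 := (mu \x mu)%E.
Local Notation RR := (measurableTypeR R * measurableTypeR R)%type.

Lemma measurable_affine (c d : R) : measurable_fun setT (fun x : R => c * x + d).
Proof. by apply: measurable_funD => //; exact: mulrl_measurable. Qed.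

Lemma lebesgue_measure_affine_preimage (c d : R) (A : set (measurableTypeR R)) : c != 0 ->
  measurable A ->
  mu ((fun x => c * x + d) @^-1` A) = ((`|c|^-1)%:E * mu A)%E.
Proof.
move=> c0 mA.
pose f := fun x : measurableTypeR R => c * x + d : measurableTypeR R.
have mf : measurable_fun setT f by exact: measurable_affine.
have nc : 0 < `|c| by rewrite normr_gt0.
have nc0 : 0 <= `|c| by [].
pose m' := mscale (NngNum nc0) (pushforward_measure mu mf).
have key : forall X : set R, ocitv X -> mu X = m' X.
  move=> X /= [[a b]/= _ <-]; rewrite /m' /mscale /pushforward -/f /=.
  have [c_gt0|c_lt0|ce0] := ltgtP 0 c; last by rewrite -ce0 eqxx in c0.
  - rewrite [X in (_ * mu X)%E](_ : _ = `](a - d) / c, (b - d) / c]%classic); last first.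
      apply/seteqP; split => x /=; rewrite !in_itv/= /f => /andP[h1 h2]; apply/andP; split.
      + by rewrite ltr_pdivrMr//; lra.
      + by rewrite ler_pdivlMr//; lra.
      + by move: h1; rewrite ltr_pdivrMr//; lra.
      + by move: h2; rewrite ler_pdivlMr//; lra.
    rewrite !lebesgue_measure_itv/= !lte_fin ltr_pM2r ?invr_gt0// ltrD2r.
    case: ifPn => _; last by rewrite mule0.
    rewrite -!EFinB -EFinM gtr0_norm//; congr EFin; field; lra.
  - rewrite [X in (_ * mu X)%E](_ : _ = `[(b - d) / c, (a - d) / c[%classic); last first.
      apply/seteqP; split => x /=; rewrite !in_itv/= /f => /andP[h1 h2]; apply/andP; split.
      + by rewrite ler_ndivrMr//; lra.
      + by rewrite ltr_ndivlMr//; lra.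
      + by move: h2; rewrite ltr_ndivlMr//; lra.
      + by move: h1; rewrite ler_ndivrMr//; lra.
    rewrite !lebesgue_measure_itv/= !lte_fin ltr_nM2r ?invr_lt0// ltrD2r.
    case: ifPn => _; last by rewrite mule0.
    rewrite -!EFinB -EFinM ltr0_norm//; congr EFin; field; lra.
have := lebesgue_measure_unique key mA.
rewrite /m' /mscale/= /pushforward => ->.
by rewrite muleA -EFinM mulVf ?gt_eqF// mul1e.
Qed.

(** Uniqueness of the product measure reduces a shear to its effect on
    rectangles, and there each horizontal slice is translated and scaled.
    Shears and the swap compose to the change to characteristic coordinates. *)
Lemma mu2_shear_preimage (c e : R) (X : set RR) : c != 0 ->
  measurable X ->
  mu2 ((fun p : RR => (c * p.1 + e * p.2, p.2) : RR) @^-1` X) = ((`|c|^-1)%:E * mu2 X)%E.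
Proof.
move=> c0 mX.
pose f := fun p : measurableTypeR R * measurableTypeR R =>
  (c * p.1 + e * p.2, p.2) : measurableTypeR R * measurableTypeR R.
have mf : measurable_fun setT f.
  apply/measurable_fun_pairP; split.
    by apply: measurable_funD; apply: measurable_funM.
  exact: measurable_snd.
have nc : 0 < `|c| by rewrite normr_gt0.
have nc0 : 0 <= `|c| by [].
pose m' := mscale (NngNum nc0) (pushforward_measure mu2 mf).
have key : forall A B : set (measurableTypeR R), measurable A -> measurable B -> m' (A `*` B) = (mu A * mu B)%E.
  move=> A B mA mB.
  have mP : measurable (f @^-1` (A `*` B)).
    by rewrite -[X in measurable X]setTI; apply: (mf measurableT); exact: measurableX.
  transitivity (`|c|%:E * mu2 (f @^-1` (A `*` B)))%E => //.
  have -> : mu2 (f @^-1` (A `*` B)) = (mu \x^ mu)%E (f @^-1` (A `*` B)).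
    apply: product_measure_unique mP => // A' B' mA' mB'.
    exact: product_measure2E.
  rewrite /product_measure2.
  transitivity (`|c|%:E * \int[mu]_(b in B) ((`|c|^-1)%:E * mu A))%E.
    congr (_ * _)%E; rewrite [RHS]integral_mkcond; apply: eq_integral => b _ /=.
    rewrite patchE; case: ifPn => bB.
      rewrite -(@lebesgue_measure_affine_preimage c (e * b)) //.
      congr (mu _); apply/seteqP; split => x; rewrite /ysection /= inE /f /=; first by case.
      by split => //; exact: set_mem.
    rewrite (_ : ysection _ _ = set0) ?measure0//.
    by apply/seteqP; split => x //; rewrite /ysection /= inE /f /= => -[_ /mem_set]; rewrite (negbTE bB).
  rewrite integral_cst// muleA muleA -EFinM mulfV ?mul1e//.
  by rewrite gt_eqF.
have := product_measure_unique key mX.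
rewrite /m' /mscale/= /pushforward => ->.
by rewrite muleA -EFinM mulVf ?gt_eqF// mul1e.
Qed.


Lemma mu2_swap_preimage (X : set RR) : measurable X ->
  mu2 ((fun p : RR => (p.2, p.1) : RR) @^-1` X) = mu2 X.
Proof.
move=> mX.
pose f := fun p : RR => (p.2, p.1) : RR.
have mf : measurable_fun setT f.
  by apply/measurable_fun_pairP; split; [exact: measurable_snd|exact: measurable_fst].
apply/esym; apply: (product_measure_unique (m' := pushforward_measure mu2 mf)) => // A B mA mB.
transitivity (mu2 (B `*` A)); last by rewrite /= product_measure1E// muleC.
by congr (mu2 _); apply/seteqP; split => -[x y] /= [].
Qed.

(** The inverse of [(x, t) |-> (x + s t, x - s t)] for [s ^+ 2 = 1]. Both signs
    of [s] are kept because reversing time exchanges the two characteristic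
    coordinates: a statement about one edge of a rectangle proved for all [s]
    covers the other edge too. *)
Definition charinv (s : R) (p : RR) : RR :=
  ((p.1 + p.2) / 2, s * (p.1 - p.2) / 2).

Lemma measurable_charinv s : measurable_fun setT (charinv s).
Proof.
apply/measurable_fun_pairP; split; apply: measurable_funM => //.
  exact: measurable_funD.
by apply: measurable_funM => //; exact: measurable_funB.
Qed.

Lemma mu2_charinv_preimage s (X : set RR) : s * s = 1 -> measurable X ->
  mu2 (charinv s @^-1` X) = (2%:E * mu2 X)%E.
Proof.
move=> ss mX.
have s0 : s != 0 by apply: contra_eq_neq ss => ->; rewrite mul0r eq_sym oner_neq0.
have ns : `|s| = 1.
  apply/eqP; rewrite -(@eqrXn2 _ 2)//; by rewrite -normrX expr2 ss normr1 expr1n.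
pose X1 := (fun p : RR => (1 * p.1 + s * p.2, p.2) : RR) @^-1` X.
pose X2 := (fun p : RR => (p.2, p.1) : RR) @^-1` X1.
have mX1 : measurable X1.
  rewrite -[X in measurable X]setTI; apply: (_ : measurable_fun setT _) => //.
  apply/measurable_fun_pairP; split; last exact: measurable_snd.
  by apply: measurable_funD; apply: measurable_funM.
have mX2 : measurable X2.
  rewrite -[X in measurable X]setTI; apply: (_ : measurable_fun setT _) => //.
  by apply/measurable_fun_pairP; split; [exact: measurable_snd|exact: measurable_fst].
transitivity (mu2 ((fun p : RR => ((s / 2) * p.1 + (- s / 2) * p.2, p.2) : RR) @^-1` X2)).
  have E p : charinv s p = (1 * p.2 + s * (s / 2 * p.1 + - s / 2 * p.2),
      s / 2 * p.1 + - s / 2 * p.2).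
    have -> : s * (s / 2 * p.1 + - s / 2 * p.2) = (s * s) / 2 * (p.1 - p.2) by field.
    by rewrite ss /charinv; congr pair; field.
  by congr (mu2 _); apply/seteqP; split => p; rewrite /X2 /X1 /preimage/= E.
rewrite mu2_shear_preimage//; last by rewrite mulf_neq0// invr_eq0 pnatr_eq0.
rewrite mu2_swap_preimage// mu2_shear_preimage ?oner_neq0// normr1 invr1 mul1e.
by rewrite normrM ns mul1r normfV ger0_norm// invrK.
Qed.
End AffineImages.

(** A map that multiplies the measure of every set by a constant multiplies
    integrals by that constant. *)
Section ScaledMeasure.
Context d {T : measurableType d} {R : realType}.
Variable m : {measure set T -> \bar R}.
Variables (phi : T -> T) (k : R).
Hypothesis mphi : measurable_fun setT phi.
Hypothesis k0 : 0 <= k.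
Hypothesis scaled : forall A, measurable A -> m (phi @^-1` A) = (k%:E * m A)%E.

Lemma ge0_integral_scaled (f : T -> \bar R) : measurable_fun setT f ->
  (forall x, 0 <= f x)%E -> (\int[m]_x f (phi x) = k%:E * \int[m]_x f x)%E.
Proof.
move=> mf f0.
have := @ge0_integral_pushforward _ _ _ _ _ phi mphi m setT f measurableT mf (fun x _ => f0 x).
rewrite preimage_setT => <-.
rewrite -(@ge0_integral_mscale _ _ _ m setT measurableT (NngNum k0) f mf)//.
apply: (@eq_measure_integral _ _ _ _ (mscale (NngNum k0) m) (pushforward_measure m mphi)).
by move=> A mA _; exact: scaled.
Qed.

Lemma integrable_scaled (f : T -> R) : m.-integrable setT (EFin \o f) ->
  m.-integrable setT (EFin \o (f \o phi)).
Proof.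
move=> /integrableP[mf foo]; apply/integrableP; split.
  exact: measurableT_comp mf mphi.
rewrite /= (@ge0_integral_scaled (fun x => `|(f x)%:E|%E)) ?lte_mul_pinfty//.
exact: measurableT_comp.
Qed.

Lemma Rintegral_scaled (f : T -> R) : m.-integrable setT (EFin \o f) ->
  \int[m]_x f (phi x) = k * \int[m]_x f x.
Proof.
move=> fi; rewrite /Rintegral.
have [mf _] := integrableP _ _ _ fi.
rewrite -[k in RHS]/(fine k%:E) -fineM//; last exact: integrable_fin_num.
congr fine; rewrite [in LHS]integralE [in RHS]integralE.
rewrite muleBr//; last first.
  apply: fin_num_adde_defr.
  by have := integrable_pos_fin_num measurableT fi.
have Ep := @ge0_integral_scaled ((EFin \o f)^\+)%E (measurable_funepos mf) (fun x => funepos_ge0 _ x).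
have En := @ge0_integral_scaled ((EFin \o f)^\-)%E (measurable_funeneg mf) (fun x => funeneg_ge0 _ x).
by rewrite -Ep -En; congr (_ - _)%E; apply: eq_integral => x _; rewrite ?funeposE ?funenegE.
Qed.
End ScaledMeasure.

(** * Real-valued integrals over the line and the plane *)

Section RealIntegral.
Context d {T : measurableType d} {R : realType}.
Variable m : {measure set T -> \bar R}.
Implicit Types f g h : T -> R.
Local Notation intg f := (m.-integrable setT (EFin \o f)).

Lemma intg_measurable f : intg f -> measurable_fun setT f.
Proof. by move=> /measurable_int /measurable_EFinP. Qed.

Lemma intgD f g : intg f -> intg g -> intg (fun x => f x + g x).
Proof. by move=> fi gi; have := integrableD measurableT fi gi. Qed.

Lemma intgB f g : intg f -> intg g -> intg (fun x => f x - g x).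
Proof. by move=> fi gi; have := integrableB measurableT fi gi. Qed.

Lemma intgZ k f : intg f -> intg (fun x => k * f x).
Proof. by move=> fi; have := integrableZl measurableT k fi. Qed.

Lemma intg_le f g : measurable_fun setT f -> intg g ->
  (forall x, `|f x| <= g x) -> intg f.
Proof.
move=> mf gi fg; apply: (le_integrable measurableT _ _ gi).
  exact/measurable_EFinP.
by move=> x _ /=; rewrite lee_fin (le_trans (fg x))// ler_norm.
Qed.

Lemma intgM f h M : intg f -> measurable_fun setT h ->
  (forall x, `|h x| <= M) -> intg (fun x => f x * h x).
Proof.
move=> fi mh hM.
apply: (@intg_le _ (fun x => M * `|f x|)).
- exact: measurable_funM (intg_measurable fi) mh.
- by apply: intgZ; have := integrable_norm fi.
- by move=> x; rewrite normrM mulrC ler_wpM2r.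
Qed.

Lemma intg_norm f : intg f -> intg (fun x => `|f x|).
Proof. by move=> fi; have := integrable_norm fi. Qed.

Lemma RintD f g : intg f -> intg g ->
  \int[m]_x (f x + g x) = \int[m]_x f x + \int[m]_x g x.
Proof. exact: RintegralD. Qed.

Lemma RintB f g : intg f -> intg g ->
  \int[m]_x (f x - g x) = \int[m]_x f x - \int[m]_x g x.
Proof. exact: RintegralB. Qed.

Lemma RintZ k f : intg f -> \int[m]_x (k * f x) = k * \int[m]_x f x.
Proof. by move=> fi; exact: RintegralZl. Qed.

Lemma ler_Rint f g : intg f -> intg g -> (forall x, f x <= g x) ->
  \int[m]_x f x <= \int[m]_x g x.
Proof. by move=> fi gi fg; apply: le_Rintegral. Qed.

Lemma ler_norm_Rint f g : measurable_fun setT f -> intg g ->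
  (forall x, `|f x| <= g x) -> `|\int[m]_x f x| <= \int[m]_x g x.
Proof.
move=> mf gi fg; have fi := intg_le mf gi fg.
apply: (le_trans (le_normr_Rintegral measurableT fi)).
by apply: ler_Rint => //; exact: intg_norm.
Qed.

Lemma eq_Rint_ae f g : measurable_fun setT f -> measurable_fun setT g ->
  {ae m, forall x, f x = g x} -> \int[m]_x f x = \int[m]_x g x.
Proof.
move=> mf mg fg; rewrite /Rintegral; congr fine; apply: ae_eq_integral => //.
- exact/measurable_EFinP.
- exact/measurable_EFinP.
- by apply: filterS fg => x /= ->.
Qed.

Lemma Rint_dominated_cvg (f_ : nat -> T -> R) f g :
  (forall n, measurable_fun setT (f_ n)) ->
  (forall x, f_ ^~ x @ \oo --> f x) -> intg g ->
  (forall n x, `|f_ n x| <= g x) ->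
  \int[m]_x f_ n x @[n --> \oo] --> \int[m]_x f x.
Proof.
move=> mf ff gi fg.
have mff : measurable_fun setT f.
  by apply: (measurable_fun_cvg mf) => x _; exact: ff.
have fi : intg f.
  apply: intg_le gi _ => // x.
  have h : `|f_ n x| @[n --> \oo] --> `|f x| by apply: cvg_norm; exact: ff.
  rewrite -(cvg_lim (@Rhausdorff R) h).
  apply: limr_le; first by apply/cvg_ex; exists `|f x|.
  by apply: nearW => n; exact: fg.
apply: fine_cvg; rewrite fineK; last exact: (integrable_fin_num _ fi).
apply: (@dominated_cvg _ _ _ m setT measurableT (fun n x => (f_ n x)%:E) (fun x => (f x)%:E) (EFin \o g)) => //.
- by move=> n; exact/measurable_EFinP.
- by move=> x _; apply/fine_cvgP; split; [exact: nearW|exact: ff].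
- by move=> n x _ /=; rewrite lee_fin.
Unshelve. all: by end_near. Qed.

Lemma Rint_indic (A : set T) f : measurable A ->
  \int[m]_(x in A) f x = \int[m]_x (f x * \1_A x).
Proof.
move=> mA; rewrite Rintegral_mkcond; apply: eq_Rintegral => x _.
by rewrite patchE indicE; case: ifPn => _; rewrite ?mulr1 ?mulr0.
Qed.

Lemma intg_indic (A : set T) f : measurable A ->
  (m.-integrable A (EFin \o f) <-> intg (fun x => f x * \1_A x)).
Proof.
move=> mA; rewrite (@integrable_mkcond _ _ _ m A) //.
rewrite (_ : (EFin \o f) \_ A = (EFin \o (fun x => f x * \1_A x)))//.
apply/funext => x /=; rewrite patchE indicE /=.
by case: ifPn => _; rewrite ?mulr1 ?mulr0.
Qed.

Lemma measurable_indicR (A : set T) : measurable A ->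
  measurable_fun setT (\1_A : T -> R).
Proof. by move=> mA; exact: measurable_indic. Qed.

Lemma norm_indic_le1 (A : set T) (x : T) : `|\1_A x| <= 1 :> R.
Proof. by rewrite indicE; case: (_ \in _); rewrite ?normr1 ?normr0. Qed.

End RealIntegral.

Section ProductIntegral.
Context {R : realType}.
Local Notation mu := (@lebesgue_measure R).
Local Notation mu2 := (mu \x mu)%E.
Local Notation RR := (measurableTypeR R * measurableTypeR R)%type.

Lemma intg_prodM (f g : R -> R) :
  mu.-integrable setT (EFin \o f) -> mu.-integrable setT (EFin \o g) ->
  mu2.-integrable setT (EFin \o (fun p : RR => f p.1 * g p.2)).
Proof.
move=> fi gi.
have mf := intg_measurable fi; have mg := intg_measurable gi.
have mfg : measurable_fun setT (fun p : RR => f p.1 * g p.2).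
  by apply: measurable_funM; [exact: (measurableT_comp mf)|exact: (measurableT_comp mg)].
apply/integrable12ltyP; first exact/measurable_EFinP.
rewrite /fubini_F /=.
under eq_integral => x _.
  under eq_integral => y _ do rewrite normrM EFinM.
  rewrite ge0_integralZl//; last first.
    by apply/measurable_EFinP; exact: measurableT_comp.
  over.
rewrite ge0_integralZr//.
- apply: lte_mul_pinfty; first exact: integral_ge0.
    apply: (@integrable_fin_num _ _ _ mu setT) => //; exact: (intg_norm fi).
  by have /integrableP[] := gi.
- by apply/measurable_EFinP; exact: measurableT_comp.
- exact: integral_ge0.
Qed.

(** The inner integral is finite only almost everywhere; the real-valued
    integral takes the value [0] elsewhere, which does not affect
    integrability. *)
Lemma integrable_fubini_inner (F : RR -> R) : mu2.-integrable setT (EFin \o F) ->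
  mu.-integrable setT (EFin \o (fun x => \int[mu]_y F (x, y))).
Proof.
move=> Fi; have h := integrable_fubini_F Fi.
have mm : measurable_fun setT (fun x => \int[mu]_y F (x, y)).
  by apply: measurableT_comp (measurable_int _ h) => //.
apply: (le_integrable measurableT _ _ h); first exact/measurable_EFinP.
move=> x _ /=; rewrite /Rintegral /fubini_F /=.
by case: (\int[_]_y _)%E => [r| |] //=; rewrite ?normr0 ?leey.
Qed.

Lemma Rint_fubini (F : RR -> R) : mu2.-integrable setT (EFin \o F) ->
  \int[mu2]_p F p = \int[mu]_x \int[mu]_y F (x, y).
Proof.
move=> Fi; have h := integrable_fubini_F Fi.
rewrite /Rintegral -(integral12_prod_meas1 Fi); congr fine.
have mF := measurable_int _ h.
apply: ae_eq_integral => //.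
  by apply/measurable_EFinP; apply: measurableT_comp mF.
have := integrable_ae measurableT h; apply: filterS => x /= hx _.
by rewrite /fubini_F fineK//; exact: hx.
Qed.

Lemma Rint_prodM (f g : R -> R) :
  mu.-integrable setT (EFin \o f) -> mu.-integrable setT (EFin \o g) ->
  \int[mu2]_p (f p.1 * g p.2) = (\int[mu]_x f x) * (\int[mu]_y g y).
Proof.
move=> fi gi; rewrite (Rint_fubini (intg_prodM fi gi))/=.
under eq_Rintegral => x _ do rewrite RintZ//.
by rewrite RintegralZr.
Qed.
End ProductIntegral.

(** * Smooth steps and bumps *)

Section Bumps.
Context {R : realType}.
Local Notation mu := (@lebesgue_measure R).
Local Notation mu2 := (mu \x mu)%E.
Local Notation RR := (measurableTypeR R * measurableTypeR R)%type.
Implicit Types (f g : R -> R) (a b c d k x y : R).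

(** Differentiability in epsilon-delta form, which is how the derivatives of
    primitives and of the profiles are combined later. *)
Lemma is_derive1_eps f x a : is_derive x 1 f a <->
  forall e, 0 < e -> exists2 dl, 0 < dl &
    forall h, `|h| < dl -> `|f (x + h) - f x - a * h| <= e * `|h|.
Proof.
split=> [[fd fa] e e0|H].
- have : h^-1 *: (f (h *: 1 + x) - f x) @[h --> 0^'] --> a.
    by rewrite -fa; exact: fd.
  move=> /cvgr_dist_le /(_ e e0); rewrite near_withinE => -[dl /= dl0 H].
  exists dl => // h hd; have [->|h0] := eqVneq h 0.
    by rewrite addr0 subrr mulr0 subrr normr0 mulr0.
  have := H h; rewrite /= sub0r normrN => /(_ hd h0); rewrite /GRing.scale/= mulr1 (addrC h x) => He.
  have -> : f (x + h) - f x - a * h = - (a - h^-1 * (f (x + h) - f x)) * h by field.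
  by rewrite normrM normrN ler_wpM2r.
- have Hc : h^-1 *: (f (h *: 1 + x) - f x) @[h --> 0^'] --> a.
    apply/cvgrPdist_le => e e0; rewrite near_withinE.
    have [dl dl0 Hd] := H e e0; exists dl => // h hd0 h0.
    have hd : `|h| < dl by move: hd0; rewrite /= sub0r normrN.
    have := Hd h hd; rewrite /GRing.scale/= mulr1 (addrC h x) => He.
    have -> : a - h^-1 * (f (x + h) - f x) = - (f (x + h) - f x - a * h) / h by field.
    by rewrite normrM normrN normfV ler_pdivrMr ?normr_gt0.
  split; first by apply/cvg_ex; exists a.
  exact: (cvg_lim (@Rhausdorff R) Hc).
Qed.

Definition clip01 y : R := Num.max 0 (Num.min 1 y).

Lemma clip01_lip x y : `|clip01 x - clip01 y| <= `|x - y|.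
Proof.
rewrite /clip01 /Num.max /Num.min /Order.max /Order.min.
case: (ltP 1 x) => x1; case: (ltP 1 y) => y1; rewrite ?ltr01;
  case: (ltP 0 x) => x0; case: (ltP 0 y) => y0;
  rewrite ler_norml; apply/andP; split; case: (ger0P (x - y)) => ?; lra.
Qed.

Lemma clip01_ge0 x : 0 <= clip01 x.
Proof. by rewrite /clip01 le_max lexx. Qed.

Lemma clip01_le1 x : clip01 x <= 1.
Proof. by rewrite /clip01 ge_max ler01 ge_min lexx. Qed.

Lemma clip01_le0 x : x <= 0 -> clip01 x = 0.
Proof.
move=> x0; rewrite /clip01; apply/max_idPl; rewrite ge_min; apply/orP; by right.
Qed.

Lemma clip01_ge1 x : 1 <= x -> clip01 x = 1.
Proof. by move=> x1; rewrite /clip01 (min_idPl x1); apply/max_idPr. Qed.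

Lemma clip01_id x : 0 <= x <= 1 -> clip01 x = x.
Proof. by move=> /andP[x0 x1]; rewrite /clip01 (min_idPr x1); apply/max_idPr. Qed.

(** Clipping the argument at [0] and [1] creates no corner when the derivative
    vanishes there. *)
Lemma is_derive_clip01 f g : (forall y, is_derive y 1 f (g y)) ->
  g 0 = 0 -> g 1 = 0 ->
  forall y, is_derive y 1 (f \o clip01) (g (clip01 y)).
Proof.
move=> fg g0 g1 y.
have [/andP[y0 y1]|yn] := boolP (0 < y < 1).
  apply/is_derive1_eps => e e0.
  have [dl dl0 H] := (is_derive1_eps f y (g y)).1 (fg y) e e0.
  exists (Num.min dl (Num.min y (1 - y))).
    by rewrite !lt_min dl0 y0 subr_gt0.
  move=> h; rewrite !lt_min => /and3P[h1 h2 h3] /=.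
  have hh := ler_norm h; have hh' : - h <= `|h| by rewrite -normrN ler_norm.
  rewrite !clip01_id; [exact: H|by apply/andP; split; lra|by apply/andP; split; lra].
have gc : g (clip01 y) = 0.
  move: yn; rewrite negb_and -!leNgt => /orP[h|h]; first by rewrite clip01_le0.
  by rewrite clip01_ge1.
apply/is_derive1_eps => e e0.
have [dl dl0 H] := (is_derive1_eps f (clip01 y) _).1 (fg (clip01 y)) e e0.
exists dl => // h hd /=.
have lip : `|clip01 (y + h) - clip01 y| <= `|h|.
  by rewrite (le_trans (clip01_lip _ _))// addrC addKr.
have := H (clip01 (y + h) - clip01 y) (le_lt_trans lip hd).
have -> : clip01 y + (clip01 (y + h) - clip01 y) = clip01 (y + h) by ring.
rewrite gc !mul0r => /le_trans; apply.
by rewrite ler_wpM2l// ltW.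
Qed.

Lemma continuous_clip01 : continuous clip01.
Proof.
move=> x; apply/cvgrPdist_le => e e0; exists e => //= y xy.
by rewrite (le_trans (clip01_lip _ _))// ltW.
Qed.

(** The derivative is part of the data because supports of a function and of
    its derivatives have to be tracked together. *)
Definition C1fun (f f' : R -> R) :=
  (forall x, is_derive x 1 f (f' x)) /\ continuous f'.

Definition supp_in a b f := forall x, ~~ (a <= x <= b) -> f x = 0.

Lemma C1fun_cont f f' : C1fun f f' -> continuous f.
Proof.
move=> [H _] x; apply: differentiable_continuous; apply/derivable1_diffP.
by have [] := H x.
Qed.

(** The quintic smooth step, rising from [0] to [1] over a length [1 / k]. It
    is C^2, which is what the second order equation needs: each factor of a
    test function is differentiated twice. *)
Definition stp k a x : R :=
  let y := clip01 (k * (x - a)) in 6 * y ^+ 5 - 15 * y ^+ 4 + 10 * y ^+ 3.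
(** The derivative of the step, a bump of mass one; as [k] grows it becomes an
    approximate identity. *)
Definition bmp k a x : R :=
  let y := clip01 (k * (x - a)) in k * (30 * y ^+ 2 * (1 - y) ^+ 2).
Definition dbmp k a x : R :=
  let y := clip01 (k * (x - a)) in k * (k * (60 * y * (1 - y) * (1 - 2 * y))).

Lemma is_derive_affine k a x : is_derive x 1 (fun x : R => k * (x - a)) k.
Proof.
apply/is_derive1_eps => e e0; exists 1 => // h _.
have -> : k * (x + h - a) - k * (x - a) - k * h = 0 by ring.
by rewrite normr0 mulr_ge0// ltW.
Qed.

Lemma continuous_clip_affine (p : R -> R) k a : continuous p ->
  continuous (fun x => p (clip01 (k * (x - a)))).
Proof.
move=> cp x; apply: (@continuous_comp _ _ _ (fun x => clip01 (k * (x - a))) p); last exact: cp.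
apply: (@continuous_comp _ _ _ (fun x => k * (x - a)) clip01); last exact: continuous_clip01.
apply: differentiable_continuous; apply/derivable1_diffP.
by have [] := is_derive_affine k a x.
Qed.

Lemma stp_C1 k a : C1fun (stp k a) (bmp k a).
Proof.
split=> [x|].
  pose f y : R := 6 * y ^+ 5 - 15 * y ^+ 4 + 10 * y ^+ 3.
  pose g y : R := 30 * y ^+ 2 * (1 - y) ^+ 2.
  have fg y : is_derive y 1 f (g y).
    by rewrite /f; apply: is_derive_eq; rewrite /g /GRing.scale/=; ring.
  have h := @is_derive_clip01 f g fg _ _ (k * (x - a)).
  have {}h : is_derive (k * (x - a)) 1 (f \o clip01) (g (clip01 (k * (x - a)))).
    by apply: h; rewrite /g; ring.
  rewrite /bmp mulrC.
  exact: (@is_derive1_comp _ (f \o clip01) (fun x => k * (x - a)) x _ _ h (is_derive_affine k a x)).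
apply: (@continuous_clip_affine (fun y => k * (30 * y ^+ 2 * (1 - y) ^+ 2))) => y.
apply: differentiable_continuous; apply/derivable1_diffP.
by apply: (@ex_derive _ _ _ _ _ _ _ _).
Qed.

Lemma bmp_C1 k a : C1fun (bmp k a) (dbmp k a).
Proof.
split=> [x|].
  pose f y : R := k * (30 * y ^+ 2 * (1 - y) ^+ 2).
  pose g y : R := k * (60 * y * (1 - y) * (1 - 2 * y)).
  have fg y : is_derive y 1 f (g y).
    by rewrite /f; apply: is_derive_eq; rewrite /g /GRing.scale/=; ring.
  have h := @is_derive_clip01 f g fg _ _ (k * (x - a)).
  have {}h : is_derive (k * (x - a)) 1 (f \o clip01) (g (clip01 (k * (x - a)))).
    by apply: h; rewrite /g; ring.
  rewrite /dbmp mulrC.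
  exact: (@is_derive1_comp _ (f \o clip01) (fun x => k * (x - a)) x _ _ h (is_derive_affine k a x)).
apply: (@continuous_clip_affine (fun y => k * (k * (60 * y * (1 - y) * (1 - 2 * y))))) => y.
apply: differentiable_continuous; apply/derivable1_diffP.
by apply: (@ex_derive _ _ _ _ _ _ _ _).
Qed.

Lemma bmp_ge0 k a x : 0 <= k -> 0 <= bmp k a x.
Proof.
move=> k0; rewrite /bmp; apply: mulr_ge0 => //; apply: mulr_ge0; last exact: sqr_ge0.
by apply: mulr_ge0 => //; exact: sqr_ge0.
Qed.

Lemma bmp_supp k a : 0 < k -> supp_in a (a + k^-1) (bmp k a).
Proof.
move=> k0 x; rewrite negb_and -!ltNge => /orP[h|h]; rewrite /bmp.
  rewrite clip01_le0; first by ring.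
  by rewrite pmulr_rle0//; lra.
rewrite clip01_ge1; first by ring.
by rewrite -ler_pdivrMl//; lra.
Qed.

Lemma stp_le k a x : 0 < k -> x <= a -> stp k a x = 0.
Proof.
move=> k0 xa; rewrite /stp clip01_le0; first by ring.
by rewrite pmulr_rle0//; lra.
Qed.

Lemma stp_ge k a x : 0 < k -> a + k^-1 <= x -> stp k a x = 1.
Proof.
move=> k0 xa; rewrite /stp clip01_ge1; first by ring.
by rewrite -ler_pdivrMl//; lra.
Qed.

Lemma stp_01 k a x : 0 <= stp k a x <= 1.
Proof.
rewrite /stp; set y := clip01 _.
have y0 : 0 <= y := clip01_ge0 _; have y1 : y <= 1 := clip01_le1 _.
have h1 : 0 <= (1 - y) by lra.
apply/andP; split.
  have -> : 6 * y ^+ 5 - 15 * y ^+ 4 + 10 * y ^+ 3 =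
    y ^+ 3 * (6 * (1 - y) ^+ 2 + 3 * (1 - y) + 1) by ring.
  by apply: mulr_ge0; [exact: exprn_ge0|rewrite !addr_ge0// mulr_ge0// exprn_ge0].
rewrite -subr_ge0.
have -> : 1 - (6 * y ^+ 5 - 15 * y ^+ 4 + 10 * y ^+ 3) =
    (1 - y) ^+ 3 * (6 * y ^+ 2 + 3 * y + 1) by ring.
by apply: mulr_ge0; [exact: exprn_ge0|rewrite !addr_ge0// mulr_ge0// exprn_ge0].
Qed.

Lemma continuous_measurableR f : continuous f -> measurable_fun setT f.
Proof. exact: continuous_measurable_fun. Qed.

Lemma measurable_bmp k a : measurable_fun setT (bmp k a).
Proof. by apply: continuous_measurableR; case: (stp_C1 k a). Qed.

Lemma measurable_stp k a : measurable_fun setT (stp k a).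
Proof. by apply: continuous_measurableR; exact: C1fun_cont (stp_C1 k a). Qed.

Lemma bmp_bound k a x : 0 <= k -> `|bmp k a x| <= k * 30.
Proof.
move=> k0; rewrite ger0_norm ?bmp_ge0// /bmp; set y := clip01 _.
have y0 : 0 <= y := clip01_ge0 _; have y1 : y <= 1 := clip01_le1 _.
rewrite ler_wpM2l// -mulrA -[leRHS]mulr1 ler_wpM2l//.
by apply: mulr_ile1; rewrite ?exprn_ge0 ?exprn_ile1//; lra.
Qed.

Lemma integral_C1 f f' a b : C1fun f f' -> a <= b ->
  mu.-integrable `[a, b] (EFin \o f') /\ \int[mu]_(x in `[a, b]) f' x = f b - f a.
Proof.
move=> ff ab; split.
  apply: continuous_compact_integrable; first exact: segment_compact.
  by apply: continuous_subspaceT => x; exact: ff.2.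
move: ab; rewrite le_eqVlt => /orP[/eqP ->|ab].
  by rewrite subrr set_itv1 Rintegral_set1.
rewrite /Rintegral (@continuous_FTC2 _ f' f)//.
- by apply: continuous_subspaceT => x; exact: ff.2.
- split=> [x _| |]; first by have [] := ff.1 x.
  + by apply: cvg_at_right_filter; exact: (C1fun_cont ff).
  + by apply: cvg_at_left_filter; exact: (C1fun_cont ff).
- by move=> x _; rewrite derive1E; have [] := ff.1 x.
Qed.

Lemma bmp_integral k a : 0 < k ->
  mu.-integrable setT (EFin \o bmp k a) /\ \int[mu]_x bmp k a x = 1.
Proof.
move=> k0.
have E x : bmp k a x = bmp k a x * \1_(`[a, a + k^-1]%classic : set R) x.
  rewrite indicE; case: (boolP (x \in _)) => h; first by rewrite mulr1.
  by rewrite mulr0 bmp_supp//; move: h; rewrite mem_setE/= in_itv.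
have ka : a <= a + k^-1 by rewrite lerDl invr_ge0 ltW.
have [bi bE] := integral_C1 (stp_C1 k a) ka.
split.
  by rewrite (_ : bmp k a = (fun x => bmp k a x * \1_(`[a, a + k^-1]%classic : set R) x));
    [exact: (intg_indic _ _ _).1|apply/funext => x; exact: E].
under eq_Rintegral => x _ do rewrite E.
by rewrite -Rint_indic// bE stp_ge// stp_le// subr0.
Qed.
End Bumps.

(** * The wave equation in characteristic coordinates *)

Section Windows.
Context {R : realType}.
Local Notation mu := (@lebesgue_measure R).
Local Notation mu2 := (mu \x mu)%E.
Local Notation RR := (measurableTypeR R * measurableTypeR R)%type.
Implicit Types (f g : R -> R) (a b c d k x y : R).

Lemma C1funB f f' g g' : C1fun f f' -> C1fun g g' ->
  C1fun (fun x => f x - g x) (fun x => f' x - g' x).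
Proof.
move=> [f1 f2] [g1 g2]; split=> x.
  by have := is_deriveB (f1 x) (g1 x).
by apply: cvgB; [exact: f2|exact: g2].
Qed.

Lemma dbmp_supp k a : 0 < k -> supp_in a (a + k^-1) (dbmp k a).
Proof.
move=> k0 x; rewrite negb_and -!ltNge => /orP[h|h]; rewrite /dbmp.
  rewrite clip01_le0; first by ring.
  by rewrite pmulr_rle0//; lra.
rewrite clip01_ge1; first by ring.
by rewrite -ler_pdivrMl//; lra.
Qed.

Lemma supp_inW a b a' b' f : a' <= a -> b <= b' -> supp_in a b f -> supp_in a' b' f.
Proof.
move=> aa bb H x nx; apply: H; apply: contra nx => /andP[h1 h2].
by rewrite (le_trans aa h1) (le_trans h2 bb).
Qed.

Lemma supp_inB a b f g : supp_in a b f -> supp_in a b g ->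
  supp_in a b (fun x => f x - g x).
Proof. by move=> fs gs x nx; rewrite fs// gs// subr0. Qed.

(** A difference of two steps rises near [a], comes down near [a'] and vanishes
    outside, so it is an admissible test function although neither step is. *)
Lemma window_supp k a k' a' b : 0 < k -> 0 < k' -> a <= a' -> a + k^-1 <= b -> a' + k'^-1 <= b ->
  [/\ supp_in a b (fun x => stp k a x - stp k' a' x),
      supp_in a b (fun x => bmp k a x - bmp k' a' x) &
      supp_in a b (fun x => dbmp k a x - dbmp k' a' x)].
Proof.
move=> k0 k'0 aa ab a'b; split.
- move=> x; rewrite negb_and -!ltNge => /orP[h|h].
    by rewrite !stp_le ?subr0//; lra.
  by rewrite !stp_ge ?subrr//; lra.
- apply: (@supp_inB a b (bmp k a) (bmp k' a')).
    have H := @bmp_supp R k a k0; exact: (supp_inW _ _ H).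
  have H := @bmp_supp R k' a' k'0; exact: (supp_inW _ _ H).
- apply: (@supp_inB a b (dbmp k a) (dbmp k' a')).
    have H := @dbmp_supp k a k0; exact: (supp_inW _ _ H).
  have H := @dbmp_supp k' a' k'0; exact: (supp_inW _ _ H).
Qed.

Lemma plateau_supp k a b : 0 < k -> a + k^-1 <= b ->
  [/\ supp_in a b (fun x => stp k a x - stp k (b - k^-1) x),
      supp_in a b (fun x => bmp k a x - bmp k (b - k^-1) x) &
      supp_in a b (fun x => dbmp k a x - dbmp k (b - k^-1) x)].
Proof. by move=> k0 ab; apply: window_supp => //; rewrite ?subrK// lerBrDr. Qed.

Lemma window_C1 k a k' a' : C1fun (fun x => stp k a x - stp k' a' x) (fun x => bmp k a x - bmp k' a' x).
Proof. exact: C1funB (stp_C1 _ _) (stp_C1 _ _). Qed.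

Lemma dwindow_C1 k a k' a' : C1fun (fun x => bmp k a x - bmp k' a' x) (fun x => dbmp k a x - dbmp k' a' x).
Proof. exact: C1funB (bmp_C1 _ _) (bmp_C1 _ _). Qed.

Lemma window_le1 k a k' a' x : `|stp k a x - stp k' a' x| <= 1.
Proof.
have /andP[h1 h2] := stp_01 k a x; have /andP[h3 h4] := stp_01 k' a' x.
by rewrite ler_norml; apply/andP; split; lra.
Qed.

(** Locked so that simplification does not unfold the numeral. *)
Definition natk (n : nat) : R := locked n.+1%:R.

Lemma natk_gt0 n : 0 < natk n.
Proof. by rewrite /natk -lock. Qed.

Lemma natkV_lt e : 0 < e -> \forall n \near \oo, (natk n)^-1 < e.
Proof.
move=> e0; apply: filterS (near_infty_natSinv_lt (PosNum e0)) => n.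
by rewrite /natk -lock.
Qed.

#[local] Hint Resolve natk_gt0 : core.

Lemma stp_cvg_left a x : stp (natk n) a x @[n --> \oo] --> ((a < x)%R%:R : R).
Proof.
apply: cvg_near_cst; case: ltP => ax; last by apply: nearW => n; rewrite stp_le.
have e0 : 0 < x - a by rewrite subr_gt0.
near=> n; rewrite stp_ge//.
by rewrite -lerBrDl ltW//; near: n; exact: natkV_lt.
Unshelve. all: by end_near. Qed.

(** The step is shifted to the left of [b] so that the window built from it
    stays inside the rectangle. *)
Lemma stp_cvg_right b x : stp (natk n) (b - (natk n)^-1) x @[n --> \oo] --> ((b <= x)%R%:R : R).
Proof.
apply: cvg_near_cst; case: leP => bx.
  by apply: nearW => n; rewrite stp_ge// subrK.
have e0 : 0 < b - x by rewrite subr_gt0.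
near=> n; rewrite stp_le//.
by rewrite lerBrDr addrC -lerBrDr ltW//; near: n; exact: natkV_lt.
Unshelve. all: by end_near. Qed.

Lemma window_cvg a b x : a < b ->
  stp (natk n) a x - stp (natk n) (b - (natk n)^-1) x @[n --> \oo] -->
  (\1_(`]a, b[%classic : set R) x : R).
Proof.
move=> ab; have -> : \1_(`]a, b[%classic : set R) x = (a < x)%R%:R - (b <= x)%R%:R :> R.
  rewrite indicE mem_setE/= in_itv/=.
  by case: (ltP a x) => /=; case: (ltP x b) => //= ? ?; rewrite ?subr0 ?subrr//; lra.
by apply: cvgB; [exact: stp_cvg_left|exact: stp_cvg_right].
Qed.

(** Only products are tested against; this is enough for the rectangles below,
    and products of functions of the two characteristic coordinates are easy to
    write down in space-time. *)
Definition weak_d1 (U P : RR -> R) a b c d :=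
  forall chi chi' psi psi', C1fun chi chi' -> C1fun psi psi' ->
  supp_in a b chi -> supp_in a b chi' -> supp_in c d psi -> supp_in c d psi' ->
  \int[mu2]_p (U p * (chi' p.1 * psi p.2)) = - \int[mu2]_p (P p * (chi p.1 * psi p.2)).

(** The weak form of [- 4 U_12 = F], both derivatives having been moved to the
    test function. *)
Definition weak_d12 (U F : RR -> R) a b c d :=
  forall chi chi' chi'' psi psi' psi'', C1fun chi chi' -> C1fun chi' chi'' ->
  C1fun psi psi' -> C1fun psi' psi'' ->
  [/\ supp_in a b chi, supp_in a b chi' & supp_in a b chi''] ->
  [/\ supp_in c d psi, supp_in c d psi' & supp_in c d psi''] ->
  \int[mu2]_p (U p * (chi' p.1 * psi' p.2)) =
  - 4^-1 * \int[mu2]_p (F p * (chi p.1 * psi p.2)).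

Definition cont_on_box (U : RR -> R) a b c d := forall x y, a <= x <= b -> c <= y <= d ->
  forall e, 0 < e -> exists2 dl, 0 < dl & forall p : RR, a <= p.1 <= b -> c <= p.2 <= d ->
    `|p.1 - x| <= dl -> `|p.2 - y| <= dl -> `|U p - U (x, y)| <= e.

Lemma intg_test (U : RR -> R) f g M N : mu2.-integrable setT (EFin \o U) ->
  measurable_fun setT f -> measurable_fun setT g ->
  (forall x, `|f x| <= M) -> (forall x, `|g x| <= N) ->
  mu2.-integrable setT (EFin \o (fun p : RR => U p * (f p.1 * g p.2))).
Proof.
move=> Ui mf mg fM gN; apply: (@intgM _ _ _ _ _ _ (M * N)) => //.
  by apply: measurable_funM; [exact: (measurableT_comp mf)|exact: (measurableT_comp mg)].
by move=> p; rewrite normrM ler_pM.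
Qed.

Lemma intg_bmp2 (U : RR -> R) k a k' c : 0 < k -> 0 < k' -> mu2.-integrable setT (EFin \o U) ->
  mu2.-integrable setT (EFin \o (fun p : RR => U p * (bmp k a p.1 * bmp k' c p.2))).
Proof.
move=> k0 k'0 Ui; apply: (@intg_test _ _ _ (k * 30) (k' * 30)) => //; try exact: measurable_bmp.
  by move=> x; apply: bmp_bound; exact: ltW.
by move=> x; apply: bmp_bound; exact: ltW.
Qed.

Lemma bmp_average (U : RR -> R) k a k' c v e : 0 < k -> 0 < k' ->
  mu2.-integrable setT (EFin \o U) ->
  (forall p : RR, a <= p.1 <= a + k^-1 -> c <= p.2 <= c + k'^-1 -> `|U p - v| <= e) ->
  `|\int[mu2]_p (U p * (bmp k a p.1 * bmp k' c p.2)) - v| <= e.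
Proof.
move=> k0 k'0 Ui H.
have [ai aE] := bmp_integral a k0; have [ci cE] := bmp_integral c k'0.
have pi := intg_prodM ai ci; have pE := Rint_prodM ai ci.
rewrite aE cE mulr1 in pE.
have UBi := intg_bmp2 a c k0 k'0 Ui.
have vBi := intgZ v pi.
have -> : v = \int[mu2]_p (v * (bmp k a p.1 * bmp k' c p.2)) by rewrite RintZ// pE mulr1.
rewrite -RintB//.
have -> : e = \int[mu2]_p (e * (bmp k a p.1 * bmp k' c p.2)) by rewrite RintZ// pE mulr1.
apply: ler_norm_Rint; last 2 first.
- exact: intgZ.
- move=> p; rewrite -mulrBl normrM.
  rewrite (ger0_norm (mulr_ge0 (bmp_ge0 a p.1 (ltW k0)) (bmp_ge0 c p.2 (ltW k'0)))).
  have [h1|h1] := boolP (a <= p.1 <= a + k^-1); last first.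
    by rewrite (bmp_supp k0 h1) mul0r !mulr0.
  have [h2|h2] := boolP (c <= p.2 <= c + k'^-1); last first.
    by rewrite (bmp_supp k'0 h2) !mulr0.
  apply: ler_wpM2r; last exact: H.
  by rewrite mulr_ge0// bmp_ge0// ltW.
- exact: intg_measurable (intgB UBi vBi).
Qed.

Lemma near_box a b A k x dl (p : R) : a <= A -> A + k <= b -> x - k <= A -> A <= x ->
  k < dl -> A <= p <= A + k -> [/\ a <= p <= b, `|p - x| <= dl & True].
Proof.
move=> ? ? ? ? ? /andP[? ?]; split => //; first by apply/andP; split; lra.
by rewrite ler_norml; apply/andP; split; lra.
Qed.

(** At a corner of the box the bump must sit inside, hence slightly to the
    right of a left end point and slightly to the left of a right one; the two
    sequences of base points allow for both. *)
Lemma bmp_point (U : RR -> R) a b c d x y (A C : nat -> R) :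
  mu2.-integrable setT (EFin \o U) -> cont_on_box U a b c d ->
  a <= x <= b -> c <= y <= d ->
  (\forall n \near \oo, [/\ a <= A n, A n + (natk n)^-1 <= b & x - (natk n)^-1 <= A n <= x]) ->
  (\forall n \near \oo, [/\ c <= C n, C n + (natk n)^-1 <= d & y - (natk n)^-1 <= C n <= y]) ->
  \int[mu2]_p (U p * (bmp (natk n) (A n) p.1 * bmp (natk n) (C n) p.2)) @[n --> \oo] --> U (x, y).
Proof.
move=> Ui Uc hx hy hA hC; apply/cvgrPdist_le => e e0.
have [dl dl0 H] := Uc x y hx hy e e0.
near=> n; rewrite distrC; apply: bmp_average => // p hp1 hp2.
have [A1 A2 /andP[A3 A4]] : [/\ a <= A n, A n + (natk n)^-1 <= b & x - (natk n)^-1 <= A n <= x] by near: n.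
have [C1 C2 /andP[C3 C4]] : [/\ c <= C n, C n + (natk n)^-1 <= d & y - (natk n)^-1 <= C n <= y] by near: n.
have kn : (natk n)^-1 < dl by near: n; exact: natkV_lt.
have [? ? ?] := near_box A1 A2 A3 A4 kn hp1.
have [? ? ?] := near_box C1 C2 C3 C4 kn hp2.
by apply: H.
Unshelve. all: by end_near. Qed.


Lemma Rint_window2_cvg (G : RR -> R) (w1 w2 : nat -> R -> R) (l1 l2 : R -> R) :
  mu2.-integrable setT (EFin \o G) ->
  (forall n, measurable_fun setT (w1 n)) -> (forall n, measurable_fun setT (w2 n)) ->
  (forall n x, `|w1 n x| <= 1) -> (forall n x, `|w2 n x| <= 1) ->
  (forall x, w1 ^~ x @ \oo --> l1 x) -> (forall x, w2 ^~ x @ \oo --> l2 x) ->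
  \int[mu2]_p (G p * (w1 n p.1 * w2 n p.2)) @[n --> \oo] -->
  \int[mu2]_p (G p * (l1 p.1 * l2 p.2)).
Proof.
move=> Gi m1 m2 b1 b2 c1 c2.
apply: (@Rint_dominated_cvg _ _ _ _ _ _ (fun p => `|G p|)).
- move=> n; apply: measurable_funM; first exact: intg_measurable Gi.
  by apply: measurable_funM; [exact: (measurableT_comp (m1 n))|exact: (measurableT_comp (m2 n))].
- move=> p; apply: cvgM; first exact: cvg_cst.
  by apply: cvgM; [exact: c1|exact: c2].
- exact: intg_norm.
- move=> n p; rewrite normrM -[leRHS]mulr1 ler_wpM2l// normrM.
  by apply: mulr_ile1.
Qed.

Lemma measurable_window k a k' a' : measurable_fun setT (fun x => stp k a x - stp k' a' x).
Proof. by apply: measurable_funB; exact: measurable_stp. Qed.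

Lemma Rint_bmp_diff (U : RR -> R) k a k' a' l c l' c' : 0 < k -> 0 < k' -> 0 < l -> 0 < l' ->
  mu2.-integrable setT (EFin \o U) ->
  \int[mu2]_p (U p * ((bmp k a p.1 - bmp k' a' p.1) * (bmp l c p.2 - bmp l' c' p.2))) =
  \int[mu2]_p (U p * (bmp k a p.1 * bmp l c p.2))
  - \int[mu2]_p (U p * (bmp k a p.1 * bmp l' c' p.2))
  - \int[mu2]_p (U p * (bmp k' a' p.1 * bmp l c p.2))
  + \int[mu2]_p (U p * (bmp k' a' p.1 * bmp l' c' p.2)).
Proof.
move=> k0 k'0 l0 l'0 Ui.
rewrite -!(RintB, RintD); do ?[exact: intg_bmp2|apply: intgB|apply: intgD].
by apply: eq_Rintegral => p _; ring.
Qed.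

Lemma near_up_corner a b : a < b -> \forall n \near \oo,
  [/\ a <= a, a + (natk n)^-1 <= b & a - (natk n)^-1 <= a <= a].
Proof.
move=> ab; have e0 : 0 < b - a by rewrite subr_gt0.
near=> n; have kn : (natk n)^-1 < b - a by near: n; exact: natkV_lt.
have k0 : 0 < (natk n)^-1 by rewrite invr_gt0.
by split; [|lra|apply/andP; split; lra].
Unshelve. all: by end_near. Qed.

Lemma near_down_corner a b : a < b -> \forall n \near \oo,
  [/\ a <= b - (natk n)^-1, b - (natk n)^-1 + (natk n)^-1 <= b & b - (natk n)^-1 <= b - (natk n)^-1 <= b].
Proof.
move=> ab; have e0 : 0 < b - a by rewrite subr_gt0.
near=> n; have kn : (natk n)^-1 < b - a by near: n; exact: natkV_lt.
have k0 : 0 < (natk n)^-1 by rewrite invr_gt0.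
by split; [lra|lra|apply/andP; split; lra].
Unshelve. all: by end_near. Qed.

(** Test the equation with a product of two windows. The derivatives of the
    windows are bumps concentrating at the four corners with alternating signs,
    while the windows themselves converge to the indicator of the rectangle. *)
Lemma rectangle_identity (U F : RR -> R) a b c d : a < b -> c < d ->
  mu2.-integrable setT (EFin \o U) -> mu2.-integrable setT (EFin \o F) ->
  cont_on_box U a b c d -> weak_d12 U F a b c d ->
  U (a, c) - U (a, d) - U (b, c) + U (b, d) =
  - 4^-1 * \int[mu2]_p (F p * (\1_(`]a, b[%classic : set R) p.1 * \1_(`]c, d[%classic : set R) p.2)).
Proof.
move=> ab cd Ui Fi Uc H.
have ax : a <= a <= b by rewrite lexx ltW. have bx : a <= b <= b by rewrite lexx ltW.
have cx : c <= c <= d by rewrite lexx ltW. have dx : c <= d <= d by rewrite lexx ltW.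
have ua := near_up_corner ab; have ub := near_down_corner ab.
have uc := near_up_corner cd; have ud := near_down_corner cd.
pose lhs n := \int[mu2]_p (U p * ((bmp (natk n) a p.1 - bmp (natk n) (b - (natk n)^-1) p.1) *
  (bmp (natk n) c p.2 - bmp (natk n) (d - (natk n)^-1) p.2))).
have L1 : lhs n @[n --> \oo] --> U (a, c) - U (a, d) - U (b, c) + U (b, d).
  rewrite /lhs; under eq_fun => n do rewrite Rint_bmp_diff//.
  apply: cvgD; [apply: cvgB; [apply: cvgB|]|].
  - exact: (bmp_point (A := fun=> a) (C := fun=> c) Ui Uc ax cx ua uc).
  - exact: (bmp_point (A := fun=> a) (C := fun n => d - (natk n)^-1) Ui Uc ax dx ua ud).
  - exact: (bmp_point (A := fun n => b - (natk n)^-1) (C := fun=> c) Ui Uc bx cx ub uc).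
  - exact: (bmp_point (A := fun n => b - (natk n)^-1) (C := fun n => d - (natk n)^-1) Ui Uc bx dx ub ud).
pose rhs n := - 4^-1 * \int[mu2]_p (F p * ((stp (natk n) a p.1 - stp (natk n) (b - (natk n)^-1) p.1) *
  (stp (natk n) c p.2 - stp (natk n) (d - (natk n)^-1) p.2))).
have L2 : rhs n @[n --> \oo] --> - 4^-1 * \int[mu2]_p (F p * (\1_(`]a, b[%classic : set R) p.1 * \1_(`]c, d[%classic : set R) p.2)).
  apply: cvgMr; apply: (Rint_window2_cvg (w1 := fun n x => stp (natk n) a x - stp (natk n) (b - (natk n)^-1) x)
     (w2 := fun n x => stp (natk n) c x - stp (natk n) (d - (natk n)^-1) x)) => //.
  - by move=> n; exact: measurable_window.
  - by move=> n; exact: measurable_window.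
  - by move=> n x; exact: window_le1.
  - by move=> n x; exact: window_le1.
  - by move=> x; exact: window_cvg.
  - by move=> x; exact: window_cvg.
have E : \forall n \near \oo, lhs n = rhs n.
  near=> n; have k0 := natk_gt0 n.
  have [_ na _] : [/\ a <= a, a + (natk n)^-1 <= b & a - (natk n)^-1 <= a <= a] by near: n.
  have [_ nc _] : [/\ c <= c, c + (natk n)^-1 <= d & c - (natk n)^-1 <= c <= c] by near: n.
  have [h1 h2 h3] := plateau_supp k0 na.
  have [h4 h5 h6] := plateau_supp k0 nc.
  by apply: (H _ _ _ _ _ _ (window_C1 _ _ _ _) (dwindow_C1 _ _ _ _) (window_C1 _ _ _ _) (dwindow_C1 _ _ _ _)).
have L3 : rhs n @[n --> \oo] --> U (a, c) - U (a, d) - U (b, c) + U (b, d).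
  by apply: cvg_trans L1; apply: near_eq_cvg.
exact: (cvg_unique (@Rhausdorff R) L3 L2).
Unshelve. all: by end_near. Qed.

Lemma normr1_le1 : `|1 : R| <= 1. Proof. by rewrite normr1. Qed.
#[local] Hint Resolve normr1_le1 : core.

Lemma bool_sub01 (bb : bool) (z : R) : 0 <= z <= 1 -> `|bb%:R - z| <= 1.
Proof.
move=> /andP[z0 z1]; rewrite ler_norml; case: bb; rewrite ?mulr1n ?mulr0n.
  by apply/andP; split; lra.
by apply/andP; split; lra.
Qed.

(** On the line of the first variable through the lower edge, [U] is the
    primitive of an integrable function: test with a second factor that rises
    sharply at [c] and comes down slowly at a fixed place; the slow part only
    sees the weak derivative [P], the product of both only sees [F]. *)
Lemma edge_primitive (U P F : RR -> R) a b c d : c < d ->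
  mu2.-integrable setT (EFin \o U) -> mu2.-integrable setT (EFin \o P) ->
  mu2.-integrable setT (EFin \o F) ->
  cont_on_box U a b c d -> weak_d1 U P a b c d -> weak_d12 U F a b c d ->
  exists2 q : R -> R, mu.-integrable setT (EFin \o q) &
    forall x, a < x <= b ->
      U (x, c) - U (a, c) = \int[mu]_s (q s * \1_(`]a, x[%classic : set R) s).
Proof.
move=> cd Ui Pi Fi Uc HP HF.
have [m mk] : exists m, c + (natk m)^-1 + (natk m)^-1 <= d.
  have e0 : 0 < (d - c) / 2 by rewrite divr_gt0// subr_gt0.
  have [m _ Hm] := natkV_lt e0.
  by exists m; have := Hm m (leqnn m) => /= h; lra.
(* The slow descent of the second factor takes place between [c1] and [d]. *)
pose k := natk m; pose c1 := c + k^-1.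
have k0 : 0 < k by exact: natk_gt0. have kV : 0 < k^-1 by rewrite invr_gt0.
pose G p := P p * (1 * bmp k c1 p.2) + 4^-1 * (F p * (1 * ((c < p.2)%R%:R - stp k c1 p.2))).
have b2 x : `|(c < x)%R%:R - stp k c1 x| <= (1 : R).
  exact: bool_sub01 (stp_01 k c1 x).
have mstep : measurable_fun setT (fun x : R => (c < x)%R%:R : R).
  rewrite (_ : (fun x => _) = \1_(`]c, +oo[%classic : set R)); first exact: measurable_indicR.
  by apply/funext => x; rewrite indicE mem_setE/= in_itv/= andbT.
have PBi : mu2.-integrable setT (EFin \o (fun p : RR => P p * (1 * bmp k c1 p.2))).
  apply: (@intg_test _ (fun=> 1) (bmp k c1) 1 (k * 30)) => //; first exact: measurable_bmp.
  by move=> y; apply: bmp_bound; exact: ltW.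
have FBi : mu2.-integrable setT (EFin \o (fun p : RR => F p * (1 * ((c < p.2)%R%:R - stp k c1 p.2)))).
  apply: (@intg_test _ (fun=> 1) (fun x => (c < x)%R%:R - stp k c1 x) 1 1) => //.
  by apply: measurable_funB => //; exact: measurable_stp.
have Gi : mu2.-integrable setT (EFin \o G).
  exact: (intgD PBi (intgZ 4^-1 FBi)).
exists (fun s => \int[mu]_y G (s, y)); first exact: integrable_fubini_inner.
move=> x /andP[ax xb].
have ax' : a < b by lra.
have mi : measurable_fun setT (\1_(`]a, x[%classic : set R) : R -> R) by exact: measurable_indicR.
transitivity (\int[mu2]_p (G p * (\1_(`]a, x[%classic : set R) p.1 * 1))); last first.
  rewrite Rint_fubini/=; last first.
    apply: (@intg_test G (\1_(`]a, x[%classic : set R)) (fun=> 1) 1 1) => // s.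
    exact: norm_indic_le1.
  apply: eq_Rintegral => s _ /=.
  rewrite indicE; case: (_ \in _); last first.
    by rewrite mulr0; under eq_Rintegral do rewrite mul0r mulr0; rewrite Rintegral_cst// mul0r.
  by rewrite [RHS]mulr1; apply: eq_Rintegral => y _; rewrite !mulr1.
have aa : a <= a <= b by rewrite lexx ltW. have xx : a <= x <= b by rewrite xb ltW.
have cc : c <= c <= d by rewrite lexx ltW.
have cc1 : c < c1 by rewrite /c1; lra.
have c1d : c1 + k^-1 <= d by [].
have c1d' : c1 <= d by apply: le_trans c1d; rewrite lerDl ltW.
have ua := near_up_corner ax; have ux := near_down_corner ax; have uc := near_up_corner cc1.
have ua' : \forall n \near \oo, [/\ a <= a, a + (natk n)^-1 <= b & a - (natk n)^-1 <= a <= a].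
  by apply: filterS ua => n [h1 h2 h3]; split => //; exact: le_trans h2 xb.
have ux' : \forall n \near \oo, [/\ a <= x - (natk n)^-1, x - (natk n)^-1 + (natk n)^-1 <= b & x - (natk n)^-1 <= x - (natk n)^-1 <= x].
  by apply: filterS ux => n [h1 h2 h3]; split => //; exact: le_trans h2 xb.
have uc' : \forall n \near \oo, [/\ c <= c, c + (natk n)^-1 <= d & c - (natk n)^-1 <= c <= c].
  by apply: filterS uc => n [h1 h2 h3]; split => //; exact: le_trans h2 c1d'.
pose w n s := stp (natk n) a s - stp (natk n) (x - (natk n)^-1) s.
pose w' n s := bmp (natk n) a s - bmp (natk n) (x - (natk n)^-1) s.
pose lhs n := \int[mu2]_p (U p * (w' n p.1 * bmp (natk n) c p.2)).
have L1 : lhs n @[n --> \oo] --> U (a, c) - U (x, c).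
  have -> : lhs = fun n => \int[mu2]_p (U p * (bmp (natk n) a p.1 * bmp (natk n) c p.2))
      - \int[mu2]_p (U p * (bmp (natk n) (x - (natk n)^-1) p.1 * bmp (natk n) c p.2)).
    apply/funext => n; rewrite -RintB; try exact: intg_bmp2.
    by apply: eq_Rintegral => p _; rewrite /w'; ring.
  apply: cvgB.
  - exact: (bmp_point (A := fun=> a) (C := fun=> c) Ui Uc aa cc ua' uc').
  - exact: (bmp_point (A := fun n => x - (natk n)^-1) (C := fun=> c) Ui Uc xx cc ux' uc').
pose rhs n := - (\int[mu2]_p (P p * (w n p.1 * bmp k c1 p.2)))
  + - 4^-1 * \int[mu2]_p (F p * (w n p.1 * (stp (natk n) c p.2 - stp k c1 p.2))).
have wc s : w ^~ s @ \oo --> (\1_(`]a, x[%classic : set R) s : R) by exact: window_cvg.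
have mw n : measurable_fun setT (w n) by exact: measurable_window.
have bw n s : `|w n s| <= 1 by exact: window_le1.
have kB : 0 < k * 30 by rewrite mulr_gt0.
have L2 : rhs n @[n --> \oo] --> - \int[mu2]_p (G p * (\1_(`]a, x[%classic : set R) p.1 * 1)).
  have -> : - (\int[mu2]_p (G p * (\1_(`]a, x[%classic : set R) p.1 * 1))) =
     - (\int[mu2]_p ((P p * (1 * bmp k c1 p.2)) * (\1_(`]a, x[%classic : set R) p.1 * 1)))
     + - 4^-1 * \int[mu2]_p (F p * (\1_(`]a, x[%classic : set R) p.1 * ((c < p.2)%R%:R - stp k c1 p.2))).
    have Fi2 : mu2.-integrable setT (EFin \o (fun p : RR => F p *
        (\1_(`]a, x[%classic : set R) p.1 * ((c < p.2)%R%:R - stp k c1 p.2)))).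
      apply: (@intg_test F (\1_(`]a, x[%classic : set R)) (fun x => (c < x)%R%:R - stp k c1 x) 1 1) => //.
        by apply: measurable_funB => //; exact: measurable_stp.
      by move=> s; exact: norm_indic_le1.
    have Pi2 : mu2.-integrable setT (EFin \o (fun p : RR => (P p * (1 * bmp k c1 p.2)) *
        (\1_(`]a, x[%classic : set R) p.1 * 1))).
      apply: (@intg_test (fun p => P p * (1 * bmp k c1 p.2)) (\1_(`]a, x[%classic : set R)) (fun=> 1) 1 1) => // s.
      exact: norm_indic_le1.
    rewrite mulNr -RintZ// -opprD -RintD//; last exact: intgZ.
    by congr (- _); apply: eq_Rintegral => p _; rewrite /G; ring.
  apply: cvgD.
    apply: cvgN.
    rewrite [X in X @ _ --> _](_ : _ = fun n => \int[mu2]_p ((P p * (1 * bmp k c1 p.2)) * (w n p.1 * 1))).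
      apply: (Rint_window2_cvg (w1 := w) (w2 := fun _ _ => 1) (l1 := \1_(`]a, x[%classic : set R)) (l2 := fun=> 1) PBi) => // s; exact: cvg_cst.
    by apply/funext => n; apply: eq_Rintegral => p _; ring.
  apply: cvgMr.
  apply: (Rint_window2_cvg (w1 := w) (w2 := fun n s => stp (natk n) c s - stp k c1 s)
    (l1 := \1_(`]a, x[%classic : set R)) (l2 := fun s => (c < s)%R%:R - stp k c1 s)) => //.
  - by move=> n; exact: measurable_window.
  - by move=> n s; exact: window_le1.
  - by move=> s; apply: cvgB; [exact: stp_cvg_left|exact: cvg_cst].
have E : \forall n \near \oo, lhs n = rhs n.
  near=> n; have kn0 := natk_gt0 n.
  have [_ na _] : [/\ a <= a, a + (natk n)^-1 <= x & a - (natk n)^-1 <= a <= a] by near: n.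
  have [_ nc _] : [/\ c <= c, c + (natk n)^-1 <= c1 & c - (natk n)^-1 <= c <= c] by near: n.
  have [h1 h2 h3] := plateau_supp kn0 na.
  have [h4 h5 h6] := window_supp kn0 k0 (ltW cc1) (le_trans nc c1d') c1d.
  have s1 := supp_inW (lexx a) xb h1; have s2 := supp_inW (lexx a) xb h2.
  have s3 := supp_inW (lexx a) xb h3.
  have b1' : supp_in c d (bmp k c1) by have h := @bmp_supp R k c1 k0; exact: (supp_inW (ltW cc1) c1d h).
  have b2' : supp_in c d (dbmp k c1) by have h := @dbmp_supp k c1 k0; exact: (supp_inW (ltW cc1) c1d h).
  have e1 := HP _ _ _ _ (window_C1 _ _ _ _) (bmp_C1 _ _) s1 s2 b1' b2'.
  have e2 := HF _ _ _ _ _ _ (window_C1 _ _ _ _) (dwindow_C1 _ _ _ _) (window_C1 _ _ _ _) (dwindow_C1 _ _ _ _) (And3 s1 s2 s3) (And3 h4 h5 h6).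
  rewrite /rhs -e2 -e1 /lhs.
  rewrite -RintD; last 2 first.
  - apply: (@intg_test U (w' n) (bmp k c1) (natk n * 30 + natk n * 30) (k * 30)) => //; try exact: measurable_bmp.
    + by apply: measurable_funB; exact: measurable_bmp.
    + by move=> s; rewrite (le_trans (ler_normB _ _))// lerD// bmp_bound ?ltW.
    + by move=> s; rewrite bmp_bound ?ltW.
  - apply: (@intg_test U (w' n) (fun s => bmp (natk n) c s - bmp k c1 s) (natk n * 30 + natk n * 30) (natk n * 30 + k * 30)) => //.
    + by apply: measurable_funB; exact: measurable_bmp.
    + by apply: measurable_funB; exact: measurable_bmp.
    + by move=> s; rewrite (le_trans (ler_normB _ _))// lerD// bmp_bound ?ltW.
    + by move=> s; rewrite (le_trans (ler_normB _ _))// lerD// bmp_bound ?ltW.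
  by apply: eq_Rintegral => p _; rewrite /w'; ring.
have L3 : rhs n @[n --> \oo] --> U (a, c) - U (x, c).
  by apply: cvg_trans L1; apply: near_eq_cvg.
have := cvg_unique (@Rhausdorff R) L3 L2.
by move=> h; rewrite -opprB h opprK.
Unshelve. all: by end_near. Qed.

End Windows.

(** * Test functions adapted to the characteristics *)

Section CharacteristicTests.
Context {R : realType}.
Local Notation mu := (@lebesgue_measure R).
Local Notation mu2 := (mu \x mu)%E.
Local Notation RR := (measurableTypeR R * measurableTypeR R)%type.
Implicit Types (a b c d s x y : R) (chi psi : R -> R).

Lemma is_derive_comp_affine chi chi' k l x : is_derive (k * x + l) 1 chi (chi' (k * x + l)) ->
  is_derive x 1 (fun y => chi (k * y + l)) (chi' (k * x + l) * k).
Proof.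
move=> h; apply: (@is_derive1_comp _ chi (fun y => k * y + l)) => //.
apply/is_derive1_eps => e e0; exists 1 => // z _.
have -> : k * (x + z) + l - (k * x + l) - k * z = 0 by ring.
by rewrite normr0 mulr_ge0// ltW.
Qed.

Definition chartest s chi psi (p : R * R) : R :=
  chi (p.1 + s * p.2) * psi (p.1 - s * p.2).

Lemma chartest_derive_x s chi chi' psi psi' (x t : R) : C1fun chi chi' -> C1fun psi psi' ->
  is_derive x 1 (fun y => chartest s chi psi (y, t))
    (chartest s chi' psi (x, t) + chartest s chi psi' (x, t)).
Proof.
move=> hc hp; rewrite /chartest/=.
have := @is_derive_comp_affine chi chi' 1 (s * t) x (hc.1 _).
have := @is_derive_comp_affine psi psi' 1 (- (s * t)) x (hp.1 _).
rewrite !mul1r !mulr1 => h1 h2.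
have := is_deriveM h2 h1.
rewrite (_ : (_ * _)%R = (fun y : R => chi (y + s * t) * psi (y - s * t))); last first.
  apply/funext => y; transitivity (chi (1 * y + s * t) * psi (1 * y - s * t)) => //.
  by rewrite !mul1r.
by rewrite !mul1r /GRing.scale/= addrC (mulrC (psi _)).
Qed.

Lemma chartest_derive_t s chi chi' psi psi' (x t : R) : C1fun chi chi' -> C1fun psi psi' ->
  is_derive t 1 (fun y => chartest s chi psi (x, y))
    (s * (chartest s chi' psi (x, t) - chartest s chi psi' (x, t))).
Proof.
move=> hc hp; rewrite /chartest/=.
have := @is_derive_comp_affine chi chi' s x t (hc.1 _).
have := @is_derive_comp_affine psi psi' (- s) x t (hp.1 _).
move=> h1 h2.
have := is_deriveM h2 h1.
rewrite (_ : (_ * _)%R = (fun y : R => chi (x + s * y) * psi (x - s * y))); last first.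
  apply/funext => y; transitivity (chi (s * y + x) * psi (- s * y + x)) => //.
  by rewrite mulNr (addrC x) (addrC x).
rewrite /GRing.scale/= mulNr (addrC (s * t)) (addrC (- (s * t))) => h3.
apply: is_derive_eq h3 _; ring.
Qed.

Lemma chartest_dx s chi chi' psi psi' : C1fun chi chi' -> C1fun psi psi' ->
  dx (chartest s chi psi) = fun p => chartest s chi' psi p + chartest s chi psi' p.
Proof.
move=> hc hp; apply/funext => -[x t]; rewrite /dx derive1E.
by have [] := @chartest_derive_x s _ _ _ _ x t hc hp.
Qed.

Lemma chartest_dt s chi chi' psi psi' : C1fun chi chi' -> C1fun psi psi' ->
  dt (chartest s chi psi) = fun p => s * (chartest s chi' psi p - chartest s chi psi' p).
Proof.
move=> hc hp; apply/funext => -[x t]; rewrite /dt derive1E.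
by have [] := @chartest_derive_t s _ _ _ _ x t hc hp.
Qed.

Lemma continuous_charp s : continuous (fun p : R * R => p.1 + s * p.2).
Proof.
move=> p; apply: cvgD; first exact: cvg_fst.
by apply: cvgMr; exact: cvg_snd.
Qed.

Lemma continuous_charm s : continuous (fun p : R * R => p.1 - s * p.2).
Proof.
move=> p; apply: cvgB; first exact: cvg_fst.
by apply: cvgMr; exact: cvg_snd.
Qed.

Lemma continuous_chartest s chi psi : continuous chi -> continuous psi ->
  continuous (chartest s chi psi).
Proof.
move=> cc cp p; apply: cvgM.
- apply: (@continuous_comp _ _ _ (fun p : R * R => p.1 + s * p.2) chi); last exact: cc.
  exact: continuous_charp.
- apply: (@continuous_comp _ _ _ (fun p : R * R => p.1 - s * p.2) psi); last exact: cp.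
  exact: continuous_charm.
Qed.

Definition charbox s a b c d : set (R * R) :=
  [set p | a <= p.1 + s * p.2 <= b /\ c <= p.1 - s * p.2 <= d].

Lemma charinv_p s (q : R * R) : s * s = 1 -> (charinv s q).1 + s * (charinv s q).2 = q.1.
Proof.
move=> ss; rewrite /charinv/=.
have -> : s * (s * (q.1 - q.2) / 2) = (s * s) * (q.1 - q.2) / 2 by ring.
by rewrite ss; field.
Qed.

Lemma charinv_m s (q : R * R) : s * s = 1 -> (charinv s q).1 - s * (charinv s q).2 = q.2.
Proof.
move=> ss; rewrite /charinv/=.
have -> : s * (s * (q.1 - q.2) / 2) = (s * s) * (q.1 - q.2) / 2 by ring.
by rewrite ss; field.
Qed.

Lemma charinvK s x t : s * s = 1 -> charinv s (x + s * t, x - s * t) = (x, t).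
Proof.
move=> ss; rewrite /charinv/=; congr pair; first by field.
have -> : s * (x + s * t - (x - s * t)) / 2 = (s * s) * t by field.
by rewrite ss mul1r.
Qed.

Lemma continuous_charinv s : continuous (charinv s : R * R -> R * R).
Proof.
move=> p.
have h1 : (q.1 + q.2) / 2 @[q --> p] --> (p.1 + p.2) / 2.
  by apply: cvgMl; apply: cvgD; [exact: cvg_fst|exact: cvg_snd].
have h2 : s * (q.1 - q.2) / 2 @[q --> p] --> s * (p.1 - p.2) / 2.
  by apply: cvgMl; apply: cvgMr; apply: cvgB; [exact: cvg_fst|exact: cvg_snd].
exact: cvg_pair h1 h2.
Qed.

Lemma charboxE s a b c d : s * s = 1 ->
  charbox s a b c d = (charinv s : R * R -> R * R) @` (`[a, b]%classic `*` `[c, d]%classic).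
Proof.
move=> ss; apply/seteqP; split => [[x t] [/= h1 h2]|_ [q [/= h1 h2] <-]].
  exists (x + s * t, x - s * t); last exact: charinvK.
  by split; rewrite /= in_itv.
by split; rewrite ?charinv_p ?charinv_m//; move: h1 h2; rewrite !in_itv.
Qed.

Lemma compact_charbox s a b c d : s * s = 1 -> compact (charbox s a b c d).
Proof.
move=> ss; rewrite charboxE//; apply: continuous_compact.
  by apply: continuous_subspaceT => p; exact: continuous_charinv.
by apply: compact_setX; exact: segment_compact.
Qed.

Lemma measurable_charbox s a b c d : measurable (charbox s a b c d).
Proof.
have m1 : measurable_fun setT (fun p : RR => p.1 + s * p.2).
  by apply: measurable_funD => //; apply: measurable_funM.
have m2 : measurable_fun setT (fun p : RR => p.1 - s * p.2).
  by apply: measurable_funB => //; apply: measurable_funM.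
rewrite (_ : charbox _ _ _ _ _ =
  ((fun p : RR => p.1 + s * p.2) @^-1` `[a, b]%classic) `&`
  ((fun p : RR => p.1 - s * p.2) @^-1` `[c, d]%classic)); last first.
  by apply/seteqP; split => p /=; rewrite !in_itv.
by apply: measurableI; rewrite -[X in measurable X]setTI; [apply: m1|apply: m2].
Qed.

Lemma chartest_off s a b c d chi psi p : supp_in a b chi -> supp_in c d psi ->
  ~ charbox s a b c d p -> chartest s chi psi p = 0.
Proof.
move=> hc hp np; rewrite /chartest.
have [h1|h1] := boolP (a <= p.1 + s * p.2 <= b); last by rewrite (hc _ h1) mul0r.
have [h2|h2] := boolP (c <= p.1 - s * p.2 <= d); last by rewrite (hp _ h2) mulr0.
by exfalso; apply: np.
Qed.

(** These products are genuine test functions of the weak equation as soon as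
    the characteristic rectangle that supports them lies in the domain. *)
Lemma chartest_test s a b c d chi chi' psi psi' (Om : set (R * R)) : s * s = 1 ->
  C1fun chi chi' -> C1fun psi psi' -> supp_in a b chi -> supp_in c d psi ->
  charbox s a b c d `<=` Om -> test_fun Om (chartest s chi psi).
Proof.
move=> ss hc hp sc sp KO; split.
- by move=> x t; have [] := @chartest_derive_x s _ _ _ _ x t hc hp.
- by move=> x t; have [] := @chartest_derive_t s _ _ _ _ x t hc hp.
- rewrite (chartest_dx _ hc hp) => p; apply: cvgD.
    by apply: continuous_chartest; [exact: hc.2|exact: C1fun_cont hp].
  by apply: continuous_chartest; [exact: C1fun_cont hc|exact: hp.2].
- rewrite (chartest_dt _ hc hp) => p; apply: cvgMr; apply: cvgB.
    by apply: continuous_chartest; [exact: hc.2|exact: C1fun_cont hp].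
  by apply: continuous_chartest; [exact: C1fun_cont hc|exact: hp.2].
- exists (charbox s a b c d); split => //; first exact: compact_charbox.
  by move=> p np; exact: chartest_off np.
Qed.

(** Passing from an integral over the domain to one over the plane, by cutting
    the weakly differentiable function down to the support of the test
    function. *)
Lemma Rint_restrict (Om K : set RR) (g h : RR -> R) : K `<=` Om ->
  (forall p, ~ K p -> h p = 0) ->
  \int[mu2]_(p in Om) (g p * h p) = \int[mu2]_p ((g p * \1_K p) * h p).
Proof.
move=> KO h0; rewrite Rintegral_mkcond; apply: eq_Rintegral => p _.
have h0' : p \notin K -> h p = 0.
  by move=> /negP pK; apply: h0 => Kp; apply: pK; exact: mem_set.
rewrite patchE indicE; case: ifPn => pO.
  by case: (boolP (p \in K)) => pK; [rewrite mulr1|rewrite (h0' pK) !mulr0].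
rewrite h0' ?mulr0//; apply: contra pO => /set_mem pK.
by apply/mem_set; exact: KO.
Qed.

Lemma continuous_measurable_chartest s chi psi : measurable_fun setT chi -> measurable_fun setT psi ->
  measurable_fun setT (chartest s chi psi : RR -> R).
Proof.
move=> mc mp; apply: measurable_funM.
  apply: (measurableT_comp mc); apply: measurable_funD => //.
  by apply: measurable_funM.
apply: (measurableT_comp mp); apply: measurable_funB => //.
by apply: measurable_funM.
Qed.
End CharacteristicTests.

Section CharacteristicForm.
Context {R : realType}.
Local Notation mu := (@lebesgue_measure R).
Local Notation mu2 := (mu \x mu)%E.
Local Notation RR := (measurableTypeR R * measurableTypeR R)%type.
Implicit Types (a b c d s x y : R) (chi psi : R -> R) (Om : set (R * R)).

(** The wave operator in terms of weak derivatives, with the right-hand side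
    left open; the same lemmas then serve the solution and the travelling
    pulse. *)
Definition weak_wave Om (u f : R * R -> R) := exists ux ut uxx utt,
  [/\ weak_dx Om u ux /\ weak_dt Om u ut, weak_dx Om ux uxx /\ weak_dt Om ut utt
    & f = (fun p => utt p - uxx p)].

Lemma supp_bounded a b (f : R -> R) : continuous f -> supp_in a b f ->
  exists M, forall x, `|f x| <= M.
Proof.
move=> cf sf; have [ab|ba] := leP a b.
  have cnf : {within `[a, b], continuous (fun x => `|f x|)}.
    apply: continuous_subspaceT => x.
    by apply: cvg_norm; exact: cf.
  have [c _ H] := EVT_max ab cnf.
  exists `|f c| => x; have [xab|xab] := boolP (a <= x <= b).
    by apply: H; rewrite in_itv.
  by rewrite sf// normr0.
exists 0 => x; rewrite sf ?normr0//; apply/negP => /andP[h1 h2].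
by have := le_trans h1 h2; rewrite leNgt ba.
Qed.

Lemma locint_restrict Om (g : R * R -> R) s a b c d : s * s = 1 -> locint Om g ->
  charbox s a b c d `<=` Om ->
  mu2.-integrable setT (EFin \o (fun p : RR => g p * \1_(charbox s a b c d) p)).
Proof.
move=> ss gi KO.
apply: (intg_indic _ _ _).1; first exact: measurable_charbox.
by apply: gi => //; exact: compact_charbox.
Qed.

Lemma intg_chartest (g : RR -> R) s a b c d chi psi : mu2.-integrable setT (EFin \o g) ->
  continuous chi -> continuous psi -> supp_in a b chi -> supp_in c d psi ->
  mu2.-integrable setT (EFin \o (fun p : RR => g p * chartest s chi psi p)).
Proof.
move=> gi cc cp sc sp.
have [M HM] := supp_bounded cc sc; have [N HN] := supp_bounded cp sp.
apply: (@intgM _ _ _ _ _ _ (M * N)) => //.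
  by apply: continuous_measurable_chartest; exact: continuous_measurableR.
by move=> p; rewrite /chartest normrM ler_pM.
Qed.

Lemma chartest_charinv s chi psi q : s * s = 1 ->
  chartest s chi psi (charinv s q) = chi q.1 * psi q.2.
Proof. by move=> ss; rewrite /chartest charinv_p// charinv_m. Qed.

Lemma scaled_charinv s : s * s = 1 -> forall A : set RR, measurable A ->
  mu2 (charinv s @^-1` A) = (2%:E * mu2 A)%E.
Proof. by move=> ss A mA; exact: mu2_charinv_preimage. Qed.

Lemma Rint_charinv s (g : RR -> R) : s * s = 1 -> mu2.-integrable setT (EFin \o g) ->
  \int[mu2]_q g (charinv s q) = 2 * \int[mu2]_p g p.
Proof.
move=> ss gi.
exact: (Rintegral_scaled (measurable_charinv s) (ler0n _ 2) (scaled_charinv ss) gi).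
Qed.

Lemma intg_charinv s (g : RR -> R) : s * s = 1 -> mu2.-integrable setT (EFin \o g) ->
  mu2.-integrable setT (EFin \o (fun q => g (charinv s q))).
Proof.
move=> ss gi.
exact: (integrable_scaled (measurable_charinv s) (ler0n _ 2) (scaled_charinv ss) gi).
Qed.

Lemma indic_charbox s a b c d (q : R * R) : s * s = 1 ->
  \1_(charbox s a b c d) (charinv s q) =
  \1_(`[a, b]%classic : set R) q.1 * \1_(`[c, d]%classic : set R) q.2 :> R.
Proof.
move=> ss; rewrite !indicE.
have -> : (charinv s q \in charbox s a b c d) = (q.1 \in `[a, b]%classic) && (q.2 \in `[c, d]%classic).
  apply/idP/andP => [/set_mem [/=]|[]].
    by rewrite charinv_p// charinv_m// => h1 h2; rewrite !mem_setE/= !in_itv/=.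
  by rewrite !mem_setE/= !in_itv/= => h1 h2; apply/mem_set; split; rewrite ?charinv_p ?charinv_m.
by case: (_ \in _); case: (_ \in _); rewrite ?mulr1 ?mulr0 ?mul0r.
Qed.

(** The first characteristic derivative is half of [u_x + s u_t]; the factor
    [2] of the change of variables cancels on both sides. *)
Lemma weak_d1_charbox s a b c d Om (u ux ut : R * R -> R) : s * s = 1 ->
  charbox s a b c d `<=` Om -> weak_dx Om u ux -> weak_dt Om u ut ->
  let K := \1_(charbox s a b c d) in
  weak_d1 (fun q : RR => u (charinv s q) * K (charinv s q))
    (fun q : RR => 2^-1 * ((ux (charinv s q) + s * ut (charinv s q)) * K (charinv s q)))
    a b c d.
Proof.
move=> ss KO [ui uxi Hx] [_ uti Ht] K chi chi' psi psi' hc hp s1 s2 s3 s4.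
have ccp := C1fun_cont hc; have cpp := C1fun_cont hp.
have uK := locint_restrict ss ui KO; have uxK := locint_restrict ss uxi KO.
have utK := locint_restrict ss uti KO.
pose phi := chartest s chi psi.
have T := chartest_test ss hc hp s1 s3 KO.
have off f g p : supp_in a b f -> supp_in c d g -> ~ charbox s a b c d p -> chartest s f g p = 0.
  by move=> h1 h2 h3; exact: (chartest_off h1 h2 h3).
have ex : \int[mu2]_p ((u p * K p) * dx phi p) = - \int[mu2]_p ((ux p * K p) * phi p).
  rewrite -(@Rint_restrict _ Om) -?(@Rint_restrict _ Om)//; first exact: Hx.
    by move=> p np; exact: off.
  by move=> p np; rewrite (chartest_dx _ hc hp) !off// addr0.
have et : \int[mu2]_p ((u p * K p) * dt phi p) = - \int[mu2]_p ((ut p * K p) * phi p).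
  rewrite -(@Rint_restrict _ Om) -?(@Rint_restrict _ Om)//; first exact: Ht.
    by move=> p np; exact: off.
  by move=> p np; rewrite (chartest_dt _ hc hp) !off// subr0 mulr0.
have i1 : mu2.-integrable setT (EFin \o (fun p : RR => u p * K p * chartest s chi' psi p)).
  by apply: (intg_chartest s uK hc.2 cpp s2 s3).
have i2 : mu2.-integrable setT (EFin \o (fun p : RR => u p * K p * chartest s chi psi' p)).
  by apply: (intg_chartest s uK ccp hp.2 s1 s4).
have i3 : mu2.-integrable setT (EFin \o (fun p : RR => ux p * K p * phi p)).
  by apply: (intg_chartest s uxK ccp cpp s1 s3).
have i4 : mu2.-integrable setT (EFin \o (fun p : RR => ut p * K p * phi p)).
  by apply: (intg_chartest s utK ccp cpp s1 s3).
have i5 : mu2.-integrable setT (EFin \o (fun p : RR => 2^-1 * (ux p * K p * phi p + s * (ut p * K p * phi p)))).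
  by apply: intgZ; apply: intgD => //; exact: intgZ.
transitivity (2 * \int[mu2]_p (u p * K p * chartest s chi' psi p)).
  rewrite -(Rint_charinv ss i1); apply: eq_Rintegral => q _ /=.
  by rewrite chartest_charinv.
transitivity (- (2 * \int[mu2]_p (2^-1 * (ux p * K p * phi p + s * (ut p * K p * phi p))))); last first.
  rewrite -(Rint_charinv ss i5); congr (- _); apply: eq_Rintegral => q _.
  by rewrite /= /phi chartest_charinv//; ring.
rewrite RintZ; last by apply: intgD => //; exact: intgZ.
rewrite RintD//; last exact: intgZ.
rewrite RintZ//.
have ex' : \int[mu2]_p (u p * K p * chartest s chi' psi p) + \int[mu2]_p (u p * K p * chartest s chi psi' p) =
    - \int[mu2]_p ((ux p * K p) * phi p).
  rewrite -ex -RintD//; apply: eq_Rintegral => p _.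
  by rewrite (chartest_dx _ hc hp) mulrDr.
have et' : s * (\int[mu2]_p (u p * K p * chartest s chi' psi p) - \int[mu2]_p (u p * K p * chartest s chi psi' p)) =
    - \int[mu2]_p ((ut p * K p) * phi p).
  rewrite -et -RintB// -RintZ; last exact: intgB.
  by apply: eq_Rintegral => p _; rewrite (chartest_dt _ hc hp); ring.
set A := \int[mu2]_p (u p * K p * chartest s chi' psi p) in ex' et' *.
set B := \int[mu2]_p (u p * K p * chartest s chi psi' p) in ex' et'.
have e1 : \int[mu2]_p (ux p * K p * phi p) = - (A + B) by rewrite ex' opprK.
have e2 : \int[mu2]_p (ut p * K p * phi p) = - (s * (A - B)) by rewrite et' opprK.
rewrite e1 e2.
have -> : s * - (s * (A - B)) = - (s * s) * (A - B) by ring.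
by rewrite ss; field.
Qed.

(** Testing the weak second derivatives once against a product and the first
    ones against its derivatives, the terms with a twice differentiated factor
    cancel in [u_tt - u_xx], which leaves [- 4] times the mixed derivative. *)
Lemma weak_d12_charbox s a b c d Om (u f : R * R -> R) : s * s = 1 ->
  charbox s a b c d `<=` Om -> weak_wave Om u f ->
  let K := \1_(charbox s a b c d) in
  weak_d12 (fun q : RR => u (charinv s q) * K (charinv s q))
    (fun q : RR => f (charinv s q) * K (charinv s q)) a b c d.
Proof.
move=> ss KO [ux [ut [uxx [utt [[Hx Ht] [Hxx Htt] ->]]]]] K chi chi' chi'' psi psi' psi''.
move=> hc hc' hp hp' [s1 s2 s3] [s4 s5 s6].
have [ui uxi Hx'] := Hx; have [_ uti Ht'] := Ht.
have [_ uxxi Hxx'] := Hxx; have [_ utti Htt'] := Htt.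
have c1 := C1fun_cont hc; have c2 := C1fun_cont hp.
have c3 := C1fun_cont hc'; have c4 := C1fun_cont hp'.
have uK := locint_restrict ss ui KO; have uxK := locint_restrict ss uxi KO.
have utK := locint_restrict ss uti KO.
have uxxK := locint_restrict ss uxxi KO; have uttK := locint_restrict ss utti KO.
have off f1 g p : supp_in a b f1 -> supp_in c d g -> ~ charbox s a b c d p -> chartest s f1 g p = 0.
  by move=> h1 h2 h3; exact: (chartest_off h1 h2 h3).
pose I (g : R * R -> R) f1 f2 := \int[mu2]_p (g p * K p * chartest s f1 f2 p).
have Exx f1 f1' f2 f2' (w wx : R * R -> R) : weak_dx Om w wx -> C1fun f1 f1' -> C1fun f2 f2' ->
    supp_in a b f1 -> supp_in a b f1' -> supp_in c d f2 -> supp_in c d f2' ->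
    I w f1' f2 + I w f1 f2' = - I wx f1 f2.
  move=> [wi wxi Hw] h1 h2 t1 t2 t3 t4.
  have wK := locint_restrict ss wi KO.
  have T := chartest_test ss h1 h2 t1 t3 KO.
  have k1 := C1fun_cont h1; have k2 := C1fun_cont h2.
  rewrite /I -RintD; last 2 first.
  - by apply: (intg_chartest s wK h1.2 k2 t2 t3).
  - by apply: (intg_chartest s wK k1 h2.2 t1 t4).
  transitivity (\int[mu2]_p ((w p * K p) * dx (chartest s f1 f2) p)).
    by apply: eq_Rintegral => p _; rewrite (chartest_dx _ h1 h2) mulrDr.
  rewrite -(@Rint_restrict _ Om) -?(@Rint_restrict _ Om)//; first exact: Hw.
    by move=> p np; exact: off.
  by move=> p np; rewrite (chartest_dx _ h1 h2) !off// addr0.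
have Ett f1 f1' f2 f2' (w wt : R * R -> R) : weak_dt Om w wt -> C1fun f1 f1' -> C1fun f2 f2' ->
    supp_in a b f1 -> supp_in a b f1' -> supp_in c d f2 -> supp_in c d f2' ->
    s * (I w f1' f2 - I w f1 f2') = - I wt f1 f2.
  move=> [wi wxi Hw] h1 h2 t1 t2 t3 t4.
  have wK := locint_restrict ss wi KO.
  have T := chartest_test ss h1 h2 t1 t3 KO.
  have k1 := C1fun_cont h1; have k2 := C1fun_cont h2.
  have j1 : mu2.-integrable setT (EFin \o (fun p : RR => w p * K p * chartest s f1' f2 p)).
    by apply: (intg_chartest s wK h1.2 k2 t2 t3).
  have j2 : mu2.-integrable setT (EFin \o (fun p : RR => w p * K p * chartest s f1 f2' p)).
    by apply: (intg_chartest s wK k1 h2.2 t1 t4).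
  rewrite /I -RintB// -RintZ; last exact: intgB.
  transitivity (\int[mu2]_p ((w p * K p) * dt (chartest s f1 f2) p)).
    by apply: eq_Rintegral => p _; rewrite (chartest_dt _ h1 h2); ring.
  rewrite -(@Rint_restrict _ Om) -?(@Rint_restrict _ Om)//; first exact: Hw.
    by move=> p np; exact: off.
  by move=> p np; rewrite (chartest_dt _ h1 h2) !off// subr0 mulr0.
have x0 := Exx _ _ _ _ _ _ Hxx hc hp s1 s2 s4 s5.
have x1 := Exx _ _ _ _ _ _ Hx hc' hp s2 s3 s4 s5.
have x2 := Exx _ _ _ _ _ _ Hx hc hp' s1 s2 s5 s6.
have t0 := Ett _ _ _ _ _ _ Htt hc hp s1 s2 s4 s5.
have t1 := Ett _ _ _ _ _ _ Ht hc' hp s2 s3 s4 s5.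
have t2 := Ett _ _ _ _ _ _ Ht hc hp' s1 s2 s5 s6.
have iu : mu2.-integrable setT (EFin \o (fun p : RR => u p * K p * chartest s chi' psi' p)).
  by apply: (intg_chartest s uK hc.2 hp.2 s2 s5).
have itt : mu2.-integrable setT (EFin \o (fun p : RR => utt p * K p * chartest s chi psi p)).
  by apply: (intg_chartest s uttK c1 c2 s1 s4).
have ixx : mu2.-integrable setT (EFin \o (fun p : RR => uxx p * K p * chartest s chi psi p)).
  by apply: (intg_chartest s uxxK c1 c2 s1 s4).
transitivity (2 * I u chi' psi').
  rewrite -(Rint_charinv ss iu); apply: eq_Rintegral => q _ /=.
  by rewrite chartest_charinv.
have i5 := intgB itt ixx.
transitivity (- 4^-1 * (2 * \int[mu2]_p (utt p * K p * chartest s chi psi p - uxx p * K p * chartest s chi psi p))); last first.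
  rewrite -(Rint_charinv ss i5); congr (_ * _); apply: eq_Rintegral => q _.
  by rewrite /= chartest_charinv//; ring.
rewrite RintB// -/(I utt chi psi) -/(I uxx chi psi).
have -> : I uxx chi psi = I u chi'' psi + I u chi' psi' + (I u chi' psi' + I u chi psi'').
  rewrite x1 x2 -[LHS]opprK -x0; ring.
have -> : I utt chi psi = (s * s) * (I u chi'' psi - I u chi' psi' - (I u chi' psi' - I u chi psi'')).
  have -> : (s * s) * (I u chi'' psi - I u chi' psi' - (I u chi' psi' - I u chi psi'')) =
    s * (s * (I u chi'' psi - I u chi' psi') - s * (I u chi' psi' - I u chi psi'')) by ring.
  rewrite t1 t2 -[LHS]opprK -t0; ring.
by rewrite ss; field.
Qed.
End CharacteristicForm.

(** * Continuous weak solutions on characteristic rectangles *)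

Section CharacteristicBox.
Context {R : realType}.
Local Notation mu := (@lebesgue_measure R).
Local Notation mu2 := (mu \x mu)%E.
Local Notation RR := (measurableTypeR R * measurableTypeR R)%type.
Implicit Types (a b c d s x y : R) (Om : set (R * R)).

Lemma continuous_near2 (u : R * R -> R) (p : R * R) e : {for p, continuous u} -> 0 < e ->
  exists2 dl, 0 < dl & forall q : R * R, `|q.1 - p.1| <= dl -> `|q.2 - p.2| <= dl -> `|u q - u p| <= e.
Proof.
move=> cu e0; have /cvgrPdist_le /(_ e e0) := cu.
move=> [[A B] /= [[da da0 HA] [db db0 HB]] H].
exists (Num.min da db / 2); first by rewrite divr_gt0// lt_min; apply/andP; split.
have h m : m = Num.min da db -> 0 < m -> m / 2 < da /\ m / 2 < db.
  move=> -> m0.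
  have h1 : Num.min da db <= da by rewrite ge_min lexx.
  have h2 : Num.min da db <= db by rewrite ge_min lexx orbT.
  by split; lra.
have m0 : 0 < Num.min da db by rewrite lt_min; apply/andP; split.
have [ha hb] := h _ erefl m0.
move=> [q1 q2] /= hq1 hq2; rewrite distrC; apply: (H (q1, q2)); split => /=.
  by apply: HA; rewrite /= distrC (le_lt_trans hq1).
by apply: HB; rewrite /= distrC (le_lt_trans hq2).
Qed.

Lemma norm_charinv s (q : R * R) p dl : s * s = 1 ->
  `|q.1 - p.1| <= dl -> `|q.2 - p.2| <= dl ->
  `|(charinv s q).1 - (charinv s p).1| <= dl /\ `|(charinv s q).2 - (charinv s p).2| <= dl.
Proof.
move=> ss h1 h2; rewrite /charinv/=.
have ns : `|s| = 1.
  by apply/eqP; rewrite -(@eqrXn2 _ 2)// -normrX expr2 ss normr1 expr1n.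
split.
  have -> : (q.1 + q.2) / 2 - (p.1 + p.2) / 2 = ((q.1 - p.1) + (q.2 - p.2)) / 2 by field.
  rewrite normrM normfV (@ger0_norm _ 2)// ler_pdivrMr//.
  by rewrite (le_trans (ler_normD _ _))//; lra.
have -> : s * (q.1 - q.2) / 2 - s * (p.1 - p.2) / 2 = s * (((q.1 - p.1) - (q.2 - p.2)) / 2) by field.
rewrite normrM ns mul1r normrM normfV (@ger0_norm _ 2)// ler_pdivrMr//.
by rewrite (le_trans (ler_normB _ _))//; lra.
Qed.

(** The rectangle identity and the absolute continuity along an edge,
    transported to a space-time solution continuous on the characteristic
    rectangle. *)
Lemma char_box s a b c d Om (u f : R * R -> R) : s * s = 1 -> a < b -> c < d ->
  charbox s a b c d `<=` Om -> weak_wave Om u f ->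
  (forall p, charbox s a b c d p -> {for p, continuous u}) ->
  [/\ mu2.-integrable setT (EFin \o (fun q : RR => f (charinv s q) *
        (\1_(`[a, b]%classic : set R) q.1 * \1_(`[c, d]%classic : set R) q.2))),
      u (charinv s (a, c)) - u (charinv s (a, d)) - u (charinv s (b, c)) + u (charinv s (b, d))
      = - 4^-1 * \int[mu2]_q (f (charinv s q) *
        (\1_(`]a, b[%classic : set R) q.1 * \1_(`]c, d[%classic : set R) q.2))
    & exists2 q : R -> R, mu.-integrable setT (EFin \o q) & forall x, a < x <= b ->
      u (charinv s (x, c)) - u (charinv s (a, c)) = \int[mu]_y (q y * \1_(`]a, x[%classic : set R) y)].
Proof.
move=> ss ab cd KO H cu.
have W1 := weak_d12_charbox ss KO H.
have [ux [ut [uxx [utt [[Hx Ht] [Hxx Htt] fE]]]]] := H.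
have W2 := weak_d1_charbox ss KO Hx Ht.
pose K : RR -> R := \1_(charbox s a b c d).
have [ui uxi _] := Hx; have [_ uti _] := Ht; have [_ uxxi _] := Hxx; have [_ utti _] := Htt.
have uK := locint_restrict ss ui KO; have uxK := locint_restrict ss uxi KO.
have utK := locint_restrict ss uti KO.
have uxxK := locint_restrict ss uxxi KO; have uttK := locint_restrict ss utti KO.
have fK : mu2.-integrable setT (EFin \o (fun p : RR => f p * K p)).
  rewrite (_ : (fun p => f p * K p) = fun p => utt p * K p - uxx p * K p); first exact: intgB.
  by apply/funext => p; rewrite fE mulrBl.
have pK : mu2.-integrable setT (EFin \o (fun p : RR => 2^-1 * ((ux p + s * ut p) * K p))).
  rewrite (_ : (fun p => _) = fun p => 2^-1 * (ux p * K p + s * (ut p * K p))).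
    by apply: intgZ; apply: intgD => //; exact: intgZ.
  by apply/funext => p; ring.
have Ui := intg_charinv ss uK; have Fi := intg_charinv ss fK; have Pi := intg_charinv ss pK.
have inK q : a <= q.1 <= b -> c <= q.2 <= d -> charbox s a b c d (charinv s q).
  by move=> h1 h2; split; rewrite ?charinv_p ?charinv_m.
have KE q : a <= q.1 <= b -> c <= q.2 <= d -> K (charinv s q) = 1.
  by move=> h1 h2; rewrite /K indicE mem_set//; exact: inK.
have Uc : cont_on_box (fun q : RR => u (charinv s q) * K (charinv s q)) a b c d.
  move=> x y hx hy e e0.
  have [dl dl0 Hd] := continuous_near2 (cu _ (inK (x, y) hx hy)) e0.
  exists dl => // p hp1 hp2 d1 d2; rewrite !KE// !mulr1.
  by have [? ?] := @norm_charinv s p (x, y) dl ss d1 d2; exact: Hd.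
have Kac x y : a <= x <= b -> c <= y <= d -> u (charinv s (x, y)) * K (charinv s (x, y)) = u (charinv s (x, y)).
  by move=> h1 h2; rewrite KE// mulr1.
have aa : a <= a <= b by rewrite lexx ltW. have bb : a <= b <= b by rewrite lexx ltW.
have cc : c <= c <= d by rewrite lexx ltW. have dd : c <= d <= d by rewrite lexx ltW.
split.
- rewrite (_ : (fun q : RR => _) = fun q : RR => f (charinv s q) * K (charinv s q)) //.
  by apply/funext => q; rewrite /K indic_charbox.
- have := rectangle_identity ab cd Ui Fi Uc W1; rewrite !Kac// => ->.
  congr (_ * _); apply: eq_Rintegral => q _; rewrite -mulrA; congr (_ * _).
  rewrite /K indic_charbox// !indicE !mem_setE/= !in_itv/=.
  case: (ltP a q.1) => h1 /=; last by rewrite !mul0r mulr0.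
  case: (ltP q.1 b) => h2 /=; last by rewrite !mul0r mulr0.
  case: (ltP c q.2) => h3 /=; last by rewrite !mulr0.
  case: (ltP q.2 d) => h4 /=; last by rewrite !mulr0.
  by rewrite (ltW h1) (ltW h2) (ltW h3) (ltW h4) !mulr1.
- have [q qi Hq] := edge_primitive cd Ui Pi Fi Uc W2 W1.
  exists q => // x xab; rewrite -Hq// !Kac//.
  by move: xab => /andP[h1 h2]; rewrite h2 ltW.
Qed.

(** Lebesgue differentiation, for a primitive written with an indicator. *)
Lemma primitive_derive (Q : R -> R) a : mu.-integrable setT (EFin \o Q) ->
  {ae mu, forall x, a < x -> is_derive x 1 (fun x => \int[mu]_s (Q s * \1_(`]a, x[%classic : set R) s)) (Q x)}.
Proof.
move=> Qi.
pose f s := Q s * \1_(`]a, +oo[%classic : set R) s.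
have fi : mu.-integrable setT (EFin \o f).
  by apply: (intgM Qi (measurable_indicR _) (M := 1)) => // s; exact: norm_indic_le1.
have lf : locally_integrable setT f.
  apply: open_integrable_locally => //; exact: openT.
have := @FTC1Ny R f (fun y => integrableS _ _ _ fi) lf.
have mT : forall y, measurable (`]-oo, y]%classic : set (measurableTypeR R)) by [].
move=> /(_ measurableT mT (fun=> @subsetT _ _)).
apply: filterS; first exact: (ae_filter_ringOfSetsType mu).
move=> x [dF FE] ax.
have E y : \int[mu]_(t in `]-oo, y]) f t = \int[mu]_s (Q s * \1_(`]a, y[%classic : set R) s).
  rewrite -Rintegral_itv_bndo_bndc; last by apply: integrableS fi.
  rewrite Rint_indic//; apply: eq_Rintegral => s _.
  rewrite /f -mulrA; congr (_ * _); rewrite !indicE !mem_setE/= !in_itv/= andbT.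
  by case: (ltP a s) => /=; case: (ltP s y) => /=; rewrite ?mulr0 ?mul0r ?mulr1.
have fx : f x = Q x by rewrite /f indicE mem_setE/= in_itv/= ax mulr1.
rewrite -fx -FE (_ : (fun x0 => _) = (fun y => \int[mu]_(t in `]-oo, y]) f t)); last first.
  by apply/funext => y; rewrite E.
by rewrite derive1E; apply: DeriveDef.
Qed.

End CharacteristicBox.

(** * The triangle estimate for vanishing Cauchy data *)

Section Triangle.
Context {R : realType}.
Local Notation mu := (@lebesgue_measure R).
Local Notation mu2 := (mu \x mu)%E.
Local Notation RR := (measurableTypeR R * measurableTypeR R)%type.
Local Notation I1 A := (\1_(A%classic : set R) : R -> R).
Implicit Types (a b c d s x y : R).

Lemma intg_indic_itv a b : mu.-integrable setT (EFin \o I1 `[a, b]).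
Proof.
have h : mu.-integrable `[a, b] (EFin \o (fun=> 1 : R)).
  apply: continuous_compact_integrable; first exact: segment_compact.
  by apply: continuous_subspaceT => x; exact: cvg_cst.
have := (intg_indic mu (fun=> 1 : R) (measurable_itv `[a, b])).1 h.
by rewrite (_ : (fun x => 1 * _) = I1 `[a, b])//; apply/funext => x; rewrite mul1r.
Qed.

Lemma Rint_indic_itv a b : a <= b -> \int[mu]_x I1 `[a, b] x = b - a.
Proof.
move=> ab; transitivity (\int[mu]_(x in `[a, b]) (1 : R)).
  rewrite (@Rint_indic _ _ _ mu `[a, b]%classic (fun=> 1))//.
  by under [RHS]eq_Rintegral do rewrite mul1r.
have E : mu `[a, b]%classic = (b - a)%:E.
  rewrite lebesgue_measure_itv/= lte_fin; case: ltP => //= h.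
  by congr EFin; apply/esym/eqP; rewrite subr_eq0 eq_le h ab.
by rewrite Rintegral_cst// mul1r (_ : fine _ = fine (b - a)%:E)//; congr fine.
Qed.

Lemma ler_Rint_box (H : RR -> R) M a b c d : a <= b -> c <= d -> measurable_fun setT H ->
  (forall q : RR, `|H q| <= M * (I1 `[a, b] q.1 * I1 `[c, d] q.2)) ->
  mu2.-integrable setT (EFin \o H) /\ `|\int[mu2]_q H q| <= M * ((b - a) * (d - c)).
Proof.
move=> ab cd mH HM.
have bi := intg_prodM (intg_indic_itv a b) (intg_indic_itv c d).
have Mi := intgZ M bi.
split; first exact: (intg_le mH Mi).
rewrite (le_trans (ler_norm_Rint mH Mi HM))// RintZ//.
by rewrite Rint_prodM ?Rint_indic_itv//; exact: intg_indic_itv.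
Qed.

Lemma Rint_fubini_indic (G : RR -> R) (A : set R) : measurable (A : set (measurableTypeR R)) ->
  mu2.-integrable setT (EFin \o G) ->
  \int[mu2]_q (G q * \1_A q.1) = \int[mu]_s ((\int[mu]_y G (s, y)) * \1_A s).
Proof.
move=> mA Gi; rewrite Rint_fubini/=; last first.
  apply: (@intgM _ _ _ _ _ _ 1) => //; last by move=> p; exact: norm_indic_le1.
  by apply: (measurableT_comp (measurable_indicR _)).
apply: eq_Rintegral => s _.
rewrite indicE; case: (_ \in _).
  by rewrite [RHS]mulr1; apply: eq_Rintegral => y _; rewrite !mulr1.
by rewrite mulr0; under eq_Rintegral do rewrite mulr0; rewrite Rintegral_cst// mul0r.
Qed.

Lemma measurable_indic_fst (A : set R) : measurable (A : set (measurableTypeR R)) ->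
  measurable_fun setT (fun q : RR => \1_A q.1 : R).
Proof. by move=> mA; apply: (measurableT_comp (measurable_indicR mA)). Qed.

Lemma measurable_indic_snd (A : set R) : measurable (A : set (measurableTypeR R)) ->
  measurable_fun setT (fun q : RR => \1_A q.2 : R).
Proof. by move=> mA; apply: (measurableT_comp (measurable_indicR mA)). Qed.

Lemma indic_itvE (i : interval R) x : I1 [set` i] x = (x \in i)%:R.
Proof. by rewrite indicE mem_setE. Qed.

Lemma ae1S (P S : R -> Prop) : (forall x, P x -> S x) ->
  {ae mu, forall x, P x} -> {ae mu, forall x, S x}.
Proof.
by move=> H; apply: filterS => //; exact: (ae_filter_ringOfSetsType mu).
Qed.

Lemma ae1S2 (P Q S : R -> Prop) : (forall x, P x -> Q x -> S x) ->
  {ae mu, forall x, P x} -> {ae mu, forall x, Q x} -> {ae mu, forall x, S x}.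
Proof.
by move=> H; apply: filterS2 => //; exact: (ae_filter_ringOfSetsType mu).
Qed.

Lemma ae_fst_neq x : {ae mu2, forall q : RR, q.1 != x}.
Proof.
exists ([set x] `*` setT); split; first exact: measurableX.
  have h : mu [set x] = 0%E := lebesgue_measure_set1 x.
  have E := @product_measure1E _ _ _ _ R mu mu [set x] setT (measurable_set1 x) measurableT.
  apply: (etrans E); transitivity (0 * mu setT)%E; last by rewrite mul0e.
  by congr (_ * _)%E.
by move=> q /= /negP; rewrite negbK => /eqP.
Qed.

Lemma ae_snd_neq x : {ae mu2, forall q : RR, q.2 != x}.
Proof.
exists (setT `*` [set x]); split; first exact: measurableX.
  have h : mu [set x] = 0%E := lebesgue_measure_set1 x.
  have E := @product_measure1E _ _ _ _ R mu mu setT [set x] measurableT (measurable_set1 x).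
  apply: (etrans E); transitivity (mu setT * 0)%E; last by rewrite mule0.
  by congr (_ * _)%E.
by move=> q /= /negP; rewrite negbK => /eqP.
Qed.

(** This lemma and the next ones on indicators encode the plane geometry of the
    triangle, one coordinate at a time. *)
Lemma indic_shrink y d x s : 0 <= d ->
  `|I1 `]y, x[ s - I1 `]y + d, x[ s| <= I1 `[y, y + d] s.
Proof.
move=> d0; rewrite !indic_itvE !in_itv/=.
case: (ltP y s) => k1; case: (ltP (y + d) s) => k2; case: (ltP s x) => k3;
  case: (leP y s) => k4; case: (leP s (y + d)) => k5;
  rewrite /= ?subr0 ?subrr ?sub0r ?normrN ?normr0 ?normr1//; lra.
Qed.

Lemma indic_subset_itv a b c d s : c <= a -> b <= d ->
  `|I1 `]a, b[ s| <= I1 `[c, d] s.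
Proof.
move=> ca bd; rewrite !indic_itvE !in_itv/=.
case: (ltP a s) => k1; case: (ltP s b) => k2; case: (leP c s) => k3;
  case: (leP s d) => k4; rewrite /= ?normr0 ?normr1//; lra.
Qed.

Lemma indic_split al be x y s z : al < z -> z < s -> z <= be -> s != y -> y < x ->
  I1 `]al, x[ s - I1 `]al, y[ s = I1 `]y, x[ s * I1 `]al, y[ z + I1 `]y, x[ s * I1 `[y, be] z.
Proof.
move=> h4 h2 h5 /eqP n1 yx; rewrite !indic_itvE !in_itv/=.
rewrite h4 h5 (lt_trans h4 h2) /= !andbT.
case: (ltP z y) => k1; case: (ltP s x) => k2; case: (ltP y s) => k3; case: (ltP s y) => k4;
  case: (leP y z) => k5; rewrite /= ?subr0 ?subrr ?mulr1 ?mulr0 ?addr0 ?add0r ?mul0r ?add0r//;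
  exfalso; first [lra|apply: n1; lra].
Qed.

Lemma indic_cone (y x be s z : R) : z < s ->
  `|((y < s) && (s < x))%:R * ((y <= z) && (z <= be))%:R| <=
  ((y <= s) && (s <= x))%:R * ((y <= z) && (z <= x))%:R :> R.
Proof.
move=> h.
case: (ltP y s) => k1; case: (ltP s x) => k2; case: (leP y z) => k3; case: (leP z be) => k4;
case: (leP y s) => k5; case: (leP s x) => k6; case: (leP z x) => k7;
rewrite /= ?(mul0r, mulr0, mulr1) ?normr0 ?normr1//; exfalso; lra.
Qed.

Lemma indic_diff al a x s : al < a -> a < x -> s != a ->
  I1 `]al, x[ s - I1 `]al, a[ s = I1 `]a, x[ s.
Proof.
move=> h1 h2 /eqP n1; rewrite !indic_itvE !in_itv/=.
case: (ltP al s) => k1; case: (ltP s x) => k2; case: (ltP s a) => k3; case: (ltP a s) => k4;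
rewrite /= ?subr0 ?subrr//; exfalso; first [lra|apply: n1; lra].
Qed.

(** The arithmetic behind the vanishing of the density: [q t] is a symmetric
    difference of the primitive up to [e t], and the symmetric difference is
    the small value [w] up to an area of order [t ^+ 2]. *)
Lemma density_small (a1 a2 a0 p q w tt t e M : R) : 0 < t -> 0 <= M -> t * (M + 1) <= e ->
  `|a1 - a0 - p - q * t| <= e / 4 * t -> `|a2 - a0 - p - q * - t| <= e / 4 * t ->
  `|w| <= e / 4 * t -> w = a1 - a2 + 4^-1 * tt -> `|tt| <= M * ((2 * t) * (2 * t)) ->
  `|q| <= e.
Proof.
move=> t0 M0 tM h1 h2 h3 wE h4.
have tMt : M * (2 * t * (2 * t)) <= 4 * (e * t).
  have -> : M * (2 * t * (2 * t)) = 4 * ((t * M) * t) by ring.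
  rewrite ler_pM2l// ler_pM2r//; move: tM; rewrite mulrDr mulr1; lra.
have : `|2 * t * q| <= 2 * (t * e).
  have -> : 2 * t * q = (w - 4^-1 * tt) - (a1 - a0 - p - q * t) + (a2 - a0 - p - q * - t).
    by rewrite wE; ring.
  have h5 : `|4^-1 * tt| <= e * t by rewrite normrM (@ger0_norm _ 4^-1)//; lra.
  rewrite (le_trans (ler_normD _ _))//.
  have := le_trans (ler_normB (w - 4^-1 * tt) (a1 - a0 - p - q * t)) (lerD (ler_normB _ _) (lexx _)).
  have := normr_ge0 w; lra.
rewrite !normrM (@ger0_norm _ 2)// (ger0_norm (ltW t0)) -mulrA ler_pM2l// ler_pM2l//.
Qed.

(** [W] is a solution in the triangle below the diagonal, known only through
    its rectangle identity and its behaviour on the lower edge; [W] vanishes on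
    the diagonal, which is the initial line, and so does its normal derivative
    at almost every point. [F] is bounded and supported in the triangle. *)
Section Uniqueness.
Variables (al be M : R) (W F : RR -> R).
Hypothesis albe : al < be.
Hypothesis M0 : 0 <= M.
Hypothesis mF : measurable_fun setT F.
Hypothesis FM : forall q, `|F q| <= M.
Hypothesis F0 : forall q, ~~ [&& al <= q.2, q.2 < q.1 & q.1 <= be] -> F q = 0.
Hypothesis rect : forall a b c d, al <= c -> c < d -> d < a -> a < b -> b <= be ->
  W (a, c) - W (a, d) - W (b, c) + W (b, d) =
  - 4^-1 * \int[mu2]_q (F q * (I1 `]a, b[ q.1 * I1 `]c, d[ q.2)).
Hypothesis edge : forall a, al < a -> a < be -> exists2 q : R -> R,
  mu.-integrable setT (EFin \o q) & forall x, a < x <= be ->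
  W (x, al) - W (a, al) = \int[mu]_s (q s * I1 `]a, x[ s).
Hypothesis Wc : forall x y, al <= y -> y <= x -> x <= be -> forall e, 0 < e ->
  exists2 dl, 0 < dl & forall p : RR, al <= p.2 -> p.2 <= p.1 -> p.1 <= be ->
    `|p.1 - x| <= dl -> `|p.2 - y| <= dl -> `|W p - W (x, y)| <= e.
Hypothesis W0 : forall x, al <= x <= be -> W (x, x) = 0.
Hypothesis dW0 : {ae mu, forall x, al < x < be -> forall e, 0 < e -> exists2 dl, 0 < dl &
  forall t, 0 < t < dl -> `|W (x + t, x - t)| <= e * t}.

Lemma tri_F_le q : `|F q| <= M * (I1 `[al, be] q.1 * I1 `[al, be] q.2).
Proof.
have [/and3P[h1 h2 h3]|h] := boolP [&& al <= q.2, q.2 < q.1 & q.1 <= be].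
  rewrite !indic_itvE !in_itv/= h1 h3 (le_trans h1 (ltW h2)) (le_trans (ltW h2) h3) !mulr1.
  exact: FM.
by rewrite F0// normr0 !mulr_ge0// indic_itvE.
Qed.

Lemma tri_Fi : mu2.-integrable setT (EFin \o F).
Proof. by have [] := ler_Rint_box (ltW albe) (ltW albe) mF tri_F_le. Qed.

Let K x := \int[mu2]_q (F q * I1 `]al, x[ q.1).
Let A x := W (x, al) - 4^-1 * K x.

Lemma tri_FIi (A1 A2 : interval R) :
  mu2.-integrable setT (EFin \o (fun q : RR => F q * (I1 [set` A1] q.1 * I1 [set` A2] q.2))).
Proof.
apply: (intgM tri_Fi (M := 1)).
  by apply: measurable_funM; [exact: measurable_indic_fst|exact: measurable_indic_snd].
by move=> q; rewrite normrM mulr_ile1//; exact: norm_indic_le1.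
Qed.

Lemma tri_FI1i (A1 : interval R) :
  mu2.-integrable setT (EFin \o (fun q : RR => F q * I1 [set` A1] q.1)).
Proof.
apply: (intgM tri_Fi (M := 1)); first exact: measurable_indic_fst.
by move=> q; exact: norm_indic_le1.
Qed.

Let T x y := \int[mu2]_q (F q * (I1 `]y, x[ q.1 * I1 `[y, be] q.2)).

(** Exhaust the rectangle [y, x] x [al, y], which meets the diagonal in a
    corner, by rectangles inside the triangle. *)
Lemma tri_corner x y : al < y -> y < x -> x <= be ->
  W (y, al) - W (x, al) + W (x, y) = - 4^-1 * \int[mu2]_q (F q * (I1 `]y, x[ q.1 * I1 `]al, y[ q.2)).
Proof.
move=> aly yx xbe.
apply/eqP; rewrite -subr_eq0 -normr_le0; apply/ler_addgt0Pr => e e0; rewrite add0r.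
have e30 : 0 < e / 3 by rewrite divr_gt0.
have [d1 d10 H1] := Wc (lexx al) (ltW aly) (le_trans (ltW yx) xbe) e30.
have [d2 d20 H2] := Wc (ltW aly) (lexx y) (le_trans (ltW yx) xbe) e30.
have N0 : 0 < M * (be - al) + 1 by rewrite ltr_wpDl// mulr_ge0// subr_ge0 ltW.
pose d := Num.min (Num.min d1 d2) (Num.min ((x - y) / 2) (e / 3 / (M * (be - al) + 1))).
have d0 : 0 < d by rewrite !lt_min d10 d20 divr_gt0 ?subr_gt0//= divr_gt0.
have dd1 : d <= d1 by rewrite !ge_min lexx.
have dd2 : d <= d2 by rewrite !ge_min lexx !orbT.
have dxy : d <= (x - y) / 2 by rewrite !ge_min lexx !orbT.
have dM : d * (M * (be - al) + 1) <= e / 3 by rewrite -ler_pdivlMr// !ge_min lexx !orbT.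
have ydx : y + d < x by lra.
have yd : y <= y + d by rewrite lerDl ltW.
have ald : al <= y + d by exact: le_trans (ltW aly) yd.
have ydbe : y + d <= be by exact: le_trans (ltW ydx) xbe.
have := rect (lexx al) aly _ ydx xbe; rewrite ltrDl => /(_ d0) E.
have N1 : `|W (y + d, al) - W (y, al)| <= e / 3.
  apply: H1 => //=; rewrite ?subrr ?normr0 ?(ltW d10)//.
  by rewrite addrAC subrr add0r ger0_norm// ltW.
have N2 : `|W (y + d, y) - W (y, y)| <= e / 3.
  apply: H2 => //=; rewrite ?subrr ?normr0 ?(ltW d20) ?(ltW aly)//.
  by rewrite addrAC subrr add0r ger0_norm// ltW.
rewrite W0 ?subr0 in N2; last by rewrite (ltW aly) (le_trans yd ydbe).
set J1 := \int[mu2]_q (F q * (I1 `]y + d, x[ q.1 * I1 `]al, y[ q.2)) in E.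
set J2 := \int[mu2]_q (F q * (I1 `]y, x[ q.1 * I1 `]al, y[ q.2)).
have N3 : `|J2 - J1| <= e / 3.
  rewrite /J1 /J2 -RintB; try exact: tri_FIi.
  have h : measurable_fun setT (fun q : RR => F q * (I1 `]y, x[ q.1 * I1 `]al, y[ q.2)
       - F q * (I1 `]y + d, x[ q.1 * I1 `]al, y[ q.2)).
    by apply: (intg_measurable (m := mu2)); apply: intgB; exact: tri_FIi.
  have hb q : `|F q * (I1 `]y, x[ q.1 * I1 `]al, y[ q.2) - F q * (I1 `]y + d, x[ q.1 * I1 `]al, y[ q.2)|
      <= M * (I1 `[y, y + d] q.1 * I1 `[al, be] q.2).
    rewrite -mulrBr -mulrBl normrM ler_pM// normrM ler_pM//.
    + by apply: indic_shrink; exact: ltW.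
    + by apply: indic_subset_itv => //; exact: le_trans yd ydbe.
  have [_ H] := ler_Rint_box yd (ltW albe) h hb.
  apply: (le_trans H); apply: le_trans dM; have -> : y + d - y = d by ring.
  have -> : M * (d * (be - al)) = d * (M * (be - al)) by ring.
  by rewrite ler_pM2l// lerDl.
have -> : W (y, al) - W (x, al) + W (x, y) - - 4^-1 * J2 =
  - (W (y + d, al) - W (y, al)) + W (y + d, y) + 4^-1 * (J2 - J1).
  rewrite (_ : W (x, y) = - 4^-1 * J1 - W (y + d, al) + W (y + d, y) + W (x, al)); first ring.
  by rewrite -E; ring.
rewrite (le_trans (ler_normD _ _))// (_ : e = (e / 3 + e / 3) + e / 3); last by field.
apply: lerD; first by rewrite (le_trans (ler_normD _ _))// normrN lerD.
rewrite normrM (@ger0_norm _ 4^-1)//.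
by apply: le_trans N3; rewrite ler_piMl// invf_le1 ?ler1n.
Qed.

(** Rectangles touching the diagonal are exhausted from inside, which expresses
    [W] through its values on the lower edge and the area integral. The edge
    values are then corrected into a function [A] of one variable so that only
    the integral over the triangle of vertex [(x, y)] remains. *)
Lemma tri_decomp x y : al <= y -> y < x -> x <= be -> W (x, y) = A x - A y + 4^-1 * T x y.
Proof.
move=> aly yx xbe.
have KE : K x = \int[mu2]_q (F q * (I1 `]al, x[ q.1 * I1 `[al, be] q.2)).
  apply: eq_Rintegral => q _.
  have [/and3P[h1 h2 h3]|h] := boolP [&& al <= q.2, q.2 < q.1 & q.1 <= be]; last by rewrite F0// !mul0r.
  by rewrite [I1 `[al, be] _]indic_itvE in_itv/= h1 (le_trans (ltW h2) h3) mulr1.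
have K0 : K al = 0.
  rewrite /K; transitivity (\int[mu2]_q (fun=> 0 : R) q); last by rewrite Rintegral_cst// mul0r.
  apply: eq_Rintegral => q _; rewrite indic_itvE in_itv/=.
  by case: ltP => h; rewrite ?mulr0//= ltNge (ltW h) mulr0.
move: aly; rewrite le_eqVlt => /orP[/eqP <-|aly].
  by rewrite /A /T K0 KE W0 ?lexx ?ltW//; ring.
have E := tri_corner aly yx xbe.
have : K x - K y = \int[mu2]_q (F q * (I1 `]y, x[ q.1 * I1 `]al, y[ q.2)) + T x y.
  rewrite /K -RintB; try exact: tri_FI1i.
  rewrite -RintD; try exact: tri_FIi.
  apply: eq_Rint_ae.
  - apply: (intg_measurable (m := mu2)); apply: intgB; exact: tri_FI1i.
  - apply: (intg_measurable (m := mu2)); apply: intgD; exact: tri_FIi.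
  have := @ae_fst_neq y; apply: filterS2 (@ae_snd_neq al) => q n2 n1.
  have [/and3P[h1 h2 h3]|h] := boolP [&& al <= q.2, q.2 < q.1 & q.1 <= be]; last by rewrite F0// !mul0r subrr addr0.
  have h4 : al < q.2 by rewrite lt_neqAle h1 andbT eq_sym.
  have h5 : q.2 <= be by rewrite (le_trans (ltW h2)).
  by rewrite -mulrBr -mulrDr (indic_split h4 h2 h5 n1 yx).
by rewrite /A => E2; have : T x y = K x - K y - \int[mu2]_q (F q * (I1 `]y, x[ q.1 * I1 `]al, y[ q.2)); [rewrite E2; ring|move=> ->; have := E; lra].
Qed.

Lemma tri_F_pointwise x y q :
  `|F q * (I1 `]y, x[ q.1 * I1 `[y, be] q.2)| <= `|F q| * (I1 `[y, x] q.1 * I1 `[y, x] q.2).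
Proof.
have [/and3P[h1 h2 h3]|h] := boolP [&& al <= q.2, q.2 < q.1 & q.1 <= be]; last by rewrite F0// !mul0r normr0 mul0r.
rewrite normrM ler_wpM2l// !indic_itvE !in_itv/=; exact: indic_cone.
Qed.

Lemma tri_T_le x y : y < x -> `|T x y| <= M * ((x - y) * (x - y)).
Proof.
move=> yx; have m : measurable_fun setT (fun q : RR => F q * (I1 `]y, x[ q.1 * I1 `[y, be] q.2)).
  by apply: (intg_measurable (m := mu2)); exact: tri_FIi.
have hb q : `|F q * (I1 `]y, x[ q.1 * I1 `[y, be] q.2)| <= M * (I1 `[y, x] q.1 * I1 `[y, x] q.2).
  apply: (le_trans (tri_F_pointwise _ _ _)).
  by apply: ler_wpM2r; [rewrite mulr_ge0// indic_itvE|exact: FM].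
by have [] := ler_Rint_box (ltW yx) (ltW yx) m hb.
Qed.

Lemma tri_K_le x : al <= x -> `|K x| <= M * ((x - al) * (be - al)).
Proof.
move=> ax.
have m : measurable_fun setT (fun q : RR => F q * I1 `]al, x[ q.1).
  by apply: (intg_measurable (m := mu2)); exact: tri_FI1i.
have hb q : `|F q * I1 `]al, x[ q.1| <= M * (I1 `[al, x] q.1 * I1 `[al, be] q.2).
  rewrite normrM.
  have [/and3P[h1 h2 h3]|h] := boolP [&& al <= q.2, q.2 < q.1 & q.1 <= be]; last first.
    by rewrite F0// normr0 mul0r !mulr_ge0// indic_itvE.
  apply: ler_pM => //.
  rewrite [X in _ <= _ * X]indic_itvE in_itv/= h1 (le_trans (ltW h2) h3) mulr1.
  exact: indic_subset_itv.
by have [] := ler_Rint_box ax (ltW albe) m hb.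
Qed.

(** [A] differs from the edge values of [W] by an area integral, which is
    absolutely continuous by Fubini. *)
Lemma tri_A_primitive a : al < a -> a < be -> exists2 Q : R -> R,
  mu.-integrable setT (EFin \o Q) &
  forall x, a < x <= be -> A x - A a = \int[mu]_s (Q s * I1 `]a, x[ s).
Proof.
move=> aa ab; have [q qi Hq] := edge aa ab.
have ki := integrable_fubini_inner tri_Fi.
set k := (fun x => \int[mu]_y F (x, y)) in ki.
exists (fun s => q s - 4^-1 * k s); first by apply: intgB => //; exact: intgZ.
move=> x /andP[ax xb].
have E : K x - K a = \int[mu]_s (k s * I1 `]a, x[ s).
  rewrite -Rint_fubini_indic//; last exact: tri_Fi.
  rewrite /K -RintB; try exact: tri_FI1i.
  apply: eq_Rint_ae.
  - apply: (intg_measurable (m := mu2)); apply: intgB; exact: tri_FI1i.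
  - apply: (intg_measurable (m := mu2)); exact: tri_FI1i.
  apply: filterS (@ae_fst_neq a) => s sa; rewrite -mulrBr; congr (_ * _).
  exact: indic_diff.
have mI : measurable_fun setT (I1 `]a, x[) by exact: measurable_indicR.
have i1 : mu.-integrable setT (EFin \o (fun s => q s * I1 `]a, x[ s)).
  by apply: (intgM qi mI (M := 1)) => s; exact: norm_indic_le1.
have i2 : mu.-integrable setT (EFin \o (fun s => k s * I1 `]a, x[ s)).
  by apply: (intgM ki mI (M := 1)) => s; exact: norm_indic_le1.
transitivity (\int[mu]_s (q s * I1 `]a, x[ s - 4^-1 * (k s * I1 `]a, x[ s))); last first.
  by apply: eq_Rintegral => s _; ring.
rewrite RintB//; last exact: intgZ.
rewrite RintZ// -E -Hq ?ax//.
by rewrite /A; ring.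
Qed.

(** The initial velocity vanishes: the symmetric difference quotients of [A]
    tend to [0] almost everywhere, so the density of [A] vanishes. *)
Lemma tri_A_const a x : al < a -> a < x -> x <= be -> A x = A a.
Proof.
move=> aa ax xb.
have ab : a < be := lt_le_trans ax xb.
have [Q Qi HQ] := tri_A_primitive aa ab.
have Q0 : {ae mu, forall y, a < y < be -> Q y = 0}.
  apply: ae1S2 dW0 (primitive_derive a Qi) => y dy H /andP[ay yb].
  have D := (is_derive1_eps _ _ _).1 (H ay).
  apply/eqP; rewrite -normr_le0; apply/ler_addgt0Pr => e e0; rewrite add0r.
  have e20 : 0 < e / 4 by rewrite divr_gt0.
  have [d1 d10 H1] := D _ e20.
  have aly : al < y < be by rewrite (lt_trans aa ay).
  have [d2 d20 H2] := dy aly _ e20.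
  have M1 : 0 < M + 1 by rewrite ltr_wpDl.
  pose t := Num.min (Num.min d1 d2) (Num.min (Num.min (y - a) (be - y)) (e / (M + 1))) / 2.
  have m0 : 0 < Num.min (Num.min d1 d2) (Num.min (Num.min (y - a) (be - y)) (e / (M + 1))).
    by rewrite !lt_min d10 d20 !subr_gt0 ay yb divr_gt0.
  have t0 : 0 < t by rewrite divr_gt0.
  have tm : t < Num.min (Num.min d1 d2) (Num.min (Num.min (y - a) (be - y)) (e / (M + 1))).
    by rewrite /t ltr_pdivrMr// mulr_natr mulr2n ltrDr.
  move: tm; rewrite !lt_min => /andP[/andP[td1 td2] /andP[/andP[tya tby] te]].
  have h1 := H1 t; rewrite (ger0_norm (ltW t0)) in h1; have {}h1 := h1 td1.
  have h2 := H1 (- t); rewrite normrN (ger0_norm (ltW t0)) in h2; have {}h2 := h2 td1.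
  have h3 := H2 t; rewrite t0 td2 in h3; have {}h3 := h3 isT.
  have yt : y - t < y + t by rewrite ltrD2l (lt_trans _ t0)// oppr_lt0.
  have bt1 : al <= y - t by rewrite (le_trans (ltW aa))// lerBrDr -lerBrDl ltW.
  have bt2 : y + t <= be by rewrite -lerBrDl ltW.
  have bt3 : a < y + t <= be by rewrite (lt_trans ay) ?ltrDl.
  have bt4 : a < y - t <= be by rewrite ltrBrDr -ltrBrDl tya/= (le_trans _ (ltW yb))// gerBl ltW.
  have E := @tri_decomp (y + t) (y - t) bt1 yt bt2.
  have hT := tri_T_le yt.
  have A1 := HQ (y + t) bt3.
  have A2 := HQ (y - t) bt4.
  rewrite -A1 in h1; rewrite -A2 in h2.
  have tM : t * (M + 1) <= e by rewrite -ler_pdivlMr// ltW.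
  have hT' : `|T (y + t) (y - t)| <= M * ((2 * t) * (2 * t)).
    by have -> : 2 * t = y + t - (y - t) by ring.
  exact: (density_small t0 M0 tM h1 h2 h3 E hT').
have := HQ x; rewrite ax xb => /(_ isT).
rewrite (_ : \int[mu]_s _ = 0); first by move=> /eqP; rewrite subr_eq0 => /eqP.
transitivity (\int[mu]_s (fun=> 0 : R) s); last by rewrite Rintegral_cst// mul0r.
apply: eq_Rint_ae => //.
  by apply: measurable_funM; [exact: intg_measurable Qi|exact: measurable_indicR].
apply: ae1S Q0 => s Hs; rewrite indic_itvE in_itv/=.
case: (boolP (a < s < x)) => h; last by rewrite mulr0.
by rewrite Hs ?mul0r//; move: h => /andP[-> h]; rewrite (lt_le_trans h).
Qed.

(** [A] is constant away from the corner [al], and it tends to [W (al, al) = 0]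
    there. *)
Lemma tri_A0 x : al <= x -> x <= be -> A x = 0.
Proof.
rewrite le_eqVlt => /orP[/eqP <- _|ax xb].
  have := tri_K_le (lexx al); rewrite subrr mul0r mulr0 normr_le0 => /eqP K0.
  by rewrite /A K0 W0 ?lexx ?ltW// mulr0 subr0.
apply/eqP; rewrite -normr_le0; apply/ler_addgt0Pr => e e0; rewrite add0r.
have e20 : 0 < e / 2 by rewrite divr_gt0.
have [d d0 Hd] := Wc (lexx al) (lexx al) (ltW albe) e20.
have M1 : 0 < M * (be - al) + 1 by rewrite ltr_wpDl// mulr_ge0// subr_ge0 ltW.
pose m := Num.min (Num.min d (x - al)) (e / (M * (be - al) + 1)).
have m0 : 0 < m by rewrite !lt_min d0 subr_gt0 ax divr_gt0.
have m1 : m <= d by rewrite !ge_min lexx.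
have m2 : m <= x - al by rewrite !ge_min lexx !orbT.
have m3 : m * (M * (be - al) + 1) <= e by rewrite -ler_pdivlMr// !ge_min lexx !orbT.
have aa : al < al + m / 2 by lra.
rewrite (@tri_A_const (al + m / 2) x aa) //; last by lra.
have := tri_K_le (ltW aa).
have Waa : W (al, al) = 0 by apply: W0; rewrite lexx ltW.
have := Hd (al + m / 2, al); rewrite /= subrr normr0 Waa subr0.
move=> /(_ (lexx _) (ltW aa) ltac:(lra)).
rewrite addrAC subrr add0r ger0_norm; last lra.
move=> /(_ ltac:(lra) (ltW d0)) h1 h2.
rewrite /A (le_trans (ler_normB _ _))// normrM (@ger0_norm _ 4^-1)//.
have h3 : M * (m / 2 * (be - al)) <= m * (M * (be - al) + 1).
  have -> : M * (m / 2 * (be - al)) = m * (M * (be - al)) / 2 by field.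
  rewrite [X in _ <= X]mulrDr mulr1.
  have hh : 0 <= m * (M * (be - al)).
    by apply: mulr_ge0; [exact: ltW|apply: mulr_ge0 => //; rewrite subr_ge0 ltW].
  by lra.
lra.
Qed.

(** D'Alembert's formula for zero data, as an inequality. *)
Lemma tri_bound x y : al <= y -> y < x -> x <= be ->
  `|W (x, y)| <= 4^-1 * \int[mu2]_q (`|F q| * (I1 `[y, x] q.1 * I1 `[y, x] q.2)).
Proof.
move=> aly yx xb; rewrite tri_decomp// !tri_A0 ?(le_trans aly (ltW yx)) ?(le_trans (ltW yx) xb)//.
rewrite subrr add0r normrM (@ger0_norm _ 4^-1)// ler_pM2l//.
apply: ler_norm_Rint; last exact: tri_F_pointwise.
  by apply: (intg_measurable (m := mu2)); exact: tri_FIi.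
apply: (intgM (intg_norm tri_Fi) (M := 1)).
  by apply: measurable_funM; [exact: measurable_indic_fst|exact: measurable_indic_snd].
by move=> q; rewrite normrM mulr_ile1//; exact: norm_indic_le1.
Qed.
End Uniqueness.
End Triangle.

(** * A Gronwall argument in the triangle *)

Section Gronwall.
Context {R : realType}.
Local Notation mu := (@lebesgue_measure R).
Local Notation mu2 := (mu \x mu)%E.
Local Notation RR := (measurableTypeR R * measurableTypeR R)%type.
Local Notation I1 A := (\1_(A%classic : set R) : R -> R).
Implicit Types (a b c d s x y : R).

Lemma ler_Rint_ae (f g : RR -> R) : mu2.-integrable setT (EFin \o f) ->
  mu2.-integrable setT (EFin \o g) -> (forall q, 0 <= f q) -> (forall q, 0 <= g q) ->
  {ae mu2, forall q, f q <= g q} -> \int[mu2]_q f q <= \int[mu2]_q g q.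
Proof.
move=> fi gi f0 g0 fg; apply: fine_le; try exact: (integrable_fin_num _ fi);
  try exact: (integrable_fin_num _ gi).
apply: ae_ge0_le_integral => //.
- by move=> q _; rewrite lee_fin.
- exact: measurable_int fi.
- by move=> q _; rewrite lee_fin.
- exact: measurable_int gi.
- by apply: filterS fg => q h _; rewrite lee_fin.
Qed.

Lemma expR_C1 l : l != 0 -> C1fun (fun s => l^-1 * expR (l * s)) (fun s => expR (l * s)).
Proof.
move=> l0.
have D x : is_derive x 1 (fun s => l * s) l.
  apply/is_derive1_eps => e e0; exists 1 => // h _.
  have -> : l * (x + h) - l * x - l * h = 0 by ring.
  by rewrite normr0 mulr_ge0// ltW.
have E x : is_derive x 1 (fun s => expR (l * s)) (expR (l * x) * l).
  exact: (@is_derive1_comp _ expR (fun s => l * s) x _ _ (is_derive_expR _) (D x)).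
split=> x.
  have h := is_deriveZ l^-1 (E x).
  have -> : expR (l * x) = l^-1 *: (expR (l * x) * l) by rewrite /GRing.scale/=; field.
  exact: h.
apply: differentiable_continuous; apply/derivable1_diffP.
by have [] := E x.
Qed.

Lemma Rint_expR l y x : l != 0 -> y <= x ->
  mu.-integrable setT (EFin \o (fun s => expR (l * s) * I1 `[y, x] s)) /\
  \int[mu]_s (expR (l * s) * I1 `[y, x] s) = l^-1 * (expR (l * x) - expR (l * y)).
Proof.
move=> l0 yx; have [i E] := integral_C1 (expR_C1 l0) yx.
split; first exact: ((intg_indic _ _ _).1 i).
by rewrite -Rint_indic// E mulrBr.
Qed.

(** The left-hand side is what the triangle estimate yields for the weight
    [expR (l (x - y))] with [l = C + 1], [X = expR (l x)] and [Y = expR (l y)]: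
    two integrations produce a factor of size [C / l ^+ 2], small enough to
    gain one half. *)
Lemma gronwall_algebra (C B X Y : R) : 0 <= C -> 0 <= B -> 0 < X -> 0 < Y -> Y <= X ->
  4^-1 * (C * B * ((C + 1)^-1 * (X - Y) * ((- (C + 1))^-1 * (X^-1 - Y^-1)))) <= B / 2 * (X / Y).
Proof.
move=> C0 B0 X0 Y0 YX.
have -> : (C + 1)^-1 * (X - Y) * ((- (C + 1))^-1 * (X^-1 - Y^-1)) =
   (X / Y - (2 - Y / X)) / (C + 1) ^+ 2.
  by field; rewrite !gt_eqF//; lra.
have h1 : 0 <= 2 - Y / X by rewrite subr_ge0 ler_pdivrMr//; lra.
have h2 : X / Y - (2 - Y / X) <= X / Y by lra.
have XY0 : 0 <= X / Y by rewrite divr_ge0// ltW.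
have C1 : 0 < (C + 1) ^+ 2 by rewrite exprn_gt0//; lra.
have -> : 4^-1 * (C * B * ((X / Y - (2 - Y / X)) / (C + 1) ^+ 2)) =
   B / 2 * (C / (2 * (C + 1) ^+ 2) * (X / Y - (2 - Y / X))).
  by field; rewrite !gt_eqF//; lra.
apply: ler_wpM2l; first by rewrite divr_ge0.
have k0 : 0 <= C / (2 * (C + 1) ^+ 2) by rewrite divr_ge0// mulr_ge0// ltW.
have k1 : C / (2 * (C + 1) ^+ 2) <= 1.
  have c2 : 0 < 2 * (C + 1) ^+ 2 by rewrite mulr_gt0.
  by rewrite ler_pdivrMr// [leRHS]mul1r expr2; nra.
apply: (le_trans (ler_wpM2l k0 h2)).
by rewrite -[leRHS]mul1r ler_wpM2r.
Qed.

(** For the weight [expR (- l (x - y))], every bound of the weighted [|W|]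
    improves to one half of itself, and so the weighted [|W|] vanishes. *)
Lemma triangle_gronwall al be C M (W F : RR -> R) : al < be -> 0 <= C -> 0 <= M ->
  mu2.-integrable setT (EFin \o F) ->
  (forall x, al <= x <= be -> W (x, x) = 0) ->
  (forall q, al <= q.2 -> q.2 <= q.1 -> q.1 <= be -> `|W q| <= M) ->
  (forall x y, al <= y -> y < x -> x <= be ->
    `|W (x, y)| <= 4^-1 * \int[mu2]_q (`|F q| * (I1 `[y, x] q.1 * I1 `[y, x] q.2))) ->
  {ae mu2, forall q : RR, al <= q.2 -> q.1 <= be -> `|F q| <= C * `|W q| /\ (q.1 < q.2 -> F q = 0)} ->
  forall x y, al <= y -> y <= x -> x <= be -> W (x, y) = 0.
Proof.
move=> albe C0 M0 Fi W0 WM Wb HF.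
(* A rate larger than [C] gains one half in each step, see [gronwall_algebra]. *)
pose l := C + 1; have l0 : 0 < l by rewrite /l; lra.
have ln0 : l != 0 by rewrite gt_eqF.
have nln0 : - l != 0 by rewrite oppr_eq0.
pose g (q : RR) := `|W q| * expR (- l * (q.1 - q.2)).
have step B : 0 <= B -> (forall q : RR, al <= q.2 -> q.2 <= q.1 -> q.1 <= be -> g q <= B) ->
   forall q : RR, al <= q.2 -> q.2 <= q.1 -> q.1 <= be -> g q <= B / 2.
  move=> B0 HB [x y] /= aly; rewrite le_eqVlt => /orP[/eqP <-|yx] xb.
    by rewrite /g W0 ?aly// normr0 mul0r divr_ge0.
  have [e1 E1] := Rint_expR ln0 (ltW yx); have [e2 E2] := Rint_expR nln0 (ltW yx).
  have ei := intg_prodM e1 e2; have EE := Rint_prodM e1 e2.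
  rewrite E1 E2 in EE.
  have key : \int[mu2]_q (`|F q| * (I1 `[y, x] q.1 * I1 `[y, x] q.2)) <=
    \int[mu2]_q (C * B * (expR (l * q.1) * I1 `[y, x] q.1 * (expR (- l * q.2) * I1 `[y, x] q.2))).
    apply: ler_Rint_ae.
    - apply: (intgM (intg_norm Fi) (M := 1)).
        by apply: measurable_funM; [exact: measurable_indic_fst|exact: measurable_indic_snd].
      by move=> q; rewrite normrM mulr_ile1//; exact: norm_indic_le1.
    - exact: intgZ.
    - by move=> q; rewrite !mulr_ge0// indic_itvE.
    - by move=> q; rewrite !mulr_ge0// ?expR_ge0// indic_itvE.
    apply: filterS HF => q Hq; rewrite !indic_itvE !in_itv/=.
    case: (boolP (y <= q.1 <= x)) => h1; last by rewrite !(mul0r, mulr0).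
    case: (boolP (y <= q.2 <= x)) => h2; last by rewrite !(mul0r, mulr0).
    rewrite !mulr1 -expRD.
    move: h1 h2 => /andP[h1 h2] /andP[h3 h4].
    have [Hq1 Hq2] := Hq (le_trans aly h3) (le_trans h2 xb).
    case: (ltP q.1 q.2) => h5.
      by rewrite Hq2// normr0 !mulr_ge0// expR_ge0.
    apply: (le_trans Hq1); rewrite -mulrA ler_wpM2l//.
    have := HB q (le_trans aly h3) h5 (le_trans h2 xb).
    rewrite /g mulNr expRN ler_pdivrMr ?expR_gt0// => /le_trans; apply.
    by rewrite ler_wpM2l// ler_expR mulNr -mulrBr.
  have q40 : 0 <= 4^-1 :> R by rewrite invr_ge0.
  have W1 := le_trans (Wb x y aly yx xb) (ler_wpM2l q40 key).
  rewrite RintZ// EE in W1.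
  rewrite /g/= mulNr expRN ler_pdivrMr ?expR_gt0//; apply: (le_trans W1).
  have -> : expR (l * (x - y)) = expR (l * x) / expR (l * y) by rewrite mulrBr expRD expRN.
  rewrite [- l * x]mulNr [- l * y]mulNr !expRN.
  have X0 : 0 < expR (l * x) := expR_gt0 _. have Y0 : 0 < expR (l * y) := expR_gt0 _.
  have XY : expR (l * y) <= expR (l * x) by rewrite ler_expR ler_pM2l// ltW.
  move: (expR (l * x)) (expR (l * y)) X0 Y0 XY => X Y X0 Y0 XY.
  exact: gronwall_algebra.
have gM q : al <= q.2 -> q.2 <= q.1 -> q.1 <= be -> g q <= M.
  move=> h1 h2 h3; rewrite /g -[leRHS]mulr1 ler_pM// ?expR_ge0 ?WM//.
  by rewrite -expR0 ler_expR mulNr oppr_le0 mulr_ge0// ?subr_ge0// ltW.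
have gn n q : al <= q.2 -> q.2 <= q.1 -> q.1 <= be -> g q <= M / 2 ^+ n.
  elim: n q => [|n IH] q h1 h2 h3; first by rewrite expr0 divr1 gM.
  rewrite exprSr invfM mulrA; apply: step => //.
  by rewrite divr_ge0// exprn_ge0.
move=> x y aly yx xb.
have g0 : g (x, y) <= 0.
  apply/ler_addgt0Pr => e e0; rewrite add0r.
  have [n Hn] : exists n, M / 2 ^+ n <= e.
    have M1 : 0 < M + 1 by lra.
    have : (2^-1 : R) ^+ n @[n --> \oo] --> (0 : R).
      by apply: cvg_expr; rewrite ger0_norm// invf_lt1// ltr1n.
    move=> /cvgr0_norm_le /(_ (e / (M + 1)) (divr_gt0 e0 M1)) [n _ /(_ n (leqnn n))] /= h.
    exists n; move: h; rewrite ger0_norm ?exprn_ge0// exprVn ler_pdivlMr// => h.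
    have p0 : 0 <= (2 ^+ n)^-1 :> R by rewrite invr_ge0 exprn_ge0.
    by rewrite mulrC; nra.
  exact: le_trans (gn n (x, y) aly yx xb) Hn.
apply/eqP; rewrite -normr_le0; move: g0; rewrite /g pmulr_lle0// expR_gt0//.
Qed.
End Gronwall.

(** * Time derivatives of weak solutions on the initial line *)

Section Square.
Context {R : realType}.
Local Notation mu := (@lebesgue_measure R).
Local Notation mu2 := (mu \x mu)%E.
Local Notation RR := (measurableTypeR R * measurableTypeR R)%type.
Local Notation I1 A := (\1_(A%classic : set R) : R -> R).
Implicit Types (a b c d s x y : R).

Lemma measurable_swapf : measurable_fun setT (fun q : RR => (q.2, q.1) : RR).
Proof. by apply/measurable_fun_pairP; split; [exact: measurable_snd|exact: measurable_fst]. Qed.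

Lemma swap_scaled (A : set RR) : measurable A ->
  mu2 ((fun q : RR => (q.2, q.1) : RR) @^-1` A) = (1%:E * mu2 A)%E.
Proof. by move=> mA; rewrite mul1e mu2_swap_preimage. Qed.

Lemma Rint_swap (g : RR -> R) : mu2.-integrable setT (EFin \o g) ->
  \int[mu2]_q g (q.2, q.1) = \int[mu2]_q g q.
Proof.
by move=> gi; have := Rintegral_scaled measurable_swapf ler01 swap_scaled gi; rewrite mul1r.
Qed.

Lemma intg_swap (g : RR -> R) : mu2.-integrable setT (EFin \o g) ->
  mu2.-integrable setT (EFin \o (fun q : RR => g (q.2, q.1))).
Proof. by move=> gi; exact: (integrable_scaled measurable_swapf (@ler01 R) swap_scaled gi). Qed.

Lemma measurable_below : measurable_fun setT (fun q : RR => (q.2 < q.1)%R%:R : R).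
Proof.
rewrite (_ : (fun q : RR => _) = (fun q : RR => \1_(`]0, +oo[%classic : set R) (q.1 - q.2))).
  apply: (measurableT_comp (measurable_indicR _)) => //.
  by apply: measurable_funB.
by apply/funext => q; rewrite indicE mem_setE/= in_itv/= andbT subr_gt0.
Qed.

Lemma measurable_above : measurable_fun setT (fun q : RR => (q.1 <= q.2)%R%:R : R).
Proof.
rewrite (_ : (fun q : RR => _) = (fun q : RR => \1_(`[0, +oo[%classic : set R) (q.2 - q.1))).
  apply: (measurableT_comp (measurable_indicR _)) => //.
  by apply: measurable_funB.
by apply/funext => q; rewrite indicE mem_setE/= in_itv/= andbT subr_ge0.
Qed.

Lemma norm_bool_le1 (bb : bool) : `|bb%:R : R| <= 1.
Proof. by case: bb; rewrite ?normr1 ?normr0. Qed.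

(** Cutting a rectangle with corner [(x, y)] along the diagonal, each part is
    described by one coordinate only; the error lives in the square between [x]
    and [y]. *)
Lemma indic_square_split al x y m n s z : al < s -> al < z -> m <= x -> x <= n -> m <= y -> y <= n ->
  `|(z < s)%R%:R * I1 `]al, x[ s + (s <= z)%R%:R * I1 `]al, y[ z - I1 `]al, x[ s * I1 `]al, y[ z|
  <= I1 `[m, n] s * I1 `[m, n] z.
Proof.
move=> h1 h2 h3 h4 h5 h6; rewrite !indic_itvE !in_itv/= h1 h2 /=.
case: (ltP z s) => k1; case: (ltP s x) => k2; case: (ltP z y) => k3;
  rewrite /= ?(mulr1, mulr0, mul0r, addr0, add0r, subr0, subrr) ?normr0 ?normr1 ?mulr_ge0//.
- rewrite (_ : m <= s <= n); last by apply/andP; split; lra.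
  by rewrite (_ : m <= z <= n) ?mulr1//; apply/andP; split; lra.
- rewrite (_ : m <= s <= n); last by apply/andP; split; lra.
  by rewrite (_ : m <= z <= n) ?mulr1//; apply/andP; split; lra.
Qed.

(** The primitives contribute their derivatives [q1] and [q2] at first order,
    with opposite signs because one argument moves by [t] and the other by [-
    t]; the square of side [2 |t|] is of second order. *)
Lemma square_algebra (v p1 p2 p1' p2' q1 q2 tt t e M : R) : 0 <= M ->
  `|p1' - p1 - q1 * t| <= e / 4 * `|t| -> `|p2' - p2 - q2 * - t| <= e / 4 * `|t| ->
  `|tt| <= M * (2 * `|t| * (2 * `|t|)) -> `|t| * (M + 1) <= e / 2 ->
  `|v + p1' + p2' + 4^-1 * tt - (v + p1 + p2) - (q1 - q2) * t| <= e * `|t|.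
Proof.
move=> M0 h1 h2 h3 h4.
have t0 := normr_ge0 t.
have -> : v + p1' + p2' + 4^-1 * tt - (v + p1 + p2) - (q1 - q2) * t =
  (p1' - p1 - q1 * t) + (p2' - p2 - q2 * - t) + 4^-1 * tt by ring.
have h5 : `|4^-1 * tt| <= e / 2 * `|t|.
  rewrite normrM (@ger0_norm _ 4^-1)//.
  have : M * (2 * `|t| * (2 * `|t|)) = 4 * ((`|t| * M) * `|t|) by ring.
  have : `|t| * M * `|t| <= e / 2 * `|t| by apply: ler_wpM2r => //; lra.
  lra.
rewrite (le_trans (ler_normD _ _))//.
have := ler_normD (p1' - p1 - q1 * t) (p2' - p2 - q2 * - t); lra.
Qed.

Lemma norm_lt_itv al be x t : `|t| < x - al -> `|t| < be - x -> al < x + t <= be.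
Proof. by rewrite !ltr_norml => /andP[h1 h2] /andP[h3 h4]; apply/andP; split; lra. Qed.

Section Main.
Variables (al be M : R) (V F : RR -> R).
Hypothesis albe : al < be.
Hypothesis M0 : 0 <= M.
Hypothesis mF : measurable_fun setT F.
Hypothesis FM : forall q, `|F q| <= M * (I1 `[al, be] q.1 * I1 `[al, be] q.2).
Hypothesis rect : forall a b c d, al <= a -> a < b -> b <= be -> al <= c -> c < d -> d <= be ->
  V (a, c) - V (a, d) - V (b, c) + V (b, d) =
  - 4^-1 * \int[mu2]_q (F q * (I1 `]a, b[ q.1 * I1 `]c, d[ q.2)).
Hypothesis edge1 : exists2 q : R -> R, mu.-integrable setT (EFin \o q) &
  forall x, al < x <= be -> V (x, al) - V (al, al) = \int[mu]_s (q s * I1 `]al, x[ s).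
Hypothesis edge2 : exists2 q : R -> R, mu.-integrable setT (EFin \o q) &
  forall y, al < y <= be -> V (al, y) - V (al, al) = \int[mu]_s (q s * I1 `]al, y[ s).

Let Fi : mu2.-integrable setT (EFin \o F).
Proof. by have [] := ler_Rint_box (ltW albe) (ltW albe) mF FM. Qed.

Let FMi q : `|F q| <= M.
Proof.
by apply: (le_trans (FM q)); rewrite -[leRHS]mulr1 ler_wpM2l// mulr_ile1 ?indic_itvE.
Qed.

Let E x y := \int[mu2]_q (F q * ((q.2 < q.1)%R%:R * I1 `]al, x[ q.1 +
  (q.1 <= q.2)%R%:R * I1 `]al, y[ q.2 - I1 `]al, x[ q.1 * I1 `]al, y[ q.2)).

Lemma square_F0 q : (q.1 < al) || (q.2 < al) -> F q = 0.
Proof.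
move=> h; apply/eqP; rewrite -normr_le0; apply: (le_trans (FM q)).
rewrite !indic_itvE !in_itv/= [al <= q.1]leNgt [al <= q.2]leNgt.
by move: h => /orP[->|->]; rewrite /= ?mul0r ?mulr0 ?mul0r.
Qed.

Lemma square_E_le x y m n : m <= x -> x <= n -> m <= y -> y <= n -> `|E x y| <= M * ((n - m) * (n - m)).
Proof.
move=> h1 h2 h3 h4.
pose H (q : RR) := F q * ((al < q.1)%R%:R * (al < q.2)%R%:R * ((q.2 < q.1)%R%:R * I1 `]al, x[ q.1 +
  (q.1 <= q.2)%R%:R * I1 `]al, y[ q.2 - I1 `]al, x[ q.1 * I1 `]al, y[ q.2)).
have mI : measurable_fun setT (fun q : RR => (q.2 < q.1)%R%:R * I1 `]al, x[ q.1 +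
  (q.1 <= q.2)%R%:R * I1 `]al, y[ q.2 - I1 `]al, x[ q.1 * I1 `]al, y[ q.2).
  apply: measurable_funB.
    apply: measurable_funD; apply: measurable_funM.
    - exact: measurable_below.
    - exact: measurable_indic_fst.
    - exact: measurable_above.
    - exact: measurable_indic_snd.
  by apply: measurable_funM; [exact: measurable_indic_fst|exact: measurable_indic_snd].
have st (z : R) : (al < z)%R%:R = I1 `]al, +oo[ z by rewrite indic_itvE in_itv/= andbT.
have mH : measurable_fun setT H.
  apply: measurable_funM => //; apply: measurable_funM => //.
  rewrite (_ : (fun q : RR => _) = fun q : RR => I1 `]al, +oo[ q.1 * I1 `]al, +oo[ q.2).
    by apply: measurable_funM; [exact: measurable_indic_fst|exact: measurable_indic_snd].
  by apply/funext => q; rewrite !st.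
have EH : E x y = \int[mu2]_q H q.
  apply: eq_Rint_ae => //; first exact: measurable_funM.
  have := @ae_fst_neq R al; apply: filterS2 (@ae_snd_neq R al) => q n2 n1.
  rewrite /H; case: (ltP al q.1) => k1; last first.
    by rewrite square_F0 ?mul0r// lt_neqAle n1 k1.
  case: (ltP al q.2) => k2; first by rewrite !mul1r.
  by rewrite square_F0 ?mul0r// [q.2 < al]lt_neqAle n2 k2 orbT.
rewrite EH.
have mn : m <= n by exact: le_trans h2.
have hb q : `|H q| <= M * (I1 `[m, n] q.1 * I1 `[m, n] q.2).
  rewrite /H; case: (ltP al q.1) => k1; last first.
    by rewrite !mul0r mulr0 normr0 !mulr_ge0// indic_itvE.
  case: (ltP al q.2) => k2; last first.
    by rewrite mulr0 mul0r mulr0 normr0 !mulr_ge0// indic_itvE.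
  rewrite !mul1r normrM; apply: ler_pM => //.
  exact: indic_square_split.
by have [] := ler_Rint_box mn mn mH hb.
Qed.

Lemma square_half (G : RR -> R) : mu2.-integrable setT (EFin \o G) ->
  exists2 k : R -> R, mu.-integrable setT (EFin \o k) &
  forall x, \int[mu2]_q (G q * I1 `]al, x[ q.1) = \int[mu]_s (k s * I1 `]al, x[ s).
Proof.
move=> Gi; exists (fun s => \int[mu]_z G (s, z)); first exact: integrable_fubini_inner.
by move=> x; rewrite Rint_fubini_indic.
Qed.

(** Split the rectangle below [(x, y)] along the diagonal: two triangles whose
    areas are integrals in one variable, up to a square of side [|x - y|]. *)
Lemma square_decomp : exists Q1 Q2 : R -> R,
  [/\ mu.-integrable setT (EFin \o Q1), mu.-integrable setT (EFin \o Q2) &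
  forall x y, al < x <= be -> al < y <= be ->
    V (x, y) = V (al, al) + \int[mu]_s (Q1 s * I1 `]al, x[ s) + \int[mu]_s (Q2 s * I1 `]al, y[ s)
      + 4^-1 * E x y].
Proof.
have [q1 q1i H1] := edge1; have [q2 q2i H2] := edge2.
have G1 : mu2.-integrable setT (EFin \o (fun q : RR => F q * (q.2 < q.1)%R%:R)).
  by apply: (intgM Fi measurable_below (M := 1)) => q; exact: norm_bool_le1.
have G2' : mu2.-integrable setT (EFin \o (fun q : RR => F q * (q.1 <= q.2)%R%:R)).
  by apply: (intgM Fi measurable_above (M := 1)) => q; exact: norm_bool_le1.
have G2 := intg_swap G2'.
have [k1 k1i K1] := square_half G1; have [k2 k2i K2] := square_half G2.
exists (fun s => q1 s - 4^-1 * k1 s), (fun s => q2 s - 4^-1 * k2 s); split.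
- by apply: intgB => //; exact: intgZ.
- by apply: intgB => //; exact: intgZ.
move=> x y hx hy.
have mI z : measurable_fun setT (I1 `]al, z[) by exact: measurable_indicR.
have Ii (q : R -> R) z : mu.-integrable setT (EFin \o q) -> mu.-integrable setT (EFin \o (fun s => q s * I1 `]al, z[ s)).
  by move=> qi; apply: (intgM qi (mI z) (M := 1)) => s; exact: norm_indic_le1.
have split1 (q k : R -> R) z : mu.-integrable setT (EFin \o q) -> mu.-integrable setT (EFin \o k) ->
   \int[mu]_s ((q s - 4^-1 * k s) * I1 `]al, z[ s) =
   \int[mu]_s (q s * I1 `]al, z[ s) - 4^-1 * \int[mu]_s (k s * I1 `]al, z[ s).
  move=> qi ki; rewrite -RintZ; last exact: Ii.
  rewrite -RintB; [|exact: Ii|by apply: intgZ; exact: Ii].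
  by apply: eq_Rintegral => s _; ring.
rewrite !split1// -H1// -H2// -K1 -K2.
have := rect (lexx al) (andP hx).1 (andP hx).2 (lexx al) (andP hy).1 (andP hy).2.
have G2s : \int[mu2]_q (F (q.2, q.1) * ((q.2, q.1).1 <= (q.2, q.1).2)%R%:R * I1 `]al, y[ q.1) =
    \int[mu2]_q (F q * (q.1 <= q.2)%R%:R * I1 `]al, y[ q.2).
  rewrite -(@Rint_swap (fun q => F q * (q.1 <= q.2)%R%:R * I1 `]al, y[ q.2))//.
  apply: (intgM G2' (M := 1)); first exact: measurable_indic_snd.
  by move=> q; exact: norm_indic_le1.
rewrite G2s.
have i1 : mu2.-integrable setT (EFin \o (fun q : RR => F q * (q.2 < q.1)%R%:R * I1 `]al, x[ q.1)).
  apply: (intgM G1 (M := 1)); first exact: measurable_indic_fst.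
  by move=> q; exact: norm_indic_le1.
have i2 : mu2.-integrable setT (EFin \o (fun q : RR => F q * (q.1 <= q.2)%R%:R * I1 `]al, y[ q.2)).
  apply: (intgM G2' (M := 1)); first exact: measurable_indic_snd.
  by move=> q; exact: norm_indic_le1.
have i3 : mu2.-integrable setT (EFin \o (fun q : RR => F q * (I1 `]al, x[ q.1 * I1 `]al, y[ q.2))).
  apply: (intgM Fi (M := 1)).
    by apply: measurable_funM; [exact: measurable_indic_fst|exact: measurable_indic_snd].
  by move=> q; rewrite normrM mulr_ile1//; exact: norm_indic_le1.
have -> : E x y = \int[mu2]_q (F q * (q.2 < q.1)%R%:R * I1 `]al, x[ q.1)
   + \int[mu2]_q (F q * (q.1 <= q.2)%R%:R * I1 `]al, y[ q.2)
   - \int[mu2]_q (F q * (I1 `]al, x[ q.1 * I1 `]al, y[ q.2)).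
  rewrite -RintD// -RintB//; last exact: intgD.
  by apply: eq_Rintegral => q _; ring.
set j1 := \int[mu2]_q _; set j2 := \int[mu2]_q _; set j3 := \int[mu2]_q _.
move=> h; have -> : V (x, y) = V (al, y) + V (x, al) - V (al, al) - 4^-1 * j1.
  move: h; rewrite mulNr => /eqP; rewrite -subr_eq0 => /eqP h.
  apply/eqP; rewrite -subr_eq0; apply/eqP; rewrite -[RHS]h; ring.
ring.
Qed.

(** At [(x + t, x - t)] both one-variable primitives are differentiable for
    almost every [x], and the square contributes [O(t ^+ 2)]. *)
Lemma square_derive : {ae mu, forall x, al < x < be -> exists l, forall e, 0 < e ->
  exists2 dl, 0 < dl & forall t, `|t| < dl ->
    `|V (x + t, x - t) - V (x, x) - l * t| <= e * `|t|}.
Proof.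
have [Q1 [Q2 [Q1i Q2i HV]]] := square_decomp.
apply: ae1S2 (primitive_derive al Q1i) (primitive_derive al Q2i) => x D1 D2 /andP[ax xb].
have {}D1 := (is_derive1_eps _ _ _).1 (D1 ax); have {}D2 := (is_derive1_eps _ _ _).1 (D2 ax).
exists (Q1 x - Q2 x) => e e0.
have e30 : 0 < e / 4 by rewrite divr_gt0.
have [d1 d10 H1] := D1 _ e30; have [d2 d20 H2] := D2 _ e30.
have M1 : 0 < M + 1 by rewrite ltr_wpDl.
exists (Num.min (Num.min d1 d2) (Num.min (Num.min (x - al) (be - x)) (e / 2 / (M + 1)))).
  by rewrite !lt_min d10 d20 !subr_gt0 ax xb !divr_gt0.
move=> t; rewrite !lt_min => /andP[/andP[td1 td2] /andP[/andP[tya tby] te]].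
have t1 := ler_norm t; have t2 : - t <= `|t| by rewrite -normrN ler_norm.
have b1 : al < x + t <= be by exact: norm_lt_itv.
have b2 : al < x - t <= be by apply: norm_lt_itv; rewrite normrN.
have b0 : al < x <= be by rewrite ax ltW.
rewrite (HV (x + t) (x - t) b1 b2) (HV x x b0 b0).
have h1 := H1 _ td1; have h2 := H2 (- t); rewrite normrN in h2; have {}h2 := h2 td2.
have E0 : E x x = 0.
  by have := square_E_le (lexx x) (lexx x) (lexx x) (lexx x); rewrite subrr mul0r mulr0 normr_le0 => /eqP.
have hE : `|E (x + t) (x - t)| <= M * ((2 * `|t|) * (2 * `|t|)).
  have -> : 2 * `|t| = x + `|t| - (x - `|t|) by ring.
  by apply: square_E_le; rewrite lerD2l ?lerN2// lerNl.
rewrite E0 mulr0 addr0.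
have tM : `|t| * (M + 1) <= e / 2 by rewrite -ler_pdivlMr// ltW.
exact: (square_algebra _ M0 h1 h2 hE tM).
Qed.
End Main.
End Square.

(** * Absolutely continuous functions and the space L2 of a period *)

Section PeriodicReal.
Context {R : realType}.
Local Notation mu := (@lebesgue_measure R).
Local Notation mu2 := (mu \x mu)%E.
Local Notation RR := (measurableTypeR R * measurableTypeR R)%type.
Local Notation I1 A := (\1_(A%classic : set R) : R -> R).
Local Notation TT := (`[0%R, (2 * pi)%R]%classic : set R).
Implicit Types (a b x y s : R) (h k P Q : R -> R).

Lemma twopi_gt0 : 0 < 2 * pi :> R.
Proof. by rewrite mulr_gt0// pi_gt0. Qed.

Definition loc_int h := forall a b, mu.-integrable `[a, b] (EFin \o h).

Definition primitive P h := forall a b, a <= b -> P b - P a = \int[mu]_(x in `[a, b]) h x.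

Definition L2T h := measurable_fun setT h /\ mu.-integrable TT (EFin \o (fun x => h x ^+ 2)).

Lemma intg_on (A : set R) h : measurable (A : set (measurableTypeR R)) -> measurable_fun setT h ->
  forall g : R -> R, mu.-integrable A (EFin \o g) -> (forall x, A x -> `|h x| <= g x) ->
  mu.-integrable A (EFin \o h).
Proof.
move=> mA mh g gi hg; apply: (le_integrable mA _ _ gi).
  by apply/measurable_EFinP; exact: measurable_funTS.
by move=> x Ax /=; rewrite lee_fin (le_trans (hg x Ax))// ler_norm.
Qed.

Lemma intg_cst_itv a b (c : R) : mu.-integrable `[a, b] (EFin \o (fun=> c)).
Proof.
apply: continuous_compact_integrable; first exact: segment_compact.
by apply: continuous_subspaceT => x; exact: cvg_cst.
Qed.

Lemma intgD_on (A : set R) h k : measurable (A : set (measurableTypeR R)) ->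
  mu.-integrable A (EFin \o h) ->
  mu.-integrable A (EFin \o k) -> mu.-integrable A (EFin \o (fun x => h x + k x)).
Proof. by move=> mA hi ki; have := integrableD mA hi ki. Qed.

Lemma intgB_on (A : set R) h k : measurable (A : set (measurableTypeR R)) ->
  mu.-integrable A (EFin \o h) ->
  mu.-integrable A (EFin \o k) -> mu.-integrable A (EFin \o (fun x => h x - k x)).
Proof. by move=> mA hi ki; have := integrableB mA hi ki. Qed.

Lemma intgZ_on (A : set R) c h : measurable (A : set (measurableTypeR R)) ->
  mu.-integrable A (EFin \o h) -> mu.-integrable A (EFin \o (fun x => c * h x)).
Proof. by move=> mA hi; have := integrableZl mA c hi. Qed.

Lemma L2T_mul h k : L2T h -> L2T k -> mu.-integrable TT (EFin \o (fun x => h x * k x)).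
Proof.
move=> [mh h2] [mk k2].
apply: (intg_on _ _ (g := fun x => h x ^+ 2 + k x ^+ 2)) => //.
- exact: measurable_funM.
- exact: intgD_on.
move=> x _; rewrite normrM.
have -> : h x ^+ 2 = `|h x| ^+ 2 by rewrite real_normK// num_real.
have -> : k x ^+ 2 = `|k x| ^+ 2 by rewrite real_normK// num_real.
by nra.
Qed.

Lemma L2T_int h : L2T h -> mu.-integrable TT (EFin \o h).
Proof.
move=> [mh h2]; apply: (intg_on _ mh (g := fun x => 1 + h x ^+ 2)) => //.
  by apply: intgD_on => //; exact: intg_cst_itv.
move=> x _; have -> : h x ^+ 2 = `|h x| ^+ 2 by rewrite real_normK// num_real.
by nra.
Qed.

Lemma L2TD h k : L2T h -> L2T k -> L2T (fun x => h x + k x).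
Proof.
move=> Hh Hk; split; first exact: measurable_funD Hh.1 Hk.1.
rewrite (_ : (fun x => _) = fun x => h x ^+ 2 + (2 * (h x * k x) + k x ^+ 2)); last first.
  by apply/funext => x; ring.
apply: intgD_on => //; first exact: Hh.2.
apply: intgD_on => //; last exact: Hk.2.
by apply: intgZ_on => //; exact: L2T_mul.
Qed.

Lemma L2TZ c h : L2T h -> L2T (fun x => c * h x).
Proof.
move=> Hh; split; first by apply: measurable_funM => //; exact: Hh.1.
rewrite (_ : (fun x => _) = fun x => c ^+ 2 * (h x ^+ 2)); last by apply/funext => x; ring.
by apply: intgZ_on => //; exact: Hh.2.
Qed.

Lemma L2T_cont h : continuous h -> L2T h.
Proof.
move=> ch; split; first exact: continuous_measurableR.
apply: continuous_compact_integrable; first exact: segment_compact.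
apply: continuous_subspaceT => x; rewrite (_ : (fun x => _) = fun x => h x * h x); last by apply/funext => ?; ring.
by apply: cvgM; exact: ch.
Qed.

Lemma intg_shift h (A : set R) c : measurable (A : set (measurableTypeR R)) ->
  mu.-integrable setT (EFin \o (fun x => h x * \1_A x)) ->
  mu.-integrable setT (EFin \o (fun x => h (x + c) * \1_A (x + c))).
Proof.
move=> mA hi.
have sc : forall B : set (measurableTypeR R), measurable B ->
   mu ((fun x => 1 * x + c) @^-1` B) = (1%:E * mu B)%E.
  by move=> B mB; rewrite lebesgue_measure_affine_preimage ?oner_neq0// normr1 invr1.
have ma : measurable_fun setT (fun x : measurableTypeR R => 1 * x + c : measurableTypeR R) by exact: measurable_affine.
have := @integrable_scaled _ (measurableTypeR R) R mu _ 1 ma ler01 sc _ hi.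
by rewrite (_ : (fun x => h x * \1_A x) \o _ = fun x => h (x + c) * \1_A (x + c))//;
  apply/funext => x /=; rewrite mul1r.
Qed.

Lemma three_shifts a b x : a + 2 * pi <= b ->
  `|((a - 2 * pi <= x) && (x <= b + 2 * pi))%R%:R| <=
  `|((a <= x) && (x <= b))%:R| + `|((a <= x + 2 * pi) && (x + 2 * pi <= b))%R%:R|
  + `|((a <= x - 2 * pi) && (x - 2 * pi <= b))%R%:R| :> R.
Proof.
move=> ab; have p0 := twopi_gt0; move: (2 * pi) ab p0 => p ab p0.
case: (leP (a - p) x) => k1; case: (leP x (b + p)) => k2;
  rewrite /= ?normr0 ?addr_ge0// ?normr1.
case: (leP a x) => k3; case: (leP x b) => k4; rewrite /= ?normr0 ?normr1 ?lerDl ?addr_ge0//.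
- by rewrite -addrA lerDl addr_ge0.
- have -> : a <= x - p by lra.
  have -> : x - p <= b by lra.
  by rewrite /= normr1 lerDr addr_ge0.
- have -> : a <= x + p by lra.
  have -> : x + p <= b by lra.
  by rewrite /= normr1 addrAC lerDr addr_ge0.
- by exfalso; lra.
Qed.

(** An interval longer than a period, enlarged by a period on both sides, is
    covered by three of its translates; intervals around a period therefore
    exhaust the line. *)
Lemma per_loc_int h : measurable_fun setT h -> (forall x, h (x + 2 * pi) = h x) ->
  mu.-integrable TT (EFin \o h) -> loc_int h.
Proof.
move=> mh hp hi.
have hpm x : h (x - 2 * pi) = h x by rewrite -[in RHS](subrK (2 * pi) x) hp.
have p0 := twopi_gt0.
have step a b : a + 2 * pi <= b -> mu.-integrable `[a, b] (EFin \o h) ->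
   mu.-integrable `[a - 2 * pi, b + 2 * pi] (EFin \o h).
  move=> ab abi.
  have i0 := (intg_indic mu h (measurable_itv `[a, b])).1 abi.
  have i1 := intg_shift (2 * pi) (measurable_itv `[a, b]) i0.
  have i2 := intg_shift (- (2 * pi)) (measurable_itv `[a, b]) i0.
  apply: (intg_indic mu h (measurable_itv _)).2.
  apply: (@intg_le _ _ _ mu (fun x => h x * I1 `[a - 2 * pi, b + 2 * pi] x) (fun x => `|h x * I1 `[a, b] x| + `|h (x + 2 * pi) * I1 `[a, b] (x + 2 * pi)|
     + `|h (x - 2 * pi) * I1 `[a, b] (x - 2 * pi)|)).
  - by apply: measurable_funM => //; exact: measurable_indicR.
  - by apply: intgD; [apply: intgD|]; exact: intg_norm.
  move=> x; rewrite hp hpm !normrM -!mulrDr ler_wpM2l// !indic_itvE !in_itv/=.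
  exact: three_shifts.
have all n : mu.-integrable `[- (2 * pi) *+ n, 2 * pi + (2 * pi) *+ n] (EFin \o h).
  elim: n => [|n IH]; first by rewrite !mulr0n addr0.
  have -> : - (2 * pi) *+ n.+1 = - (2 * pi) *+ n - 2 * pi :> R by rewrite mulrSr.
  have -> : 2 * pi + 2 * pi *+ n.+1 = 2 * pi + 2 * pi *+ n + 2 * pi :> R by rewrite [_ *+ n.+1]mulrSr addrA.
  apply: step => //.
  have := mulrn_wge0 n (ltW p0); rewrite mulNrn; lra.
move=> a b.
have [n Hn] : exists n, `|a| + `|b| <= (2 * pi) *+ n.
  exists (Num.bound ((`|a| + `|b|) / (2 * pi))).
  rewrite -mulr_natl -ler_pdivrMr// ltW//.
  apply: le_lt_trans (archi_boundP _); first exact: lexx.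
  by rewrite divr_ge0 ?addr_ge0// ltW.
apply: integrableS (all n) => //.
apply: subset_itv; rewrite bnd_simp.
  have := ler_norm (- a); rewrite normrN mulNrn; have := normr_ge0 b; lra.
have := ler_norm b; have := normr_ge0 a; lra.
Qed.

Lemma primitive_cont P h : loc_int h -> primitive P h -> continuous P.
Proof.
move=> hi Ph x.
have xi : x - 1 < x + 1 by lra.
have /(continuous_within_itvP _ xi) [c _ _] := parameterized_integral_continuous (ltW xi) (hi (x - 1) (x + 1)).
have {}c := c x ltac:(rewrite in_itv/=; apply/andP; split; lra).
have c2 : {for x, continuous (fun y => P (x - 1) + parameterized_integral mu (x - 1) y h)}.
  by apply: cvgD; [exact: cvg_cst|exact: c].
have E y : x - 1 <= y -> P y = P (x - 1) + parameterized_integral mu (x - 1) y h.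
  by move=> xy; rewrite /parameterized_integral -Ph//; ring.
rewrite /continuous_at [P x]E; last lra.
apply: cvg_trans c2; apply: near_eq_cvg.
exists 1 => //= y; rewrite /ball_/= ltr_norml => /andP[y1 y2].
by apply/esym/E; lra.
Qed.

(** A null set contains no interval, so continuous functions that agree almost
    everywhere agree. *)
Lemma cont_ae_eq P Q : continuous P -> continuous Q -> {ae mu, forall x, P x = Q x} -> P = Q.
Proof.
move=> cP cQ [N [mN N0 NPQ]]; apply/funext => x; apply/eqP/negPn/negP => PQ.
have d0 : 0 < `|P x - Q x| by rewrite normr_gt0 subr_eq0.
have cD : {for x, continuous (fun y => P y - Q y)} by apply: cvgB; [exact: cP|exact: cQ].
have /cvgrPdist_lt /(_ _ d0) [e /= e0 He] := cD.
have sub : `]x - e, x + e[%classic `<=` N.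
  move=> y /=; rewrite in_itv/= => /andP[y1 y2]; apply: NPQ => /= E.
  have := He y; rewrite /ball_/= E subrr subr0 => /(_ _).
  have h : `|x - y| < e by rewrite ltr_norml; apply/andP; split; lra.
  by move=> /(_ h); rewrite ltxx.
pose A : set R := `]x - e, x + e[%classic.
have : (mu A <= mu N)%E by apply: (le_measure mu) => //; rewrite inE//; exact: measurable_itv.
have -> : mu A = (2 * e)%:E; last by rewrite N0 lee_fin; lra.
rewrite /A lebesgue_measure_itv/= lte_fin; case: ltP => h; last by exfalso; clear N0; lra.
by rewrite -EFinB; congr EFin; ring.
Qed.

(** The difference of the two densities has vanishing primitive, whose
    derivative it is almost everywhere. *)
Lemma primitive_unique P h k : loc_int h -> loc_int k -> primitive P h -> primitive P k ->
  {ae mu, forall x, h x = k x}.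
Proof.
move=> hi ki Ph Pk.
have H r : {ae mu, forall x, - r < x < r -> h x = k x}.
  have hk : mu.-integrable `[- r, r] (EFin \o (fun x => h x - k x)).
    by apply: intgB_on.
  have hkI := (intg_indic mu (fun x => h x - k x) (measurable_itv `[- r, r])).1 hk.
  apply: ae1S (primitive_derive (- r) hkI) => x D /andP[x1 x2].
  have {}D := D x1.
  have Z y : - r < y < r -> \int[mu]_s ((h s - k s) * I1 `[- r, r] s * I1 `]- r, y[ s) = 0.
    move=> /andP[y1 y2].
    have hk2 : mu.-integrable `[- r, y] (EFin \o (fun x => h x - k x)).
      by apply: intgB_on.
    transitivity (\int[mu]_(s in `]- r, y[) (h s - k s)).
      rewrite [RHS]Rint_indic//; apply: eq_Rintegral => s _; rewrite -mulrA; congr (_ * _).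
      rewrite !indic_itvE !in_itv/=.
      case: (ltP (- r) s) => k1; case: (ltP s y) => k2; rewrite /= ?(mulr1, mulr0)//.
      by rewrite (ltW k1) (le_trans (ltW k2) (ltW y2)).
    have s1 : `]- r, y[%classic `<=` (`[- r, y]%classic : set R).
      by apply: subset_itv; rewrite bnd_simp.
    have s2 : `]- r, y]%classic `<=` (`[- r, y]%classic : set R).
      by apply: subset_itv; rewrite bnd_simp.
    rewrite Rintegral_itv_bndo_bndc; last by apply: integrableS hk2.
    rewrite Rintegral_itv_obnd_cbnd; last by apply: integrableS hk2.
    rewrite RintegralB//.
    by rewrite -Ph ?ltW// -Pk ?ltW// subrr.
  apply/eqP; rewrite -subr_eq0 -normr_le0; apply/ler_addgt0Pr => e e0; rewrite add0r.
  have [d d0 Hd] := (is_derive1_eps _ _ _).1 D e e0.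
  pose t := Num.min d (r - x) / 2.
  have m0 : 0 < Num.min d (r - x) by rewrite lt_min d0 subr_gt0.
  have t0 : 0 < t by rewrite divr_gt0.
  have tm : t < Num.min d (r - x) by rewrite /t ltr_pdivrMr// mulr_natr mulr2n ltrDr.
  move: tm; rewrite lt_min => /andP[td tx].
  have := Hd t; rewrite (ger0_norm (ltW t0)) => /(_ td).
  have xr : - r < x + t < r by rewrite (lt_trans x1) ?ltrDl// -ltrBrDl.
  have xr0 : - r < x < r by rewrite x1.
  rewrite (Z _ xr) (Z _ xr0).
  rewrite subrr sub0r normrN normrM (ger0_norm (ltW t0)) ler_pM2r//.
  by rewrite indic_itvE in_itv/= (ltW x1) (ltW x2) mulr1.
have : {ae mu, forall x, forall n : nat, - n%:R < x < n%:R -> h x = k x}.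
  have := @ae_foralln _ _ _ mu (fun n x => - n%:R < x < n%:R -> h x = k x) (fun n => H n%:R).
  by [].
apply: ae1S => x Hx; apply: (Hx (Num.bound `|x|)).
have hh := archi_boundP (normr_ge0 x).
by rewrite -ltr_norml.
Qed.

Lemma cont_bounded_itv P a b : continuous P -> exists M, forall x, a <= x <= b -> `|P x| <= M.
Proof.
move=> cP; have [ab|ba] := leP a b.
  have cn : {within `[a, b], continuous (fun x => `|P x|)}.
    by apply: continuous_subspaceT => x; apply: cvg_norm; exact: cP.
  have [c _ H] := EVT_max ab cn.
  by exists `|P c| => x xab; apply: H; rewrite in_itv.
by exists 0 => x /andP[h1 h2]; have := le_trans h1 h2; rewrite leNgt ba.
Qed.

Lemma measurable_leq2 : measurable_fun setT (fun q : RR => (q.2 <= q.1)%R%:R : R).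
Proof.
rewrite (_ : (fun q : RR => _) = (fun q : RR => \1_(`[0, +oo[%classic : set R) (q.1 - q.2))).
  apply: (measurableT_comp (measurable_indicR _)) => //.
  by apply: measurable_funB.
by apply/funext => q; rewrite indicE mem_setE/= in_itv/= andbT subr_ge0.
Qed.

(** Integration by parts for absolutely continuous functions: split the
    integral of [h(s) k(z)] over a square along the diagonal and integrate each
    half in the order that makes a primitive appear. *)
Lemma primitive_ibp P Q h k b : 0 <= b -> loc_int h -> loc_int k -> primitive P h -> primitive Q k ->
  \int[mu]_(x in `[0, b]) (h x * Q x) + \int[mu]_(x in `[0, b]) (P x * k x) = P b * Q b - P 0 * Q 0.
Proof.
move=> b0 hi ki Ph Qk.
have mI : measurable (`[0, b]%classic : set (measurableTypeR R)) by [].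
pose H x := h x * I1 `[0, b] x; pose K x := k x * I1 `[0, b] x.
have Hi : mu.-integrable setT (EFin \o H) by apply: (intg_indic mu h mI).1; exact: hi.
have Ki : mu.-integrable setT (EFin \o K) by apply: (intg_indic mu k mI).1; exact: ki.
have HE : \int[mu]_s H s = P b - P 0 by rewrite /H -Rint_indic// -Ph.
have KE : \int[mu]_s K s = Q b - Q 0 by rewrite /K -Rint_indic// -Qk.
have HKi := intg_prodM Hi Ki; have HKE := Rint_prodM Hi Ki.
have bl (b1 : bool) : `|b1%:R : R| <= 1 by case: b1; rewrite ?normr1 ?normr0.
have i1 : mu2.-integrable setT (EFin \o (fun q : RR => H q.1 * K q.2 * (q.2 <= q.1)%R%:R)).
  by apply: (intgM HKi measurable_leq2 (M := 1)) => q.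
have i2 : mu2.-integrable setT (EFin \o (fun q : RR => H q.1 * K q.2 * (1 - (q.2 <= q.1)%R%:R))).
  apply: (intgM HKi (M := 1)); first by apply: measurable_funB => //; exact: measurable_leq2.
  by move=> q; case: (q.2 <= q.1)%R; rewrite ?subrr ?subr0 ?normr0 ?normr1.
have E : \int[mu2]_q (H q.1 * K q.2 * (q.2 <= q.1)%R%:R) + \int[mu2]_q (H q.1 * K q.2 * (1 - (q.2 <= q.1)%R%:R))
   = (P b - P 0) * (Q b - Q 0).
  rewrite -HE -KE -HKE -RintD//; apply: eq_Rintegral => q _; ring.
have cQ := primitive_cont ki Qk; have cP := primitive_cont hi Ph.
have bdd (G : R -> R) U : mu.-integrable setT (EFin \o (fun x => G x * I1 `[0, b] x)) -> continuous U ->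
    mu.-integrable setT (EFin \o (fun x => G x * I1 `[0, b] x * U x)).
  move=> Gi cU; have [M HM] := cont_bounded_itv 0 b cU.
  apply: (@intg_le _ _ _ mu _ (fun x => M * `|G x * I1 `[0, b] x|)).
  - by apply: measurable_funM; [exact: (intg_measurable Gi)|exact: continuous_measurableR].
  - by apply: intgZ; exact: intg_norm.
  move=> x; rewrite normrM mulrC; have [xb|xb] := boolP (0 <= x <= b).
    by apply: ler_wpM2r => //; exact: HM.
  by rewrite indic_itvE in_itv/= (negbTE xb) mulr0 normr0 !mulr0.
have hQi : mu.-integrable setT (EFin \o (fun x => H x * Q x)) by exact: bdd.
have kPi : mu.-integrable setT (EFin \o (fun x => K x * P x)) by exact: bdd.
have e1 : \int[mu2]_q (H q.1 * K q.2 * (q.2 <= q.1)%R%:R) = \int[mu]_s (H s * (Q s - Q 0)).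
  rewrite Rint_fubini//=; apply: eq_Rintegral => s _.
  have [sb|sb] := boolP (0 <= s <= b); last first.
    rewrite /H indic_itvE in_itv/= (negbTE sb) mulr0 mul0r.
    by under eq_Rintegral do rewrite !mul0r; rewrite Rintegral_cst// mul0r.
  move: (sb) => /andP[s0 s1].
  rewrite Qk// Rint_indic// -RintZ; last first.
    by apply: (intg_indic mu k (measurable_itv `[0, s])).1; exact: ki.
  apply: eq_Rintegral => z _; rewrite -mulrA; congr (_ * _).
  rewrite /K -mulrA; congr (_ * _); rewrite !indic_itvE !in_itv/=.
  case: (leP 0 z) => k1; case: (leP z s) => k2; case: (leP z b) => k3; rewrite /= ?(mulr1, mulr0)//; exfalso; clear - s0 s1 k1 k2 k3; lra.
have e2 : \int[mu2]_q (H q.1 * K q.2 * (1 - (q.2 <= q.1)%R%:R)) = \int[mu]_s (K s * (P s - P 0)).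
  rewrite -(Rint_swap i2) (Rint_fubini (intg_swap i2))/=; apply: eq_Rintegral => s _.
  have [sb|sb] := boolP (0 <= s <= b); last first.
    rewrite /K indic_itvE in_itv/= (negbTE sb) mulr0 mul0r.
    by under eq_Rintegral do rewrite mulr0 !mul0r; rewrite Rintegral_cst// mul0r.
  move: (sb) => /andP[s0 s1].
  have sub : `[0, s[%classic `<=` (`[0, s]%classic : set R) by apply: subset_itv; rewrite bnd_simp.
  rewrite Ph// -Rintegral_itv_bndo_bndc; last by apply: integrableS (hi 0 s).
  rewrite Rint_indic// -RintZ; last first.
    by apply: (intg_indic mu h (measurable_itv `[0, s[)).1; apply: integrableS (hi 0 s).
  apply: eq_Rintegral => z _; rewrite (mulrC (H z)) -mulrA; congr (_ * _).
  rewrite /H -mulrA; congr (_ * _); rewrite !indic_itvE !in_itv/=.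
  case: (leP 0 z) => k1; case: (leP s z) => k2; case: (leP z b) => k3;
    rewrite /= ?subrr ?subr0 ?(mulr1, mulr0)//; exfalso; clear - s0 s1 k1 k2 k3; lra.
have E1 : \int[mu]_s (H s * (Q s - Q 0)) = \int[mu]_s (H s * Q s) - Q 0 * (P b - P 0).
  by rewrite -HE -RintZ// -RintB//; [apply: eq_Rintegral => s _; ring|exact: intgZ].
have E2 : \int[mu]_s (K s * (P s - P 0)) = \int[mu]_s (K s * P s) - P 0 * (Q b - Q 0).
  by rewrite -KE -RintZ// -RintB//; [apply: eq_Rintegral => s _; ring|exact: intgZ].
have F1 : \int[mu]_(x in `[0, b]) (h x * Q x) = \int[mu]_s (H s * Q s).
  by rewrite Rint_indic//; apply: eq_Rintegral => s _; rewrite /H; ring.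
have F2 : \int[mu]_(x in `[0, b]) (P x * k x) = \int[mu]_s (K s * P s).
  by rewrite Rint_indic//; apply: eq_Rintegral => s _; rewrite /K; ring.
rewrite F1 F2; move: E; rewrite e1 e2 E1 E2; lra.
Qed.

End PeriodicReal.

(** * The one-dimensional Sobolev inequality *)

Section PeriodicReal.
Context {R : realType}.
Local Notation mu := (@lebesgue_measure R).
Local Notation mu2 := (mu \x mu)%E.
Local Notation RR := (measurableTypeR R * measurableTypeR R)%type.
Local Notation I1 A := (\1_(A%classic : set R) : R -> R).
Local Notation TT := (`[0%R, (2 * pi)%R]%classic : set R).
Implicit Types (a b x y s : R) (h k P Q : R -> R).

Lemma TT_length : fine (mu TT) = 2 * pi.
Proof.
have E : mu TT = (2 * pi)%:E.
  rewrite lebesgue_measure_itv/= lte_fin twopi_gt0 -EFinB; congr EFin; ring.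
by rewrite (_ : fine _ = fine (2 * pi)%:E)//; congr fine.
Qed.

Lemma Rint_TT_cst (c : R) : \int[mu]_(x in TT) c = c * (2 * pi).
Proof. by rewrite Rintegral_cst//; congr (_ * _); exact: TT_length. Qed.

(** Cauchy-Schwarz in the form [|h| <= h ^+ 2 / (2 s) + s / 2], which avoids
    square roots. *)
Lemma Rint_TT_abs h s : L2T h -> 0 < s -> \int[mu]_(x in TT) (h x ^+ 2) <= s ^+ 2 ->
  mu.-integrable TT (EFin \o (fun x => `|h x|)) /\
  \int[mu]_(x in TT) `|h x| <= (1 + 2 * pi) / 2 * s.
Proof.
move=> Hh s0 hs; have hi := L2T_int Hh.
have ai : mu.-integrable TT (EFin \o (fun x => `|h x|)) by have := integrable_norm hi.
split => //.
have gi : mu.-integrable TT (EFin \o (fun x => (2 * s)^-1 * h x ^+ 2 + s / 2)).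
  apply: intgD_on => //; last exact: intg_cst_itv.
  by apply: intgZ_on => //; exact: Hh.2.
apply: (@le_trans _ _ (\int[mu]_(x in TT) ((2 * s)^-1 * h x ^+ 2 + s / 2))).
  apply: le_Rintegral => // x _.
  rewrite -subr_ge0; have -> : (2 * s)^-1 * h x ^+ 2 + s / 2 - `|h x| = (2 * s)^-1 * (`|h x| - s) ^+ 2.
    have -> : h x ^+ 2 = `|h x| ^+ 2 by rewrite real_normK// num_real.
    by field; rewrite gt_eqF.
  by rewrite mulr_ge0 ?sqr_ge0// invr_ge0 mulr_ge0// ltW.
rewrite RintegralD//; last 2 first.
- by apply: intgZ_on => //; exact: Hh.2.
- exact: intg_cst_itv.
have -> : \int[mu]_(x in TT) ((2 * s)^-1 * h x ^+ 2) = (2 * s)^-1 * \int[mu]_(x in TT) (h x ^+ 2).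
  by apply: RintegralZl => //; exact: Hh.2.
rewrite Rint_TT_cst.
have : (2 * s)^-1 * \int[mu]_(x in TT) h x ^+ 2 <= (2 * s)^-1 * s ^+ 2.
  by apply: ler_wpM2l => //; rewrite invr_ge0 mulr_ge0// ltW.
have -> : (2 * s)^-1 * s ^+ 2 = s / 2 by field; rewrite gt_eqF.
have -> : (1 + 2 * pi) / 2 * s = s / 2 + s / 2 * (2 * pi) by field.
lra.
Qed.

Definition sobolev_cst : R := (1 + 2 * pi) ^+ 2 / (2 * (2 * pi)).

Lemma sobolev_cst_ge0 : 0 <= sobolev_cst.
Proof. by rewrite divr_ge0 ?sqr_ge0// !mulr_ge0// pi_ge0. Qed.

(** The oscillation of [P] is at most the integral of [|h|], and [|P x|] is at
    most the mean of [|P|] plus the oscillation. *)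
Lemma sobolev_sup P h s : 0 < s -> loc_int h -> primitive P h -> L2T h -> L2T P ->
  \int[mu]_(x in TT) (P x ^+ 2) <= s ^+ 2 -> \int[mu]_(x in TT) (h x ^+ 2) <= s ^+ 2 ->
  forall x, TT x -> `|P x| <= sobolev_cst * s.
Proof.
move=> s0 hi Ph h2 P2 hP hh x Tx.
have [hai hab] := Rint_TT_abs h2 s0 hh; have [Pai Pab] := Rint_TT_abs P2 s0 hP.
have p0 : 0 < 2 * pi :> R by exact: twopi_gt0.
have le a b : 0 <= a -> a <= b -> b <= 2 * pi -> `|P b - P a| <= (1 + 2 * pi) / 2 * s.
  move=> a0 ab b2; rewrite Ph// (le_trans (le_normr_Rintegral _ (hi a b)))//.
  have sub : `[a, b]%classic `<=` TT by apply: subset_itv; rewrite bnd_simp.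
  apply: le_trans hab; rewrite (Rint_indic mu (fun x => `|h x|) (measurable_itv `[a, b])) (Rint_indic mu (fun x => `|h x|) (measurable_itv `[0, 2 * pi])).
  apply: ler_Rint.
  - apply: (intg_indic mu (fun x => `|h x|) (measurable_itv `[a, b])).1.
    by apply: integrableS hai.
  - exact: (intg_indic mu (fun x => `|h x|) (measurable_itv `[0, 2 * pi])).1.
  move=> y; rewrite ler_wpM2l// !indicE ler_nat; case: (boolP (y \in `[a, b]%classic)) => // /set_mem yab.
  by rewrite mem_set//; exact: sub.
have key y : TT y -> `|P x| <= `|P y| + (1 + 2 * pi) / 2 * s.
  move: Tx; rewrite /= !in_itv/= => /andP[x0 x1] /andP[y0 y1].
  have [xy|yx] := leP x y.
    by have := le x y x0 xy y1; have := ler_normB (P y) (P y - P x); rewrite opprB addrC subrK; lra.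
  by have := le y x y0 (ltW yx) x1; have := ler_normD (P x - P y) (P y); rewrite subrK; lra.
have : `|P x| * (2 * pi) <= \int[mu]_(y in TT) (`|P y| + (1 + 2 * pi) / 2 * s).
  rewrite -Rint_TT_cst; apply: le_Rintegral => //; first exact: intg_cst_itv.
  by apply: intgD_on => //; exact: intg_cst_itv.
rewrite RintegralD//; last exact: intg_cst_itv.
rewrite Rint_TT_cst -ler_pdivlMr// => /le_trans; apply.
rewrite ler_pdivrMr//.
have -> : sobolev_cst * s * (2 * pi) = (1 + 2 * pi) / 2 * s + (1 + 2 * pi) / 2 * s * (2 * pi).
  rewrite /sobolev_cst; have : 2 * pi != 0 :> R by rewrite gt_eqF.
  by move: (2 * pi) => p p1; field.
lra.
Qed.

Lemma per_natmul (T : Type) (f : R -> T) : (forall x, f (x + 2 * pi) = f x) ->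
  forall n x, f (x + (2 * pi) *+ n) = f x.
Proof.
move=> fp; elim=> [|n IH] x; first by rewrite mulr0n addr0.
by rewrite [_ *+ n.+1]mulrSr addrA fp IH.
Qed.

(** The representative of [x] in one period, chosen once for all periodic
    functions. *)
Lemma per_reduce x : exists2 y, TT y & forall (T : Type) (f : R -> T),
  (forall x, f (x + 2 * pi) = f x) -> f x = f y.
Proof.
have p0 : 0 < 2 * pi :> R by exact: twopi_gt0.
pose z := x + (2 * pi) *+ (Num.bound (`|x| / (2 * pi))).
have z0 : 0 <= z.
  have := archi_boundP (divr_ge0 (normr_ge0 x) (ltW p0)).
  rewrite ltr_pdivrMr// [_%:R * (2 * pi)]mulr_natl => h; rewrite /z.
  by have := ler_norm (- x); rewrite normrN; lra.
pose n := Num.truncn (z / (2 * pi)).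
have /andP[n1 n2] : n%:R <= z / (2 * pi) < n.+1%:R.
  by apply: truncn_itv; rewrite divr_ge0// ltW.
exists (z - (2 * pi) *+ n).
  rewrite /= in_itv/=; move: n1 n2; rewrite ler_pdivlMr// ltr_pdivrMr// ![_%:R * (2 * pi)]mulr_natl.
  by rewrite [_ *+ n.+1]mulrSr => h1 h2; apply/andP; split; lra.
move=> T f fp; rewrite -[in RHS](per_natmul fp n) subrK.
by rewrite /z per_natmul.
Qed.
End PeriodicReal.

(** * Weak derivatives of complex periodic functions *)

Section ComplexReal.
Context {R : realType}.
Local Notation C := R[i].
Local Notation mu := (@lebesgue_measure R).
Local Notation I1 A := (\1_(A%classic : set R) : R -> R).
Local Notation TT := (`[0%R, (2 * pi)%R]%classic : set R).
Local Notation re := (fun (f : R -> C) (x : R) => complex.Re (f x)).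
Local Notation im := (fun (f : R -> C) (x : R) => complex.Im (f x)).
Implicit Types (a b c x y s : R) (h k P Q : R -> R) (f g : R -> C).

Lemma ReD (z w : C) : complex.Re (z + w) = complex.Re z + complex.Re w.
Proof. by case: z w => a b [c d]. Qed.
Lemma ImD (z w : C) : complex.Im (z + w) = complex.Im z + complex.Im w.
Proof. by case: z w => a b [c d]. Qed.
Lemma ReN (z : C) : complex.Re (- z) = - complex.Re z.
Proof. by case: z. Qed.
Lemma ImN (z : C) : complex.Im (- z) = - complex.Im z.
Proof. by case: z. Qed.
Lemma ReM (z w : C) : complex.Re (z * w) = complex.Re z * complex.Re w - complex.Im z * complex.Im w.
Proof. by case: z w => a b [c d]. Qed.
Lemma ImM (z w : C) : complex.Im (z * w) = complex.Re z * complex.Im w + complex.Im z * complex.Re w.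
Proof. by case: z w => a b [c d]. Qed.
Lemma Re_real a : complex.Re (a%:C)%C = a. Proof. by []. Qed.
Lemma Im_real a : complex.Im (a%:C)%C = 0. Proof. by []. Qed.
Lemma Re_imc : complex.Re (imc : C) = 0. Proof. by []. Qed.
Lemma Im_imc : complex.Im (imc : C) = 1. Proof. by []. Qed.
Lemma complexP (z w : C) : complex.Re z = complex.Re w -> complex.Im z = complex.Im w -> z = w.
Proof. by case: z w => a b [c d] /= -> ->. Qed.

Definition ReImE := (ReD, ImD, ReN, ImN, ReM, ImM, Re_real, Im_real, Re_imc, Im_imc).

Lemma ae1and (S T : R -> Prop) : {ae mu, forall x, S x} -> {ae mu, forall x, T x} -> {ae mu, forall x, S x /\ T x}.
Proof. exact: ae1S2. Qed.

Lemma ae_shift (S : R -> Prop) c : {ae mu, forall x, S x} -> {ae mu, forall x, S (x + c)}.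
Proof.
move=> [N [mN N0 sN]]; exists ((fun x => 1 * x + c) @^-1` N); split.
- rewrite -[X in measurable X]setTI; exact: (measurable_affine 1 c).
- have := @lebesgue_measure_affine_preimage R 1 c N.
  by rewrite oner_neq0 => -> //; rewrite N0 mule0.
- by move=> x /= nS; apply: sN; rewrite /= mul1r.
Qed.

Lemma L2per_real g : L2per g -> [/\ L2T (re g), L2T (im g), loc_int (re g) & loc_int (im g)].
Proof.
move=> [gp mr mi gi].
have H (q : C -> R) : measurable_fun setT (fun x => q (g x)) -> (forall z, q z ^+ 2 <= sqmod z) -> L2T (fun x => q (g x)).
  move=> mq qs; split => //; apply: (intg_on _ _ (g := fun x => sqmod (g x))) => //.
    rewrite (_ : (fun x => _) = fun x => q (g x) * q (g x)); last by apply/funext => ?; ring.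
    exact: measurable_funM.
  by move=> x _; rewrite ger0_norm ?sqr_ge0.
have Hr : L2T (re g) by apply: H => // z; rewrite /sqmod lerDl sqr_ge0.
have Hi : L2T (im g) by apply: H => // z; rewrite /sqmod lerDr sqr_ge0.
split => //; apply: per_loc_int => //; try (by move=> x; rewrite gp); exact: L2T_int.
Qed.

Lemma L2per_sq g : L2per g -> L2norm2 g = \int[mu]_(x in TT) (complex.Re (g x) ^+ 2) + \int[mu]_(x in TT) (complex.Im (g x) ^+ 2).
Proof.
move=> /L2per_real[Hr Hi _ _]; rewrite -RintegralD//; first exact: Hr.2.
exact: Hi.2.
Qed.

Lemma wderiv_real f g : wderiv f g -> exists P Q,
  [/\ {ae mu, forall x, complex.Re (f x) = P x}, {ae mu, forall x, complex.Im (f x) = Q x},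
      primitive P (re g) & primitive Q (im g)].
Proof.
move=> [F [fF HF]]; exists (re F), (im F); split.
- by apply: ae1S fF => x ->.
- by apply: ae1S fF => x ->.
- by move=> a b ab; have := congr1 (@complex.Re R) (HF a b ab); rewrite ReD ReN.
- by move=> a b ab; have := congr1 (@complex.Im R) (HF a b ab); rewrite ImD ImN.
Qed.

Lemma real_wderiv f g P Q : {ae mu, forall x, complex.Re (f x) = P x} -> {ae mu, forall x, complex.Im (f x) = Q x} ->
  primitive P (re g) -> primitive Q (im g) -> wderiv f g.
Proof.
move=> fP fQ Pg Qg; exists (fun x => (P x +i* Q x)%C); split.
  by apply: ae1S2 fP fQ => x h1 h2; apply: complexP.
by move=> a b ab; apply: complexP; rewrite !ReImE/=; [exact: Pg|exact: Qg].
Qed.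

(** The primitives are continuous and agree almost everywhere, hence
    everywhere; their densities then agree almost everywhere. *)
Lemma wderiv_unique f f' g g' : L2per g -> L2per g' -> {ae mu, forall x, f x = f' x} ->
  wderiv f g -> wderiv f' g' -> {ae mu, forall x, g x = g' x}.
Proof.
move=> /L2per_real[_ _ gr gi] /L2per_real[_ _ gr' gi'] ff' /wderiv_real[P [Q [fP fQ Pg Qg]]]
  /wderiv_real[P' [Q' [fP' fQ' Pg' Qg']]].
have EP : P = P'.
  apply: cont_ae_eq; [exact: primitive_cont Pg|exact: primitive_cont Pg'|].
  by apply: ae1S2 (ae1and fP fP') ff' => x [<- <-] ->.
have EQ : Q = Q'.
  apply: cont_ae_eq; [exact: primitive_cont Qg|exact: primitive_cont Qg'|].
  by apply: ae1S2 (ae1and fQ fQ') ff' => x [<- <-] ->.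
have h1 := primitive_unique gr gr' Pg ltac:(by rewrite EP).
have h2 := primitive_unique gi gi' Qg ltac:(by rewrite EQ).
by apply: ae1S2 h1 h2 => x; exact: complexP.
Qed.

(** The chosen derivative [Dx f] is one among the functions equal almost
    everywhere to any given weak derivative. *)
Lemma Dx_unique f g : L2per g -> wderiv f g -> L2per (Dx f) /\ {ae mu, forall x, Dx f x = g x}.
Proof.
move=> Lg fg.
have [L1 W1] : L2per (Dx f) /\ wderiv f (Dx f).
  exact: (xgetPex (fun=> 0) (P := [set g | L2per g /\ wderiv f g]) (ex_intro _ g (conj Lg fg))).
split => //; apply: wderiv_unique W1 fg => //.
by apply/aeW.
Qed.

Lemma primitiveD P Q h k c : loc_int h -> loc_int k -> primitive P h -> primitive Q k ->
  primitive (fun x => P x + c * Q x) (fun x => h x + c * k x).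
Proof.
move=> hi ki Ph Qk a b ab; rewrite RintegralD//; last by apply: intgZ_on => //; exact: ki.
have -> : \int[mu]_(x in `[a, b]) (c * k x) = c * \int[mu]_(x in `[a, b]) k x.
  by apply: RintegralZl => //; exact: ki.
by rewrite -Ph// -Qk//; ring.
Qed.

Lemma loc_intD h k c : loc_int h -> loc_int k -> loc_int (fun x => h x + c * k x).
Proof. by move=> hi ki a b; apply: intgD_on => //; apply: intgZ_on => //; exact: ki. Qed.

Lemma loc_int_cont h : continuous h -> loc_int h.
Proof.
move=> ch a b; apply: continuous_compact_integrable; first exact: segment_compact.
exact: continuous_subspaceT.
Qed.

(** The eigenvalue equation for [p + i q], separated into real and imaginary
    parts: [p] and [q] are C^1 with derivatives [h] and [k], and these are
    absolutely continuous with densities [h2] and [k2]. *)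
Definition bloch_real (rho : R -> R) l (lam : R) p q := exists h k h2 k2,
  [/\ [/\ continuous h, continuous k, primitive p h & primitive q k],
      [/\ loc_int h2, loc_int k2, primitive h h2 & primitive k k2], 
      [/\ periodic2pi p, periodic2pi q, periodic2pi h & periodic2pi k],
      {ae mu, forall x, - (h2 x - l * k x) + l * (k x + l * p x) + rho x * p x = lam * p x} &
      {ae mu, forall x, - (k2 x + l * h x) - l * (h x - l * q x) + rho x * q x = lam * q x}].

Lemma cont_per P (g : R -> R) : continuous P -> periodic2pi g -> {ae mu, forall x, g x = P x} -> periodic2pi P.
Proof.
move=> cP gp gP x; have := gP => /(ae_shift (2 * pi)) gP'.
suff : (fun x => P (x + 2 * pi)) = P by move=> E; rewrite -[in RHS]E.
apply: cont_ae_eq => //.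
  move=> y; apply: (continuous_comp (f := fun y => y + 2 * pi)); last exact: cP.
  by apply: cvgD => //; exact: cvg_cst.
by apply: ae1S2 gP gP' => y <- <-; rewrite gp.
Qed.

Lemma L2per_lin g1 g2 (w : C) : L2per g1 -> L2per g2 -> L2per (fun x => g1 x + w * g2 x).
Proof.
move=> H1 H2; have [r1 i1 _ _] := L2per_real H1; have [r2 i2 _ _] := L2per_real H2.
have Er x : complex.Re (g1 x + w * g2 x) =
    complex.Re (g1 x) + complex.Re w * complex.Re (g2 x) + (- complex.Im w) * complex.Im (g2 x).
  by rewrite !ReImE; ring.
have Ei x : complex.Im (g1 x + w * g2 x) =
    complex.Im (g1 x) + complex.Re w * complex.Im (g2 x) + complex.Im w * complex.Re (g2 x).
  by rewrite !ReImE; ring.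
have R1 := L2TD (L2TD r1 (L2TZ (complex.Re w) r2)) (L2TZ (- complex.Im w) i2).
have I1 := L2TD (L2TD i1 (L2TZ (complex.Re w) i2)) (L2TZ (complex.Im w) r2).
split.
- by move=> x; case: H1 H2 => -> _ _ _ [-> _ _ _].
- by under eq_fun do rewrite Er; exact: R1.1.
- by under eq_fun do rewrite Ei; exact: I1.1.
- rewrite (_ : (fun x => sqmod _) = fun x =>
      (complex.Re (g1 x) + complex.Re w * complex.Re (g2 x) + (- complex.Im w) * complex.Im (g2 x)) ^+ 2
      + (complex.Im (g1 x) + complex.Re w * complex.Im (g2 x) + complex.Im w * complex.Re (g2 x)) ^+ 2).
    by apply: intgD_on => //; [exact: R1.2|exact: I1.2].
  by apply/funext => x; rewrite /sqmod Er Ei.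
Qed.

(** A continuous representative coincides with its primitive everywhere, so the
    weak derivatives can be replaced step by step by classical ones. *)
Lemma bloch_eigen_real rho l (lam : R) f : Hper 2 f -> continuous (re f) -> continuous (im f) ->
  {ae mu, forall x, - Dxl l (Dxl l f) x + (rho x)%:C%C * f x = lam%:C%C * f x} ->
  bloch_real rho l lam (re f) (im f).
Proof.
move=> [Lf [g fg [Lg [g2 gg2 [Lg2 _]]]]] cr ci ode.
have [gR gI gRl gIl] := L2per_real Lg; have [g2R g2I g2Rl g2Il] := L2per_real Lg2.
have [P [Q [fP fQ Pg Qg]]] := wderiv_real fg.
have EP : re f = P by apply: cont_ae_eq => //; exact: primitive_cont Pg.
have EQ : im f = Q by apply: cont_ae_eq => //; exact: primitive_cont Qg.
have [h [k [gh gk hg kg]]] := wderiv_real gg2.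
have ch : continuous h by exact: primitive_cont hg.
have ck : continuous k by exact: primitive_cont kg.
have [LD fD] := Dx_unique Lg fg.
have gp : periodic2pi g by case: Lg.
have fp : periodic2pi f by case: Lf.
pose G := fun x => g2 x + imc * (l%:C)%C * g x.
have LG : L2per G by exact: L2per_lin.
have phiG : wderiv (Dxl l f) G.
  apply: (real_wderiv (P := fun x => h x + (- l) * complex.Im (f x)) (Q := fun x => k x + l * complex.Re (f x))).
  - apply: ae1S2 fD gh => x fDx ghx; rewrite /Dxl !ReImE fDx ghx; ring.
  - apply: ae1S2 fD gk => x fDx gkx; rewrite /Dxl !ReImE fDx gkx; ring.
  - rewrite (_ : re G = fun x => complex.Re (g2 x) + (- l) * complex.Im (g x)); last first.
      by apply/funext => x; rewrite /G !ReImE; ring.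
    by apply: primitiveD => //; move=> a b ab; rewrite -Qg// -EQ.
  - rewrite (_ : im G = fun x => complex.Im (g2 x) + l * complex.Re (g x)); last first.
      by apply/funext => x; rewrite /G !ReImE; ring.
    by apply: primitiveD => //; move=> a b ab; rewrite -Pg// -EP.
have [_ phiD] := Dx_unique LG phiG.
have cint_ae a b : forall u v : R -> R, {ae mu, forall x, u x = v x} -> loc_int u -> loc_int v ->
   \int[mu]_(x in `[a, b]) u x = \int[mu]_(x in `[a, b]) v x.
  move=> u v uv ui vi.
  rewrite (Rint_indic mu u (measurable_itv `[a, b])) (Rint_indic mu v (measurable_itv `[a, b])).
  apply: eq_Rint_ae.
  - exact: (intg_measurable ((intg_indic mu u (measurable_itv `[a, b])).1 (ui a b))).
  - exact: (intg_measurable ((intg_indic mu v (measurable_itv `[a, b])).1 (vi a b))).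
  - by apply: ae1S uv => x ->.
have hl := loc_int_cont ch; have kl := loc_int_cont ck.
exists h, k, (re g2), (im g2); split.
- split=> // a b ab.
  + have -> : complex.Re (f b) = P b by rewrite -EP.
    have -> : complex.Re (f a) = P a by rewrite -EP.
    by rewrite Pg//; exact: cint_ae.
  + have -> : complex.Im (f b) = Q b by rewrite -EQ.
    have -> : complex.Im (f a) = Q a by rewrite -EQ.
    by rewrite Qg//; exact: cint_ae.
- by [].
- split.
  + by move=> x /=; rewrite fp.
  + by move=> x /=; rewrite fp.
  + by apply: (cont_per (g := re g)) => // x /=; rewrite gp.
  + by apply: (cont_per (g := im g)) => // x /=; rewrite gp.
- apply: ae1S2 (ae1and ode phiD) (ae1and fD (ae1and gh gk)).
  move=> x [od ph] [fdx [ghx gkx]].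
  have E : Dxl l (Dxl l f) x = G x + imc * (l%:C)%C * (g x + imc * (l%:C)%C * f x).
    by rewrite {1}/Dxl ph /Dxl fdx.
  have := congr1 (@complex.Re R) od; rewrite E /G -?ghx -?gkx.
  case: (f x) => f1 f2; case: (g x) => g1 g3; case: (g2 x) => g4 g5 /=; lra.
- apply: ae1S2 (ae1and ode phiD) (ae1and fD (ae1and gh gk)).
  move=> x [od ph] [fdx [ghx gkx]].
  have E : Dxl l (Dxl l f) x = G x + imc * (l%:C)%C * (g x + imc * (l%:C)%C * f x).
    by rewrite {1}/Dxl ph /Dxl fdx.
  have := congr1 (@complex.Im R) od; rewrite E /G -?ghx -?gkx.
  case: (f x) => f1 f2; case: (g x) => g1 g3; case: (g2 x) => g4 g5 /=; lra.
Qed.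

Lemma Hper1_lin f1 f2 c : Hper 1 f1 -> Hper 1 f2 -> Hper 1 (fun x => f1 x + (c%:C)%C * f2 x).
Proof.
move=> [L1 [g1 fg1 [Lg1 _]]] [L2 [g2 fg2 [Lg2 _]]]; split; first exact: L2per_lin.
exists (fun x => g1 x + (c%:C)%C * g2 x); last by split; first exact: L2per_lin.
have [P1 [Q1 [a1 b1 p1 q1]]] := wderiv_real fg1; have [P2 [Q2 [a2 b2 p2 q2]]] := wderiv_real fg2.
have [_ _ l1 m1] := L2per_real Lg1; have [_ _ l2 m2] := L2per_real Lg2.
apply: (real_wderiv (P := fun x => P1 x + c * P2 x) (Q := fun x => Q1 x + c * Q2 x)).
- by apply: ae1S2 a1 a2 => x h1 h2; rewrite !ReImE h1 h2; ring.
- by apply: ae1S2 b1 b2 => x h1 h2; rewrite !ReImE h1 h2; ring.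
- rewrite (_ : re _ = fun x => complex.Re (g1 x) + c * complex.Re (g2 x)); first exact: primitiveD.
  by apply/funext => x; rewrite !ReImE; ring.
- rewrite (_ : im _ = fun x => complex.Im (g1 x) + c * complex.Im (g2 x)); first exact: primitiveD.
  by apply/funext => x; rewrite !ReImE; ring.
Qed.

(** The Sobolev inequality for a representative that is determined only almost
    everywhere. *)
Lemma Hper1_sup f s : 0 < s -> Hper 1 f -> Hnorm2 1 f <= s ^+ 2 ->
  {ae mu, forall x, `|complex.Re (f x)| <= sobolev_cst * s /\ `|complex.Im (f x)| <= sobolev_cst * s}.
Proof.
move=> s0 [Lf [g fg [Lg _]]].
rewrite /Hnorm2 big_ord_recl big_ord1 /= => hs.
have [LD fD] := Dx_unique Lg fg.
have wD : wderiv f (Dx f).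
  exact: (xgetPex (fun=> 0) (P := [set g | L2per g /\ wderiv f g]) (ex_intro _ g (conj Lg fg))).2.
have [P [Q [fP fQ Pg Qg]]] := wderiv_real wD.
have [r1 i1 _ _] := L2per_real Lf; have [r2 i2 l2 m2] := L2per_real LD.
have cP := primitive_cont l2 Pg; have cQ := primitive_cont m2 Qg.
have fp : periodic2pi f by case: Lf.
have Pp : periodic2pi P by apply: (cont_per cP (g := re f)) => // x; rewrite fp.
have Qp : periodic2pi Q by apply: (cont_per cQ (g := im f)) => // x; rewrite fp.
have sqI u v : L2T u -> L2T v -> {ae mu, forall x, u x = v x} ->
    \int[mu]_(x in TT) (u x ^+ 2) = \int[mu]_(x in TT) (v x ^+ 2).
  move=> [mu_ ui] [mv vi] uv.
  rewrite (Rint_indic mu (fun x => u x ^+ 2) (measurable_itv _)) (Rint_indic mu (fun x => v x ^+ 2) (measurable_itv _)).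
  apply: eq_Rint_ae.
  - exact: (intg_measurable ((intg_indic mu (fun x => u x ^+ 2) (measurable_itv `[0, 2 * pi])).1 ui)).
  - exact: (intg_measurable ((intg_indic mu (fun x => v x ^+ 2) (measurable_itv `[0, 2 * pi])).1 vi)).
  - by apply: ae1S uv => x ->.
move: hs; rewrite (L2per_sq Lf) (L2per_sq LD) (sqI _ _ r1 (L2T_cont cP) fP) (sqI _ _ i1 (L2T_cont cQ) fQ).
have ge (u : R -> R) : 0 <= \int[mu]_(x in TT) (u x ^+ 2) by apply: Rintegral_ge0 => x _; exact: sqr_ge0.
have h1 := ge P; have h2 := ge Q; have h3 := ge (re (Dx f)); have h4 := ge (im (Dx f)) => hs.
have bP x : `|P x| <= sobolev_cst * s.
  have [y Ty ->] := per_reduce x; last exact: Pp.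
  by apply: (sobolev_sup s0 l2 Pg r2 (L2T_cont cP)) => //; move: h1 h2 h3 h4 hs; clear; lra.
have bQ x : `|Q x| <= sobolev_cst * s.
  have [y Ty ->] := per_reduce x; last exact: Qp.
  by apply: (sobolev_sup s0 m2 Qg i2 (L2T_cont cQ)) => //; move: h1 h2 h3 h4 hs; clear; lra.
by apply: ae1S2 fP fQ => x -> ->.
Qed.
End ComplexReal.

(** * Min-max comparison for abstract quadratic forms *)

Section AbstractForms.
Context {R : realType} (V : Type) (H : V -> Prop) (zero : V) (add : V -> R -> V -> V).
Hypothesis H0 : H zero.
Hypothesis Hadd : forall F c G, H F -> H G -> H (add F c G).

(** Forms are symmetric, linear and nonnegative only on the subset [H] of
    admissible vectors; linearity is stated for the single operation [F + c G],
    from which all finite combinations are built. *)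
Definition form_on (Q : V -> V -> R) := [/\ forall F G, Q F G = Q G F,
  forall F c G K, H F -> H G -> H K -> Q (add F c G) K = Q F K + c * Q G K,
  forall K, Q zero K = 0 & forall F, H F -> 0 <= Q F F].

Fixpoint combo (F : V) (c : nat -> R) (e : nat -> V) n :=
  if n is m.+1 then add (combo F c e m) (c m) (e m) else F.

Lemma combo_in F c e n : H F -> (forall j, H (e j)) -> H (combo F c e n).
Proof. by move=> HF He; elim: n => //= n IH; exact: Hadd. Qed.

Lemma form_combo Q F c e n K : form_on Q -> H F -> (forall j, H (e j)) -> H K ->
  Q (combo F c e n) K = Q F K + \sum_(j < n) c j * Q (e j) K.
Proof.
move=> [_ lin _ _] HF He HK; elim: n => [|n IH] /=; first by rewrite big_ord0 addr0.
by rewrite lin//; [rewrite IH big_ord_recr/= addrA|exact: combo_in].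
Qed.

(** The eigenvalue equation in weak form: [B (e j) G = lam j N (e j) G] for all
    admissible [G]. *)
Definition eigen_system (N B : V -> V -> R) (e : nat -> V) (lam : nat -> R) :=
  [/\ forall j, H (e j), forall i j, N (e i) (e j) = (i == j)%:R,
      forall j G, H G -> B (e j) G = lam j * N (e j) G,
      forall j, 0 <= lam j & forall i j, (i <= j)%N -> lam i <= lam j].

Definition residual (N : V -> V -> R) (e : nat -> V) F n := combo F (fun j => - N F (e j)) e n.

(** Completeness in the only form that is used: a sequence of vectors
    eventually orthogonal to each eigenvector and Cauchy in energy has members
    of arbitrarily small mass. *)
Definition form_complete (N B : V -> V -> R) (e : nat -> V) := forall r : nat -> V,
  (forall n, H (r n)) -> (forall j n, (j < n)%N -> N (r n) (e j) = 0) ->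
  (forall d, 0 < d -> exists K, forall n m, (K <= n)%N -> (n <= m)%N ->
     B (add (r m) (-1) (r n)) (add (r m) (-1) (r n)) <= d) ->
  forall d, 0 < d -> exists K, N (r K) (r K) <= d.

Section Residual.
Variables (N B : V -> V -> R) (e : nat -> V) (lam : nat -> R) (F : V).
Hypotheses (NQ : form_on N) (BQ : form_on B) (E : eigen_system N B e lam) (HF : H F).
Local Notation r := (residual N e F).
Local Notation c := (fun j => N F (e j)).

Lemma residual_in n : H (r n).
Proof. by case: E => He _ _ _ _; exact: combo_in. Qed.

Lemma residualS n : r n.+1 = add (r n) (- c n) (e n).
Proof. by []. Qed.

Lemma residual_coef n j : N (r n) (e j) = if (j < n)%N then 0 else c j.
Proof.
case: E => He ON _ _ _; rewrite form_combo//.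
have [jn|nj] := ltnP j n.
  rewrite (bigD1 (Ordinal jn))//= ON eqxx mulr1 big1 ?addr0 ?subrr// => i ij.
  by rewrite ON (_ : (i == j :> nat) = false) ?mulr0//; apply: contraNF ij => /eqP ij; apply/eqP/val_inj.
rewrite big1 ?addr0// => i _; rewrite ON (_ : (i == j :> nat) = false) ?mulr0//.
by apply: contraTF (ltn_ord i) => /eqP ->; rewrite -leqNgt.
Qed.

Lemma residual_form n j : B (r n) (e j) = if (j < n)%N then 0 else lam j * c j.
Proof.
case: E => He ON W _ _; case: BQ => sB _ _ _; case: (NQ) => sN _ _ _.
rewrite sB W; last exact: residual_in.
by rewrite sN residual_coef; case: ifP => // _; rewrite mulr0.
Qed.

Lemma form_sq Q G a K : form_on Q -> H G -> H K ->
  Q (add G a K) (add G a K) = Q G G + 2 * a * Q G K + a ^+ 2 * Q K K.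
Proof.
move=> [sQ lin _ _] HG HK; have HGK : H (add G a K) by exact: Hadd.
by rewrite lin// ![Q _ (add _ _ _)]sQ !lin// [Q K G]sQ; ring.
Qed.

Lemma residual_N n : N (r n) (r n) = N F F - \sum_(j < n) c j ^+ 2.
Proof.
case: (E) => He ON W _ _; elim: n => [|n IH]; first by rewrite big_ord0 subr0.
rewrite residualS form_sq//; last exact: residual_in.
by rewrite residual_coef ltnn IH ON eqxx big_ord_recr/=; ring.
Qed.

Lemma residual_B n : B (r n) (r n) = B F F - \sum_(j < n) lam j * c j ^+ 2.
Proof.
case: (E) => He ON W _ _; elim: n => [|n IH]; first by rewrite big_ord0 subr0.
rewrite residualS form_sq//; last exact: residual_in.
by rewrite residual_form ltnn IH W// ON eqxx big_ord_recr/=; ring.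
Qed.

Lemma residual_BB n m : (n <= m)%N -> B (r m) (r n) = B (r m) (r m).
Proof.
case: (E) => He ON W _ _ nm; case: (BQ) => sB lin _ _.
have H1 k : (k < m)%N -> B (r m) (r k.+1) = B (r m) (r k).
  move=> km; rewrite sB residualS lin//; try exact: residual_in.
  by rewrite ![B _ (r m)]sB residual_form km mulr0 addr0.
have H2 k : (k <= m)%N -> B (r m) (r k) = B (r m) F.
  by elim: k => // k IH km; rewrite H1// IH// ltnW.
by rewrite !H2.
Qed.

Lemma bessel n : \sum_(j < n) lam j * c j ^+ 2 <= B F F.
Proof.
by rewrite -subr_ge0 -residual_B; case: BQ => _ _ _; apply; exact: residual_in.
Qed.

(** The expansion of [F] starts at the [k]-th eigenvector, so its energy is at
    least [lam k] times its mass: Bessel's inequality for the energy form,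
    Parseval's identity for the mass form. Parseval holds because the residuals
    are Cauchy in energy. *)
Lemma energy_lower_bound k : form_complete N B e -> (forall j, (j < k)%N -> N F (e j) = 0) ->
  lam k * N F F <= B F F.
Proof.
case: (E) => He ON W lam0 lamm FC Fk.
have lk n : lam k * \sum_(j < n) c j ^+ 2 <= B F F.
  apply: le_trans (bessel n); rewrite mulr_sumr; apply: ler_sum => j _.
  have [jk|kj] := ltnP j k; first by rewrite Fk// expr0n !mulr0.
  by rewrite ler_wpM2r ?sqr_ge0// lamm.
have cau d : 0 < d -> exists K, forall n m, (K <= n)%N -> (n <= m)%N ->
     B (add (r m) (-1) (r n)) (add (r m) (-1) (r n)) <= d.
  move=> d0; pose s n := \sum_(j < n) lam j * c j ^+ 2.
  have s_nd : nondecreasing_seq s.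
    apply/nondecreasing_seqP => n; rewrite /s big_ord_recr/= lerDl.
    by rewrite mulr_ge0 ?sqr_ge0.
  have scv : cvgn s.
    apply: nondecreasing_is_cvgn => //; exists (B F F) => _ [n _ <-]; exact: bessel.
  have /cvgrPdist_le /(_ d d0) [K _ HK] := scv.
  exists K => n m Kn nm; rewrite form_sq//; try exact: residual_in.
  rewrite residual_BB// !residual_B -/(s m) -/(s n).
  have sm : s m <= limn s by apply: nondecreasing_cvgn_le.
  have := HK n Kn; rewrite ger0_norm ?subr_ge0; last by apply: nondecreasing_cvgn_le.
  by move=> h; lra.
apply/ler_addgt0Pr => d d0.
have d10 : 0 < d / (1 + lam k) by rewrite divr_gt0// ltr_pwDl.
have [K HK] := FC r residual_in (fun j n jn => ltac:(by rewrite residual_coef jn)) cau _ d10.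
rewrite residual_N in HK.
have {}HK := lerD HK (lexx (\sum_(j < K) c j ^+ 2)); rewrite subrK in HK.
apply: le_trans (ler_wpM2l (lam0 k) HK) _; rewrite mulrDr addrC lerD//.
rewrite mulrA ler_pdivrMr ?ltr_pwDl// mulrC ler_pM2l//.
by rewrite lerDr.
Qed.
End Residual.

Lemma span_upper_bound N B e lam a m : form_on N -> form_on B -> eigen_system N B e lam ->
  let F := combo zero a e m.+1 in
  [/\ H F, N F F = \sum_(j < m.+1) a j ^+ 2 & B F F <= lam m * N F F].
Proof.
move=> NQ BQ [He ON W lam0 lamm] F; have HF : H F by exact: combo_in.
have [sN _ zN _] := NQ; have [sB _ zB _] := BQ.
have NF j : (j < m.+1)%N -> N (e j) F = a j.
  move=> jm; rewrite sN form_combo// zN add0r (bigD1 (Ordinal jm))//= ON eqxx mulr1 big1 ?addr0//.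
  by move=> i ij; rewrite ON (_ : (i == j :> nat) = false) ?mulr0//; apply: contraNF ij => /eqP ij; apply/eqP/val_inj.
have NE : N F F = \sum_(j < m.+1) a j ^+ 2.
  rewrite {1}/F form_combo// zN add0r; apply: eq_bigr => j _.
  by rewrite NF ?ltn_ord// expr2.
have BE : B F F = \sum_(j < m.+1) lam j * a j ^+ 2.
  rewrite {1}/F form_combo// zB add0r; apply: eq_bigr => j _.
  by rewrite W// NF ?ltn_ord//; ring.
split => //; rewrite BE NE mulr_sumr; apply: ler_sum => j _.
by rewrite ler_wpM2r ?sqr_ge0// lamm// -ltnS.
Qed.

(** The span of the first [m + 1] eigenvectors of one form contains a nonzero
    vector orthogonal to the first [m] eigenvectors of the other. Its energy is
    at least [lam' m] times its mass for the second form, and at most [lam m]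
    times its mass for the first. *)
Lemma minmax_compare N B B' e e' lam lam' m A C : form_on N -> form_on B -> form_on B' ->
  eigen_system N B e lam -> eigen_system N B' e' lam' -> form_complete N B' e' ->
  (forall F, H F -> B' F F <= A * B F F + C * N F F) -> 0 <= A ->
  lam' m <= A * lam m + C.
Proof.
move=> NQ BQ BQ' E E' FC BB A0.
have [He' _ _ _ _] := E'; have [He _ _ _ _] := E.
pose M := \matrix_(i < m.+1, j < m) N (e i) (e' j).
have [v v0 vM] : exists2 v : 'rV[R]_m.+1, v != 0 & v *m M = 0.
  (* There is one more row than there are columns. *)
  have : kermx M != 0.
    rewrite kermx_eq0 /row_free; apply: contraTneq (rank_leq_col M) => ->.
    by rewrite -ltnNge.
  by case/rowV0Pn => v /sub_kermxP vM v0; exists v.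
pose a j := v 0 (inord j).
have aE (i : 'I_m.+1) : a i = v 0 i by rewrite /a inord_val.
have [HF NE BE] := span_upper_bound a m NQ BQ E.
set F := combo _ _ _ _ in HF NE BE.
have FP j : (j < m)%N -> N F (e' j) = 0.
  move=> jm; have := congr1 (fun w : 'rV_m => w 0 (Ordinal jm)) vM; rewrite !mxE => <-.
  rewrite form_combo//; case: (NQ) => _ _ -> _; rewrite add0r.
  by apply: eq_bigr => i _; rewrite aE !mxE.
have N0 : 0 < N F F.
  rewrite NE lt_def sumr_ge0 ?andbT; last by move=> i _; exact: sqr_ge0.
  apply: contra v0 => /eqP s0; apply/eqP/rowP => i; rewrite mxE -aE.
  have /psumr_eq0P : forall i : 'I_m.+1, true -> 0 <= a i ^+ 2 by move=> *; exact: sqr_ge0.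
  by move=> /(_ s0 i isT) /eqP; rewrite sqrf_eq0 => /eqP.
have lo := energy_lower_bound NQ BQ' E' HF FC FP.
rewrite -(ler_pM2r N0) (le_trans lo)// (le_trans (BB _ HF))// mulrDl lerD2r -mulrA.
exact: ler_wpM2l.
Qed.
End AbstractForms.

(** * The energy forms of the Bloch operators *)

Section BlochForms.
Context {R : realType}.
Local Notation C := R[i].
Local Notation mu := (@lebesgue_measure R).
Local Notation TT := (`[0%R, (2 * pi)%R]%classic : set R).
Implicit Types (a b c x y s : R) (h k P Q g : R -> R).

(** The real inner product of L2 over a period. Complex functions are treated
    as pairs of real ones, so that the forms are bilinear over the reals. *)
Definition TI g1 g2 := \int[mu]_(x in TT) (g1 x * g2 x).

Lemma TI_sym g1 g2 : TI g1 g2 = TI g2 g1.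
Proof. by apply: eq_Rintegral => x _; rewrite mulrC. Qed.

Lemma TI_lin c g1 g2 g3 : L2T g1 -> L2T g2 -> L2T g3 ->
  TI (fun x => g1 x + c * g2 x) g3 = TI g1 g3 + c * TI g2 g3.
Proof.
move=> H1 H2 H3; rewrite /TI.
have -> : c * \int[mu]_(x in TT) (g2 x * g3 x) = \int[mu]_(x in TT) (c * (g2 x * g3 x)).
  by rewrite RintegralZl//; exact: L2T_mul.
rewrite -RintegralD//; last 2 first.
- exact: L2T_mul.
- by apply: intgZ_on => //; exact: L2T_mul.
by apply: eq_Rintegral => x _; ring.
Qed.

Lemma TI_ge0 g : 0 <= TI g g.
Proof. by apply: Rintegral_ge0 => x _; rewrite -expr2 sqr_ge0. Qed.

Lemma TI0 g : TI (fun=> 0) g = 0.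
Proof. by rewrite /TI; under eq_Rintegral do rewrite mul0r; rewrite Rintegral_cst// mul0r. Qed.

Lemma TI_sq g : TI g g = \int[mu]_(x in TT) (g x ^+ 2).
Proof. by apply: eq_Rintegral => x _; rewrite expr2. Qed.

Lemma L2T0 : L2T (fun=> 0 : R).
Proof. by apply: L2T_cont => x; exact: cvg_cst. Qed.

Lemma L2T_lin g1 g2 c : L2T g1 -> L2T g2 -> L2T (fun x => g1 x + c * g2 x).
Proof. by move=> H1 H2; apply: L2TD => //; exact: L2TZ. Qed.

Lemma L2T_bmul (w g : R -> R) M : measurable_fun setT w -> (forall x, `|w x| <= M) -> L2T g -> L2T (fun x => w x * g x).
Proof.
move=> mw wM [mg gi]; split; first exact: measurable_funM.
apply: (intg_on _ _ (g := fun x => M ^+ 2 * g x ^+ 2)) => //.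
- rewrite (_ : (fun x => _) = fun x => (w x * g x) * (w x * g x)); last by apply/funext => ?; ring.
  by apply: measurable_funM; exact: measurable_funM.
- exact: intgZ_on.
move=> x _; rewrite ger0_norm ?sqr_ge0// exprMn ler_wpM2r ?sqr_ge0//.
by rewrite -[w x ^+ 2]real_normK ?num_real// ler_pXn2r ?nnegrE// (le_trans (normr_ge0 _) (wM x)).
Qed.

(** A vector of the form domain: a pair of periodic functions together with
    their derivatives, so that no derivative has to be chosen. *)
Definition st := ((R -> R) * (R -> R) * ((R -> R) * (R -> R)))%type.
Definition st_in (F : st) :=
  [/\ periodic2pi F.1.1 /\ periodic2pi F.1.2, L2T F.2.1 /\ L2T F.2.2,
      loc_int F.2.1 /\ loc_int F.2.2 & primitive F.1.1 F.2.1 /\ primitive F.1.2 F.2.2].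
Definition st0 : st := ((fun=> 0, fun=> 0), (fun=> 0, fun=> 0)).
Definition st_add (F : st) c (G : st) : st :=
  ((fun x => F.1.1 x + c * G.1.1 x, fun x => F.1.2 x + c * G.1.2 x),
   (fun x => F.2.1 x + c * G.2.1 x, fun x => F.2.2 x + c * G.2.2 x)).

Lemma st0_in : st_in st0.
Proof.
have Z : loc_int (fun=> 0 : R) by apply: loc_int_cont => x; exact: cvg_cst.
have PZ : primitive (fun=> 0) (fun=> 0 : R) by move=> a b _; rewrite subrr Rintegral_cst// mul0r.
by split; split => //=; exact: L2T0.
Qed.

Lemma st_add_in F c G : st_in F -> st_in G -> st_in (st_add F c G).
Proof.
move=> [[F1 F2] [F3 F4] [F5 F6] [F7 F8]] [[G1 G2] [G3 G4] [G5 G6] [G7 G8]].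
split; split => /=; try exact: L2T_lin; try exact: loc_intD; try exact: primitiveD.
  by move=> x; rewrite F1 G1.
by move=> x; rewrite F2 G2.
Qed.

Lemma st_cont F : st_in F -> continuous F.1.1 /\ continuous F.1.2.
Proof. by case=> _ _ [h1 h2] [h3 h4]; split; [exact: primitive_cont h3|exact: primitive_cont h4]. Qed.

Lemma st_L2 F : st_in F -> [/\ L2T F.1.1, L2T F.1.2, L2T F.2.1 & L2T F.2.2].
Proof. by move=> HF; have [c1 c2] := st_cont HF; case: HF => _ [h1 h2] _ _; split => //; exact: L2T_cont. Qed.

Definition mass (F G : st) := TI F.1.1 G.1.1 + TI F.1.2 G.1.2.
(** For [F = (p, q)] with derivatives [(h, k)], [dre] and [dim] are the real
    and imaginary parts of [(d/dx + i l) (p + i q)]. *)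
Definition dre l (F : st) x := F.2.1 x - l * F.1.2 x.
Definition dim l (F : st) x := F.2.2 x + l * F.1.1 x.
Definition energy (rho : R -> R) l F G :=
  TI (dre l F) (dre l G) + TI (dim l F) (dim l G)
  + (TI (fun x => rho x * F.1.1 x) G.1.1 + TI (fun x => rho x * F.1.2 x) G.1.2).

Lemma dre_L2 l F : st_in F -> L2T (dre l F).
Proof.
by move=> /st_L2[h1 h2 h3 h4]; rewrite (_ : dre l F = fun x => F.2.1 x + (- l) * F.1.2 x);
  [exact: L2T_lin|apply/funext => x; rewrite /dre mulNr].
Qed.
Lemma dim_L2 l F : st_in F -> L2T (dim l F).
Proof. by move=> /st_L2[h1 h2 h3 h4]; exact: L2T_lin. Qed.

Lemma mass_form : form_on st_in st0 st_add mass.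
Proof.
split.
- by move=> F G; rewrite /mass TI_sym [TI F.1.2 _]TI_sym.
- move=> F c G K /st_L2[? ? ? ?] /st_L2[? ? ? ?] /st_L2[? ? ? ?]; rewrite /mass /= !TI_lin//; ring.
- by move=> K; rewrite /mass /= !TI0 addr0.
- by move=> F _; rewrite /mass addr_ge0// TI_ge0.
Qed.

Section Energy.
Variables (rho : R -> R) (r0 M : R).
Hypotheses (mrho : measurable_fun setT rho) (r0pos : 0 < r0) (rho_ge : forall x, r0 <= rho x)
  (rho_le : forall x, rho x <= M).

Lemma rho_bound x : `|rho x| <= M.
Proof. by rewrite ger0_norm ?rho_le// (le_trans (ltW r0pos)). Qed.

Lemma rho_L2 g : L2T g -> L2T (fun x => rho x * g x).
Proof. by move=> gi; apply: (L2T_bmul mrho rho_bound). Qed.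

Lemma TI_rho_ge g : L2T g -> r0 * TI g g <= TI (fun x => rho x * g x) g.
Proof.
move=> gi; have -> : r0 * TI g g = \int[mu]_(x in TT) (r0 * (g x * g x)).
  by rewrite RintegralZl//; exact: L2T_mul.
apply: le_Rintegral => //.
- by apply: intgZ_on => //; exact: L2T_mul.
- by apply: L2T_mul => //; exact: rho_L2.
by move=> x _; rewrite -mulrA ler_wpM2r// -expr2 sqr_ge0.
Qed.

Lemma energy_ge_mass l F : st_in F -> r0 * mass F F <= energy rho l F F.
Proof.
move=> /st_L2[h1 h2 _ _]; have := TI_rho_ge h1; have := TI_rho_ge h2.
have := TI_ge0 (dre l F); have := TI_ge0 (dim l F).
rewrite /energy /mass; lra.
Qed.

Lemma energy_form l : form_on st_in st0 st_add (energy rho l).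
Proof.
have rs g1 g2 : TI (fun x => rho x * g1 x) g2 = TI (fun x => rho x * g2 x) g1.
  by apply: eq_Rintegral => x _; ring.
split.
- move=> F G; rewrite /energy TI_sym [TI (dim _ _) _]TI_sym; congr (_ + _); congr (_ + _); exact: rs.
- move=> F c G K HF HG HK.
  rewrite /energy.
  have -> : dre l (st_add F c G) = fun x => dre l F x + c * dre l G x by apply/funext => x; rewrite /dre/=; ring.
  have -> : dim l (st_add F c G) = fun x => dim l F x + c * dim l G x by apply/funext => x; rewrite /dim/=; ring.
  have -> : (fun x => rho x * (st_add F c G).1.1 x) = fun x => rho x * F.1.1 x + c * (rho x * G.1.1 x).
    by apply/funext => x /=; ring.
  have -> : (fun x => rho x * (st_add F c G).1.2 x) = fun x => rho x * F.1.2 x + c * (rho x * G.1.2 x).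
    by apply/funext => x /=; ring.
  have [? ? ? ?] := st_L2 HF; have [? ? ? ?] := st_L2 HG; have [? ? ? ?] := st_L2 HK.
  rewrite !TI_lin//; try exact: rho_L2; try exact: dre_L2; try exact: dim_L2; ring.
- move=> K; rewrite /energy.
  have -> : dre l st0 = fun=> 0 by apply/funext => x; rewrite /dre/=; ring.
  have -> : dim l st0 = fun=> 0 by apply/funext => x; rewrite /dim/=; ring.
  have -> : (fun x => rho x * st0.1.1 x) = fun=> 0 by apply/funext => x /=; ring.
  by rewrite !TI0 !addr0.
- move=> F HF; apply: le_trans (energy_ge_mass l HF); apply: mulr_ge0; first exact: ltW.
  by case: mass_form => _ _ _; apply.
Qed.

Lemma TI_square g1 g2 c : L2T g1 -> L2T g2 ->
  TI (fun x => g1 x + c * g2 x) (fun x => g1 x + c * g2 x) = TI g1 g1 + 2 * c * TI g1 g2 + c ^+ 2 * TI g2 g2.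
Proof.
move=> h1 h2; have h3 := L2T_lin c h1 h2.
rewrite (TI_lin c h1 h2 h3) (TI_sym g1) (TI_sym g2) (TI_lin c h1 h2 h1) (TI_lin c h1 h2 h2) (TI_sym g2 g1).
ring.
Qed.

(** Young's inequality: the defect of the two sides is the square of [g1 - (c /
    s) g2], up to a positive factor. *)
Lemma TI_sq_le g1 g2 c s : 0 < s -> L2T g1 -> L2T g2 ->
  TI (fun x => g1 x + c * g2 x) (fun x => g1 x + c * g2 x) <= (1 + s) * TI g1 g1 + (1 + s^-1) * c ^+ 2 * TI g2 g2.
Proof.
move=> s0 h1 h2; rewrite TI_square//.
have := TI_ge0 (fun x => g1 x + (- (c / s)) * g2 x); rewrite TI_square//.
move: (TI g1 g1) (TI g1 g2) (TI g2 g2) => A B D h.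
rewrite -subr_ge0.
have -> : (1 + s) * A + (1 + s^-1) * c ^+ 2 * D - (A + 2 * c * B + c ^+ 2 * D) =
  s * (A + 2 * - (c / s) * B + (- (c / s)) ^+ 2 * D) by field; rewrite gt_eqF.
by rewrite mulr_ge0// ltW.
Qed.

(** Changing [l] by [d] perturbs [d/dx + i l] by multiplication with [i d],
    whose contribution is absorbed by Young's inequality. The parameter [s]
    stays free because its best choice depends on the eigenvalue. *)
Lemma energy_shift l d s F : 0 < s -> st_in F ->
  energy rho (l + d) F F <= (1 + s) * energy rho l F F + (1 + s^-1) * d ^+ 2 * mass F F.
Proof.
move=> s0 HF; have [h1 h2 _ _] := st_L2 HF.
rewrite /energy /mass.
have -> : dre (l + d) F = fun x => dre l F x + (- d) * F.1.2 x by apply/funext => x; rewrite /dre; ring.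
have -> : dim (l + d) F = fun x => dim l F x + d * F.1.1 x by apply/funext => x; rewrite /dim; ring.
have e1 := TI_sq_le (- d) s0 (dre_L2 l HF) h2; have e2 := TI_sq_le d s0 (dim_L2 l HF) h1.
rewrite sqrrN in e1.
have p1 := le_trans (mulr_ge0 (ltW r0pos) (TI_ge0 _)) (TI_rho_ge h1).
have p2 := le_trans (mulr_ge0 (ltW r0pos) (TI_ge0 _)) (TI_rho_ge h2).
have p3 := mulr_ge0 (ltW s0) p1; have p4 := mulr_ge0 (ltW s0) p2.
move: e1 e2 p3 p4; rewrite !mulrDl !mulrDr !mul1r; lra.
Qed.

(** Since [rho] is bounded below, the energy controls the mass and hence the
    derivatives; the Sobolev inequality does the rest. *)
Lemma energy_sup l : exists2 K, 0 < K & forall F s, 0 < s -> st_in F -> energy rho l F F <= s ^+ 2 ->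
  forall x, `|F.1.1 x| <= K * s /\ `|F.1.2 x| <= K * s.
Proof.
pose L := 2 + 2 * l ^+ 2 / r0 + r0^-1.
have L1 : 1 <= L.
  rewrite /L; have : 0 <= 2 * l ^+ 2 / r0 by apply: divr_ge0; [rewrite mulr_ge0 ?sqr_ge0|exact: ltW].
  have : 0 < r0^-1 by rewrite invr_gt0.
  lra.
have L0 : 0 < L by exact: lt_le_trans L1.
exists ((sobolev_cst + 1) * L); first by rewrite mulr_gt0// ltr_wpDl// sobolev_cst_ge0.
move=> F s s0 HF En; have [h1 h2 h3 h4] := st_L2 HF.
have m1 := TI_rho_ge h1; have m2 := TI_rho_ge h2.
have a0 := TI_ge0 (dre l F); have b0 := TI_ge0 (dim l F).
have n1 := TI_ge0 F.1.1; have n2 := TI_ge0 F.1.2.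
have q1 := mulr_ge0 (ltW r0pos) n1; have q2 := mulr_ge0 (ltW r0pos) n2.
have N1 : TI F.1.1 F.1.1 <= r0^-1 * s ^+ 2.
  rewrite -ler_pdivrMl ?invr_gt0// invrK; move: En; rewrite /energy; lra.
have N2 : TI F.1.2 F.1.2 <= r0^-1 * s ^+ 2.
  rewrite -ler_pdivrMl ?invr_gt0// invrK; move: En; rewrite /energy; lra.
have D1 : TI F.2.1 F.2.1 <= 2 * TI (dre l F) (dre l F) + 2 * l ^+ 2 * TI F.1.2 F.1.2.
  have := TI_sq_le l ltr01 (dre_L2 l HF) h2; rewrite invr1.
  rewrite (_ : (fun x => _) = F.2.1) => [h|]; first by lra.
  by apply/funext => x; rewrite /dre; ring.
have D2 : TI F.2.2 F.2.2 <= 2 * TI (dim l F) (dim l F) + 2 * l ^+ 2 * TI F.1.1 F.1.1.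
  have := TI_sq_le (- l) ltr01 (dim_L2 l HF) h1; rewrite invr1 sqrrN.
  rewrite (_ : (fun x => _) = F.2.2) => [h|]; first by lra.
  by apply/funext => x; rewrite /dim; ring.
have l2 := sqr_ge0 l.
have k1 := ler_wpM2l l2 N1; have k2 := ler_wpM2l l2 N2.
have Ls : 0 < L * s by rewrite mulr_gt0.
have s2 := sqr_ge0 s.
have big : L * s ^+ 2 <= (L * s) ^+ 2.
  by rewrite exprMn ler_wpM2r// expr2 ler_peMl// ltW.
have Lex : L * s ^+ 2 = 2 * s ^+ 2 + 2 * (l ^+ 2 * (r0^-1 * s ^+ 2)) + r0^-1 * s ^+ 2.
  by rewrite /L; ring.
have r1 : 0 < r0^-1 by rewrite invr_gt0.
have z1 : 0 <= r0^-1 * s ^+ 2 by exact: mulr_ge0 (ltW r1) s2.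
have z0 : 0 <= l ^+ 2 * (r0^-1 * s ^+ 2) by exact: mulr_ge0.
have [[P1 P2] _ [li1 li2] [pr1 pr2]] := HF.
have fin P h : periodic2pi P -> loc_int h -> primitive P h -> L2T h -> L2T P -> TI P P <= L * s ^+ 2 ->
   TI h h <= L * s ^+ 2 -> forall x, `|P x| <= (sobolev_cst + 1) * L * s.
  move=> Pp lh Ph Lh LP PP hh x; have [y Ty ->] := per_reduce x; last exact: Pp.
  rewrite !TI_sq in PP hh.
  apply: le_trans (sobolev_sup Ls lh Ph Lh LP (le_trans PP big) (le_trans hh big) Ty) _.
  by rewrite -mulrA ler_wpM2r ?lerDl// ltW.
move=> x; split.
  by apply: (fin _ _ P1 li1 pr1 h3 h1); move: En; rewrite /energy; lra.
by apply: (fin _ _ P2 li2 pr2 h4 h2); move: En; rewrite /energy; lra.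
Qed.
End Energy.
End BlochForms.

(** * Completeness and the weak form of the eigenvalue equation *)

Section BlochVelocity.
Context {R : realType}.
Local Notation C := R[i].
Local Notation mu := (@lebesgue_measure R).
Local Notation TT := (`[0%R, (2 * pi)%R]%classic : set R).
Implicit Types (a b c x y s : R) (h k P Q g : R -> R).

Lemma uniform_cauchy_limit (w : nat -> R -> R) : (forall n, continuous (w n)) ->
  (forall d, 0 < d -> exists K, forall n m, (K <= n)%N -> (n <= m)%N -> forall x, `|w m x - w n x| <= d) ->
  exists2 p, continuous p & forall d, 0 < d -> exists K, forall n, (K <= n)%N -> forall x, `|w n x - p x| <= d.
Proof.
move=> cw cau.
have cv x : cvgn (fun n => w n x).
  apply/cauchy_cvgP/cauchy_exP => d d0.
  have [K HK] := cau (d / 2) ltac:(by rewrite divr_gt0).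
  exists (w K x); exists K => // n Kn; rewrite /ball/= distrC.
  by apply: le_lt_trans (HK K n (leqnn _) Kn x) _; rewrite ltr_pdivrMr// mulr_natr mulr2n ltrDr.
pose p x := limn (fun n => w n x).
have unif d : 0 < d -> exists K, forall n, (K <= n)%N -> forall x, `|w n x - p x| <= d.
  move=> d0; have [K HK] := cau d d0; exists K => n Kn x.
  apply/ler_addgt0Pr => e e0.
  have /cvgrPdist_le /(_ e e0) [K2 _ HK2] := cv x.
  have /HK2 /= h1 : (K2 <= maxn n K2)%N by exact: leq_maxr.
  have h2 := HK n (maxn n K2) Kn (leq_maxl _ _) x.
  rewrite distrC; have := ler_normD (p x - w (maxn n K2) x) (w (maxn n K2) x - w n x).
  by rewrite addrA subrK => h3; apply: le_trans h3 _; rewrite addrC lerD.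
exists p => // x; apply/cvgrPdist_le => e e0.
have e3 : 0 < e / 3 by rewrite divr_gt0.
have [K HK] := unif _ e3.
have /cvgrPdist_le /(_ _ e3) := cw K x.
apply: filterS => y h; have h1 := HK K (leqnn _) x; have h2 := HK K (leqnn _) y.
rewrite -(distrC (p x)) in h1.
have := ler_normD (p x - w K x) (w K x - w K y + (w K y - p y)).
have := ler_normD (w K x - w K y) (w K y - p y).
have -> : p x - w K x + (w K x - w K y + (w K y - p y)) = p x - p y by ring.
have : e / 3 + (e / 3 + e / 3) = e by field.
by lra.
Qed.

Lemma TI_small g1 g2 d M : L2T g1 -> L2T g2 -> (forall x, `|g1 x| <= d) -> (forall x, TT x -> `|g2 x| <= M) ->
  `|TI g1 g2| <= d * M * (2 * pi).
Proof.
move=> h1 h2 b1 b2; have i12 := L2T_mul h1 h2.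
apply: le_trans (le_normr_Rintegral _ i12) _ => //.
rewrite -Rint_TT_cst; apply: le_Rintegral => //.
- by have := integrable_norm i12.
- exact: intg_cst_itv.
by move=> x Tx; rewrite normrM ler_pM// b2.
Qed.

Section Complete.
Variables (rho : R -> R) (r0 M : R).
Hypotheses (mrho : measurable_fun setT rho) (r0pos : 0 < r0) (rho_ge : forall x, r0 <= rho x)
  (rho_le : forall x, rho x <= M).

(** Convergence in energy is uniform convergence, so completeness of the
    eigenfunctions among continuous functions is enough. *)
Lemma energy_complete l (e : nat -> st) : (forall j, st_in (e j)) ->
  (forall p q, continuous p -> continuous q -> periodic2pi p -> periodic2pi q ->
     (forall j, TI p (e j).1.1 + TI q (e j).1.2 = 0) -> (forall x, p x = 0) /\ (forall x, q x = 0)) ->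
  form_complete st_in st_add mass (energy rho l) e.
Proof.
move=> He comp r Hr orth cau.
have [K K0 HK] := energy_sup mrho r0pos rho_ge rho_le l.
have unif d : 0 < d -> exists n0, forall n m, (n0 <= n)%N -> (n <= m)%N -> forall x,
    `|(r m).1.1 x - (r n).1.1 x| <= d /\ `|(r m).1.2 x - (r n).1.2 x| <= d.
  move=> d0; have dK : 0 < d / K by rewrite divr_gt0.
  have [n0 Hn] := cau ((d / K) ^+ 2) ltac:(by rewrite exprn_gt0).
  exists n0 => n m n0n nm x.
  have := HK _ _ dK (st_add_in (-1) (Hr m) (Hr n)) (Hn n m n0n nm) x.
  by rewrite /= !mulN1r mulrC divfK ?gt_eqF.
have [p cp Hp] := uniform_cauchy_limit (fun n => (st_cont (Hr n)).1)
  (fun d d0 => let: ex_intro n0 H := unif d d0 in ex_intro _ n0 (fun n m u1 u2 z => (H n m u1 u2 z).1)).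
have [q cq Hq] := uniform_cauchy_limit (fun n => (st_cont (Hr n)).2)
  (fun d d0 => let: ex_intro n0 H := unif d d0 in ex_intro _ n0 (fun n m u1 u2 z => (H n m u1 u2 z).2)).
have per (w : nat -> R -> R) g : (forall n, periodic2pi (w n)) ->
    (forall d, 0 < d -> exists K, forall n, (K <= n)%N -> forall x, `|w n x - g x| <= d) -> periodic2pi g.
  move=> wp wg x; apply/eqP; rewrite -subr_eq0 -normr_le0; apply/ler_addgt0Pr => d d0; rewrite add0r.
  have [k Hk] := wg _ (divr_gt0 d0 (ltr0n _ 2)).
  have h1 := Hk k (leqnn _) x; have := Hk k (leqnn _) (x + 2 * pi); rewrite wp distrC => h2.
  have := ler_normD (g (x + 2 * pi) - w k x) (w k x - g x); rewrite addrA subrK; lra.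
have pp : periodic2pi p by apply: per Hp => n; case: (Hr n) => -[].
have qp : periodic2pi q by apply: per Hq => n; case: (Hr n) => -[].
have p0 : 0 < 2 * pi :> R by exact: twopi_gt0.
have orthpq j : TI p (e j).1.1 + TI q (e j).1.2 = 0.
  have [c1 c2] := st_cont (He j).
  have [M1 HM1] := cont_bounded_itv 0 (2 * pi) c1; have [M2 HM2] := cont_bounded_itv 0 (2 * pi) c2.
  have M10 : 0 <= M1 by apply: le_trans (normr_ge0 _) (HM1 0 _); rewrite lexx ltW.
  have M20 : 0 <= M2 by apply: le_trans (normr_ge0 _) (HM2 0 _); rewrite lexx ltW.
  apply/eqP; rewrite -normr_le0; apply/ler_addgt0Pr => d d0; rewrite add0r.
  pose A := (M1 + M2) * (2 * pi) + 1.
  have A0 : 0 < A by rewrite ltr_wpDl// mulr_ge0 ?addr_ge0// ltW.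
  have dA : 0 < d / A by rewrite divr_gt0.
  have [k1 Hk1] := Hp _ dA; have [k2 Hk2] := Hq _ dA.
  pose n := maxn (maxn k1 k2) j.+1.
  have {Hk1} Hk1 := Hk1 n ltac:(by rewrite !leq_max leqnn).
  have {Hk2} Hk2 := Hk2 n ltac:(by rewrite !leq_max leqnn orbT).
  have := orth j n ltac:(by rewrite !leq_max ltnSn orbT); rewrite /mass => O.
  have [a1 a2 _ _] := st_L2 (Hr n); have [b1 b2 _ _] := st_L2 (He j).
  have lp := L2T_cont cp; have lq := L2T_cont cq.
  have t1 := @TI_small (fun x => (r n).1.1 x + (-1) * p x) _ (d / A) M1 (L2T_lin (-1) a1 lp) b1
     (fun x => ltac:(by rewrite /= mulN1r; exact: Hk1)) (fun x Tx => HM1 x ltac:(by move: Tx; rewrite /= in_itv)).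
  have t2 := @TI_small (fun x => (r n).1.2 x + (-1) * q x) _ (d / A) M2 (L2T_lin (-1) a2 lq) b2
     (fun x => ltac:(by rewrite /= mulN1r; exact: Hk2)) (fun x Tx => HM2 x ltac:(by move: Tx; rewrite /= in_itv)).
  rewrite !TI_lin// in t1 t2.
  have t3 := ler_normD (TI (r n).1.1 (e j).1.1 + -1 * TI p (e j).1.1) (TI (r n).1.2 (e j).1.2 + -1 * TI q (e j).1.2).
  have E : TI (r n).1.1 (e j).1.1 + -1 * TI p (e j).1.1 + (TI (r n).1.2 (e j).1.2 + -1 * TI q (e j).1.2) =
    - (TI p (e j).1.1 + TI q (e j).1.2) by move: O; lra.
  rewrite E normrN in t3; apply: le_trans t3 _; apply: le_trans (lerD t1 t2) _.
  have -> : d / A * M1 * (2 * pi) + d / A * M2 * (2 * pi) = d * ((A - 1) / A) by rewrite /A; ring.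
  by apply: ler_piMr; [exact: ltW|rewrite ler_pdivrMr// mul1r lerBlDr lerDl].
have [pz qz] := comp p q cp cq pp qp orthpq.
move=> d d0.
pose s := Num.min 1 (d / (4 * pi)).
have s0 : 0 < s by rewrite lt_min ltr01 divr_gt0// mulr_gt0// pi_gt0.
have [k1 Hk1] := Hp _ s0; have [k2 Hk2] := Hq _ s0.
exists (maxn k1 k2); set n := maxn _ _.
have {}Hk1 x : `|(r n).1.1 x| <= s by have := Hk1 n (leq_maxl _ _) x; rewrite pz subr0.
have {}Hk2 x : `|(r n).1.2 x| <= s by have := Hk2 n (leq_maxr _ _) x; rewrite qz subr0.
have [a1 a2 _ _] := st_L2 (Hr n).
have t1 := TI_small a1 a1 Hk1 (fun x _ => Hk1 x); have t2 := TI_small a2 a2 Hk2 (fun x _ => Hk2 x).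
rewrite ger0_norm ?TI_ge0// in t1; rewrite ger0_norm ?TI_ge0// in t2.
rewrite /mass; apply: le_trans (lerD t1 t2) _.
have -> : s * s * (2 * pi) + s * s * (2 * pi) = s * (s * (4 * pi)) by ring.
have sd : s * (4 * pi) <= d.
  by rewrite -ler_pdivlMr ?mulr_gt0 ?pi_gt0// /s ge_min lexx orbT.
apply: le_trans sd; rewrite ler_piMl ?mulr_ge0 ?pi_ge0 ?(ltW s0)//.
by rewrite /s ge_min lexx.
Qed.

(** The eigenvalue equation in weak form, by integration by parts over a
    period; the boundary terms cancel by periodicity. *)
Lemma bloch_weak l lam p q : L2T p -> L2T q -> bloch_real rho l lam p q -> exists F : st,
  [/\ F.1 = (p, q), st_in F & forall G, st_in G -> energy rho l F G = lam * mass F G].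
Proof.
move=> Lp Lq [h [k [h2 [k2 [[ch ck ph qk] [ih ik hh kk] [pp qp hp kp] e1 e2]]]]].
have lh := loc_int_cont ch; have lk := loc_int_cont ck.
have Lh := L2T_cont ch; have Lk := L2T_cont ck.
pose F : st := ((p, q), (h, k)).
have HF : st_in F by [].
exists F; split => // G HG.
have [G1 G2 G3 G4] := st_L2 HG; have [[gp1 gp2] _ [gi1 gi2] [gg1 gg2]] := HG.
have p0 : 0 <= 2 * pi :> R by rewrite ltW// twopi_gt0.
have per0 g : periodic2pi g -> g (2 * pi) = g 0 by move=> /(_ 0); rewrite add0r.
pose a x := dre l F x; pose b x := dim l F x.
pose a2 x := h2 x + (- l) * k x; pose b2 x := k2 x + l * h x.
have pa : primitive a a2.
  have := primitiveD (- l) ih lk hh qk; congr primitive; apply/funext => x; rewrite /a /dre/=; ring.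
have pb : primitive b b2 by exact: (primitiveD l ik lh kk ph).
have ia2 : loc_int a2 by exact: loc_intD.
have ib2 : loc_int b2 by exact: loc_intD.
have I1 := primitive_ibp p0 ia2 gi1 pa gg1; have I2 := primitive_ibp p0 ib2 gi2 pb gg2.
have ea : a (2 * pi) = a 0 by rewrite /a /dre/= !per0.
have eb : b (2 * pi) = b 0 by rewrite /b /dim/= !per0.
rewrite ea (per0 _ gp1) subrr in I1; rewrite eb (per0 _ gp2) subrr in I2.
have La := dre_L2 l HF; have Lb := dim_L2 l HF.
have ca : continuous G.1.1 by case: (st_cont HG).
have cb : continuous G.1.2 by case: (st_cont HG).
have mulc (w g : R -> R) : loc_int w -> continuous g -> mu.-integrable TT (EFin \o (fun x => w x * g x)).
  move=> iw cg; have [B HB] := cont_bounded_itv 0 (2 * pi) cg.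
  have B0 : 0 <= B by apply: le_trans (normr_ge0 _) (HB 0 _); rewrite lexx.
  have i0 := (intg_indic mu w (measurable_itv `[0, 2 * pi])).1 (iw _ _).
  apply: (intg_indic mu (fun x => w x * g x) (measurable_itv `[0, 2 * pi])).2.
  apply: (@intg_le _ _ _ mu _ (fun x => B * `|w x * \1_(`[0, 2 * pi]%classic : set R) x|)).
  - rewrite (_ : (fun x => _) = fun x => w x * \1_(`[0, 2 * pi]%classic : set R) x * g x).
      by apply: measurable_funM; [exact: (intg_measurable i0)|exact: continuous_measurableR].
    by apply/funext => x; ring.
  - by apply: intgZ; exact: intg_norm.
  move=> x; rewrite mulrAC normrM mulrC; have [xb|xb] := boolP (0 <= x <= 2 * pi).
    by apply: ler_wpM2r => //; exact: HB.
  by rewrite indic_itvE in_itv/= (negbTE xb) mulr0 normr0 !mulr0.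
have i1 := mulc _ _ ia2 ca; have i2 := mulc _ _ ib2 cb.
have rL1 := rho_L2 mrho r0pos rho_ge rho_le Lp; have rL2 := rho_L2 mrho r0pos rho_ge rho_le Lq.
(* The two components of the equation, multiplied by those of [G] and added. *)
pose Z x := (- a2 x * G.1.1 x + - b2 x * G.1.2 x)
   + (l * (b x * G.1.1 x) + (- l) * (a x * G.1.2 x) + (rho x * p x * G.1.1 x + rho x * q x * G.1.2 x))
   - lam * (p x * G.1.1 x + q x * G.1.2 x).
have Z0 : {ae mu, forall x, Z x = 0}.
  apply: ae1S2 e1 e2 => x z1 z2.
  have E1 : - a2 x + l * b x + rho x * p x = lam * p x by rewrite -z1 /a2 /b /dim/=; ring.
  have E2 : - b2 x - l * a x + rho x * q x = lam * q x by rewrite -z2 /b2 /a /dre/=; ring.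
  rewrite /Z.
  have -> : lam * (p x * G.1.1 x + q x * G.1.2 x) = lam * p x * G.1.1 x + lam * q x * G.1.2 x by ring.
  by rewrite -E1 -E2; ring.
have j1 : mu.-integrable TT (EFin \o (fun x => - a2 x * G.1.1 x)).
  by rewrite (_ : (fun x => _) = fun x => (-1) * (a2 x * G.1.1 x)); [exact: intgZ_on|apply/funext => x; ring].
have j2 : mu.-integrable TT (EFin \o (fun x => - b2 x * G.1.2 x)).
  by rewrite (_ : (fun x => _) = fun x => (-1) * (b2 x * G.1.2 x)); [exact: intgZ_on|apply/funext => x; ring].
have k1 := L2T_mul Lb G1; have k22 := L2T_mul La G2.
have k3 := L2T_mul rL1 G1; have k4 := L2T_mul rL2 G2.
have m1 := L2T_mul Lp G1; have m2 := L2T_mul Lq G2.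
have lin c w : mu.-integrable TT (EFin \o w) -> \int[mu]_(x in TT) (c * w x) = c * \int[mu]_(x in TT) w x.
  by move=> iw; exact: RintegralZl.
have ZI : mu.-integrable TT (EFin \o Z).
  apply: intgB_on => //; last by apply: intgZ_on => //; exact: intgD_on.
  apply: intgD_on => //; first exact: intgD_on.
  apply: intgD_on => //; last exact: intgD_on.
  by apply: intgD_on => //; exact: intgZ_on.
have Zint : \int[mu]_(x in TT) Z x = 0.
  rewrite (Rint_indic mu Z (measurable_itv `[0, 2 * pi])).
  transitivity (\int[mu]_(x in setT) (0 : R)); last by rewrite Rintegral_cst// mul0r.
  apply: eq_Rint_ae => //.
    exact: (intg_measurable ((intg_indic mu Z (measurable_itv `[0, 2 * pi])).1 ZI)).
  by apply: ae1S Z0 => x ->; rewrite mul0r.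
have Zexp : \int[mu]_(x in TT) Z x = (- (\int[mu]_(x in TT) (a2 x * G.1.1 x)) + - (\int[mu]_(x in TT) (b2 x * G.1.2 x)))
   + (l * TI b G.1.1 + (- l) * TI a G.1.2 + (TI (fun x => rho x * p x) G.1.1 + TI (fun x => rho x * q x) G.1.2))
   - lam * (TI p G.1.1 + TI q G.1.2).
  rewrite /Z RintegralB//; last 2 first.
  - apply: intgD_on => //; first exact: intgD_on.
    apply: intgD_on => //; last exact: intgD_on.
    by apply: intgD_on => //; exact: intgZ_on.
  - by apply: intgZ_on => //; exact: intgD_on.
  rewrite lin; last exact: intgD_on.
  rewrite (RintegralD _ m1 m2)// RintegralD//; last 2 first.
  - exact: intgD_on.
  - apply: intgD_on => //; last exact: intgD_on.
    by apply: intgD_on => //; exact: intgZ_on.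
  rewrite (RintegralD _ j1 j2)// RintegralD//; last 2 first.
  - by apply: intgD_on => //; exact: intgZ_on.
  - exact: intgD_on.
  rewrite (RintegralD _ k3 k4)// RintegralD//; last 2 first.
  - exact: intgZ_on.
  - exact: intgZ_on.
  rewrite (lin _ _ k1) (lin _ _ k22).
  have -> : \int[mu]_(x in TT) (- a2 x * G.1.1 x) = - (\int[mu]_(x in TT) (a2 x * G.1.1 x)).
    by rewrite -mulN1r -lin//; apply: eq_Rintegral => x _; ring.
  have -> : \int[mu]_(x in TT) (- b2 x * G.1.2 x) = - (\int[mu]_(x in TT) (b2 x * G.1.2 x)).
    by rewrite -mulN1r -lin//; apply: eq_Rintegral => x _; ring.
  by [].
have A1 : TI a (dre l G) = \int[mu]_(x in TT) (a x * G.2.1 x) + (- l) * TI a G.1.2.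
  rewrite (_ : dre l G = fun x => G.2.1 x + (- l) * G.1.2 x); last by apply/funext => x; rewrite /dre mulNr.
  by rewrite TI_sym TI_lin// TI_sym [TI _ a]TI_sym.
have A2 : TI b (dim l G) = \int[mu]_(x in TT) (b x * G.2.2 x) + l * TI b G.1.1.
  by rewrite /dim TI_sym TI_lin// TI_sym [TI _ b]TI_sym.
have EE : energy rho l F G = TI a (dre l G) + TI b (dim l G)
  + (TI (fun x => rho x * p x) G.1.1 + TI (fun x => rho x * q x) G.1.2) by [].
rewrite EE A1 A2 /mass/=; clear - I1 I2 Zint Zexp.
move: Zint; rewrite Zexp; lra.
Qed.
End Complete.
End BlochVelocity.

(** * The group velocity is at most one *)

Section GroupVelocity.
Context {R : realType}.
Local Notation C := R[i].
Local Notation mu := (@lebesgue_measure R).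
Local Notation TT := (`[0%R, (2 * pi)%R]%classic : set R).
Implicit Types (a b c x y s : R) (P Q g : R -> R).

(** Coefficients are bounded only almost everywhere, whereas the forms need a
    bounded representative. *)
Lemma X0_bounded (rho : R -> R) : inX0 rho -> exists (rho' : R -> R) (r0 M : R), [/\ measurable_fun setT rho', 0 < r0,
  forall x, r0 <= rho' x, forall x, rho' x <= M & {ae mu, forall x, rho x = rho' x}].
Proof.
move=> [mr [M HM] _ _ [r0 r00 Hr]].
pose M' := Num.max r0 M.
exists (fun x => Num.min (rho x) M'), r0, M'; split => //.
- by apply: measurable_minr.
- by move=> x; rewrite le_min Hr /M' le_max lexx.
- by move=> x; rewrite ge_min lexx orbT.
- apply: ae1S HM => x; rewrite ler_norml => /andP[_ h].
  by apply/esym/min_idPl; rewrite /M' le_max h orbT.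
Qed.

Lemma bloch_real_ae rho rho' l (lam : R) p q : {ae mu, forall x, rho x = rho' x} ->
  bloch_real rho l lam p q -> bloch_real rho' l lam p q.
Proof.
move=> rr [h [k [h2 [k2 [H1 H2 H3 e1 e2]]]]]; exists h, k, h2, k2; split => //.
  by apply: ae1S2 rr e1 => x ->.
by apply: ae1S2 rr e2 => x ->.
Qed.

(** Multiplication by [i]: over the reals each complex eigenfunction
    contributes the two eigenvectors [f] and [i f]. *)
Lemma bloch_real_rot rho l (lam : R) p q : bloch_real rho l lam p q ->
  bloch_real rho l lam (fun x => - q x) p.
Proof.
move=> [h [k [h2 [k2 [[ch ck ph qk] [ih ik hh kk] [pp qp hp kp] e1 e2]]]]].
have cN (g : R -> R) : continuous g -> continuous (fun x => - g x) by move=> cg x; apply: cvgN; exact: cg.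
have lN (g : R -> R) : loc_int g -> loc_int (fun x => - g x).
  move=> ig a b; have := intgZ_on (-1) (measurable_itv `[a, b]) (ig a b).
  by congr (mu.-integrable _ _); apply/funext => x /=; rewrite mulN1r.
have pN P g : loc_int g -> primitive P g -> primitive (fun x => - P x) (fun x => - g x).
  move=> ig Pg a b ab; have -> : \int[mu]_(x in `[a, b]) - g x = - (\int[mu]_(x in `[a, b]) g x).
    have <- : \int[mu]_(x in `[a, b]) (-1 * g x) = - (\int[mu]_(x in `[a, b]) g x).
      by rewrite -[RHS]mulN1r; apply: RintegralZl => //; exact: ig.
    by apply: eq_Rintegral => x _; rewrite mulN1r.
  by rewrite -Pg//; ring.
have eN (g : R -> R) : periodic2pi g -> periodic2pi (fun x => - g x) by move=> gp x; rewrite gp.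
exists (fun x => - k x), h, (fun x => - k2 x), h2; split => //.
- split=> //; [exact: cN|apply: pN => //; exact: loc_int_cont].
- split=> //; [exact: lN|exact: pN].
- by split=> //; exact: eN.
- apply: ae1S e2 => x; lra.
- apply: ae1S e1 => x; lra.
Qed.

Lemma ip_re p q p' q' : L2T p -> L2T q -> L2T p' -> L2T q' ->
  complex.Re (ip (fun x => (p x +i* q x)%C) (fun x => (p' x +i* q' x)%C)) = TI p p' + TI q q'.
Proof.
move=> h1 h2 h3 h4; rewrite /ip /cint /=.
rewrite /TI -RintegralD//; [|exact: L2T_mul|exact: L2T_mul].
by apply: eq_Rintegral => x _; ring.
Qed.

Lemma ip_im p q p' q' : L2T p -> L2T q -> L2T p' -> L2T q' ->
  complex.Im (ip (fun x => (p x +i* q x)%C) (fun x => (p' x +i* q' x)%C)) = TI q p' - TI p q'.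
Proof.
move=> h1 h2 h3 h4; rewrite /ip /cint /=.
rewrite /TI -RintegralB//; [|exact: L2T_mul|exact: L2T_mul].
by apply: eq_Rintegral => x _; ring.
Qed.

Lemma TI_oppl g1 g2 : L2T g1 -> L2T g2 -> TI (fun x => - g1 x) g2 = - TI g1 g2.
Proof.
move=> h1 h2; have := TI_lin (-1) L2T0 h1 h2; rewrite TI0 add0r mulN1r => <-.
by congr (TI _ _); apply/funext => x; rewrite add0r mulN1r.
Qed.

(** The real eigenvectors are listed as [f 0, i f 0, f 1, i f 1] and so on,
    which is why the eigenvalue of index [j] is [omega j./2 l ^+ 2]. *)
Lemma bloch_system (rho : R -> R) (omega : nat -> R -> R) (f : nat -> R -> R -> C) (rho' : R -> R) (r0 M l : R) :
  bloch_bands rho omega f -> measurable_fun setT rho' -> 0 < r0 -> (forall x, r0 <= rho' x) ->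
  (forall x, rho' x <= M) -> {ae mu, forall x, rho x = rho' x} ->
  exists e, eigen_system st_in mass (energy rho' l) e (fun j => omega j./2 l ^+ 2) /\
    form_complete st_in st_add mass (energy rho' l) e.
Proof.
move=> [om _ _ _ /(_ l)[reg eq ON comp]] mr r00 rr rM rae.
pose p k x := complex.Re (f k l x); pose q k x := complex.Im (f k l x).
have fE k : f k l = fun x => (p k x +i* q k x)%C.
  by apply/funext => x; rewrite /p /q; case: (f k l x).
have pq k : [/\ L2T (p k), L2T (q k) & bloch_real rho' l (omega k l ^+ 2) (p k) (q k)].
  have [Hf c1 c2] := reg k; split; [exact: L2T_cont|exact: L2T_cont|].
  by apply: (bloch_real_ae rae); apply: bloch_eigen_real => //; exact: eq.
(* The pair [(P j, Q j)] is [f] for even [j] and [i f] for odd [j]. *)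
pose P j := if odd j then fun x => - q j./2 x else p j./2.
pose Q j := if odd j then p j./2 else q j./2.
have L2N g : L2T g -> L2T (fun x => - g x).
  by move=> /(L2TZ (-1)); congr L2T; apply/funext => x; rewrite mulN1r.
have LPQ j : L2T (P j) /\ L2T (Q j).
  by rewrite /P /Q; have [h1 h2 _] := pq j./2; case: (odd j); split => //; exact: L2N.
have PQ j : exists F : st, [/\ F.1 = (P j, Q j), st_in F & forall G, st_in G ->
    energy rho' l F G = omega j./2 l ^+ 2 * mass F G].
  apply: (bloch_weak mr r00 rr rM) => //; try by case: (LPQ j).
  rewrite /P /Q; have [_ _ h] := pq j./2; case: (odd j) => //; exact: bloch_real_rot.
have [e He] := boolp.choice PQ.
exists e; split.
  split.
  - by move=> j; case: (He j).
  - move=> i j; have [Ei _ _] := He i; have [Ej _ _] := He j.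
    rewrite /mass Ei Ej /= /P /Q.
    have [a1 a2 _] := pq i./2; have [b1 b2 _] := pq j./2.
    have r1 := ip_re a1 a2 b1 b2; have i1 := ip_im a1 a2 b1 b2.
    rewrite -!fE ON in r1 i1.
    have ijE : (i == j) = (odd i == odd j) && (i./2 == j./2).
      apply/eqP/andP => [->|[/eqP h1 /eqP h2]]; first by rewrite !eqxx.
      by rewrite -(odd_double_half i) -(odd_double_half j) h1 h2.
    rewrite ijE.
    have re1 (b : bool) : complex.Re (b%:R : C) = b%:R by case: b.
    have im1 (b : bool) : complex.Im (b%:R : C) = 0 by case: b.
    rewrite re1 in r1; rewrite im1 in i1.
    case: (odd i); case: (odd j) => /=.
    + rewrite TI_oppl//; last exact: L2N.
      by rewrite TI_sym TI_oppl// opprK TI_sym r1 addrC.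
    + by rewrite TI_oppl// addrC -opprB -i1 oppr0 // mulr0n.
    + by rewrite TI_sym TI_oppl// TI_sym addrC -i1.
    + by rewrite -r1.
  - by move=> j G HG; case: (He j) => _ _; apply.
  - by move=> j; exact: sqr_ge0.
  - move=> i j ij; have mono : forall n m : nat, (n <= m)%N -> omega n l <= omega m l.
      move=> n m /subnKC <-; elim: (m - n)%N => [|k IH]; first by rewrite addn0.
      by rewrite addnS; apply: le_trans IH _; case: (om (n + k)%N l).
    have og n : 0 <= omega n l by apply: ltW; case: (om n l).
    by rewrite ler_pXn2r ?nnegrE// mono// half_leq.
apply: (energy_complete mr r00 rr rM); first by move=> j; case: (He j).
move=> g1 g2 c1 c2 per1 per2 orth.
have l1 := L2T_cont c1; have l2 := L2T_cont c2.
have Lg : L2per (fun x => (g1 x +i* g2 x)%C).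
  split => /=; [by move=> x; rewrite per1 per2|exact: l1.1|exact: l2.1|].
  by rewrite /sqmod/=; apply: intgD_on => //; [exact: l1.2|exact: l2.2].
have Z0 : forall k, ip (fun x => (g1 x +i* g2 x)%C) (f k l) = 0.
  move=> k; have [a1 a2 _] := pq k; rewrite (fE k); apply: complexP.
    rewrite ip_re//; have := orth k.*2; have [-> _ _] := He k.*2.
    by rewrite /P /Q/= odd_double doubleK.
  rewrite ip_im//; have := orth k.*2.+1; have [-> _ _] := He k.*2.+1.
  rewrite /P /Q/= odd_double/= uphalf_double TI_sym TI_oppl// TI_sym => h.
  by rewrite -[RHS]h addrC.
have ae0 := comp _ Lg Z0.
have Z : continuous (fun x : R => 0 : R) by move=> x; exact: (cvg_cst (0 : R)).
have z1 : g1 = fun=> 0.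
  by apply: cont_ae_eq => //; apply: ae1S ae0 => x /(congr1 (@complex.Re R)).
have z2 : g2 = fun=> 0.
  by apply: cont_ae_eq => //; apply: ae1S ae0 => x /(congr1 (@complex.Im R)).
by rewrite z1 z2.
Qed.

(** Min-max with the shifted form, for [s = |d| / omega n l]: then [(1 + s)
    omega ^+ 2 + (1 + 1 / s) d ^+ 2] is the square of [omega + |d|]. *)
Lemma band_lipschitz (rho : R -> R) (omega : nat -> R -> R) (f : nat -> R -> R -> C) n l d :
  inX0 rho -> bloch_bands rho omega f -> omega n (l + d) <= omega n l + `|d|.
Proof.
move=> /X0_bounded[rho' [r0 [M [mr r00 rr rM rae]]]] Bl.
have om0 k l' : 0 < omega k l' by case: Bl => /(_ k l') [].
have [-> |d0] := eqVneq d 0; first by rewrite addr0 normr0 addr0.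
have [e [E _]] := bloch_system l Bl mr r00 rr rM rae.
have [e' [E' C']] := bloch_system (l + d) Bl mr r00 rr rM rae.
have nd0 : 0 < `|d| by rewrite normr_gt0.
pose s := `|d| / omega n l; have s0 : 0 < s by rewrite divr_gt0.
have := @minmax_compare R st st_in st0 st_add st0_in (fun F c G => @st_add_in R F c G) mass (energy rho' l) (energy rho' (l + d))
  e e' _ _ n.*2 (1 + s) ((1 + s^-1) * d ^+ 2) (mass_form) (energy_form mr r00 rr rM l)
  (energy_form mr r00 rr rM (l + d)) E E' C' (fun F HF => energy_shift mr r00 rr rM l d s0 HF).
rewrite /= doubleK => /(_ ltac:(by rewrite addr_ge0// ltW)).
have -> : (1 + s) * omega n l ^+ 2 + (1 + s^-1) * d ^+ 2 = (omega n l + `|d|) ^+ 2.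
  rewrite -[d ^+ 2]real_normK ?num_real// /s; have w := om0 n l.
  by move: (omega n l) `|d| w nd0 => w t w0 t0; field; rewrite !gt_eqF.
by rewrite ler_pXn2r// nnegrE ?addr_ge0// ltW.
Qed.

(** If the band is not differentiable at [l], the derivative is [0] by
    convention and the bound is trivial. *)
Lemma group_velocity_le1 (rho : R -> R) (omega : nat -> R -> R) (f : nat -> R -> R -> C) n l :
  inX0 rho -> bloch_bands rho omega f -> `|derive1 (omega n) l| <= 1.
Proof.
move=> rX Bl.
have lip d : `|omega n (d + l) - omega n l| <= `|d|.
  have h1 := band_lipschitz n l d rX Bl.
  have h2 := band_lipschitz n (l + d) (- d) rX Bl.
  rewrite (addrK d l) normrN in h2; rewrite (addrC d l) ler_norml; apply/andP; split; lra.
have [D|D] := pselect (cvg ((fun h => h^-1 *: (omega n (h + l) - omega n l)) @ 0^')); last first.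
  by rewrite /derive1 (dvgP D) normr0.
rewrite /derive1; set L := lim _.
apply/ler_addgt0Pr => e e0.
have /cvgrPdist_le /(_ e e0) H := D.
have [h [h0 /= Hh]] : exists h, h != 0 /\ `|L - h^-1 *: (omega n (h + l) - omega n l)| <= e.
  have := filter_ex (filterI H (nbhs_dnbhs_neq (0 : R))).
  by move=> [h [h1 h2]]; exists h.
have q1 : `|h^-1 *: (omega n (h + l) - omega n l)| <= 1.
  by rewrite normrZ normfV ler_pdivrMl ?normr_gt0// mulr1.
by have := ler_normD (L - h^-1 *: (omega n (h + l) - omega n l)) (h^-1 *: (omega n (h + l) - omega n l)); rewrite subrK; lra.
Qed.
End GroupVelocity.

(** * Fejer sums *)

Section Fejer.
Context {R : realType}.
Local Notation mu := (@lebesgue_measure R).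
Local Notation TT := (`[0%R, (2 * pi)%R]%classic : set R).
Implicit Types (x y z : R) (G : R -> R) (s : nat -> R) (j k m n : nat).

(** The squared modulus of a geometric sum, that is [n] times the Fejer kernel. *)
Definition fejer n y := (\sum_(k < n) cos (k%:R * y)) ^+ 2 + (\sum_(k < n) sin (k%:R * y)) ^+ 2.
(** The frequency [|j - k|]; only natural frequencies occur, so that only half
    of the Fourier modes is needed. *)
Definition natdist j k := ((j - k) + (k - j))%N.

Lemma natdistE j k y : cos (j%:R * y) * cos (k%:R * y) + sin (j%:R * y) * sin (k%:R * y) = cos ((natdist j k)%:R * y) :> R.
Proof.
rewrite -cosB /natdist; case: (leqP j k) => jk.
  rewrite (eqP jk) add0n natrB// -cosN; congr cos; ring.
by rewrite (eqP (ltnW jk)) addn0 natrB ?(ltnW jk)//; congr cos; ring.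
Qed.

Lemma fejerE n y : fejer n y = \sum_(j < n) \sum_(k < n) cos ((natdist j k)%:R * y).
Proof.
rewrite /fejer !expr2 !big_distrlr /= -big_split; apply: eq_bigr => j _.
by rewrite -big_split; apply: eq_bigr => k _; rewrite -natdistE.
Qed.

Lemma fejer_ge0 n y : 0 <= fejer n y.
Proof. by rewrite addr_ge0 ?sqr_ge0. Qed.

(** The geometric sum multiplied by [1 - exp(i y)]. *)
Lemma fejer_telescope n y :
  (\sum_(k < n) cos (k%:R * y)) * (1 - cos y) + (\sum_(k < n) sin (k%:R * y)) * sin y = 1 - cos (n%:R * y) /\
  (\sum_(k < n) sin (k%:R * y)) * (1 - cos y) - (\sum_(k < n) cos (k%:R * y)) * sin y = - sin (n%:R * y).
Proof.
elim: n => [|n [IH1 IH2]]; first by rewrite !big_ord0 (mulr0n 1) !mul0r cos0 sin0 !subrr addr0 oppr0.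
have E : n.+1%:R * y = n%:R * y + y by rewrite -natr1 mulrDl mul1r.
rewrite !big_ord_recr/= E cosD sinD; split; lra.
Qed.

Lemma fejer_decay n y : fejer n y * (2 - 2 * cos y) <= 4.
Proof.
have [h1 h2] := fejer_telescope n y; rewrite /fejer.
move: (\sum_(k < n) cos _) (\sum_(k < n) sin _) h1 h2 => A B h1 h2.
have e1 := cos2Dsin2 y; have e2 := cos2Dsin2 (n%:R * y).
have cb : - 1 <= cos (n%:R * y) by exact: cos_geN1.
have -> : (A ^+ 2 + B ^+ 2) * (2 - 2 * cos y) = (1 - cos (n%:R * y)) ^+ 2 + (- sin (n%:R * y)) ^+ 2.
  rewrite -h1 -h2.
  have -> : (A * (1 - cos y) + B * sin y) ^+ 2 + (B * (1 - cos y) - A * sin y) ^+ 2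
     = (A ^+ 2 + B ^+ 2) * (1 - 2 * cos y + (cos y ^+ 2 + sin y ^+ 2)) by ring.
  by rewrite e1; ring.
have -> : (1 - cos (n%:R * y)) ^+ 2 + (- sin (n%:R * y)) ^+ 2 = 1 - 2 * cos (n%:R * y) + (cos (n%:R * y) ^+ 2 + sin (n%:R * y) ^+ 2) by ring.
rewrite e2; lra.
Qed.

(** For fixed [k] every distance is attained at most twice. *)
Lemma sum_natdist s n k : (forall m, 0 <= s m) -> (k < n)%N ->
  \sum_(j < n) s (natdist j k) <= 2 * \sum_(m < n) s m.
Proof.
move=> s0 kn; rewrite -(big_mkord xpredT (fun j => s (natdist j k))) -(big_mkord xpredT s).
rewrite (big_cat_nat (leq0n k) (ltnW kn)) /= mulrDl mul1r; apply: lerD.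
  have sub : \sum_(0 <= m < k.+1) s m <= \sum_(0 <= m < n) s m.
    by rewrite [leRHS](big_cat_nat (leq0n k.+1) kn)/= lerDl sumr_ge0.
  apply: le_trans sub; rewrite big_nat_recl// -[leLHS]add0r; apply: lerD => //.
  rewrite big_nat_rev /= !big_mkord; apply: ler_sum => j _.
  rewrite add0n /natdist subKn// (_ : (k - j.+1 - k = 0)%N) //.
  by apply/eqP; rewrite subn_eq0 leq_subr.
rewrite -{1}(add0n k) big_addn; have sub : \sum_(0 <= m < n - k) s m <= \sum_(0 <= m < n) s m.
  by rewrite [leRHS](big_cat_nat (leq0n (n - k)) (leq_subr k n))/= lerDl sumr_ge0.
apply: le_trans sub; apply: ler_sum => j _.
by rewrite /natdist addnK (_ : (k - (j + k) = 0)%N) ?addn0//; apply/eqP; rewrite subn_eq0 leq_addl.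
Qed.

Lemma cont_on_TT G : continuous G -> mu.-integrable TT (EFin \o G).
Proof.
move=> cG; apply: continuous_compact_integrable; first exact: segment_compact.
exact: continuous_subspaceT.
Qed.

Lemma RintZ_TT (c : R) G : mu.-integrable TT (EFin \o G) ->
  \int[mu]_(x in TT) (c * G x) = c * \int[mu]_(x in TT) G x.
Proof. by move=> iG; exact: RintegralZl. Qed.

Lemma Rint_TT_sum n (h : nat -> R -> R) : (forall k, continuous (h k)) ->
  (forall m, continuous (fun x => \sum_(k < m) h k x)) /\
  \int[mu]_(x in TT) (\sum_(k < n) h k x) = \sum_(k < n) \int[mu]_(x in TT) h k x.
Proof.
move=> ch; have cs m : continuous (fun x => \sum_(k < m) h k x).
  elim: m => [|m IH]; first by under eq_fun do rewrite big_ord0; move=> x; exact: cvg_cst.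
  under eq_fun do rewrite big_ord_recr/=.
  by move=> x; apply: cvgD; [exact: IH|exact: ch].
split => //; elim: n => [|n IH].
  by rewrite big_ord0; under eq_Rintegral do rewrite big_ord0; rewrite Rintegral_cst// mul0r.
rewrite big_ord_recr/= -IH -RintegralD//; [|exact: cont_on_TT|exact: cont_on_TT].
by apply: eq_Rintegral => x _; rewrite big_ord_recr.
Qed.

Lemma cos_aff_cont (a b : R) : continuous (fun z => cos (a * (b - z))).
Proof.
move=> z; apply: (continuous_comp (f := fun z => a * (b - z))); last exact: continuous_cos.
by apply: cvgM; [exact: cvg_cst|apply: cvgB; [exact: cvg_cst|exact: cvg_id]].
Qed.

Lemma int_cos_period k z0 : \int[mu]_(z in TT) cos (k%:R * (z0 - z)) = if k == 0%N then 2 * pi else 0.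
Proof.
case: eqP => [->|/eqP k0].
  by under eq_Rintegral do rewrite mul0r cos0; rewrite Rint_TT_cst mul1r.
have kR : (k%:R : R) != 0 by rewrite pnatr_eq0.
have C1 : C1fun (fun z => - (k%:R)^-1 * sin (k%:R * (z0 - z))) (fun z => cos (k%:R * (z0 - z))).
  split; last exact: cos_aff_cont.
  move=> z; apply/is_derive1_eps => e e0.
  have [d d0 Hd] := (is_derive1_eps _ _ _).1 (is_derive_sin (k%:R * (z0 - z))) e e0.
  have kp : 0 < (k%:R : R) by rewrite ltr0n lt0n.
  exists (d / k%:R); first by rewrite divr_gt0.
  move=> h hd; have := Hd (- (k%:R * h)).
  rewrite normrN normrM (ger0_norm (ltW kp)) => /(_ ltac:(by rewrite mulrC -ltr_pdivlMr)).
  have -> : k%:R * (z0 - z) + - (k%:R * h) = k%:R * (z0 - (z + h)) by ring.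
  move=> H; rewrite -(ler_pM2l kp) (le_trans _ (le_trans H _)) //; last by rewrite le_eqVlt; apply/orP; left; apply/eqP; ring.
  rewrite -{1}[k%:R]gtr0_norm// -normrM -[leRHS]normrN le_eqVlt; apply/orP; left; apply/eqP.
  by congr (`| _ |); field.
have [_ ->] := integral_C1 C1 (ltW twopi_gt0).
have E : k%:R * (z0 - 2 * pi) = k%:R * z0 - (pi *+ 2) *+ k.
  rewrite mulrBr; congr (_ - _); rewrite [LHS]mulr_natl; congr (_ *+ _); exact: mulr_natl.
rewrite E subr0; have -> : sin (k%:R * z0 - (pi *+ 2) *+ k) = sin (k%:R * z0).
  have sp m y : sin (y + (pi *+ 2) *+ m) = sin y :> R.
    by elim: m => [|m IH]; rewrite ?mulr0n ?addr0// mulrSr addrA sinD2pi.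
  by rewrite -[LHS](sp k) subrK.
by rewrite subrr.
Qed.

Lemma fejer_aff_cont n z0 : continuous (fun z => fejer n (z0 - z)).
Proof.
under eq_fun do rewrite fejerE.
apply: (Rint_TT_sum 0 (h := fun j z => \sum_(k < n) cos ((natdist j k)%:R * (z0 - z))) _).1 => j.
by apply: (Rint_TT_sum 0 (h := fun k z => cos ((natdist j k)%:R * (z0 - z))) _).1 => k; exact: cos_aff_cont.
Qed.

Lemma fejer_mass n z0 : \int[mu]_(z in TT) fejer n (z0 - z) = n%:R * (2 * pi).
Proof.
under eq_Rintegral do rewrite fejerE.
rewrite (Rint_TT_sum n (h := fun j z => \sum_(k < n) cos ((natdist j k)%:R * (z0 - z))) _).2; last first.
  by move=> j; apply: (Rint_TT_sum 0 (h := fun k z => cos ((natdist j k)%:R * (z0 - z))) _).1 => k; exact: cos_aff_cont.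
have -> : n%:R * (2 * pi) = \sum_(j < n) (2 * pi) :> R by rewrite sumr_const card_ord [LHS]mulr_natl.
apply: eq_bigr => j _.
rewrite (Rint_TT_sum n (h := fun k z => cos ((natdist j k)%:R * (z0 - z))) _).2; last by move=> k; exact: cos_aff_cont.
rewrite (bigD1 j)//= int_cos_period /natdist subnn eqxx big1 ?addr0 ?mul1r// => i ij.
rewrite int_cos_period addn_eq0 !subn_eq0 -eqn_leq.
by rewrite (_ : (j == i :> nat) = false)//; apply: contraNF ij => /eqP h; apply/eqP/val_inj.
Qed.

(** Each of the [n ^+ 2] terms of the kernel picks one Fourier coefficient, and
    each frequency occurs at most [2 n] times. *)
Lemma fejer_coef G s n z0 : continuous G -> (forall k, 0 <= s k) ->
  (forall k, `|\int[mu]_(z in TT) (G z * cos (k%:R * z))| <= s k) ->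
  (forall k, `|\int[mu]_(z in TT) (G z * sin (k%:R * z))| <= s k) ->
  `|\int[mu]_(z in TT) (G z * fejer n (z0 - z))| <= n%:R * (4 * \sum_(k < n) s k).
Proof.
move=> cG s0 hc hs.
have cGc k : continuous (fun z => G z * cos (k%:R * (z0 - z))).
  by move=> z; apply: cvgM; [exact: cG|exact: cos_aff_cont].
have one k : `|\int[mu]_(z in TT) (G z * cos (k%:R * (z0 - z)))| <= 2 * s k.
  have ccos : continuous (fun z => G z * cos (k%:R * z)).
    move=> z; apply: cvgM; first exact: cG.
    apply: (continuous_comp (f := fun z => k%:R * z)); last exact: continuous_cos.
    by apply: cvgM; [exact: cvg_cst|exact: cvg_id].
  have csin : continuous (fun z => G z * sin (k%:R * z)).
    move=> z; apply: cvgM; first exact: cG.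
    apply: (continuous_comp (f := fun z => k%:R * z)); last exact: continuous_sin.
    by apply: cvgM; [exact: cvg_cst|exact: cvg_id].
  have -> : \int[mu]_(z in TT) (G z * cos (k%:R * (z0 - z))) =
     cos (k%:R * z0) * \int[mu]_(z in TT) (G z * cos (k%:R * z)) + sin (k%:R * z0) * \int[mu]_(z in TT) (G z * sin (k%:R * z)).
    rewrite -(RintZ_TT (cos (k%:R * z0))); last exact: cont_on_TT.
    rewrite -(RintZ_TT (sin (k%:R * z0))); last exact: cont_on_TT.
    rewrite -RintegralD//; last 2 first.
    - by apply: intgZ_on => //; exact: cont_on_TT.
    - by apply: intgZ_on => //; exact: cont_on_TT.
    by apply: eq_Rintegral => z _; rewrite mulrBr cosB; ring.
  apply: le_trans (ler_normD _ _) _; rewrite !normrM; have -> : 2 * s k = s k + s k by ring.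
  apply: lerD.
    apply: le_trans (hc k); rewrite ler_piMl// ler_norml cos_geN1 cos_le1//.
  by apply: le_trans (hs k); rewrite ler_piMl// ler_norml sin_geN1 sin_le1.
have -> : \int[mu]_(z in TT) (G z * fejer n (z0 - z)) =
  \sum_(j < n) \sum_(k < n) \int[mu]_(z in TT) (G z * cos ((natdist j k)%:R * (z0 - z))).
  under eq_Rintegral do rewrite fejerE mulr_sumr.
  rewrite (Rint_TT_sum n (h := fun j z => G z * \sum_(k < n) cos ((natdist j k)%:R * (z0 - z))) _).2; last first.
    move=> j z; apply: cvgM; first exact: cG.
    by apply: (Rint_TT_sum 0 (h := fun k z => cos ((natdist j k)%:R * (z0 - z))) _).1 => k; exact: cos_aff_cont.
  apply: eq_bigr => j _; under eq_Rintegral do rewrite mulr_sumr.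
  by rewrite (Rint_TT_sum n (h := fun k z => G z * cos ((natdist j k)%:R * (z0 - z))) _).2.
rewrite exchange_big/=; apply: le_trans (ler_norm_sum _ _ _) _.
have -> : n%:R * (4 * \sum_(k < n) s k) = \sum_(k < n) (4 * \sum_(k < n) s k) by rewrite sumr_const card_ord mulr_natl.
apply: ler_sum => k _.
apply: le_trans (ler_norm_sum _ _ _) _.
have := sum_natdist s0 (ltn_ord k).
have : \sum_(i < n) `|\int[mu]_(z in TT) (G z * cos ((natdist i k)%:R * (z0 - z)))| <= 2 * \sum_(i < n) s (natdist i k).
  by rewrite mulr_sumr; apply: ler_sum => i _; exact: one.
lra.
Qed.

(** Near [z0] continuity makes the difference small. Elsewhere on the period [2
    - 2 cos (z0 - z)] is bounded below, because an interior point [z0] stays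
    away from its translates. *)
Lemma fejer_modulus G z0 e : continuous G -> 0 < z0 < 2 * pi -> 0 < e ->
  exists2 kap, 0 <= kap & forall z, TT z -> `|G z0 - G z| <= e + kap * (2 - 2 * cos (z0 - z)).
Proof.
move=> cG /andP[z00 z02] e0.
have [M HM] := cont_bounded_itv 0 (2 * pi) cG.
have /cvgrPdist_le /(_ e e0) [d0 /= d00 Hd0] := cG z0.
pose d := Num.min (d0 / 2) (Num.min z0 (2 * pi - z0)).
have d_gt0 : 0 < d by rewrite !lt_min divr_gt0//= z00 subr_gt0.
have d_d0 : d < d0 by rewrite gt_min ltr_pdivrMr// mulr_natr mulr2n ltrDr d00.
have d_z0 : d <= z0 by rewrite /d !ge_min lexx !orbT.
have d_z2 : d <= 2 * pi - z0 by rewrite /d !ge_min lexx !orbT.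
have pi0 := pi_gt0 R.
have dpi : d <= pi by lra.
have c0 : 0 < 2 - 2 * cos d.
  have : cos d < cos 0 by rewrite ltr_cos// in_itv/= ?lexx ?pi_ge0 ?(ltW d_gt0).
  rewrite cos0; lra.
have M0 : 0 <= M by apply: le_trans (normr_ge0 _) (HM 0 _); rewrite lexx ltW// twopi_gt0.
exists (2 * M / (2 - 2 * cos d)); first by rewrite divr_ge0 ?mulr_ge0// ltW.
move=> z; rewrite /= in_itv/= => /andP[z1 z2].
have cge : 0 <= 2 - 2 * cos (z0 - z) by have := cos_le1 (z0 - z); lra.
have [zd|zd] := ltP `|z0 - z| d0.
  apply: le_trans (Hd0 z zd) _; rewrite lerDl mulr_ge0// divr_ge0 ?mulr_ge0// ltW.
have dz : d <= `|z0 - z| by apply: ltW; exact: lt_le_trans zd.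
have lz : `|z0 - z| <= 2 * pi - d by rewrite ler_norml; apply/andP; split; lra.
have cosle : cos (z0 - z) <= cos d.
  have -> : cos (z0 - z) = cos `|z0 - z| by case: (ger0P (z0 - z)) => // _; rewrite cosN.
  move: dz lz; move: `|z0 - z| => y dz lz.
  have [yp|py] := leP y pi.
    rewrite leNgt ltr_cos ?in_itv/= -?leNgt// ?(ltW d_gt0) ?dpi// yp andbT; lra.
  have -> : cos y = cos (2 * pi - y).
    by rewrite mulr_natl [RHS]cosB cos2pi sin2pi mul1r mul0r addr0.
  rewrite leNgt ltr_cos ?in_itv/= -?leNgt ?(ltW d_gt0) ?dpi//; last by apply/andP; split; lra.
  lra.
have zz : 0 <= z0 <= 2 * pi by rewrite !ltW.
have h1 := HM z0 zz; have h2 := HM z ltac:(by rewrite z1 z2).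
apply: (@le_trans _ _ (2 * M)).
  by have := ler_normB (G z0) (G z); lra.
rewrite -[leLHS]add0r; apply: lerD; first exact: ltW.
rewrite mulrAC ler_pdivlMr// ler_wpM2l ?mulr_ge0//; lra.
Qed.

(** Fejer's theorem as a sup bound: a continuous function is bounded by the sum
    of its Fourier coefficients. Relative to the mass of the kernel, the error
    made at [z0] is at most [e'] plus a term of order [1 / n], by
    [fejer_modulus] and [fejer_decay]. *)
Lemma fejer_sup G s B z0 : continuous G -> (forall k, 0 <= s k) ->
  (forall k, `|\int[mu]_(z in TT) (G z * cos (k%:R * z))| <= s k) ->
  (forall k, `|\int[mu]_(z in TT) (G z * sin (k%:R * z))| <= s k) ->
  (forall n, \sum_(k < n) s k <= B) -> 0 < z0 < 2 * pi ->
  `|G z0| * (2 * pi) <= 4 * B.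
Proof.
move=> cG s0 hc hs sB zz; have p0 : 0 < 2 * pi :> R := twopi_gt0.
apply/ler_addgt0Pr => e e0.
pose e' := e / (2 * (2 * pi)).
have e'0 : 0 < e' by rewrite divr_gt0// mulr_gt0.
have [kap kap0 Hk] := fejer_modulus cG zz e'0.
pose n := (Num.bound (kap * 4 * (2 * pi) / (e / 2))).+1.
have hn : kap * 4 * (2 * pi) <= n%:R * (e / 2).
  have e20 : 0 < e / 2 by rewrite divr_gt0.
  rewrite -ler_pdivrMr// (le_trans (ltW (archi_boundP _)))//; last by rewrite ler_nat leqnSn.
  by apply: divr_ge0; [rewrite !mulr_ge0// pi_ge0|exact: ltW].
have n0 : 0 < (n%:R : R) by rewrite ltr0n.
have cF := @fejer_aff_cont n z0.
have cGF : continuous (fun z => G z * fejer n (z0 - z)) by move=> z; apply: cvgM; [exact: cG|exact: cF].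
have cDF : continuous (fun z => (G z0 - G z) * fejer n (z0 - z)).
  by move=> z; apply: cvgM; [apply: cvgB; [exact: cvg_cst|exact: cG]|exact: cF].
have E : G z0 * (n%:R * (2 * pi)) = \int[mu]_(z in TT) (G z * fejer n (z0 - z)) + \int[mu]_(z in TT) ((G z0 - G z) * fejer n (z0 - z)).
  rewrite -(fejer_mass n z0) -RintZ_TT; last exact: cont_on_TT.
  rewrite -RintegralD//; [|exact: cont_on_TT|exact: cont_on_TT].
  by apply: eq_Rintegral => z _; ring.
have D : `|\int[mu]_(z in TT) ((G z0 - G z) * fejer n (z0 - z))| <= e' * (n%:R * (2 * pi)) + kap * 4 * (2 * pi).
  apply: le_trans (le_normr_Rintegral _ (cont_on_TT cDF)) _ => //.
  rewrite -(fejer_mass n z0) -RintZ_TT; last exact: cont_on_TT.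
  rewrite -Rint_TT_cst -RintegralD//; last 2 first.
  - by apply: intgZ_on => //; exact: cont_on_TT.
  - exact: intg_cst_itv.
  apply: le_Rintegral => //.
  - by have := integrable_norm (cont_on_TT cDF).
  - apply: intgD_on => //; last exact: intg_cst_itv.
    by apply: intgZ_on => //; exact: cont_on_TT.
  move=> z Tz; rewrite normrM (ger0_norm (fejer_ge0 _ _)).
  apply: le_trans (ler_wpM2r (fejer_ge0 _ _) (Hk z Tz)) _.
  rewrite mulrDl lerD2l -!mulrA ler_wpM2l// mulrC; exact: fejer_decay.
have C := fejer_coef n z0 cG s0 hc hs.
have C2 : n%:R * (4 * \sum_(k < n) s k) <= n%:R * (4 * B) by rewrite ler_pM2l// ler_pM2l.
rewrite -(ler_pM2l n0).
have -> : n%:R * (`|G z0| * (2 * pi)) = `|G z0 * (n%:R * (2 * pi))|.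
  by rewrite normrM (ger0_norm (mulr_ge0 (ltW n0) (ltW p0))); ring.
rewrite E; apply: le_trans (ler_normD _ _) _.
have h : e' * (n%:R * (2 * pi)) = n%:R * (e / 2).
  by rewrite /e'; move: (2 * pi) p0 => p p0; field; rewrite gt_eqF.
have D2 := le_trans D (lerD (lexx _) hn); rewrite h in D2.
apply: le_trans (lerD (le_trans C C2) D2) _.
by rewrite le_eqVlt; apply/orP; left; apply/eqP; field.
Qed.
End Fejer.

(** * The space X embeds into the bounded functions *)

Section XSup.
Context {R : realType}.
Local Notation C := R[i].
Local Notation mu := (@lebesgue_measure R).
Local Notation TT := (`[0%R, (2 * pi)%R]%classic : set R).
Implicit Types (x z e : R) (g : R -> R -> R) (m n k : nat).

(** What remains of membership in X once the norm is treated separately: enough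
    for the sup bound, and stable under linear combinations. *)
Definition goodX g := [/\ continuous (fun p : R * R => g p.1 p.2), (forall x, periodic2pi (fun z => g z x)),
  (forall z, periodic2pi (g z)) & forall i, Hper 1 (zcoef g i)].

Lemma inX_good g : inX g -> goodX g.
Proof.
move=> [cg pz px [_ [H _] _]]; by split.
Qed.

Lemma goodX_eps g z x e : goodX g -> 0 < e -> exists2 d, 0 < d & forall z' x', `|z' - z| < d -> `|x' - x| < d -> `|g z' x' - g z x| < e.
Proof.
move=> [cg _ _ _] e0; have /cvgrPdist_lt /(_ e e0) := cg (z, x).
move=> [[A B] /= [[d1 d10 H1] [d2 d20 H2]] AB].
exists (Num.min d1 d2); first by rewrite lt_min d10.
move=> z' x'; rewrite !lt_min => /andP[h1 _] /andP[_ h2].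
rewrite distrC; apply: (AB (z', x')); split; [apply: H1|apply: H2]; by rewrite /= distrC.
Qed.

Lemma goodX_z g (x : R) : goodX g -> forall z : R, {for z, continuous (fun z => g z x)}.
Proof.
move=> Hg z; apply/cvgrPdist_lt => e e0; have [d d0 H] := goodX_eps z x Hg e0.
exists d => // z' /=; rewrite distrC => h; rewrite distrC; apply: H => //.
by rewrite subrr normr0.
Qed.

Lemma goodX_x g (z : R) : goodX g -> forall x : R, {for x, continuous (g z)}.
Proof.
move=> Hg x; apply/cvgrPdist_lt => e e0; have [d d0 H] := goodX_eps z x Hg e0.
exists d => // x' /=; rewrite distrC => h; rewrite distrC; apply: H => //.
by rewrite subrr normr0.
Qed.

Lemma zcos_cont g i x : goodX g -> continuous (fun z => g z x * cos (i * z)).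
Proof.
move=> Hg z; apply: cvgM; first exact: (@goodX_z g x Hg z).
apply: (continuous_comp (f := fun z => i * z)); last exact: continuous_cos.
by apply: cvgM; [exact: cvg_cst|exact: cvg_id].
Qed.

Lemma zsin_cont g i x : goodX g -> continuous (fun z => g z x * sin (i * z)).
Proof.
move=> Hg z; apply: cvgM; first exact: (@goodX_z g x Hg z).
apply: (continuous_comp (f := fun z => i * z)); last exact: continuous_sin.
by apply: cvgM; [exact: cvg_cst|exact: cvg_id].
Qed.

Lemma zcoefE g (i : int) x : goodX g -> zcoef g i x =
  (((2 * pi)^-1 * \int[mu]_(z in TT) (g z x * cos (i%:~R * z)))
   +i* (- ((2 * pi)^-1 * \int[mu]_(z in TT) (g z x * sin (i%:~R * z)))))%C.
Proof.
move=> Hg.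
have e1 : \int[mu]_(z in TT) complex.Re ((g z x)%:C%C * cis (- (i%:~R * z))) = \int[mu]_(z in TT) (g z x * cos (i%:~R * z)).
  by apply: eq_Rintegral => z _; rewrite /= cosN mul0r subr0.
have e2 : \int[mu]_(z in TT) complex.Im ((g z x)%:C%C * cis (- (i%:~R * z))) = - (\int[mu]_(z in TT) (g z x * sin (i%:~R * z))).
  rewrite -[RHS]mulN1r -RintZ_TT; last by apply: cont_on_TT; exact: zsin_cont.
  by apply: eq_Rintegral => z _; rewrite /= sinN mul0r addr0; ring.
by rewrite /zcoef /cint e1 e2; apply: complexP; rewrite /=; ring.
Qed.

Lemma goodX_lin g1 g2 (c : R) : goodX g1 -> goodX g2 -> goodX (fun z x => g1 z x + c * g2 z x).
Proof.
move=> H1 H2; have [c1 z1 x1 h1] := H1; have [c2 z2 x2 h2] := H2; split.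
- by move=> p; apply: cvgD; [exact: c1|apply: cvgM; [exact: cvg_cst|exact: c2]].
- by move=> x z; rewrite z1 z2.
- by move=> z x; rewrite x1 x2.
move=> i; rewrite (_ : zcoef _ i = fun x => zcoef g1 i x + (c%:C)%C * zcoef g2 i x).
  exact: Hper1_lin.
apply/funext => x; rewrite (zcoefE i x H1) (zcoefE i x H2) /zcoef /cint.
have e1 : \int[mu]_(z in TT) complex.Re ((g1 z x + c * g2 z x)%:C%C * cis (- (i%:~R * z))) =
    \int[mu]_(z in TT) (g1 z x * cos (i%:~R * z)) + c * \int[mu]_(z in TT) (g2 z x * cos (i%:~R * z)).
  rewrite -RintZ_TT; last by apply: cont_on_TT; exact: zcos_cont.
  rewrite -RintegralD//; last 2 first.
  - by apply: cont_on_TT; exact: zcos_cont.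
  - by apply: intgZ_on => //; apply: cont_on_TT; exact: zcos_cont.
  by apply: eq_Rintegral => z _; rewrite /= cosN; ring.
have e2 : \int[mu]_(z in TT) complex.Im ((g1 z x + c * g2 z x)%:C%C * cis (- (i%:~R * z))) =
    (-1) * \int[mu]_(z in TT) (g1 z x * sin (i%:~R * z)) + (- c) * \int[mu]_(z in TT) (g2 z x * sin (i%:~R * z)).
  rewrite -RintZ_TT; last by apply: cont_on_TT; exact: zsin_cont.
  rewrite -RintZ_TT; last by apply: cont_on_TT; exact: zsin_cont.
  rewrite -RintegralD//; last 2 first.
  - by apply: intgZ_on => //; apply: cont_on_TT; exact: zsin_cont.
  - by apply: intgZ_on => //; apply: cont_on_TT; exact: zsin_cont.
  by apply: eq_Rintegral => z _; rewrite /= sinN; ring.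
by rewrite e1 e2; apply: complexP; rewrite /=; ring.
Qed.

Lemma sqmod_ge0 (w : C) : 0 <= sqmod w.
Proof. by rewrite addr_ge0 ?sqr_ge0. Qed.

Lemma Hnorm2_ge0 s (h : R -> C) : 0 <= Hnorm2 s h.
Proof.
by apply: sumr_ge0 => j _; apply: Rintegral_ge0 => x _; exact: sqmod_ge0.
Qed.

Lemma lnorm2_ge0 (I : choiceType) (m : I -> int) k s (h : I -> R -> C) : (0 <= lnorm2 m k s h)%E.
Proof.
apply: esum_ge0 => i _; rewrite lee_fin mulr_ge0 ?Hnorm2_ge0// exprn_ge0// addr_ge0// sqr_ge0 //.
Qed.

Lemma Xnorm_modes g e n : 0 <= e -> (Xnorm g <= e%:E)%E ->
  \sum_(k < n) (1 + k%:R ^+ 2) * Hnorm2 1 (zcoef g k%:Z) <= e ^+ 2.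
Proof.
move=> e0; have -> : e%:E = sqrte (e%:E ^+ 2) by rewrite sqrte_sqr gee0_abs// lee_fin.
rewrite /Xnorm lee_sqrt; last by rewrite -EFin_expe lee_fin sqr_ge0.
rewrite -EFin_expe => h; rewrite -lee_fin; apply: le_trans h.
have l0 := lnorm2_ge0; apply: (@le_trans _ _ (lnorm2 id 1 1 (zcoef g))); last first.
  by apply: le_trans (leeDl _ _); [exact: leeDr|exact: l0].
apply: esum_ge; exists (Posz @` `I_n).
  by split => //; apply: finite_image; exact: finite_II.
rewrite fsbig_image; last by move=> i j _ _ [].
rewrite -fsbig_ord sumEFin lee_fin; apply: ler_sum => k _.
by rewrite expr1.
Qed.

(** By induction, the first [m + 1] terms add up to at most [3 - 2 / (m + 1)]. *)
Lemma inv_sq_sum n : \sum_(k < n) (1 + k%:R ^+ 2)^-1 <= 3 :> R.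
Proof.
have H m : \sum_(k < m.+1) (1 + k%:R ^+ 2)^-1 <= 3 - 2 / m.+1%:R :> R.
  elim: m => [|m IH]; first by rewrite big_ord_recr/= big_ord0 expr0n/= addr0 invr1; lra.
  rewrite big_ord_recr/=; apply: le_trans (lerD IH (lexx _)) _.
  have m0 : 0 < (m.+1%:R : R) by rewrite ltr0n.
  rewrite -[m.+2%:R]natr1; move: (m.+1%:R : R) m0 => t t0.
  rewrite -subr_ge0.
  have -> : 3 - 2 / (t + 1) - (3 - 2 / t + (1 + t ^+ 2)^-1) = (t ^+ 2 - t + 2) / (t * (t + 1) * (1 + t ^+ 2)).
    by field; rewrite !gt_eqF//; first [lra|nra].
  rewrite divr_ge0//; first by nra.
  by rewrite !mulr_ge0 ?addr_ge0 ?sqr_ge0// ltW.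
case: n => [|m]; first by rewrite big_ord0.
by apply: le_trans (H m) _; rewrite gerBl divr_ge0.
Qed.

Lemma ae_cont_le (h : R -> R) c : continuous h -> {ae mu, forall x, h x <= c} -> forall x, h x <= c.
Proof.
move=> ch hc; have cm : continuous (fun x => Num.max (h x) c).
  by move=> x; apply: continuous_max; [exact: ch|exact: cvg_cst].
have cc : continuous (fun x : R => c) by move=> x; exact: cvg_cst.
have E := cont_ae_eq cm cc (ae1S (fun x hx => max_idPr hx) hc).
by move=> x; have <- := congr1 (fun f : R -> R => f x) E; rewrite le_max lexx.
Qed.

Definition X_cst : R := 16 * sobolev_cst.

(** In [z] the function is bounded by the sum of its Fourier coefficients, and
    in [x] each coefficient is bounded by its H^1 norm. The sum of these norms
    is controlled by the norm of X through Cauchy-Schwarz with the weights [1 +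
    k ^+ 2]. The number [e / w k] under the root makes [s k] positive. *)
Lemma X_sup g e : goodX g -> 0 < e -> (Xnorm g <= e%:E)%E -> forall z x, `|g z x| <= X_cst * e.
Proof.
move=> Hg e0 Xe; have [cg gz gx gH] := Hg.
have p0 : 0 < 2 * pi :> R := twopi_gt0.
pose w k := (1 + k%:R ^+ 2 : R).
have w0 k : 0 < w k by rewrite ltr_wpDr ?sqr_ge0.
pose s k := Num.sqrt (Hnorm2 1 (zcoef g k%:Z) + (e / w k) ^+ 2).
have sp k : 0 < s k by rewrite sqrtr_gt0 ltr_wpDl ?Hnorm2_ge0// exprn_gt0// divr_gt0.
have s2 k : s k ^+ 2 = Hnorm2 1 (zcoef g k%:Z) + (e / w k) ^+ 2.
  by rewrite sqr_sqrtr// addr_ge0 ?Hnorm2_ge0// sqr_ge0.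
(* The difference of the two sides is a multiple of [(w k * s k - e) ^+ 2]. *)
have sle k : s k <= 2^-1 * (w k * Hnorm2 1 (zcoef g k%:Z) / e + 2 * e * (w k)^-1).
  have -> : Hnorm2 1 (zcoef g k%:Z) = s k ^+ 2 - (e / w k) ^+ 2 by rewrite s2 addrK.
  rewrite -subr_ge0; have -> : 2^-1 * (w k * (s k ^+ 2 - (e / w k) ^+ 2) / e + 2 * e * (w k)^-1) - s k =
    (w k * s k - e) ^+ 2 / (2 * w k * e) by field; rewrite !gt_eqF.
  by rewrite divr_ge0 ?sqr_ge0// !mulr_ge0// ltW.
have ssum n : \sum_(k < n) s k <= 4 * e.
  apply: le_trans (ler_sum _ (fun (k : 'I_n) _ => sle k)) _.
  rewrite -mulr_sumr big_split/= -mulr_suml -mulr_sumr.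
  have h1 := Xnorm_modes n (ltW e0) Xe; have h2 := inv_sq_sum n.
  have h3 : (\sum_(k < n) w k * Hnorm2 1 (zcoef g k%:Z)) / e <= e by rewrite ler_pdivrMr// -expr2.
  have h4 : 2 * e * \sum_(k < n) (w k)^-1 <= 2 * e * 3 by rewrite ler_pM2l ?mulr_gt0.
  lra.
have modes : {ae mu, forall x, forall k : nat, `|complex.Re (zcoef g k%:Z x)| <= sobolev_cst * s k /\
     `|complex.Im (zcoef g k%:Z x)| <= sobolev_cst * s k}.
  apply: (@ae_foralln _ _ _ mu (fun k x => `|complex.Re (zcoef g k%:Z x)| <= sobolev_cst * s k /\
     `|complex.Im (zcoef g k%:Z x)| <= sobolev_cst * s k)) => k.
  by apply: Hper1_sup => //; rewrite s2 lerDl sqr_ge0.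
have inside z : 0 < z < 2 * pi -> forall x, `|g z x| <= X_cst * e.
  move=> zz; apply: (@ae_cont_le (fun x => `|g z x|)).
    by move=> x; apply: cvg_norm; exact: (@goodX_x g z Hg x).
  apply: ae1S modes => x Hx.
  have S0 := @sobolev_cst_ge0 R.
  have := @fejer_sup R (fun z => g z x) (fun k => 2 * pi * (sobolev_cst * s k)) (2 * pi * (sobolev_cst * (4 * e))) z
    (@goodX_z g x Hg).
  move=> /(_ _ _ _ _ zz).
  have -> : `|g z x| * (2 * pi) <= 4 * (2 * pi * (sobolev_cst * (4 * e))) = (`|g z x| <= X_cst * e).
    rewrite (_ : 4 * _ = X_cst * e * (2 * pi)) ?ler_pM2r// /X_cst; ring.
  apply.
  - by move=> k; exact: mulr_ge0 (ltW p0) (mulr_ge0 S0 (ltW (sp k))).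
  - move=> k; have [h _] := Hx k; move: h; rewrite (zcoefE _ _ Hg)/= normrM gtr0_norm ?invr_gt0//.
    by rewrite ler_pdivrMl.
  - move=> k; have [_ h] := Hx k; move: h; rewrite (zcoefE _ _ Hg)/= normrN normrM gtr0_norm ?invr_gt0//.
    by rewrite ler_pdivrMl.
  - move=> n; have -> : \sum_(k < n) 2 * pi * (sobolev_cst * s k) = 2 * pi * (sobolev_cst * \sum_(k < n) s k).
      by rewrite -mulr_sumr -mulr_sumr.
    by apply: ler_wpM2l (ltW p0) _ _ _; exact: ler_wpM2l.
(* The end points of the period are not interior, and are reached by continuity. *)
have at0 x : `|g 0 x| <= X_cst * e.
  apply/ler_addgt0Pr => d d0.
  have /cvgrPdist_le /(_ d d0) [r /= r0 Hr] := @goodX_z g x Hg 0.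
  pose z := Num.min r (2 * pi) / 2.
  have m0 : 0 < Num.min r (2 * pi) by rewrite lt_min r0.
  have z0 : 0 < z by rewrite divr_gt0.
  have zm : z < Num.min r (2 * pi) by rewrite /z ltr_pdivrMr// mulr_natr mulr2n ltrDr.
  move: zm; rewrite lt_min => /andP[zr z2].
  have h1 := inside z ltac:(by rewrite z0 z2) x.
  have := Hr z; rewrite /= sub0r normrN gtr0_norm// => /(_ zr) h2.
  have := ler_normD (g 0 x - g z x) (g z x); rewrite subrK; lra.
move=> z x; have [y + Hy] := per_reduce z; have -> : g z x = g y x := Hy _ (fun z => g z x) (gz x).
rewrite /= in_itv/= => /andP[]; rewrite le_eqVlt => /orP[/eqP <- _|y0]; first exact: at0.
rewrite le_eqVlt => /orP[/eqP ->|y2]; last by apply: inside; rewrite y0.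
by have := gz x 0; rewrite add0r => ->.
Qed.
End XSup.

(** * Differentiability of profiles and of weak solutions *)

Section C2Profile.
Context {R : realType}.
Local Notation mu := (@lebesgue_measure R).
Implicit Types (x z e xi eta : R) (w : R -> R -> R -> R).

Lemma near_ereal0 (F : set_system R) (h : R -> \bar R) e : 0 < e -> h @ F --> 0%E -> F [set y | (h y <= e%:E)%E].
Proof.
move=> e0 H; have := H [set y | (y <= e%:E)%E]; apply.
exists e => //= y /=; rewrite sub0r normrN lee_fin => h1.
by apply: ltW; apply: le_lt_trans h1; exact: ler_norm.
Qed.

(** The difference quotients converge in X, hence uniformly. *)
Lemma C2X_sup w : C2X setT w -> exists w1, [/\ forall xi, goodX (w xi), forall xi, goodX (w1 xi) &
  forall xi e, 0 < e -> exists2 d, 0 < d & forall eta z x, `|eta - xi| < d ->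
    `|w eta z x - w xi z x - (eta - xi) * w1 xi z x| <= e * `|eta - xi|].
Proof.
move=> [w1 [w2 [Hin D1 _ _]]]; exists w1.
have g0 xi : goodX (w xi) by apply: inX_good; case: (Hin xi I).
have g1 xi : goodX (w1 xi) by apply: inX_good; case: (Hin xi I).
split=> // xi e e0.
have S0 : 0 < @X_cst R + 1 by rewrite ltr_wpDl// mulr_ge0// sobolev_cst_ge0.
have e1 : 0 < e / (X_cst + 1) by rewrite divr_gt0.
have [d /= d0 Hd] := near_ereal0 e1 (D1 xi I).
exists d => // eta z x h.
have [->|ne] := eqVneq eta xi; first by rewrite !subrr mul0r normr0 mulr0 subrr normr0.
have hd : eta - xi != 0 by rewrite subr_eq0.
have gD : goodX (fun z x => (eta - xi)^-1 * (w eta z x - w xi z x) - w1 xi z x).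
  have a1 := goodX_lin (- 2) (g1 xi) (g1 xi).
  have a2 := goodX_lin (eta - xi)^-1 a1 (goodX_lin (-1) (g0 eta) (g0 xi)).
  rewrite (_ : (fun z x => _) = (fun z x => w1 xi z x + - 2 * w1 xi z x + (eta - xi)^-1 * (w eta z x + -1 * w xi z x)))//.
  by apply/funext => z'; apply/funext => x'; ring.
have := X_sup gD e1 (Hd eta _ _ _); rewrite /= distrC => /(_ h ne I z x) H.
have -> : w eta z x - w xi z x - (eta - xi) * w1 xi z x =
  (eta - xi) * ((eta - xi)^-1 * (w eta z x - w xi z x) - w1 xi z x) by field.
rewrite normrM mulrC ler_wpM2r//; apply: le_trans H _.
by rewrite mulrA ler_pdivrMr// mulrC ler_pM2l// lerDl.
Qed.

(** Joint continuity in the three variables follows from continuity in [(z, x)]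
    for each [xi] and the uniform derivative in [xi]. *)
Lemma C2X_joint w w1 xi z x e : (forall xi, goodX (w xi)) -> (forall xi, goodX (w1 xi)) ->
  (forall xi e, 0 < e -> exists2 d, 0 < d & forall eta z x, `|eta - xi| < d ->
    `|w eta z x - w xi z x - (eta - xi) * w1 xi z x| <= e * `|eta - xi|) -> 0 < e ->
  exists2 d, 0 < d & forall eta z' x', `|eta - xi| < d -> `|z' - z| < d -> `|x' - x| < d ->
    `|w eta z' x' - w xi z x| <= e.
Proof.
move=> g0 g1 D e0; have e2 : 0 < e / 2 by rewrite divr_gt0.
have [d1 d10 H1] := goodX_eps z x (g0 xi) e2.
have [d2 d20 H2] := goodX_eps z x (g1 xi) ltr01.
have [d3 d30 H3] := D xi 1 ltr01.
pose M := `|w1 xi z x| + 2; have M0 : 0 < M by rewrite ltr_wpDl.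
exists (Num.min (Num.min d1 d2) (Num.min d3 (e / 2 / M))).
  by rewrite !lt_min d10 d20 d30 divr_gt0.
move=> eta z' x'; rewrite !lt_min => /andP[_ /andP[h3 h4]] /andP[/andP[k1 k2] _] /andP[/andP[m1 m2] _].
have a1 := H1 z' x' k1 m1; have a2 := H2 z' x' k2 m2; have a3 := H3 eta z' x' h3.
have a4 : `|eta - xi| * M <= e / 2 by rewrite -ler_pdivlMr// ltW.
have b1 : `|w1 xi z' x'| <= `|w1 xi z x| + 1.
  by have := ler_normD (w1 xi z' x' - w1 xi z x) (w1 xi z x); rewrite subrK; lra.
have b2 : `|eta - xi| * `|w1 xi z' x'| <= `|eta - xi| * (`|w1 xi z x| + 1) by apply: ler_wpM2l.
have b3 : `|w eta z' x' - w xi z' x'| <= `|eta - xi| * M.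
  have := ler_normD (w eta z' x' - w xi z' x' - (eta - xi) * w1 xi z' x') ((eta - xi) * w1 xi z' x').
  rewrite subrK normrM /M; move: a3 b2; rewrite mul1r !mulrDr mulr1; lra.
have := ler_normD (w eta z' x' - w xi z' x') (w xi z' x' - w xi z x).
rewrite addrA subrK; lra.
Qed.
End C2Profile.

Section CharAe.
Context {R : realType}.
Local Notation mu := (@lebesgue_measure R).
Local Notation mu2 := (mu \x mu)%E.
Local Notation RR := (measurableTypeR R * measurableTypeR R)%type.
Local Notation I1 A := (\1_(A%classic : set R) : R -> R).

Lemma ae_charinv (s : R) (S : R * R -> Prop) : s * s = 1 -> {ae mu2, forall p, S p} -> {ae mu2, forall q : RR, S (charinv s q)}.
Proof.
move=> ss [N [mN N0 sN]]; exists (charinv s @^-1` N); split.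
- rewrite -[X in measurable X]setTI; exact: (measurable_charinv s).
- by rewrite mu2_charinv_preimage// N0 mule0.
- by move=> q /= nS; apply: sN.
Qed.

(** Truncation turns a bound that holds almost everywhere into one that holds
    everywhere. *)
Definition clip (K y : R) := Num.max (- K) (Num.min K y).

Lemma clip_le K y : 0 <= K -> `|clip K y| <= K.
Proof.
move=> K0; rewrite ler_norml /clip le_max lexx/= ge_max ge_min lexx andbT; lra.
Qed.

Lemma clip_id K y : `|y| <= K -> clip K y = y.
Proof.
rewrite ler_norml => /andP[h1 h2]; rewrite /clip (min_idPr h2); exact/max_idPr.
Qed.

Lemma measurable_clip (f : RR -> R) K : measurable_fun setT f -> measurable_fun setT (fun q => clip K (f q)).
Proof. by move=> mf; apply: measurable_maxr => //; apply: measurable_minr. Qed.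

(** A continuous weak solution with bounded right-hand side satisfies the
    hypotheses of [square_derive] in characteristic coordinates; the second
    edge is obtained from [char_box] with the sign [-1], that is by reversing
    time. *)
Lemma wave_time_derivative al be M Om (u f : R * R -> R) : al < be -> 0 <= M ->
  charbox 1 al be al be `<=` Om -> weak_wave Om u f ->
  (forall p, charbox 1 al be al be p -> {for p, continuous u}) ->
  {ae mu2, forall p, charbox 1 al be al be p -> `|f p| <= M} ->
  {ae mu, forall x, al < x < be -> exists l, forall e, 0 < e -> exists2 dl, 0 < dl & forall t, `|t| < dl ->
    `|u (x, t) - u (x, 0) - l * t| <= e * `|t|}.
Proof.
move=> albe M0 sub Wu cu fM.
pose F0 (q : RR) := f (charinv 1 q) * (I1 `[al, be] q.1 * I1 `[al, be] q.2).
pose F q := clip M (F0 q).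
have one : (1 : R) * 1 = 1 by rewrite mul1r.
have [F0i _ E1] := char_box one albe albe sub Wu cu.
have mF0 : measurable_fun setT F0 by exact: (intg_measurable F0i).
have mF : measurable_fun setT F by exact: measurable_clip.
have FM q : `|F q| <= M * (I1 `[al, be] q.1 * I1 `[al, be] q.2).
  rewrite /F /F0 !indic_itvE; case: (q.1 \in _); case: (q.2 \in _);
    rewrite ?(mulr0, mul0r, mulr1) ?clip_le//; by rewrite clip_id ?normr0.
have FF0 : {ae mu2, forall q, F q = F0 q}.
  apply: filterS (ae_charinv one fM) => q Hq; rewrite /F clip_id// /F0 !indic_itvE.
  case: (boolP (q.1 \in _)) => h1; last by rewrite mul0r mulr0 normr0.
  case: (boolP (q.2 \in _)) => h2; last by rewrite !mulr0 normr0.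
  by rewrite !mulr1; apply: Hq; rewrite charboxE//; exists q.
have subbox a b c d : al <= a -> b <= be -> al <= c -> d <= be -> charbox 1 a b c d `<=` charbox 1 al be al be.
  by move=> ha hb hc hd p [/andP[h1 h2] /andP[h3 h4]]; split; apply/andP; split; clear - ha hb hc hd h1 h2 h3 h4; lra.
have rect a b c d : al <= a -> a < b -> b <= be -> al <= c -> c < d -> d <= be ->
  (u \o charinv 1) (a, c) - (u \o charinv 1) (a, d) - (u \o charinv 1) (b, c) + (u \o charinv 1) (b, d) =
  - 4^-1 * \int[mu2]_q (F q * (I1 `]a, b[ q.1 * I1 `]c, d[ q.2)).
  move=> ha ab hb hc cd hd; have sb := subbox a b c d ha hb hc hd.
  have [_ -> _] := char_box one ab cd (subset_trans sb sub) Wu (fun p Kp => cu p (sb p Kp)).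
  congr (_ * _).
  transitivity (\int[mu2]_q (F0 q * (I1 `]a, b[ q.1 * I1 `]c, d[ q.2))).
    apply: eq_Rintegral => q _; rewrite /F0 -!mulrA; congr (_ * _); rewrite !indic_itvE !in_itv/=.
    case: (ltP a q.1) => k1; case: (ltP q.1 b) => k2; case: (ltP c q.2) => k3; case: (ltP q.2 d) => k4;
      rewrite /= ?(mulr1, mulr0)//.
    by rewrite (le_trans ha (ltW k1)) (le_trans (ltW k2) hb) (le_trans hc (ltW k3)) (le_trans (ltW k4) hd) !mulr1.
  have mI : measurable_fun setT (fun q : RR => I1 `]a, b[ q.1 * I1 `]c, d[ q.2).
    by apply: measurable_funM; [exact: measurable_indic_fst|exact: measurable_indic_snd].
  apply: eq_Rint_ae; [exact: measurable_funM|exact: measurable_funM|].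
  by apply: filterS FF0 => q ->.
have edge1 : exists2 q : R -> R, mu.-integrable setT (EFin \o q) &
  forall x, al < x <= be -> (u \o charinv 1) (x, al) - (u \o charinv 1) (al, al) = \int[mu]_s (q s * I1 `]al, x[ s).
  exact: E1.
have edge2 : exists2 q : R -> R, mu.-integrable setT (EFin \o q) &
  forall x, al < x <= be -> (u \o charinv 1) (al, x) - (u \o charinv 1) (al, al) = \int[mu]_s (q s * I1 `]al, x[ s).
  (* For the sign [-1] the two characteristic coordinates are exchanged. *)
  have m1 : (-1 : R) * -1 = 1 by rewrite mulrNN mul1r.
  have inv x y : charinv (-1) (x, y) = charinv 1 (y, x) :> R * R.
    by rewrite /charinv/=; congr pair; field.
  have box : charbox (-1) al be al be `<=` charbox 1 al be al be.
    by move=> p [h1 h2]; split; move: h1 h2; rewrite !mulN1r !mul1r opprK.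
  have [_ _ [q qi Hq]] := char_box m1 albe albe (subset_trans box sub) Wu (fun p Kp => cu p (box p Kp)).
  by exists q => // x xab; have := Hq x xab; rewrite /= !inv.
have := square_derive albe M0 mF FM rect edge1 edge2.
apply: ae1S => x H xab; have [l Hl] := H xab; exists l => e e0; have [dl dl0 Hd] := Hl e e0.
exists dl => // t td; have := Hd t td; rewrite /=.
have -> : charinv 1 (x + t, x - t) = (x, t) by have := charinvK x t one; rewrite mul1r.
have -> // : charinv 1 (x, x) = (x, 0) by have := charinvK x 0 one; rewrite mulr0 addr0 subr0.
Qed.
End CharAe.

(** * The travelling profile and its velocity *)

Section Travelling.
Context {R : realType}.
Local Notation mu := (@lebesgue_measure R).
Local Notation mu2 := (mu \x mu)%E.
Local Notation RR := (measurableTypeR R * measurableTypeR R)%type.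
Implicit Types (x z e t xi eta : R).

Lemma ae_fst (S : R -> Prop) : {ae mu, forall x, S x} -> {ae mu2, forall p : RR, S p.1}.
Proof.
move=> [N [mN N0 sN]]; exists (N `*` setT); split.
- exact: measurableX.
- by rewrite product_measure1E//= N0 mul0e.
- by move=> p /= nS; split => //; exact: sN.
Qed.

Lemma ae2S (S S' : R * R -> Prop) : (forall p, S p -> S' p) ->
  {ae mu2, forall p : RR, S p} -> {ae mu2, forall p : RR, S' p}.
Proof. by move=> H [N [mN N0 sN]]; exists N; split => // p /= nS; apply: sN => /= /H. Qed.

Lemma wave_solution_weak rho r gamma Om (u : R -> R -> R) : wave_solution rho r gamma Om u ->
  exists f, weak_wave Om (fun p => u p.1 p.2) f /\
   {ae mu2, forall p : RR, Om p -> f p = gamma * r p.1 * u p.1 p.2 ^+ 3 - rho p.1 * u p.1 p.2}.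
Proof.
move=> [ux [ut [uxx [utt [H1 H2 E _]]]]].
exists (fun p => utt p - uxx p); split; first by exists ux, ut, uxx, utt.
by apply: (ae2S _ E) => p H Op; rewrite -(H Op); ring.
Qed.

Lemma X0_bounded2 (rho r : R -> R) : inX0 rho -> inX0 r ->
  exists2 M, 0 <= M & {ae mu2, forall p : RR, `|rho p.1| <= M /\ `|r p.1| <= M}.
Proof.
move=> [_ [M1 H1] _ _ _] [_ [M2 H2] _ _ _]; exists (`|M1| + `|M2|); first by rewrite addr_ge0.
apply: filterS2 (ae_fst H1) (ae_fst H2) => p h1 h2; split.
  by apply: le_trans h1 _; apply: le_trans (ler_norm _) _; rewrite lerDl.
by apply: le_trans h2 _; apply: le_trans (ler_norm _) _; rewrite lerDr.
Qed.

Section Profile.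
Variables (w w1 : R -> R -> R -> R) (c l0 om : R).
Hypothesis g0 : forall xi, goodX (w xi).
Hypothesis g1 : forall xi, goodX (w1 xi).
Hypothesis D : forall xi e, 0 < e -> exists2 d, 0 < d & forall eta z x, `|eta - xi| < d ->
    `|w eta z x - w xi z x - (eta - xi) * w1 xi z x| <= e * `|eta - xi|.

Definition carried (p : R * R) : R := w (p.1 - c * p.2) (l0 * p.1 - om * p.2) p.1.

Lemma carried_cont p : {for p, continuous carried}.
Proof.
apply/cvgrPdist_le => e e0.
have [d d0 H] := C2X_joint (p.1 - c * p.2) (l0 * p.1 - om * p.2) p.1 g0 g1 D e0.
pose K := 2 + `|c| + `|l0| + `|om|.
have K0 : 0 < K by rewrite /K !ltr_wpDr.
pose d' := d / K; have d'0 : 0 < d' by rewrite divr_gt0.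
have dK : d' * K = d by rewrite /d' divfK// gt_eqF.
exists (ball p.1 d', ball p.2 d'); first by split; exact: nbhsx_ballx.
move=> q [/= q1 q2]; rewrite /ball/= in q1 q2; rewrite distrC in q1; rewrite distrC in q2; rewrite distrC.
have n1 : `|c * (q.2 - p.2)| <= `|c| * d' by rewrite normrM ler_wpM2l// ltW.
have n2 : `|l0 * (q.1 - p.1)| <= `|l0| * d' by rewrite normrM ler_wpM2l// ltW.
have n3 : `|om * (q.2 - p.2)| <= `|om| * d' by rewrite normrM ler_wpM2l// ltW.
have [a1 a2 a3] : [/\ 0 <= `|c| * d', 0 <= `|l0| * d' & 0 <= `|om| * d'] by split; apply: mulr_ge0 (normr_ge0 _) (ltW d'0).
have E : d' * 2 + `|c| * d' + `|l0| * d' + `|om| * d' = d by rewrite -dK /K; ring.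
apply: H.
- have -> : q.1 - c * q.2 - (p.1 - c * p.2) = (q.1 - p.1) - c * (q.2 - p.2) by ring.
  by have := ler_normB (q.1 - p.1) (c * (q.2 - p.2)); lra.
- have -> : l0 * q.1 - om * q.2 - (l0 * p.1 - om * p.2) = l0 * (q.1 - p.1) - om * (q.2 - p.2) by ring.
  by have := ler_normB (l0 * (q.1 - p.1)) (om * (q.2 - p.2)); lra.
- lra.
Qed.

(** Only the [xi]-derivative of the profile is known to exist everywhere and
    uniformly, so the increment along the moving frame is split off first. *)
Lemma carried_xi_difference x e : 0 < e -> exists2 d, 0 < d & forall t, `|t| < d ->
  `|w (x - c * t) (l0 * x - om * t) x - w x (l0 * x - om * t) x + c * t * w1 x (l0 * x) x| <= e * `|t|.
Proof.
move=> e0; pose K := 1 + `|c|; have K0 : 0 < K by rewrite ltr_wpDr.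
have e20 : 0 < e / 2 / K by rewrite !divr_gt0.
have [d1 d10 H1] := D x e20.
have [d2 d20 H2] := goodX_eps (l0 * x) x (g1 x) e20.
pose K2 := 1 + `|c| + `|om|; have K20 : 0 < K2 by rewrite /K2 !ltr_wpDr.
exists (Num.min d1 d2 / K2); first by rewrite divr_gt0// lt_min d10.
move=> t; rewrite ltr_pdivlMr// lt_min => /andP[t1 t2].
have b1 : `|c * t| <= `|t| * K2 by rewrite normrM mulrC ler_wpM2l// /K2; have := normr_ge0 om; lra.
have b2 : `|om * t| <= `|t| * K2 by rewrite normrM mulrC ler_wpM2l// /K2; have := normr_ge0 c; lra.
have := H1 (x - c * t) (l0 * x - om * t) x; rewrite (_ : x - c * t - x = - (c * t)); last by ring.
rewrite normrN => /(_ (le_lt_trans b1 t1)) h1.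
have := H2 (l0 * x - om * t) x; rewrite (_ : l0 * x - om * t - l0 * x = - (om * t)); last by ring.
rewrite normrN subrr normr0 => /(_ (le_lt_trans b2 t2) d20) h2.
have h3 : `|c * t * (w1 x (l0 * x - om * t) x - w1 x (l0 * x) x)| <= `|c * t| * (e / 2 / K).
  by rewrite normrM ler_wpM2l// ltW.
have h4 : `|c * t| * (e / 2 / K) <= e / 2 * `|t|.
  have -> : `|c * t| * (e / 2 / K) = e / 2 * `|t| * (`|c| / K) by rewrite normrM; ring.
  apply: ler_piMr; first by apply: mulr_ge0 => //; apply: ltW; rewrite divr_gt0.
  by rewrite ler_pdivrMr// mul1r /K lerDr.
set A := w (x - c * t) _ _ - _ in h1 *.
have -> : A + c * t * w1 x (l0 * x) x = A - - (c * t) * w1 x (l0 * x - om * t) x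
   - c * t * (w1 x (l0 * x - om * t) x - w1 x (l0 * x) x) by ring.
apply: le_trans (ler_normB _ _) _.
have -> : e * `|t| = e / 2 * `|t| + e / 2 * `|t| by field.
apply: lerD; last exact: le_trans h3 h4.
by apply: le_trans h1 _; rewrite mulrC.
Qed.

(** If the carried profile is differentiable in time, so is its part in [z],
    because the part in [xi] is always differentiable; the chain rule then
    identifies the velocity with the prescribed one. For [om = 0] there is no
    part in [z]. *)
Lemma carried_velocity x l : (forall e, 0 < e -> exists2 dl, 0 < dl & forall t, `|t| < dl ->
    `|carried (x, t) - carried (x, 0) - l * t| <= e * `|t|) ->
  forall e, 0 < e -> exists2 dl, 0 < dl & forall t, `|t| < dl ->
    `|carried (x, t) - carried (x, 0) -
      (- c * derive1 (fun xi => w xi (l0 * x) x) x - om * derive1 (fun z => w x z x) (l0 * x)) * t| <= e * `|t|.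
Proof.
move=> Hl.
have dxi : derive1 (fun xi => w xi (l0 * x) x) x = w1 x (l0 * x) x.
  have ED : is_derive x 1 (fun xi => w xi (l0 * x) x) (w1 x (l0 * x) x).
    apply/is_derive1_eps => e e0; have [d d0 H] := D x e0.
    exists d => // h hd; have := H (x + h) (l0 * x) x.
    by rewrite (addrC x h) addrK (mulrC h) (addrC h x); apply.
  by rewrite derive1E; case: ED.
have [om0|om0] := eqVneq om 0.
  rewrite dxi om0 mul0r subr0 => e e0; have [d d0 H] := carried_xi_difference x e0.
  exists d => // t td; have := H t td; rewrite /carried/= om0 !mul0r !mulr0 !subr0.
  by congr (`| _ | <= _); ring.
suff -> : - c * derive1 (fun xi => w xi (l0 * x) x) x - om * derive1 (fun z => w x z x) (l0 * x) = l by [].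
have ED : is_derive (l0 * x) 1 (fun z => w x z x) (- (l + c * w1 x (l0 * x) x) / om).
  apply/is_derive1_eps => e e0.
  have e1 : 0 < e * `|om| / 2 by rewrite divr_gt0// mulr_gt0// normr_gt0.
  have [d1 d10 H1] := Hl _ e1; have [d2 d20 H2] := carried_xi_difference x e1.
  exists (Num.min d1 d2 * `|om|); first by rewrite mulr_gt0 ?normr_gt0// lt_min d10.
  move=> h; rewrite -ltr_pdivrMr ?normr_gt0// -normfV -normrM => hd.
  (* Moving in time by [t] moves the second argument by [h]. *)
  pose t := - (h / om).
  have hE : l0 * x + h = l0 * x - om * t by rewrite /t; field.
  have tn : `|t| = `|h| / `|om| by rewrite normrN normrM normfV.
  have : `|t| < Num.min d1 d2 by rewrite normrN.
  rewrite lt_min => /andP[t1 t2].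
  have {}H1 := H1 t t1; have {}H2 := H2 t t2; rewrite hE.
  have E : w x (l0 * x - om * t) x - w x (l0 * x) x - - (l + c * w1 x (l0 * x) x) / om * h =
     (carried (x, t) - carried (x, 0) - l * t) -
     (w (x - c * t) (l0 * x - om * t) x - w x (l0 * x - om * t) x + c * t * w1 x (l0 * x) x).
    have hh : h = - (om * t) by rewrite /t; field.
    by rewrite [in LHS]hh /carried/= !mulr0 !subr0; field.
  rewrite E; apply: le_trans (ler_normB _ _) _; apply: le_trans (lerD H1 H2) _.
  rewrite tn le_eqVlt; apply/orP; left; apply/eqP; field; rewrite normr_eq0//.
have -> : derive1 (fun z => w x z x) (l0 * x) = - (l + c * w1 x (l0 * x) x) / om.
  by rewrite derive1E; case: ED.
by rewrite dxi; field.
Qed.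
End Profile.
End Travelling.

(** * The travelling profile in its strip *)

Section Strip.
Context {R : realType}.
Local Notation mu := (@lebesgue_measure R).
Local Notation mu2 := (mu \x mu)%E.
Local Notation RR := (measurableTypeR R * measurableTypeR R)%type.
Implicit Types (x z e t xi eta : R).

Lemma compact_norm_bound (A : set (R * R)) (u : R * R -> R) : compact A -> {within A, continuous u} ->
  exists2 M, 0 <= M & forall p, A p -> `|u p| <= M.
Proof.
move=> cA cu; have /compact_bounded [M [_ HM]] := continuous_compact cu cA.
exists (`|M| + 1); first by rewrite addr_ge0.
move=> p Ap; apply: HM; last by exists p.
by apply: le_lt_trans (ler_norm _) _; rewrite ltrDl.
Qed.

Lemma cube_diff (a b B : R) : `|a| <= B -> `|b| <= B -> `|a ^+ 3 - b ^+ 3| <= 3 * B ^+ 2 * `|a - b|.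
Proof.
move=> ha hb; have B0 : 0 <= B by apply: le_trans ha.
have -> : a ^+ 3 - b ^+ 3 = (a * a + a * b + b * b) * (a - b) by ring.
rewrite normrM ler_wpM2r//.
have h1 : `|a * a| <= B * B by rewrite normrM ler_pM.
have h2 : `|a * b| <= B * B by rewrite normrM ler_pM.
have h3 : `|b * b| <= B * B by rewrite normrM ler_pM.
have := ler_normD (a * a + a * b) (b * b); have := ler_normD (a * a) (a * b).
rewrite expr2; lra.
Qed.

Lemma rhs_lipschitz (gamma rh rr M B a b : R) : 0 <= M -> `|rh| <= M -> `|rr| <= M -> `|a| <= B -> `|b| <= B ->
  `|(gamma * rr * a ^+ 3 - rh * a) - (gamma * rr * b ^+ 3 - rh * b)| <= (`|gamma| * M * (3 * B ^+ 2) + M) * `|a - b|.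
Proof.
move=> M0 h1 h2 ha hb.
have -> : (gamma * rr * a ^+ 3 - rh * a) - (gamma * rr * b ^+ 3 - rh * b) =
  gamma * rr * (a ^+ 3 - b ^+ 3) - rh * (a - b) by ring.
apply: le_trans (ler_normB _ _) _; rewrite mulrDl; apply: lerD; last by rewrite normrM ler_wpM2r.
rewrite !normrM -mulrA -mulrA -[leRHS]mulrA; apply: ler_wpM2l => //.
apply: ler_pM => //; exact: cube_diff.
Qed.

Section Velocity.
Variables (w w1 : R -> R -> R -> R) (c l0 om L gamma : R) (rho r : R -> R) (tv : R -> R -> R).
Hypothesis g0 : forall xi, goodX (w xi).
Hypothesis g1 : forall xi, goodX (w1 xi).
Hypothesis D : forall xi e, 0 < e -> exists2 d, 0 < d & forall eta z x, `|eta - xi| < d ->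
    `|w eta z x - w xi z x - (eta - xi) * w1 xi z x| <= e * `|eta - xi|.
Hypothesis c1 : `|c| <= 1.
Hypothesis tvE : forall x t, `|x - c * t| <= L -> tv x t = carried w c l0 om (x, t).
Hypothesis tv_sol : wave_solution rho r gamma [set p | `|p.1 - c * p.2| < L] tv.
Hypotheses (rX : inX0 rho) (rX' : inX0 r).

(** The square with diagonal [al, be] on the initial line stays in the strip
    because the strip moves at a speed [c] of modulus at most one. *)
Lemma strip_box al be : -L < al -> be < L -> charbox 1 al be al be `<=` [set p | `|p.1 - c * p.2| < L].
Proof.
move=> aL bL p [] /=; rewrite mul1r; move: p.1 p.2 => x t /andP[h1 h2] /andP[h3 h4].
have [m1 m2] : - 1 <= c /\ c <= 1 by move: c1; rewrite ler_norml => /andP[].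
have u1 : 0 <= (be - (x + t)) * (1 - c) by apply: mulr_ge0; lra.
have u2 : 0 <= (be - (x - t)) * (1 + c) by apply: mulr_ge0; lra.
have u3 : 0 <= ((x + t) - al) * (1 - c) by apply: mulr_ge0; lra.
have u4 : 0 <= ((x - t) - al) * (1 + c) by apply: mulr_ge0; lra.
by rewrite ltr_norml; apply/andP; split; lra.
Qed.

Lemma tv_cont (p : R * R) : `|p.1 - c * p.2| < L -> {for p, continuous (fun p : R * R => tv p.1 p.2)}.
Proof.
move=> pL; have cp : {for p, continuous (fun q : R * R => `|q.1 - c * q.2|)}.
  apply: (@cvg_norm _ R^o); apply: cvgB; first exact: cvg_fst.
  by apply: cvgM; [exact: cvg_cst|exact: cvg_snd].
have near_eq : \forall q \near p, carried w c l0 om q = tv q.1 q.2.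
  have /cvgrPdist_lt /(_ (L - `|p.1 - c * p.2|)) := cp.
  rewrite subr_gt0 => /(_ pL); apply: filterS => q; rewrite ltr_norml => /andP[h _].
  by rewrite tvE; [case: q {h}|lra].
have E : carried w c l0 om p = tv p.1 p.2 by rewrite tvE ?(ltW pL)//; case: (p).
have := @carried_cont R w w1 c l0 om g0 g1 D p; rewrite /prop_for /continuous_at /= E => H.
by apply: cvg_trans H; exact: near_eq_cvg.
Qed.

(** The travelling profile is a solution in the strip, so almost everywhere on
    the initial line it has a time derivative, by exhaustion of the interval
    [-L, L]; [carried_velocity] says which one. *)
Lemma strip_velocity : {ae mu, forall x, `|x| < L -> forall e, 0 < e -> exists2 dl, 0 < dl & forall t, `|t| < dl ->
    `|carried w c l0 om (x, t) - carried w c l0 om (x, 0) -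
      (- c * derive1 (fun xi => w xi (l0 * x) x) x - om * derive1 (fun z => w x z x) (l0 * x)) * t| <= e * `|t|}.
Proof.
have [f [Wf fE]] := wave_solution_weak tv_sol.
have [M M0 HM] := X0_bounded2 rX rX'.
have one : (1 : R) * 1 = 1 by rewrite mul1r.
have step (be : R) : be < L -> {ae mu, forall x, `|x| < be -> exists l, forall e, 0 < e -> exists2 dl, 0 < dl &
    forall t, `|t| < dl -> `|tv x t - tv x 0 - l * t| <= e * `|t|}.
  move=> bL; have [be0|be0] := leP be 0.
    by apply: aeW => x /lt_le_trans /(_ be0); rewrite ltNge normr_ge0.
  have albe : - be < be by lra.
  have sub : charbox 1 (- be) be (- be) be `<=` [set p | `|p.1 - c * p.2| < L].
    by apply: strip_box => //; lra.
  have cu p : charbox 1 (- be) be (- be) be p -> {for p, continuous (fun p : R * R => tv p.1 p.2)}.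
    by move=> /sub; exact: tv_cont.
  have [B B0 HB] : exists2 B, 0 <= B & forall p, charbox 1 (- be) be (- be) be p -> `|tv p.1 p.2| <= B.
    have cc : compact (charbox 1 (- be) be (- be) be : set (R * R)) by exact: compact_charbox.
    have [B B0 HB] := compact_norm_bound cc (continuous_subspaceT (@carried_cont R w w1 c l0 om g0 g1 D)).
    exists B => // p Kp; rewrite tvE ?(ltW (sub p Kp))//.
    by have := HB p Kp; case: p {Kp}.
  have fM : {ae mu2, forall p : RR, charbox 1 (- be) be (- be) be p -> `|f p| <= (`|gamma| * M * (3 * B ^+ 2) + M) * B}.
    apply: filterS2 fE HM => p fp [h1 h2] Kp; rewrite (fp (sub p Kp)).
    (* The right-hand side vanishes for the zero function, so that its Lipschitz
       bound is also a bound of its size. *)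
    have := @rhs_lipschitz gamma (rho p.1) (r p.1) M B (tv p.1 p.2) 0 M0 h1 h2 (HB p Kp).
    rewrite normr0 => /(_ B0); rewrite expr0n/= !mulr0 !subr0 => /le_trans; apply.
    by apply: ler_wpM2l; [rewrite addr_ge0// !mulr_ge0 ?sqr_ge0|exact: HB].
  have M1 : 0 <= (`|gamma| * M * (3 * B ^+ 2) + M) * B.
    by rewrite mulr_ge0// addr_ge0// mulr_ge0 ?mulr_ge0 ?sqr_ge0.
  have := wave_time_derivative albe M1 sub Wf cu fM.
  apply: ae1S => x H xb; apply: H; by rewrite -ltr_norml.
have : {ae mu, forall x, forall n : nat, `|x| < L - n.+1%:R^-1 -> exists l, forall e, 0 < e -> exists2 dl, 0 < dl &
    forall t, `|t| < dl -> `|tv x t - tv x 0 - l * t| <= e * `|t|}.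
  apply: (@ae_foralln _ _ _ mu (fun n x => `|x| < L - n.+1%:R^-1 -> exists l, forall e, 0 < e -> exists2 dl, 0 < dl &
    forall t, `|t| < dl -> `|tv x t - tv x 0 - l * t| <= e * `|t|)) => n.
  by apply: step; rewrite gtrBl invr_gt0.
apply: ae1S => x Hx xL.
have [n Hn] : exists n : nat, `|x| < L - n.+1%:R^-1.
  exists (Num.bound (L - `|x|)^-1).
  have d0 : 0 < L - `|x| by rewrite subr_gt0.
  rewrite ltrBrDr -ltrBrDl invf_plt ?posrE//.
  by apply: lt_le_trans (archi_boundP _) _; rewrite ?invr_ge0 ?ltW// ltr_nat.
have [l Hl] := Hx n Hn.
have x0 : 0 < L - `|x| by rewrite subr_gt0.
have tv0 : tv x 0 = carried w c l0 om (x, 0) by apply: tvE; rewrite mulr0 subr0 ltW.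
have Hc : forall e, 0 < e -> exists2 dl, 0 < dl & forall t, `|t| < dl ->
    `|carried w c l0 om (x, t) - carried w c l0 om (x, 0) - l * t| <= e * `|t|.
  move=> e e0; have [d d0 Hd] := Hl e e0.
  exists (Num.min d (L - `|x|)); first by rewrite lt_min d0.
  move=> t; rewrite lt_min => /andP[td tL]; have := Hd t td.
  rewrite tv0 tvE //.
  have : `|c * t| <= `|t| by rewrite normrM ler_piMl.
  by have := ler_normB x (c * t); lra.
exact: (carried_velocity g1 D Hc).
Qed.
End Velocity.
End Strip.

(** * Uniqueness in a backward triangle *)

Section TriangleUnique.
Context {R : realType}.
Local Notation mu := (@lebesgue_measure R).
Local Notation mu2 := (mu \x mu)%E.
Local Notation RR := (measurableTypeR R * measurableTypeR R)%type.
Local Notation I1 A := (\1_(A%classic : set R) : R -> R).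
Variables (al be C M : R) (Ou Ov : set (R * R)) (u v fu fv : R * R -> R).
Hypothesis albe : al < be.
Hypotheses (C0 : 0 <= C) (M0 : 0 <= M).
Hypothesis subu : forall a b c d, al <= c -> c < d -> d < a -> a < b -> b <= be -> charbox 1 a b c d `<=` Ou.
Hypothesis subv : forall a b c d, al <= c -> c < d -> d < a -> a < b -> b <= be -> charbox 1 a b c d `<=` Ov.
Hypothesis cu : forall p, Ou p -> {for p, continuous u}.
Hypothesis cv : forall p, Ov p -> {for p, continuous v}.
Hypotheses (Wu : weak_wave Ou u fu) (Wv : weak_wave Ov v fv).
Hypothesis lip : {ae mu2, forall p : RR, Ou p -> Ov p ->
  `|u p| <= M -> `|v p| <= M -> `|fu p - fv p| <= C * `|u p - v p|}.
Let W (q : RR) := u (charinv 1 q) - v (charinv 1 q).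
Let T (q : RR) := [&& al <= q.2, q.2 < q.1 & q.1 <= be].
Hypothesis uM : forall q : RR, al <= q.2 -> q.2 <= q.1 -> q.1 <= be -> `|u (charinv 1 q)| <= M /\ `|v (charinv 1 q)| <= M.
Hypothesis Wc : forall x y, al <= y -> y <= x -> x <= be -> forall e, 0 < e ->
  exists2 dl, 0 < dl & forall p : RR, al <= p.2 -> p.2 <= p.1 -> p.1 <= be ->
    `|p.1 - x| <= dl -> `|p.2 - y| <= dl -> `|W p - W (x, y)| <= e.
Hypothesis W0 : forall x, al <= x <= be -> W (x, x) = 0.
Hypothesis dW0 : {ae mu, forall x, al < x < be -> forall e, 0 < e -> exists2 dl, 0 < dl &
  forall t, 0 < t < dl -> `|W (x + t, x - t)| <= e * t}.

Let h (q : RR) := fu (charinv 1 q) - fv (charinv 1 q).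
Let G (q : RR) := h q * (T q)%:R.
Let F q := clip (C * (2 * M)) (G q).
Let one : (1 : R) * 1 = 1. Proof. exact: mul1r. Qed.

Let boxu a b c d (c1 : al <= c) (cd : c < d) (da : d < a) (ab : a < b) (b1 : b <= be) :=
  char_box one ab cd (subu c1 cd da ab b1) Wu (fun p Kp => cu (subu c1 cd da ab b1 Kp)).
Let boxv a b c d (c1 : al <= c) (cd : c < d) (da : d < a) (ab : a < b) (b1 : b <= be) :=
  char_box one ab cd (subv c1 cd da ab b1) Wv (fun p Kp => cv (subv c1 cd da ab b1 Kp)).

Let box_h a b c d : al <= c -> c < d -> d < a -> a < b -> b <= be ->
  mu2.-integrable setT (EFin \o (fun q : RR => h q * (I1 `[a, b] q.1 * I1 `[c, d] q.2))).
Proof.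
move=> c1 cd da ab b1; have [iu _ _] := boxu c1 cd da ab b1; have [iv _ _] := boxv c1 cd da ab b1.
rewrite (_ : (fun q => _) = fun q : RR => fu (charinv 1 q) * (I1 `[a, b] q.1 * I1 `[c, d] q.2)
   - fv (charinv 1 q) * (I1 `[a, b] q.1 * I1 `[c, d] q.2)); first exact: intgB.
by apply/funext => q; rewrite mulrBl.
Qed.

(* The triangle is not closed, and [h] is known to be measurable only on closed
   rectangles inside it; countably many of these, with rational corners, cover it. *)
Let E (n : nat) : set RR := match (unpickle n : option (rat * rat)) with
  | Some r => if [&& al < ratr r.2, ratr r.2 < (ratr r.1 : R) & ratr r.1 < be]
     then `[ratr r.1, be]%classic `*` `[al, ratr r.2]%classic else set0
  | None => set0 end.

Let TE : [set q | T q] = \bigcup_n E n.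
Proof.
apply/seteqP; split => [q /= /and3P[q1 q2 q3]|q [n _]].
  have [d] := rat_in_itvoo q2; rewrite in_itv/= => /andP[d1 d2].
  have [a] := rat_in_itvoo d2; rewrite in_itv/= => /andP[a1 a2].
  exists (pickle (a, d)); [exact: I|rewrite /E pickleK /=].
  rewrite (le_lt_trans q1 d1) a1 (lt_le_trans a2 q3).
  by split; rewrite /= in_itv/= ?q1 ?q3 ?(ltW d1) ?(ltW a2).
rewrite /E; case: (unpickle n) => [r|//]; case: ifP => // /and3P[h1 h2 h3] [] /=.
rewrite !in_itv/= => /andP[k1 k2] /andP[k3 k4]; rewrite /T k3 k2 andbT/=.
by apply: le_lt_trans k4 (lt_le_trans h2 k1).
Qed.

Let mE n : measurable (E n).
Proof.
rewrite /E; case: (unpickle n) => [r|//]; case: ifP => // _.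
by apply: measurableX; exact: measurable_itv.
Qed.

Let mG : measurable_fun setT G.
Proof.
have mT : measurable ([set q | T q] : set RR) by rewrite TE; exact: bigcup_measurable.
have mh : measurable_fun [set q | T q] h.
  rewrite TE; apply/measurable_fun_bigcup => // n; rewrite /E.
  case: (unpickle n) => [r|]; last exact: measurable_fun_set0.
  case: ifP => [/and3P[h1 h2 h3]|_]; last exact: measurable_fun_set0.
  have i := box_h (lexx al) h1 h2 h3 (lexx be).
  apply: (eq_measurable_fun (fun q : RR => h q * (I1 `[ratr r.1, be] q.1 * I1 `[al, ratr r.2] q.2))).
    move=> q /set_mem [q1 q2]; rewrite !indicE !mem_set// !mulr1//.
  by apply: measurable_funTS; exact: (intg_measurable i).
have := (measurable_restrictT h mT).1 mh; congr measurable_fun.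
apply/funext => q; rewrite patchE /G; case: (boolP (T q)) => Tq.
  by rewrite mem_set// mulr1.
by rewrite memNset ?mulr0//; apply/negP.
Qed.

Let Tbox q : T q -> Ou (charinv 1 q) /\ Ov (charinv 1 q).
Proof.
move=> /and3P[q1 q2 q3].
pose d := (2 * q.2 + q.1) / 3; pose a := (q.2 + 2 * q.1) / 3.
have dE : d = (2 * q.2 + q.1) / 3 by []. have aE : a = (q.2 + 2 * q.1) / 3 by [].
have mem : charbox 1 a be al d (charinv 1 q).
  by rewrite charboxE//; exists q => //; split; rewrite /= in_itv/=; apply/andP; split; lra.
have [x1 x2 x3] : [/\ al < d, d < a & a < be] by split; lra.
by split; [apply: (subu _ x1 x2 x3) mem|apply: (subv _ x1 x2 x3) mem].
Qed.

Let WM q : al <= q.2 -> q.2 <= q.1 -> q.1 <= be -> `|W q| <= 2 * M.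
Proof.
move=> h1 h2 h3; have [a b] := uM h1 h2 h3.
by have := ler_normB (u (charinv 1 q)) (v (charinv 1 q)); rewrite /W; lra.
Qed.

Let Gle : {ae mu2, forall q : RR, `|G q| <= C * `|W q| /\ F q = G q}.
Proof.
apply: ae2S (ae_charinv one lip) => q H.
have K : `|G q| <= C * `|W q|.
  rewrite /G; case: (boolP (T q)) => Tq; last by rewrite mulr0 normr0 mulr_ge0.
  have [k1 k2] := Tbox Tq; move: (Tq) => /and3P[q1 q2 q3].
  by have [m1 m2] := uM q1 (ltW q2) q3; rewrite mulr1; apply: H.
split=> //; rewrite /F; case: (boolP (T q)) => Tq; last first.
  by rewrite /G (negbTE Tq) mulr0 clip_id// normr0 !mulr_ge0.
move: (Tq) => /and3P[q1 q2 q3]; rewrite clip_id//; apply: le_trans K _.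
by apply: ler_wpM2l => //; exact: WM (ltW q2) _.
Qed.

(** The difference of two solutions and of their right-hand sides satisfies the
    hypotheses of [tri_bound], and the Lipschitz bound feeds
    [triangle_gronwall]. *)
Lemma triangle_unique x y : al <= y -> y <= x -> x <= be -> u (charinv 1 (x, y)) = v (charinv 1 (x, y)).
Proof.
move=> aly yx xb.
have K0 : 0 <= C * (2 * M) by rewrite !mulr_ge0.
have mF : measurable_fun setT F by exact: measurable_clip.
have FM q : `|F q| <= C * (2 * M) by exact: clip_le.
have F0 q : ~~ T q -> F q = 0.
  by move=> nT; rewrite /F /G (negbTE nT) mulr0 clip_id// normr0.
have rect a b c d : al <= c -> c < d -> d < a -> a < b -> b <= be ->
  W (a, c) - W (a, d) - W (b, c) + W (b, d) =
  - 4^-1 * \int[mu2]_q (F q * (I1 `]a, b[ q.1 * I1 `]c, d[ q.2)).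
  move=> c1 cd da ab b1.
  have [iu Eu _] := boxu c1 cd da ab b1; have [iv Ev _] := boxv c1 cd da ab b1.
  have mI : measurable_fun setT (fun q : RR => I1 `]a, b[ q.1 * I1 `]c, d[ q.2).
    by apply: measurable_funM; [exact: measurable_indic_fst|exact: measurable_indic_snd].
  have bI (q : RR) : `|I1 `]a, b[ q.1 * I1 `]c, d[ q.2| <= 1.
    by rewrite normrM mulr_ile1// norm_indic_le1.
  have opn (g : RR -> R) : mu2.-integrable setT (EFin \o (fun q : RR => g q * (I1 `[a, b] q.1 * I1 `[c, d] q.2))) ->
     mu2.-integrable setT (EFin \o (fun q : RR => g q * (I1 `]a, b[ q.1 * I1 `]c, d[ q.2))).
    move=> ig; have := intgM (M := 1) ig mI bI.
    congr (mu2.-integrable _ (EFin \o _)); apply/funext => q.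
    rewrite -mulrA; congr (_ * _); rewrite !indic_itvE !in_itv/=.
    case: (ltP a q.1) => k1; case: (ltP q.1 b) => k2; case: (ltP c q.2) => k3; case: (ltP q.2 d) => k4;
      rewrite /= ?(mulr1, mulr0, mul0r)//.
    by rewrite (ltW k1) (ltW k2) (ltW k3) (ltW k4) !mulr1.
  have EW : W (a, c) - W (a, d) - W (b, c) + W (b, d) =
     - 4^-1 * \int[mu2]_q (fu (charinv 1 q) * (I1 `]a, b[ q.1 * I1 `]c, d[ q.2)) -
     - 4^-1 * \int[mu2]_q (fv (charinv 1 q) * (I1 `]a, b[ q.1 * I1 `]c, d[ q.2)).
    by rewrite -Eu -Ev /W; ring.
  rewrite EW -mulrBr -RintB; [|exact: opn|exact: opn].
  congr (_ * _); apply: eq_Rint_ae.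
  - by apply: measurable_funB; [exact: (intg_measurable (opn _ iu))|exact: (intg_measurable (opn _ iv))].
  - exact: measurable_funM.
  apply: ae2S Gle => q [_ ->]; rewrite -mulrBl /G -mulrA; congr (_ * _); rewrite !indic_itvE !in_itv/=.
  case: (ltP a q.1) => k1; case: (ltP q.1 b) => k2; case: (ltP c q.2) => k3; case: (ltP q.2 d) => k4;
      rewrite /= ?(mulr1, mulr0, mul0r)//.
  by rewrite /T (le_trans c1 (ltW k3)) (lt_trans k4 (lt_trans da k1)) (le_trans (ltW k2) b1).
have edge a : al < a -> a < be -> exists2 q : R -> R,
  mu.-integrable setT (EFin \o q) & forall x, a < x <= be ->
  W (x, al) - W (a, al) = \int[mu]_s (q s * I1 `]a, x[ s).
  (* Any [d] strictly between [al] and [a] gives a rectangle in the triangle whose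
     lower edge is the one in question. *)
  move=> ala abe; pose d := (al + a) / 2; have dE : d = (al + a) / 2 by [].
  have [x1 x2] : al < d /\ d < a by split; lra.
  have [_ _ [qu iu Hu]] := boxu (lexx al) x1 x2 abe (lexx be).
  have [_ _ [qv iv Hv]] := boxv (lexx al) x1 x2 abe (lexx be).
  exists (fun s => qu s - qv s); first exact: intgB.
  move=> z za; have H1 := Hu z za; have H2 := Hv z za.
  have mI : measurable_fun setT (I1 `]a, z[) by exact: measurable_indicR.
  have bI s : `|I1 `]a, z[ s| <= 1 by exact: norm_indic_le1.
  transitivity (\int[mu]_s (qu s * I1 `]a, z[ s) - \int[mu]_s (qv s * I1 `]a, z[ s)).
    by rewrite -H1 -H2 /W; ring.
  rewrite -RintB; [|exact: (intgM (M := 1) iu mI bI)|exact: (intgM (M := 1) iv mI bI)].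
  by apply: eq_Rintegral => s _; rewrite mulrBl.
have bound := tri_bound albe K0 mF FM F0 rect edge Wc W0 dW0.
have Fbox q : `|F q| <= C * (2 * M) * (I1 `[al, be] q.1 * I1 `[al, be] q.2).
  case: (boolP (T q)) => [/and3P[q1 q2 q3]|nT]; last by rewrite F0// normr0 !mulr_ge0// ?indic_itvE ?ler0n.
  rewrite !indic_itvE !in_itv/= q1 q3 (le_trans q1 (ltW q2)) (le_trans (ltW q2) q3) !mulr1; exact: FM.
have Fi : mu2.-integrable setT (EFin \o F).
  by have [] := ler_Rint_box (ltW albe) (ltW albe) mF Fbox.
have K1 : 0 <= 2 * M by rewrite mulr_ge0.
have HF : {ae mu2, forall q : RR, al <= q.2 -> q.1 <= be -> `|F q| <= C * `|W q| /\ (q.1 < q.2 -> F q = 0)}.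
  apply: ae2S Gle => q [g1 ->] _ _; split => // q12.
  by rewrite /G /T [q.2 < q.1]ltNge (ltW q12) andbF mulr0.
have := triangle_gronwall albe C0 K1 Fi W0 WM bound HF aly yx xb.
by rewrite /W => /eqP; rewrite subr_eq0 => /eqP.
Qed.
End TriangleUnique.

(** * Agreement in the backward cone *)

Section Final.
Context {R : realType}.
Local Notation mu := (@lebesgue_measure R).
Local Notation mu2 := (mu \x mu)%E.
Local Notation RR := (measurableTypeR R * measurableTypeR R)%type.

Lemma within_eps (A : set (R * R)) (u : R * R -> R) p e : {within A, continuous u} -> A p -> 0 < e ->
  exists2 d, 0 < d & forall q : R * R, A q -> `|q.1 - p.1| < d -> `|q.2 - p.2| < d -> `|u q - u p| <= e.
Proof.
move=> /subspace_continuousP cu Ap e0; have /cvgrPdist_le /(_ e e0) := cu p Ap.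
move=> [[P Q] /= [[d1 d10 H1] [d2 d20 H2]] PQ].
exists (Num.min d1 d2); first by rewrite lt_min d10.
move=> q Aq; rewrite !lt_min => /andP[h1 _] /andP[_ h2]; rewrite distrC; apply: (PQ q) => //.
by split; [apply: H1|apply: H2]; rewrite /= distrC.
Qed.

Lemma right_limit_eps (g : R -> R) (l e : R) : g @ 0^'+ --> l -> 0 < e ->
  exists2 d, 0 < d & forall t, 0 < t < d -> `|g t - l| <= e.
Proof.
move=> /cvgrPdist_le H e0; have [d /= d0 Hd] := H e e0.
exists d => // t /andP[t0 td]; rewrite distrC; apply: Hd => //=.
by rewrite sub0r normrN gtr0_norm.
Qed.

(** The travelling pulse has the Cauchy data of [u] on the base of the backward
    triangle of [(x, t)], both are bounded on this compact triangle, and the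
    triangle lies in the strip where the pulse is a solution. *)
Lemma cone_agreement (rho r : R -> R) (gamma c l0 om L : R) (w w1 : R -> R -> R -> R) (tv u : R -> R -> R) (D : set (R * R)) (u0 u1 : R -> R) :
  (forall xi, goodX (w xi)) -> (forall xi, goodX (w1 xi)) ->
  (forall xi e, 0 < e -> exists2 d, 0 < d & forall eta z x, `|eta - xi| < d ->
    `|w eta z x - w xi z x - (eta - xi) * w1 xi z x| <= e * `|eta - xi|) ->
  `|c| <= 1 -> inX0 rho -> inX0 r ->
  (forall x t, `|x - c * t| <= L -> tv x t = carried w c l0 om (x, t)) ->
  wave_solution rho r gamma [set p | `|p.1 - c * p.2| < L] tv ->
  existence_domain D -> cauchy_solution rho r gamma u0 u1 D u ->
  (forall x, u0 x = carried w c l0 om (x, 0)) ->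
  (forall x, u1 x = - c * derive1 (fun xi => w xi (l0 * x) x) x - om * derive1 (fun z => w x z x) (l0 * x)) ->
  forall x t, D (x, t) -> 0 < t -> `|x| + t < L -> u x t = tv x t.
Proof.
move=> g0 g1 Dw c1 rX rX' tvE tvsol [[U oU DE] cone] [usol ucont ui uvel] u0E u1E x t Dxt t0 xtL.
have one : (1 : R) * 1 = 1 by rewrite mul1r.
have vel := strip_velocity g0 g1 Dw c1 tvE tvsol rX rX'.
have [fu [Wu fuE]] := wave_solution_weak usol.
have [fv [Wv fvE]] := wave_solution_weak tvsol.
have [M M0 HM] := X0_bounded2 rX rX'.
pose al := x - t; pose be := x + t.
have alE : al = x - t by []. have beE : be = x + t by [].
have albe : al < be by lra.
have aL : - L < al by have := ler_norm (- x); rewrite normrN; lra.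
have bL : be < L by have := ler_norm x; lra.
have tri_cone (p : R * R) : al <= p.1 - p.2 -> 0 <= p.2 -> p.1 + p.2 <= be -> D p.
  move=> h1 h2 h3; apply: (cone x t Dxt); split => //.
  by rewrite ler_norml; apply/andP; split; clear - h1 h2 h3 alE beE; lra.
have tri_strip (p : R * R) : al <= p.1 - p.2 -> 0 <= p.2 -> p.1 + p.2 <= be -> `|p.1 - c * p.2| < L.
  move=> h1 h2 h3; apply: (strip_box c1 aL bL).
  by split; apply/andP; split; rewrite mul1r; clear - h1 h2 h3; lra.
have box_tri a b cc d (p : R * R) : al <= cc -> cc < d -> d < a -> a < b -> b <= be -> charbox 1 a b cc d p ->
    [/\ al <= p.1 - p.2, 0 < p.2 & p.1 + p.2 <= be].
  move=> h1 h2 h3 h4 h5 [] /=; rewrite mul1r => /andP[k1 k2] /andP[k3 k4]; clear - h1 h2 h3 h4 h5 k1 k2 k3 k4; split; lra.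
have subu a b cc d : al <= cc -> cc < d -> d < a -> a < b -> b <= be ->
    charbox 1 a b cc d `<=` D `&` [set p | 0 < p.2].
  move=> h1 h2 h3 h4 h5 p /(box_tri _ _ _ _ _ h1 h2 h3 h4 h5) [k1 k2 k3]; split => //.
  by apply: tri_cone => //; exact: ltW.
have subv a b cc d : al <= cc -> cc < d -> d < a -> a < b -> b <= be ->
    charbox 1 a b cc d `<=` [set p : R * R | `|p.1 - c * p.2| < L].
  move=> h1 h2 h3 h4 h5 p /(box_tri _ _ _ _ _ h1 h2 h3 h4 h5) [k1 k2 k3].
  by apply: tri_strip => //; exact: ltW.
have cu p : (D `&` [set p | 0 < p.2]) p -> {for p, continuous (fun p : R * R => u p.1 p.2)}.
  move=> [Dp p2]; apply/cvgrPdist_le => e e0.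
  have [d d0 Hd] := within_eps ucont Dp e0.
  have Up : U p by move: Dp; rewrite DE => -[].
  have nU : nbhs p U by apply: open_nbhs_nbhs.
  have nB : nbhs p [set q : R * R | `|q.1 - p.1| < d /\ `|q.2 - p.2| < d /\ 0 < q.2].
    pose m := Num.min d p.2; have m0 : 0 < m by rewrite lt_min d0.
    exists (ball p.1 m, ball p.2 m); first by split; exact: nbhsx_ballx.
    move=> q [/= q1 q2]; rewrite /ball/= !lt_min in q1 q2; rewrite distrC in q1; rewrite distrC in q2.
    move: q1 q2 => /andP[q1 _] /andP[q2 q3]; split; [exact: q1|split; first exact: q2].
    move: q3; rewrite ltr_norml => /andP[q3 _]; clear - q3; lra.
  apply: filterS2 nU nB => q Uq [q1 [q2 q3]]; rewrite distrC; apply: Hd => //.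
  by rewrite DE; split => //; exact: ltW.
have cv p : [set p : R * R | `|p.1 - c * p.2| < L] p -> {for p, continuous (fun p : R * R => tv p.1 p.2)}.
  by move=> pL; exact: (tv_cont g0 g1 Dw tvE pL).
(* The closed backward triangle, as half of a characteristic square. *)
pose A : set (R * R) := charbox 1 al be al be `&` [set p | 0 <= p.2].
have cA : compact A.
  apply: compact_closedI; first exact: compact_charbox.
  rewrite (_ : [set p | _] = (fun p : R * R => p.2) @^-1` `[0, +oo[%classic); last first.
    by apply/seteqP; split => p /=; rewrite in_itv/= andbT.
  apply: preimage_closed; first by move=> p _; exact: cvg_snd.
  exact: rray_closed.
have AD p : A p -> [/\ al <= p.1 - p.2, 0 <= p.2 & p.1 + p.2 <= be].
  by move=> [[]]; rewrite mul1r /= => /andP[k1 k2] /andP[k3 k4] k5; split.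
have [B1 B10 HB1] : exists2 B, 0 <= B & forall p : R * R, A p -> `|u p.1 p.2| <= B.
  apply: (@compact_norm_bound _ A (fun p : R * R => u p.1 p.2)) => //.
  by apply: continuous_subspaceW ucont => p /AD[k1 k2 k3]; exact: tri_cone.
have [B2 B20 HB2] := compact_norm_bound cA (continuous_subspaceT (@carried_cont R w w1 c l0 om g0 g1 Dw)).
pose B := B1 + B2; have B0 : 0 <= B by rewrite addr_ge0.
have triA (q : R * R) : al <= q.2 -> q.2 <= q.1 -> q.1 <= be -> A (charinv 1 q).
  move=> h1 h2 h3; split; last by rewrite /charinv /= mul1r divr_ge0// subr_ge0.
  by rewrite charboxE//; exists q => //; split; rewrite /= in_itv/=; apply/andP; split; clear - h1 h2 h3; lra.
have Atv p : A p -> tv p.1 p.2 = carried w c l0 om p.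
  by move=> /AD[k1 k2 k3]; rewrite tvE ?(ltW (tri_strip p k1 k2 k3))//; case: (p).
have uM (q : R * R) : al <= q.2 -> q.2 <= q.1 -> q.1 <= be ->
    `|u (charinv 1 q).1 (charinv 1 q).2| <= B /\ `|tv (charinv 1 q).1 (charinv 1 q).2| <= B.
  move=> h1 h2 h3; have Aq := triA q h1 h2 h3; split.
    by apply: le_trans (HB1 _ Aq) _; rewrite lerDl.
  by rewrite (Atv _ Aq); apply: le_trans (HB2 _ Aq) _; rewrite lerDr.
pose C := `|gamma| * M * (3 * B ^+ 2) + M.
have C0 : 0 <= C by rewrite addr_ge0// !mulr_ge0 ?sqr_ge0.
have lip : {ae mu2, forall p : RR, (D `&` [set p | 0 < p.2]) p -> [set p : R * R | `|p.1 - c * p.2| < L] p ->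
  `|u p.1 p.2| <= B -> `|tv p.1 p.2| <= B -> `|fu p - fv p| <= C * `|u p.1 p.2 - tv p.1 p.2|}.
  apply: filterS2 (filterI fuE fvE) HM => p [e1 e2] [h1 h2] Dp Sp b1 b2.
  by rewrite (e1 Dp) (e2 Sp); exact: rhs_lipschitz.
pose W (q : RR) := u (charinv 1 q).1 (charinv 1 q).2 - tv (charinv 1 q).1 (charinv 1 q).2.
have Wc (x' y : R) : al <= y -> y <= x' -> x' <= be -> forall e, 0 < e ->
  exists2 dl, 0 < dl & forall p : RR, al <= p.2 -> p.2 <= p.1 -> p.1 <= be ->
    `|p.1 - x'| <= dl -> `|p.2 - y| <= dl -> `|W p - W (x', y)| <= e.
  move=> ha hy hx e e0; have e2 : 0 < e / 2 by rewrite divr_gt0.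
  have A0 := triA (x', y) ha hy hx; have [k1 k2 k3] := AD _ A0.
  have [d1 d10 H1] := within_eps ucont (tri_cone _ k1 k2 k3) e2.
  have [d2 d20 H2] := continuous_near2 (@carried_cont R w w1 c l0 om g0 g1 Dw (charinv 1 (x', y))) e2.
  exists (Num.min (d1 / 2) d2); first by rewrite lt_min divr_gt0.
  move=> p p1 p2 p3; rewrite !le_min => /andP[a1 a2] /andP[b1 b2].
  have Ap := triA p p1 p2 p3; have [m1 m2 m3] := AD _ Ap.
  have d12 : d1 / 2 < d1 by rewrite ltr_pdivrMr// mulr_natr mulr2n ltrDr.
  have n1 : (charinv 1 p).1 - (charinv 1 (x', y)).1 = ((p.1 - x') + (p.2 - y)) / 2 by rewrite /charinv/=; field.
  have n2 : (charinv 1 p).2 - (charinv 1 (x', y)).2 = ((p.1 - x') - (p.2 - y)) / 2 by rewrite /charinv/=; field.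
  have avg (s s' d : R) : `|s| <= d -> `|s'| <= d -> `|(s + s') / 2| <= d /\ `|(s - s') / 2| <= d.
    clear; rewrite !ler_norml => /andP[s1 s2] /andP[s3 s4]; split; apply/andP; split; lra.
  have [q1 q2] := avg _ _ _ a1 b1; have [q3 q4] := avg _ _ _ a2 b2.
  have {}H1 := H1 (charinv 1 p) (tri_cone _ m1 m2 m3); rewrite n1 n2 in H1.
  have {}H1 := H1 (le_lt_trans q1 d12) (le_lt_trans q2 d12).
  have {}H2 := H2 (charinv 1 p); rewrite n1 n2 in H2; have {}H2 := H2 q3 q4.
  rewrite /W (Atv _ Ap) (Atv _ A0).
  have -> : forall a b a' b' : R, a - b - (a' - b') = (a - a') - (b - b') by move=> *; ring.
  apply: le_trans (ler_normB _ _) _; have -> : e = e / 2 + e / 2 by field.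
  exact: lerD.
have ci (y s : R) : charinv 1 (y + s, y - s) = (y, s) by have := charinvK y s one; rewrite mul1r.
have tv_init (y : R) : al <= y <= be -> tv y 0 = carried w c l0 om (y, 0) /\ D (y, 0).
  move=> /andP[h1 h2]; split; last by apply: tri_cone => /=; clear - h1 h2; lra.
  by apply: tvE; have := tri_strip (y, 0); rewrite /= => h; apply: ltW; apply: h; clear - h1 h2; lra.
have W0 (y : R) : al <= y <= be -> W (y, y) = 0.
  move=> yab; have [k1 k2] := tv_init y yab.
  have -> : W (y, y) = W (y + 0, y - 0) by rewrite addr0 subr0.
  by rewrite /W ci /= ui// u0E k1 subrr.
have dW0 : {ae mu, forall y, al < y < be -> forall e, 0 < e -> exists2 dl, 0 < dl &
  forall s, 0 < s < dl -> `|W (y + s, y - s)| <= e * s}.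
  apply: ae1S2 vel uvel => y Hv Hu /andP[y1 y2] e e0.
  have yL : `|y| < L by rewrite ltr_norml; apply/andP; split; clear - aL bL y1 y2; lra.
  have [k1 k2] := tv_init y ltac:(by rewrite !ltW).
  have e2 : 0 < e / 2 by rewrite divr_gt0.
  have [d1 d10 H1] := Hv yL _ e2; have [d2 d20 H2] := right_limit_eps (Hu k2) e2.
  exists (Num.min (Num.min d1 d2) (Num.min (y - al) (be - y))).
    by rewrite !lt_min d10 d20 !subr_gt0 y1 y2.
  move=> s /andP[s0]; rewrite !lt_min => /andP[/andP[s1 s2] /andP[s3 s4]].
  have {}H1 := H1 s; rewrite gtr0_norm// in H1; have {}H1 := H1 s1.
  have {}H2 := H2 s ltac:(by rewrite s0 s2); rewrite u1E in H2.
  set l := (- c * _ - _) in H1 H2.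
  rewrite /W ci /=.
  have tvs : tv y s = carried w c l0 om (y, s).
    by apply: tvE; apply: ltW; apply: (tri_strip (y, s)) => /=; clear - s0 s3 s4; lra.
  have H3 : `|u y s - u y 0 - l * s| <= e / 2 * s.
    have -> : u y s - u y 0 - l * s = s * (s^-1 * (u y s - u y 0) - l) by field; rewrite gt_eqF.
    by rewrite normrM gtr0_norm// mulrC ler_pM2r.
  rewrite tvs; have uy : u y 0 = carried w c l0 om (y, 0) by rewrite ui// u0E.
  rewrite uy in H3.
  have -> : u y s - carried w c l0 om (y, s) = (u y s - carried w c l0 om (y, 0) - l * s) -
     (carried w c l0 om (y, s) - carried w c l0 om (y, 0) - l * s) by ring.
  apply: le_trans (ler_normB _ _) _; have -> : e * s = e / 2 * s + e / 2 * s by field.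
  exact: lerD.
have := triangle_unique albe C0 B0 subu subv cu cv Wu Wv lip uM Wc W0 dW0 (x := be) (y := al) (lexx _) (ltW albe) (lexx _).
by rewrite beE alE ci.
Qed.
End Final.

Unset Implicit Arguments.
Theorem theorem1p11 (R : realType) (rho r : R -> R) (gamma l0 : R)
    (n0 N : nat) (omega : nat -> R -> R) (f : nat -> R -> R -> R[i])
    (rhoX0 : inX0 rho) (rX0 : inX0 r) (gamma_neq0 : gamma != 0)
    (l0_gt0 : 0 < l0) (N_gt0 : (0 < N)%N)
    (bloch : bloch_bands rho omega f)
    (H : hypH rho r gamma l0 n0 N omega f)
    (eps0 cst : R) (eps0_gt0 : 0 < eps0) (cst_gt0 : 0 < cst)
    (eps : R) (eps_bnd : 0 < eps < eps0)
    (v : R -> R -> R -> R)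
    (v_profile : pulse_profile rho r gamma l0 n0 N omega f cst eps v)
    (phi : R -> R -> R -> R)
    (phiC2 : C2X (~` `[- xi_max N eps, xi_max N eps]) phi)
    (vextC2 : C2X setT (v_ext N eps v phi))
    (D : set (R * R)) (D_dom : existence_domain D)
    (u : R -> R -> R)
    (u_sol : cauchy_solution rho r gamma
               (u0_of l0 (v_ext N eps v phi))
               (u1_of l0 n0 omega eps (v_ext N eps v phi)) D u) :
  forall x t : R, D (x, t) ->
    - xi_max N eps <= x <= xi_max N eps -> 0 < t ->
    `|x| + t < xi_max N eps ->
    u x t = v (x - cg l0 n0 omega * t)
              (l0 * x - omega_eps l0 n0 omega eps * t) x.
Proof.
move=> x t Dxt _ t0 xtL.
have [w1 [g0 g1 Dw]] := C2X_sup vextC2.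
have [_ tvsol _] := v_profile.
apply: (cone_agreement g0 g1 Dw (group_velocity_le1 n0 l0 rhoX0 bloch) rhoX0 rX0 _ tvsol D_dom u_sol _ _ Dxt t0 xtL).
- by move=> y s h; rewrite /carried /v_ext /= h.
- by move=> y; rewrite /carried /u0_of /= !mulr0 !subr0.
- by move=> y.
Qed.
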